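(* Let $L,H,T>0$ and consider the minimization problem for $E_0$ in the rectangle $\Omega=(-T,T)\times(-H,H)$, subject to the boundary conditions $u(x,\pm H)=(\pm1,0)$ for $|x|\le T$ (imposed in $E_0$ through the normal-component condition $u\cdot\nu=0$ and the boundary penalty term) and $2T$-periodicity in $x$. There exist constants $L_0\approx1.27$ and $L_1\approx2.14$ such that whenever $L/H\in(L_0,L_1)$ and $T=H\,\tilde T(L/H)$, where $\tilde T=\tilde T(L/H)\in(\sqrt2-1,1)$ is the solution of $$\frac LH\left(\sqrt{\Big(\frac LH\Big)^2+4\tilde T^2}-\frac LH\right)-\frac{8\tilde T^3(1-\tilde T^2)}{(\tilde T^2+1)^2}=0,$$ we have $$\inf E_0(u)<2T\inf_{\mathcal{A}^0}E_0^{1D}(u).$$ Here the infimum on the left is taken over all $u\in H_{\mathrm{div}}(\Omega;\mathbb{S}^1)\cap BV(\Omega;\mathbb{S}^1)$ such that $u\cdot\nu=0$ on the top and bottom $y=\pm H$ and $u$ is $2T$-periodic in $x$.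
   Context: $H_{\mathrm{div}}(\Omega;\mathbb{S}^1)$ (resp. $BV(\Omega;\mathbb{S}^1)$) is the set of $L^2$ vector fields with weak divergence in $L^2$ (resp. of bounded variation) and $|u|=1$ a.e.; $2T$-periodicity in $x$ means that $u$ is regarded as a field on the cylinder obtained from $\Omega$ by identifying the sides $x=\pm T$ (so the divergence and the jump set $J_u$ are those of the periodic extension, counted over one period). The energy is $$E_0(u)=\frac L2\int_\Omega(\mathrm{div}\,u)^2\,dx+\frac16\int_{J_u}|u_--u_+|^3\,d\mathcal{H}^1+\frac16\int_{\{y=\pm H\}}|u_{\partial\Omega}-g|^3\,d\mathcal{H}^1,$$ with $g=(\pm1,0)$ on $y=\pm H$, $u_{\partial\Omega}$ the trace of $u$, $u_\pm$ the one-sided traces of $u$ on $J_u$, $\nu$ the outward unit normal, and $\mathcal{H}^1$ one-dimensional Hausdorff measure. The one-dimensional problem on the right is $$\mathcal{A}^0=\{u=(u_1,u_2):\ u_1^3\in BV((-H,H)),\ u_2\in H^1((-H,H)),\ u_2(\pm H)=0,\ |u|=1\ \text{a.e.}\},$$ $$E^{1D}_0(u)=\frac L2\int_{-H}^H(u_2')^2\,dy+\frac43\sum_{y_j\in J_{u_1}}\big(1-u_2^2(y_j)\big)^{3/2}+\frac16|u_1(-H)+1|^3+\frac16|u_1(H)-1|^3,$$ where $J_{u_1}\subset(-H,H)$ is the jump set of $u_1$ and $u_1(\pm H)$ are one-sided limits at the endpoints. *)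

(* Defs.v *)
From HB Require Import structures.
From mathcomp Require Import all_boot all_order all_algebra.
From mathcomp Require Import all_classical all_reals all_analysis.

Set Implicit Arguments.
Unset Strict Implicit.
Unset Printing Implicit Defensive.

Import Order.TTheory GRing.Theory Num.Theory.
Import numFieldNormedType.Exports.

Local Open Scope classical_set_scope.
Local Open Scope ring_scope.

(* The norm that the library puts on [R * R] is the max norm; all lengths and
   moduli below are Euclidean. *)
Definition enorm {R : realType} (v : R * R) : R :=
  Num.sqrt (v.1 ^+ 2 + v.2 ^+ 2).

Definition edot {R : realType} (v w : R * R) : R := v.1 * w.1 + v.2 * w.2.

Definition area {R : realType} :
    {measure set (measurableTypeR R * measurableTypeR R) -> \bar R} :=
  (@lebesgue_measure R \x @lebesgue_measure R)%E.

Section Hausdorff.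
Context {R : realType}.
Local Open Scope ereal_scope.

(* The singleton 0 makes the diameter of the empty set 0. *)
Definition ediam (A : set (R * R)) : \bar R :=
  ereal_sup ([set 0] `|`
    [set z | exists p q, [/\ A p, A q & z = (enorm (p - q)%R)%:E]]).

Definition gauge (delta : R) (A : set (R * R)) : \bar R :=
  if ediam A <= delta%:E then ediam A else +oo.

(* [mu_ext] takes the infimum over countable covers by Borel sets; this is the
   same as over arbitrary covers because a set and its closure have the same
   diameter.  [gauge] gives the value [+oo] to the covers having a piece of
   diameter larger than [delta]. *)
Definition hausdorff1_pre (delta : R) : set (R * R) -> \bar R :=
  @mu_ext _ (measurableTypeR R * measurableTypeR R)%type R (gauge delta).

Definition hausdorff1 (A : set (R * R)) : \bar R :=
  ereal_sup [set hausdorff1_pre delta A | delta in [set d : R | (0 < d)%R]].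

Lemma ediam_ge0 A : 0 <= ediam A.
Proof. by apply: ereal_sup_ubound; left. Qed.

Lemma gauge_ge0 delta A : 0 <= gauge delta A.
Proof. by rewrite /gauge; case: ifP => // _; exact: ediam_ge0. Qed.

Lemma ediam0 : ediam set0 = 0.
Proof.
apply/eqP; rewrite eq_le ediam_ge0 andbT.
by apply: ge_ereal_sup => z [->//|[p [q []]]].
Qed.

Lemma gauge0 (delta : R) : (0 < delta)%R -> gauge delta set0 = 0.
Proof. by move=> d0; rewrite /gauge ediam0 lee_fin ltW. Qed.

Lemma hausdorff1_0 : hausdorff1 set0 = 0.
Proof.
apply/eqP; rewrite eq_le; apply/andP; split.
  apply: ge_ereal_sup => z [d /= d0 <-].
  by rewrite [X in X <= _](mu_ext0 (gauge0 d0) (gauge_ge0 d)).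
apply: ereal_sup_ubound; exists 1%R => //=.
exact: (mu_ext0 (gauge0 ltr01) (gauge_ge0 1)).
Qed.

Lemma hausdorff1_ge0 A : 0 <= hausdorff1 A.
Proof.
apply: (@le_trans _ _ (hausdorff1_pre 1 A)).
  exact: (mu_ext_ge0 (gauge_ge0 1)).
by apply: ereal_sup_ubound; exists 1%R => //=.
Qed.

Lemma le_hausdorff1 : {homo hausdorff1 : A B / A `<=` B >-> A <= B}.
Proof.
move=> A B AB; apply: ge_ereal_sup => z [d d0 <-].
apply: (@le_trans _ _ (hausdorff1_pre d B)); first exact: le_mu_ext.
by apply: ereal_sup_ubound; exists d.
Qed.

Lemma hausdorff1_sigma_subadditive : sigma_subadditive hausdorff1.
Proof.
move=> A; apply: ge_ereal_sup => z [d /= d0 <-].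
apply: (le_trans (mu_ext_sigma_subadditive (gauge_ge0 d) A)).
apply: lee_nneseries => n _; first by move=> _; exact: (mu_ext_ge0 (gauge_ge0 d)).
by apply: ereal_sup_ubound; exists d.
Qed.

HB.instance Definition _ := isOuterMeasure.Build R (R * R)%type hausdorff1
  hausdorff1_0 hausdorff1_ge0 le_hausdorff1 hausdorff1_sigma_subadditive.

Definition hausdorff1_outer : {outer_measure set (R * R) -> \bar R} :=
  hausdorff1.

(* One-dimensional Hausdorff measure, as a measure on its Caratheodory
   measurable sets. *)
Definition Hone :
    {measure set (caratheodory_type hausdorff1_outer) -> \bar R} :=
  (hausdorff1_outer : set (caratheodory_type hausdorff1_outer) -> \bar R).

End Hausdorff.

Section FunctionSpaces.
Context {R : realType}.

Fixpoint Ck {V : normedModType R} (k : nat) (f : V -> R) : Prop :=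
  if k is k'.+1 then
    (forall x, differentiable f x) /\ (forall v, Ck k' ('D_v f))
  else continuous f.

Definition compactly_supported {V : normedModType R} (D : set V)
    (f : V -> R) : Prop :=
  exists K : set V, [/\ compact K, K `<=` D & forall x, ~ K x -> f x = 0].

Definition Cc1 {V : normedModType R} (D : set V) : set (V -> R) :=
  [set f | Ck 1 f /\ compactly_supported D f].

Definition Ccoo {V : normedModType R} (D : set V) : set (V -> R) :=
  [set f | (forall k, Ck k f) /\ compactly_supported D f].

Definition dx (f : R * R -> R) : R * R -> R := 'D_(1, 0) f.
Definition dy (f : R * R -> R) : R * R -> R := 'D_(0, 1) f.

Definition BV2 (D : set (R * R)) (f : R * R -> R) : Prop :=
  area.-integrable D (EFin \o f) /\
  exists C : R, forall P Q : R * R -> R, Cc1 D P -> Cc1 D Q ->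
    (forall p, enorm (P p, Q p) <= 1) ->
    \int[area]_(p in D) (f p * (dx P p + dy Q p)) <= C.

Definition L2 (D : set R) (f : R -> R) : Prop :=
  measurable_fun D f /\
  (@lebesgue_measure R).-integrable D (fun y => (f y ^+ 2)%:E).

Definition BV1 (D : set R) (f : R -> R) : Prop :=
  (@lebesgue_measure R).-integrable D (EFin \o f) /\
  exists C : R, forall P : R -> R, Cc1 D P -> (forall y, `|P y| <= 1) ->
    \int[@lebesgue_measure R]_(y in D) (f y * derive1 P y) <= C.

Definition weak_derivative (D : set R) (f f' : R -> R) : Prop :=
  forall P : R -> R, Ccoo D P ->
    \int[@lebesgue_measure R]_(y in D) (f y * derive1 P y) =
    - \int[@lebesgue_measure R]_(y in D) (f' y * P y).

Definition W12 (D : set R) (f : R -> R) : Prop :=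
  L2 D f /\ exists f', L2 D f' /\ weak_derivative D f f'.

Definition wderive (D : set R) (f : R -> R) : R -> R :=
  xget (fun=> 0) [set f' | L2 D f' /\ weak_derivative D f f'].

End FunctionSpaces.

(* Fields on the cylinder are functions on [R * R] that are [2T]-periodic in
   the first variable; only their values on the strip |y| < H matter. *)
Section Cylinder.
Context {R : realType}.
Variables T H : R.

Definition rectangle : set (R * R) :=
  [set p | -T < p.1 < T /\ -H < p.2 < H].

Definition strip : set (R * R) := [set p | -H < p.2 < H].

Definition one_period : set (R * R) := [set p | -T <= p.1 < T].

Definition top_bottom : set (R * R) := [set p | p.2 = H \/ p.2 = - H].

Definition xperiodic {Y : Type} (f : R * R -> Y) : Prop :=
  forall p, f (p.1 + 2 * T, p.2) = f p.

Definition L2_per (f : R * R -> R) : Prop :=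
  [/\ xperiodic f, measurable_fun strip f &
      area.-integrable rectangle (fun p => (f p ^+ 2)%:E)].

(* Testing on the whole strip, and not only on the rectangle, makes this the
   divergence of the periodic extension. *)
Definition weak_divergence (u : R * R -> R * R) (d : R * R -> R) : Prop :=
  forall P : R * R -> R, Ccoo strip P ->
    \int[area]_(p in strip) ((u p).1 * dx P p + (u p).2 * dy P p) =
    - \int[area]_(p in strip) (d p * P p).

Definition wdiv (u : R * R -> R * R) : R * R -> R :=
  xget (fun=> 0) [set d | L2_per d /\ weak_divergence u d].

Definition unit_valued (u : R * R -> R * R) : Prop :=
  {ae area, forall p, rectangle p -> enorm (u p) = 1}.

Definition Hdiv_S1 (u : R * R -> R * R) : Prop :=
  [/\ L2_per (fst \o u), L2_per (snd \o u),
      exists d, L2_per d /\ weak_divergence u d & unit_valued u].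

Definition BV_S1 (u : R * R -> R * R) : Prop :=
  [/\ BV2 rectangle (fst \o u), BV2 rectangle (snd \o u) & unit_valued u].

(* The part of the disc of radius r about p lying in the strip and on the side
   of p towards which nu points. *)
Definition half_disc (p nu : R * R) (r : R) : set (R * R) :=
  [set q | [/\ strip q, enorm (q - p) < r & 0 < edot (q - p) nu]].

Definition one_sided_trace (u : R * R -> R * R) (p nu a : R * R) : Prop :=
  (fun r : R =>
     (r ^+ 2)^-1 * \int[area]_(q in half_disc p nu r) enorm (u q - a))
  @ 0^'+ --> (0 : R).

(* c = (u_+, u_-); the pair is unique up to exchanging its components. *)
Definition jump_pair (u : R * R -> R * R) (p : R * R)
    (c : (R * R) * (R * R)) : Prop :=
  c.1 <> c.2 /\
  exists nu, [/\ enorm nu = 1, one_sided_trace u p nu c.1 &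
                 one_sided_trace u p (- nu) c.2].

Definition jump_set (u : R * R -> R * R) : set (R * R) :=
  [set p | strip p /\ exists c, jump_pair u p c].

Definition jump_size (u : R * R -> R * R) (p : R * R) : R :=
  let c := xget (0, 0) [set c | jump_pair u p c] in enorm (c.2 - c.1).

(* On y = H and y = -H the outward normal is (0, 1) and (0, -1), and g is
   (1, 0) and (-1, 0). *)
Definition outward (p : R * R) : R * R := (0, Num.sg p.2).
Definition gbdry (p : R * R) : R * R := (Num.sg p.2, 0).

Definition is_trace (u : R * R -> R * R) (p a : R * R) : Prop :=
  one_sided_trace u p (- outward p) a.

Definition trace (u : R * R -> R * R) (p : R * R) : R * R :=
  xget 0 [set a | is_trace u p a].

Definition impermeable (u : R * R -> R * R) : Prop :=
  {ae Hone, forall p, top_bottom p ->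
    exists a, is_trace u p a /\ edot a (outward p) = 0}.

Definition admissible : set (R * R -> R * R) :=
  [set u | [/\ Hdiv_S1 u, BV_S1 u, xperiodic u & impermeable u]].

Local Open Scope ereal_scope.

Definition E0 (L : R) (u : R * R -> R * R) : \bar R :=
  (L / 2)%:E * \int[area]_(p in rectangle) (wdiv u p ^+ 2)%:E +
  (6^-1)%:E *
    \int[Hone]_(p in jump_set u `&` one_period) (jump_size u p ^+ 3)%:E +
  (6^-1)%:E *
    \int[Hone]_(p in top_bottom `&` one_period)
      (enorm (trace u p - gbdry p) ^+ 3)%:E.

End Cylinder.

Section OneDimensional.
Context {R : realType}.

(* Essential one-sided limits: they do not depend on the representative and
   coincide with the one-sided limits of the good representative of a BV
   function, or with the value of the continuous representative of an H^1
   function. *)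
Definition right_limit (f : R -> R) (y a : R) : Prop :=
  forall e : R, 0 < e -> exists2 d : R, 0 < d &
    {ae @lebesgue_measure R, forall t, y < t < y + d -> `|f t - a| < e}.

Definition left_limit (f : R -> R) (y a : R) : Prop :=
  forall e : R, 0 < e -> exists2 d : R, 0 < d &
    {ae @lebesgue_measure R, forall t, y - d < t < y -> `|f t - a| < e}.

Definition right_value (f : R -> R) (y : R) : R :=
  xget 0 [set a | right_limit f y a].

Definition left_value (f : R -> R) (y : R) : R :=
  xget 0 [set a | left_limit f y a].

Definition point_value (f : R -> R) (y : R) : R :=
  xget 0 [set a | left_limit f y a /\ right_limit f y a].

Definition jump_set1 (D : set R) (f : R -> R) : set R :=
  [set y | D y /\ exists a b,
    [/\ a <> b, left_limit f y a & right_limit f y b]].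

Definition cross_section (H : R) : set R := `]-H, H[.

Definition A0 (H : R) : set (R -> R * R) :=
  [set u | [/\ BV1 (cross_section H) (fun y => (u y).1 ^+ 3),
               W12 (cross_section H) (snd \o u),
               right_limit (snd \o u) (- H) 0,
               left_limit (snd \o u) H 0 &
               {ae @lebesgue_measure R, forall y,
                  -H < y < H -> enorm (u y) = 1}]].

Local Open Scope ereal_scope.

(* (1 - u_2^2)^(3/2) is the cube of the square root. *)
Definition E1D (L H : R) (u : R -> R * R) : \bar R :=
  (L / 2)%:E *
    \int[@lebesgue_measure R]_(y in (cross_section H))
      (wderive (cross_section H) (snd \o u) y ^+ 2)%:E +
  (4 / 3)%:E *
    (\esum_(y in jump_set1 (cross_section H) (fst \o u))
      (Num.sqrt (1 - point_value (snd \o u) y ^+ 2) ^+ 3)%:E) +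
  (6^-1 * `|right_value (fst \o u) (- H) + 1| ^+ 3)%:E +
  (6^-1 * `|left_value (fst \o u) H - 1| ^+ 3)%:E.

End OneDimensional.

(* With l standing for L / H and t for T / H. *)
Definition period_equation {R : realType} (l t : R) : Prop :=
  l * (Num.sqrt (l ^+ 2 + 4 * t ^+ 2) - l)
    - 8 * t ^+ 3 * (1 - t ^+ 2) / (t ^+ 2 + 1) ^+ 2 = 0.

(* Main.v *)
(* With l = L / H, the one-dimensional infimum is at least l - l^3 / 12: an
   admissible u either pays its wall at the boundary or raises |u_2| from 0 to
   some sigma and back, which costs l sigma^2, around a jump of u_1 of cost
   (4/3) (1 - sigma^2)^(3/2), and one minimises over sigma.

   The competitor on the left is a cross-tie wall. The rectangle is divided by
   the line y = 0, across which u_1 changes sign, and by vertical lines, across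
   which u_2 changes sign; in all cells u = (+- sqrt (1 - w^2), +- w) for the
   same profile w (a, m), where a is the distance to one vertical side and m the
   distance to the boundary, both divided by H. In the middle of the cell
   w = s m, with divergence s. Near the side a = 0 one has the fan
   w = 2 X m / sqrt ((X^2 + (1 - m)^2) (X^2 + (1 + m)^2)), which removes the jump
   there up to a small shift X = a + eps, and near the opposite side a wedge in
   which w = 2 q / (1 + q^2) with q polynomial in the distance z to that side
   and in mu, the value of q corresponding to s m. All energies are then
   integrals of explicit functions; replacing 1 / (1 + q^2)^3, 1 / (1 + q^2)^4 and
   the Jacobian of m -> mu by polynomial bounds turns them into integrals of
   polynomials, evaluated in integer arithmetic. A family with one cell per half
   period serves for L / H <= 1.53 and one with two cells for larger L / H. *)
Require Import Defs.
From mathcomp Require Import all_boot all_order all_algebra.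
From mathcomp Require Import all_classical all_reals all_analysis.
From mathcomp Require Import measurable_realfun.
From mathcomp Require Import ring lra.
Import Order.TTheory GRing.Theory Num.Theory.
Import numFieldNormedType.Exports.
Set Implicit Arguments.
Unset Strict Implicit.
Unset Printing Implicit Defensive.
Local Open Scope classical_set_scope.
Local Open Scope ring_scope.

(** * Smooth cut-offs *)

(** The one-dimensional bound rests on a count: where |u_2| stays away from 1, |u_1|^3 stays away
    from 0, and a test function with one bump per sign change shows that such a BV function changes
    sign only finitely often. This produces a jump with genuine one-sided limits. The fan comes from
    the circles through (0, 1) and (0, -1): its scaled divergence at a point is the curvature of the
    circle through it, and the arc of curvature s joins the fan continuously to the region w = s m.
    The slope s belongs to a Pythagorean triple, so that after a half-angle substitution all data of
    the wedge are rational. For a fixed profile the energy bound, divided by H, is affine in L / H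
    and in the cell width separately; the period equation enters through rational bounds on its
    unique solution. On the left only upper bounds are wanted, so surface integrals are estimated by
    finite covers with segments. The function [wdiv] is a choice, and the uniqueness of weak
    divergences identifies its square integral with that of the explicit divergence. *)

Section SmoothStep.
Context {R : realType}.
Implicit Types f g : R -> R.

(** C^n on the line with every derivative exhibited as a witness, so that the closure rules are
    plain inductions; [Ck_nsmooth] and [Ck_tensor] transfer it to the predicate [Ck] of the
    statement. *)
Fixpoint nsmooth (n : nat) (f : R -> R) : Prop :=
  if n is n'.+1 then
    exists g, (forall x, is_derive x (1 : R) f (g x)) /\ nsmooth n' g
  else continuous f.

Lemma is_derive_continuous f g : (forall x, is_derive x (1 : R) f (g x)) -> continuous f.
Proof.
by move=> fg x; apply: differentiable_continuous; apply/derivable1_diffP.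
Qed.

Lemma nsmoothW n f : nsmooth n.+1 f -> nsmooth n f.
Proof.
elim: n f => [|n ih] f [g [fg sg]]; first exact: is_derive_continuous fg.
by exists g; split => //; exact: ih.
Qed.

Lemma nsmooth_cst n (c : R) : nsmooth n (fun=> c).
Proof.
elim: n c => [|n ih] c; first exact: cst_continuous.
by exists (fun=> 0); split => // x; exact: is_derive_cst.
Qed.

Lemma nsmoothD n f g : nsmooth n f -> nsmooth n g -> nsmooth n (fun x => f x + g x).
Proof.
elim: n f g => [|n ih] f g; first by move=> cf cg x; apply: cvgD; [exact: cf|exact: cg].
move=> [f' [ff' sf]] [g' [gg' sg]]; exists (fun x => f' x + g' x).
by split=> [x|]; [exact: is_deriveD|exact: ih].
Qed.

Lemma nsmoothM n f g : nsmooth n f -> nsmooth n g -> nsmooth n (fun x => f x * g x).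
Proof.
elim: n f g => [|n ih] f g; first by move=> cf cg x; apply: cvgM; [exact: cf|exact: cg].
move=> sf sg; have [f' [ff' sf']] := sf; have [g' [gg' sg']] := sg.
exists (fun x => f x * g' x + g x * f' x); split.
  by move=> x; apply: is_deriveM.
by apply: nsmoothD; apply: ih => //; exact: nsmoothW.
Qed.

Lemma nsmooth_affine n f (a b : R) : nsmooth n f -> nsmooth n (fun x => f (a * x + b)).
Proof.
elim: n f => [|n ih] f.
  move=> cf x; apply: (@continuous_comp _ _ _ (fun x => a * x + b) f); last exact: cf.
  by apply: cvgD; [apply: cvgM; [exact: cvg_cst|exact: cvg_id]|exact: cvg_cst].
move=> [f' [ff' sf']]; exists (fun x => f' (a * x + b) * a); split; last first.
  by apply: nsmoothM; [exact: ih|exact: nsmooth_cst].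
move=> x.
have da : is_derive x (1 : R) (fun x : R => a * x + b) a.
  by apply: is_derive_eq; rewrite addr0 /GRing.scale/= mulr1.
exact: (@is_derive1_comp R f (fun x => a * x + b) x _ _ (ff' (a * x + b)) da).
Qed.

(** The derivative of 1 / f contains 1 / f itself, but only with one order of smoothness less, which
    the induction already provides. *)
Lemma nsmoothV n f : (forall x, f x != 0) -> nsmooth n f -> nsmooth n (fun x => (f x)^-1).
Proof.
move=> f0; elim: n => [|n ih].
  by move=> cf x; apply: cvgV => //; exact: cf.
move=> sf; have [f' [ff' sf']] := sf.
have sV := ih (nsmoothW sf).
exists (fun x => -1 * (((f x)^-1 * (f x)^-1) * f' x)); split; last first.
  apply: nsmoothM; first exact: nsmooth_cst.
  by apply: nsmoothM => //; apply: nsmoothM.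
move=> x.
apply: (is_derive_eq (is_deriveV (f0 x) (ff' x))).
by rewrite /GRing.scale/= expr2 invfM; ring.
Qed.

(* Along ['X^2 * (p - p^`())] this family contains the iterated derivatives of
   exp (-1/x). *)
Definition expinv (p : {poly R}) (x : R) : R :=
  if 0 < x then p.[x^-1] * expR (- x^-1) else 0.

Lemma horner_le (p : {poly R}) : exists2 C : R, 0 <= C &
  forall y, 1 <= y -> `|p.[y]| <= C * y ^+ size p.
Proof.
exists (\sum_(i < size p) `|p`_i|); first exact: sumr_ge0.
move=> y y1; rewrite horner_coef mulr_suml.
apply: (le_trans (ler_norm_sum _ _ _)); apply: ler_sum => i _.
rewrite normrM ler_wpM2l// ger0_norm ?exprn_ge0 ?(le_trans ler01)//.
by rewrite ler_weXn2l// ltnW.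
Qed.

(** At y = 1 / x the exponential series gives exp y >= y^(n+2) / (n+2)!, two powers more than the
    polynomial can grow. The quadratic decay makes [expinv p] differentiable at 0 with derivative
    0. *)
Lemma expinv_le (p : {poly R}) : exists2 C : R, 0 <= C &
  forall x, `|x| <= 1 -> `|expinv p x| <= C * x ^+ 2.
Proof.
have [C C0 hC] := horner_le p.
set n := size p in hC.
exists (C * (n.+2)`!%:R); first by rewrite mulr_ge0.
move=> x x1; rewrite /expinv; case: ifPn => x0; last first.
  by rewrite normr0; apply: mulr_ge0; [exact: mulr_ge0|exact: sqr_ge0].
move: x1; rewrite gtr0_norm// => x1.
have y1 : 1 <= x^-1 by rewrite invf_ge1.
rewrite normrM (ger0_norm (expR_ge0 _)).
apply: (le_trans (ler_wpM2r (expR_ge0 _) (hC _ y1))).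
rewrite -!mulrA ler_wpM2l//.
have := @expR_ge1Dxn R x^-1 n.+1 (le_trans ler01 y1).
set y := x^-1 in y1 *; move=> hy.
have {}hy : y ^+ n.+2 <= (n.+2)`!%:R * expR y.
  rewrite -ler_pdivrMl; last by rewrite ltr0n fact_gt0.
  by rewrite mulrC (le_trans _ hy)// lerDr.
have -> : y ^+ n = x ^+ 2 * y ^+ n.+2.
  have xy : x * y = 1 by rewrite /y mulfV ?gt_eqF.
  by rewrite !exprS expr0 mulr1; transitivity ((x * y) * (x * y) * y ^+ n); [rewrite xy !mul1r|ring].
by rewrite expRN ler_pdivrMr ?expR_gt0// [X in _ <= X](_ : _ = x ^+ 2 * ((n.+2)`!%:R * expR y)) ?ler_wpM2l ?sqr_ge0//; ring.
Qed.

Lemma is_derive_expinv (p : {poly R}) x :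
  is_derive x (1 : R) (expinv p) (expinv ('X^2 * (p - p^`())) x).
Proof.
have [x0|x0|->] := ltgtP x 0.
- rewrite {2}/expinv ltNge (ltW x0)/=.
  have : is_derive x (1 : R) (cst (0 : R)) 0 by exact: is_derive_cst.
  apply: near_eq_is_derive.
  near=> z; rewrite /expinv /cst ltNge; case: ifPn => //.
  rewrite -ltNge => z0; exfalso; move: z0; apply/negP; rewrite -leNgt ltW//.
  near: z; exact: lt_nbhsl.
- have h : is_derive x (1:R) (fun z => p.[z^-1] * expR (- z^-1)) (expinv ('X^2 * (p - p^`())) x).
    have xn : x != 0 by rewrite gt_eqF.
    have dV : is_derive x (1:R) (fun z : R => z^-1) (- x^-1 ^+ 2).
      apply: (is_derive_eq (is_deriveV xn (is_derive_id x 1))).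
      by rewrite /GRing.scale/= mulr1 exprVn.
    have dN : is_derive x (1:R) (fun z : R => - z^-1) (x^-1 ^+ 2).
      by apply: (is_derive_eq (is_deriveN dV)); rewrite opprK.
    have dE := @is_derive1_comp R expR (fun z => - z^-1) x _ _ (is_derive_expR _) dN.
    have dP := @is_derive1_comp R (fun y => p.[y]) (fun z => z^-1) x _ _ (is_derive_poly p _) dV.
    apply: (is_derive_eq (is_deriveM dP dE)).
    rewrite /expinv x0 !hornerE /GRing.scale/= /comp; ring.
  move: h; apply: near_eq_is_derive.
  near=> z; rewrite /expinv; suff -> : 0 < z by [].
  near: z; exact: lt_nbhsr.
- rewrite {2}/expinv ltxx.
  have [C C0 hC] := expinv_le p.
  (* At 0 the slope function of Caratheodory is [expinv p z / z]; by [expinv_le] it is at most C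
     |z|, hence continuous there with value 0. *)
  apply/is_derive1_caratheodory.
  exists (fun z => if z == 0 then 0 else expinv p z / z); split.
  + move=> z; rewrite subr0 {2}/expinv ltxx subr0.
    by case: eqVneq => [->|z0]; [rewrite mulr0 /expinv ltxx|rewrite divfK].
  + rewrite /prop_for /continuous_at eqxx; apply/cvgr0Pnorm_lt => e e0.
    near=> z; case: eqVneq => [_|z0]; first by rewrite normr0.
    have z1 : `|z| <= 1 by near: z; exists 1 => //= z; rewrite /ball/= sub0r normrN => /ltW.
    rewrite normrM normfV ltr_pdivrMr ?normr_gt0//.
    rewrite (le_lt_trans (hC _ z1))//.
    rewrite -normr_id -[z ^+ 2]ger0_norm ?sqr_ge0// normrX expr2 mulrA normr_id.
    rewrite ltr_pM2r ?normr_gt0//.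
    apply: (@le_lt_trans _ _ ((C + 1) * `|z|)); first by rewrite ler_wpM2r// lerDl.
    rewrite mulrC -ltr_pdivlMr ?ltr_wpDl//.
    near: z; exists (e / (C + 1)) => /=; first by rewrite divr_gt0// ltr_wpDl.
    by move=> z; rewrite /ball/= sub0r normrN.
  + by rewrite eqxx.
Unshelve. all: by end_near. Qed.

Lemma nsmooth_expinv n p : nsmooth n (expinv p).
Proof.
elim: n p => [|n ih] p; first exact: is_derive_continuous (is_derive_expinv p).
by exists (expinv ('X^2 * (p - p^`()))); split => // x; exact: is_derive_expinv.
Qed.

Let h := expinv 1.

Let h_ge0 x : 0 <= h x.
Proof. by rewrite /h /expinv; case: ifP => // _; rewrite mulr_ge0 ?hornerE ?expR_ge0. Qed.

Let h_gt0 x : 0 < x -> 0 < h x.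
Proof. by move=> x0; rewrite /h /expinv x0 hornerE mul1r expR_gt0. Qed.

Let h_le0 x : x <= 0 -> h x = 0.
Proof. by rewrite /h /expinv leNgt; case: ifP. Qed.

(** The usual quotient h(x) / (h(x) + h(1 - x)); the argument is written [-1 * x + 1] to fit
    [nsmooth_affine]. *)
Definition smooth_step (x : R) : R := h x * (h x + h (-1 * x + 1))^-1.

Let den_gt0 x : 0 < h x + h (-1 * x + 1).
Proof.
have [x0|x0] := ltP 0 x; first by rewrite ltr_pwDl// h_gt0.
by rewrite ltr_wpDl// h_gt0//; lra.
Qed.

Lemma nsmooth_step n : nsmooth n smooth_step.
Proof.
apply: nsmoothM; first exact: nsmooth_expinv.
apply: nsmoothV; first by move=> x; rewrite gt_eqF.
apply: nsmoothD; first exact: nsmooth_expinv.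
exact/nsmooth_affine/nsmooth_expinv.
Qed.

Lemma smooth_step_le0 x : x <= 0 -> smooth_step x = 0.
Proof. by move=> x0; rewrite /smooth_step h_le0// mul0r. Qed.

Lemma smooth_step_ge1 x : 1 <= x -> smooth_step x = 1.
Proof.
move=> x1; rewrite /smooth_step (@h_le0 (-1 * x + 1)); last by lra.
by rewrite addr0 divff// gt_eqF// h_gt0//; lra.
Qed.

Lemma smooth_step_ge0 x : 0 <= smooth_step x.
Proof. by rewrite mulr_ge0 ?invr_ge0// ltW. Qed.

Lemma smooth_step_le1 x : smooth_step x <= 1.
Proof. by rewrite ler_pdivrMr// mul1r lerDl. Qed.

End SmoothStep.

(** * Ramps and one-sided approximate identities *)

Section TestFunctions.
Context {R : realType}.
Local Notation mu := (@lebesgue_measure R).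

Lemma bounded_fun_in {T : Type} (D : set T) (f : T -> R) (M : R) :
  (forall x, D x -> `|f x| <= M) -> [bounded f x | x in D].
Proof.
move=> fM; exists M; split; first by rewrite num_real.
by move=> M' MM' x Dx /=; apply: (le_trans (fM _ Dx)); exact: ltW.
Qed.

Lemma integrable_mulr {d} {T : measurableType d} (m : {measure set T -> \bar R})
    (D : set T) (f k : T -> R) (M : R) :
  measurable D -> m.-integrable D (EFin \o f) -> measurable_fun D k ->
  (forall x, D x -> `|k x| <= M) ->
  m.-integrable D (EFin \o (fun x => f x * k x)).
Proof.
move=> mD fi mk kM.
have := integrableMl mD fi mk (bounded_fun_in kM).
by apply: eq_integrable.
Qed.

Lemma integrable_sub {d} {T : measurableType d} (m : {measure set T -> \bar R})
    (D : set T) (f k : T -> R) :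
  measurable D -> m.-integrable D (EFin \o f) -> m.-integrable D (EFin \o k) ->
  m.-integrable D (EFin \o (fun x => f x - k x)).
Proof. by move=> mD fi ki; have := integrableB mD fi ki; apply: eq_integrable. Qed.

Lemma integrable_add {d} {T : measurableType d} (m : {measure set T -> \bar R})
    (D : set T) (f k : T -> R) :
  measurable D -> m.-integrable D (EFin \o f) -> m.-integrable D (EFin \o k) ->
  m.-integrable D (EFin \o (fun x => f x + k x)).
Proof. by move=> mD fi ki; have := integrableD mD fi ki; apply: eq_integrable. Qed.

Lemma is_derive_affine (a b x : R) : is_derive x (1 : R) (fun y : R => a * y + b) a.
Proof. by apply: is_derive_eq; rewrite addr0 /GRing.scale/= mulr1. Qed.

Lemma derive1_is_derive (f : R -> R) (x d : R) : is_derive x (1 : R) f d -> derive1 f x = d.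
Proof. by move=> h; rewrite derive1E (derive_val). Qed.

Definition dstep : R -> R := derive1 (@smooth_step R).

Lemma is_derive_step x : is_derive x (1 : R) (@smooth_step R) (dstep x).
Proof.
have [g [hg _]] := @nsmooth_step R 1.
by apply: (is_derive_eq (hg x)); rewrite /dstep (derive1_is_derive (hg x)).
Qed.

Lemma continuous_dstep : continuous dstep.
Proof.
have [g [hg sg]] := @nsmooth_step R 1.
rewrite (_ : dstep = g)//; apply/funext => x.
exact: derive1_is_derive.
Qed.

Lemma dstep_out x : x < 0 \/ 1 < x -> dstep x = 0.
Proof.
move=> h.
have [c hc] : exists c : R, \near x, cst c x = smooth_step x.
  case: h => h.
    exists 0; near=> z; rewrite /cst smooth_step_le0// ltW//.
    by near: z; exact: lt_nbhsl.
  exists 1; near=> z; rewrite /cst smooth_step_ge1// ltW//.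
  by near: z; exact: lt_nbhsr.
have := near_eq_is_derive hc (is_derive_cst c x (1 : R)).
exact: derive1_is_derive.
Unshelve. all: by end_near. Qed.

Lemma dstep_bounded : exists2 M : R, 0 < M & forall x, `|dstep x| <= M.
Proof.
have cn : {within `[0, 1 : R], continuous (fun x => `|dstep x|)}.
  apply: continuous_subspaceT => x; apply: continuous_comp; first exact: continuous_dstep.
  exact: norm_continuous.
have [c _ hc] := @EVT_max R (fun x => `|dstep x|) 0 1 ler01 cn.
exists (`|dstep c| + 1); first by rewrite ltr_wpDl.
move=> x; have [x01|] := boolP (x \in `[0, 1 : R]).
  by rewrite (le_trans (hc _ x01))// lerDl.
rewrite in_itv/= negb_and -!ltNge => /orP[] h.
  by rewrite dstep_out ?normr0 ?addr_ge0//; left.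
by rewrite dstep_out ?normr0 ?addr_ge0//; right.
Qed.

(** The ramp climbs from 0 to 1 on [x, x + h]. Its derivative [kern x h] has mass 1 and support in
    that interval, so it is an approximate identity that sees only the right of x. *)
Definition ramp (x h y : R) : R := smooth_step ((y - x) / h).
Definition kern (x h y : R) : R := dstep ((y - x) / h) / h.

Lemma ramp_ge0 x h y : 0 <= ramp x h y. Proof. exact: smooth_step_ge0. Qed.
Lemma ramp_le1 x h y : ramp x h y <= 1. Proof. exact: smooth_step_le1. Qed.

Lemma ramp0 x h y : 0 < h -> y <= x -> ramp x h y = 0.
Proof.
move=> h0 yx; apply: smooth_step_le0.
by rewrite pmulr_lle0 ?invr_gt0// subr_le0.
Qed.

Lemma ramp1 x h y : 0 < h -> x + h <= y -> ramp x h y = 1.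
Proof.
by move=> h0 yx; apply: smooth_step_ge1; rewrite ler_pdivlMr// mul1r lerBrDl.
Qed.

Lemma nsmooth_ramp n x h : nsmooth n (ramp x h).
Proof.
rewrite (_ : ramp x h = (fun y => smooth_step (h^-1 * y + (- (x / h)))))//.
  exact/nsmooth_affine/nsmooth_step.
by apply/funext => y; rewrite /ramp mulrBl mulrC.
Qed.

Lemma is_derive_ramp x h y : is_derive y (1 : R) (ramp x h) (kern x h y).
Proof.
have da : is_derive y (1:R) (fun y : R => (y - x) * h^-1) h^-1.
  rewrite (_ : (fun y : R => (y - x) * h^-1) = (fun y => h^-1 * y + (- (x / h)))).
    exact: is_derive_affine.
  by apply/funext => z; rewrite mulrBl mulrC.
exact: (@is_derive1_comp R (@smooth_step R) (fun y : R => (y - x) * h^-1) y _ _ (is_derive_step _) da).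
Qed.

Lemma continuous_kern x h : continuous (kern x h).
Proof.
move=> y; rewrite /kern; apply: cvgM; last exact: cvg_cst.
apply: (@continuous_comp _ _ _ (fun y : R => (y - x) / h) dstep); last exact: continuous_dstep.
by apply: cvgM; [apply: cvgB; [exact: cvg_id|exact: cvg_cst]|exact: cvg_cst].
Qed.

Lemma kern_out x h y : 0 < h -> y \notin `[x, x + h] -> kern x h y = 0.
Proof.
move=> h0; rewrite in_itv/= negb_and -!ltNge => /orP[] hy; rewrite /kern dstep_out ?mul0r//.
  by left; rewrite pmulr_llt0 ?invr_gt0// subr_lt0.
by right; rewrite ltr_pdivlMr// mul1r ltrBrDl.
Qed.

Lemma measurable_kern D x h : measurable_fun D (kern x h).
Proof.
apply: measurable_funS (continuous_measurable_fun (@continuous_kern x h)) => //.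
Qed.

Lemma measurable_ramp D x h : measurable_fun D (ramp x h).
Proof.
have cr : continuous (ramp x h) by exact: (@nsmooth_ramp 0).
apply: measurable_funS (continuous_measurable_fun cr) => //.
Qed.

Lemma kern_integral x h : 0 < h -> \int[mu]_(y in `[x, x + h]) kern x h y = 1.
Proof.
move=> h0; rewrite /Rintegral (@continuous_FTC2 _ _ (ramp x h)).
- by rewrite ramp1// ramp0// sube0.
- by rewrite ltrDl.
- by apply: continuous_subspaceT; exact: continuous_kern.
- have cr : continuous (ramp x h) by exact: (@nsmooth_ramp 0).
  split => //.
  + by move=> y _; have [] := is_derive_ramp x h y.
  + by apply: cvg_at_right_filter; exact: cr.
  + by apply: cvg_at_left_filter; exact: cr.
- by move=> y _; apply: derive1_is_derive; exact: is_derive_ramp.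
Qed.

Lemma nsmooth_dstep n : nsmooth n dstep.
Proof.
have [g [hg sg]] := @nsmooth_step R n.+1.
rewrite (_ : dstep = g)//; apply/funext => x.
exact: derive1_is_derive.
Qed.

Lemma nsmooth_kern n x h : nsmooth n (kern x h).
Proof.
rewrite (_ : kern x h = (fun y => dstep (h^-1 * y + (- (x / h))) * h^-1)).
  by apply: nsmoothM; [exact/nsmooth_affine/nsmooth_dstep|exact: nsmooth_cst].
by apply/funext => y; rewrite /kern mulrBl [y / h]mulrC.
Qed.

(** The kernel has mass 1, height at most M / h and support in the ball of radius 3 h about x; the
    error is therefore at most 6 M times the mean of |g - g x| over that ball, which tends to 0 at a
    Lebesgue point. The base points [xn] may move, which allows kernels on the left of x and kernels
    with rational base points. *)
Lemma integral_kern_cvg (g : R -> R) (x : R) (xn h : R^nat) :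
  mu.-integrable setT (EFin \o g) -> lebesgue_pt g x ->
  (forall n, 0 < h n) -> h @ \oo --> (0 : R) -> (forall n, `|xn n - x| <= h n) ->
  (fun n => \int[mu]_y (g y * kern (xn n) (h n) y)) @ \oo --> g x.
Proof.
move=> gi lx h0 hc hxn.
have [M M0 hM] := dstep_bounded.
apply/cvgrPdist_lt => e e0.
have e1 : 0 < e / (6 * M + 1) by rewrite divr_gt0// ltr_wpDl// mulr_ge0// ltW.
have : \forall r \near 0^'+, (davg g x r < (e / (6 * M + 1))%:E)%E.
  move/fine_cvgP : lx => [fi /cvgr0Pnorm_lt/(_ _ e1) fe].
  near=> r; have fr : davg g x r \is a fin_num by near: r.
  rewrite -(fineK fr) lte_fin; apply: (le_lt_trans (ler_norm _)).
  by near: r.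
move=> [d /= d0 hd].
have : \forall n \near \oo, `|h n| < d / 3.
  by move/cvgr0Pnorm_lt : hc; apply; rewrite divr_gt0.
apply: filterS => n.
have hn := h0 n; rewrite gtr0_norm// => hnd.
have {hd} hd : (davg g x (3 * h n) < (e / (6 * M + 1))%:E)%E.
  apply: hd => /=; last by rewrite mulr_gt0.
  by rewrite sub0r normrN gtr0_norm ?mulr_gt0//; lra.
pose I := `[xn n, xn n + h n]%classic.
have mI : measurable I by exact: measurable_itv.
have kM y : `|kern (xn n) (h n) y| <= M / h n.
  by rewrite /kern normrM ler_pM// gtr0_norm// invr_gt0.
have gIi : mu.-integrable I (EFin \o g) by apply: integrableS gi.
have gki : mu.-integrable I (EFin \o (fun y => g y * kern (xn n) (h n) y)).
  by apply: (integrable_mulr _ gIi) => //; exact: measurable_kern.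
have Ifin : (mu I < +oo)%E.
  by rewrite /I lebesgue_measure_itv/=; case: ifP => // _; rewrite -EFinB ltry.
have cki : mu.-integrable I (EFin \o (fun y => g x * kern (xn n) (h n) y)).
  apply: (@integrable_mulr _ _ _ _ (cst (g x)) _ (M / h n)) => //; last exact: measurable_kern.
  apply: measurable_bounded_integrable => //.
  by apply: (@bounded_fun_in _ _ _ `|g x|).
have -> : \int[mu]_y (g y * kern (xn n) (h n) y) = \int[mu]_(y in I) (g y * kern (xn n) (h n) y).
  rewrite [RHS]Rintegral_mkcond; congr fine; apply: eq_integral => y _; congr EFin.
  rewrite /patch; case: ifPn => // yI.
  by rewrite kern_out ?mulr0//; move: yI; rewrite notin_setE/= => /negP.
have -> : g x = \int[mu]_(y in I) (g x * kern (xn n) (h n) y).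
  rewrite RintegralZl//; first by rewrite kern_integral ?mulr1.
  apply: measurable_bounded_integrable => //; first exact: measurable_kern.
  by apply: (@bounded_fun_in _ _ _ (M / h n)).
rewrite -RintegralB//.
apply: (le_lt_trans (le_normr_Rintegral _ _)) => //.
  exact: (integrableB _ cki gki).
have gxi : mu.-integrable I (EFin \o (fun y => g y - g x)).
  have ci : mu.-integrable I (EFin \o cst (g x)).
    apply: measurable_bounded_integrable => //.
    by apply: (@bounded_fun_in _ _ _ `|g x|).
  exact: (integrable_sub _ gIi ci).
have mg : measurable_fun setT g by move/integrableP : gi => [/measurable_EFinP].
rewrite -lte_fin /Rintegral fineK; last first.
  apply: integrable_fin_num => //.
  have := integrable_abse (integrable_sub _ cki gki).
  by apply; exact: measurable_itv.
apply: (@le_lt_trans _ _ (\int[mu]_(y in ball x (3 * h n)) ((M / h n)%:E * (`|g y - g x|)%:E))%E).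
  apply: (@le_trans _ _ (\int[mu]_(y in I) ((M / h n)%:E * (`|g y - g x|)%:E))%E).
    apply: ge0_le_integral => //.
    - apply/measurable_EFinP; apply: measurableT_comp => //.
      apply: measurable_funB; apply: measurable_funM => //; try exact: measurable_kern.
      exact: measurable_funTS.
    - apply: measurable_funeM; apply/measurable_EFinP; apply: measurableT_comp => //.
      by apply: measurable_funB => //; exact: measurable_funTS.
    - move=> y _; rewrite -EFinM lee_fin -mulrBl normrM mulrC distrC.
      by rewrite ler_wpM2r.
  apply: ge0_subset_integral => //.
  - exact: measurable_ball.
  - apply: measurable_funeM; apply/measurable_EFinP; apply: measurableT_comp => //.
    by apply: measurable_funB => //; exact: measurable_funTS.
  - by move=> y _; rewrite mule_ge0// lee_fin// divr_ge0// ltW.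
  - rewrite /I => y /=; rewrite in_itv/= => /andP[y1 y2].
    by rewrite /ball/= ltr_norml; have := hxn n; rewrite ler_norml => /andP[? ?]; apply/andP; split; lra.
rewrite ge0_integralZl//; last 3 first.
  - exact: measurable_ball.
  - apply/measurable_EFinP; apply: measurableT_comp => //.
    by apply: measurable_funB => //; exact: measurable_funTS.
  - by rewrite lee_fin divr_ge0// ltW.
have hb : (\int[mu]_(y in ball x (3 * h n)) (`|g y - g x|)%:E < (6 * h n * (e / (6 * M + 1)))%:E)%E.
  move: hd; rewrite /davg /iavg lebesgue_measure_ball ?mulr_ge0//; last exact: ltW.
  rewrite inver mulrn_eq0/= mulf_eq0 gt_eqF//= gt_eqF//=.
  rewrite lte_pdivrMl; last by rewrite mulrn_wgt0// mulr_gt0.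
  by rewrite -EFinM [X in (_ < X%:E)%E -> _](_ : _ = 6 * h n * (e / (6 * M + 1))); [|rewrite mulr2n; ring].
apply: (@le_lt_trans _ _ ((M / h n)%:E * (6 * h n * (e / (6 * M + 1)))%:E)%E).
  by rewrite lee_wpmul2l ?lee_fin ?divr_ge0// ltW.
rewrite -EFinM lte_fin.
have M1 : 0 < 6 * M + 1 by rewrite ltr_wpDl// mulr_ge0// ltW.
rewrite [X in X < _](_ : _ = e * (6 * M) / (6 * M + 1)); last first.
  by field; rewrite !gt_eqF.
rewrite ltr_pdivrMr ?ltr_wpDl ?mulr_ge0 ?ltW//.
by rewrite ltr_pM2l// ltrDl.
Unshelve. all: by end_near. Qed.

End TestFunctions.

(** * One-dimensional energy *)

Section SmoothProducts.
Context {R : realType}.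

Lemma CkD (V : normedModType R) k (f g : V -> R) :
  Ck k f -> Ck k g -> Ck k (fun p => f p + g p).
Proof.
elim: k f g => [|k ih] f g /=.
  by move=> cf cg x; apply: cvgD; [exact: cf|exact: cg].
move=> [df sf] [dg sg]; split=> [x|v]; first exact: differentiableD.
rewrite (_ : 'D_v _ = fun p => 'D_v f p + 'D_v g p); first exact: ih.
apply/funext => p; apply: deriveD; exact: diff_derivable.
Qed.

Lemma is_diff_comp_proj (A : R -> R) (a : R) (pr : {linear (R * R)%type -> R}) (p : R * R) :
  continuous pr -> is_derive (pr p) (1 : R) A a ->
  is_diff p (A \o pr) (fun v => pr v * a).
Proof.
move=> cpr dA.
have dpr : is_diff p (pr : R * R -> R) pr.
  by apply: DiffDef; [exact: linear_differentiable|exact: diff_lin].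
have dfA : differentiable A (pr p) by apply/derivable1_diffP; case: dA.
have dA' : is_diff (pr p) A (fun v => v * a).
  apply: DiffDef => //; rewrite diff1E//; apply/funext => v.
  by rewrite (derive1_is_derive dA).
exact: (is_diff_comp dpr dA').
Qed.

Lemma is_diff_tensor (A B : R -> R) (a b : R) (p : R * R) :
  is_derive p.1 (1 : R) A a -> is_derive p.2 (1 : R) B b ->
  is_diff p (fun q => A q.1 * B q.2) (fun v => v.1 * a * B p.2 + A p.1 * (v.2 * b)).
Proof.
move=> dA dB.
have cfst : continuous (fst : R * R -> R) by move=> q; exact: cvg_fst.
have csnd : continuous (snd : R * R -> R) by move=> q; exact: cvg_snd.
have d1 := @is_diff_comp_proj A a fst p cfst dA.
have d2 := @is_diff_comp_proj B b snd p csnd dB.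
have E : (fun v : R * R => v.1 * a * B p.2 + A p.1 * (v.2 * b)) =
  (A \o fst) p *: (fun v : R * R => v.2 * b) + (B \o snd) p *: (fun v : R * R => v.1 * a).
  by apply/funext => v; rewrite /GRing.scale/= fctE/= addrC mulrC.
rewrite E; exact: is_diffM.
Qed.

Lemma is_diff_derive (V : normedModType R) (f df : V -> R) p v :
  is_diff p f df -> 'D_v f p = df v.
Proof. by move=> d; rewrite deriveE ?diff_val//; case: d. Qed.

Lemma Ck_tensor k (A B : R -> R) : nsmooth k A -> nsmooth k B ->
  Ck k (fun p : R * R => A p.1 * B p.2).
Proof.
elim: k A B => [|k ih] A B sA sB /=.
  move=> p; apply: cvgM.
    by apply: (@continuous_comp _ _ _ fst A); [exact: cvg_fst|exact: sA].
  by apply: (@continuous_comp _ _ _ snd B); [exact: cvg_snd|exact: sB].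
have [A' [dA sA']] := sA; have [B' [dB sB']] := sB.
have df p := is_diff_tensor (dA p.1) (dB p.2).
split=> [p|v]; first by case: (df p).
rewrite (_ : 'D_v _ = fun p => (v.1 * A' p.1) * B p.2 + A p.1 * (v.2 * B' p.2)).
  apply: CkD.
    apply: (ih (fun x => v.1 * A' x) B); last exact: nsmoothW.
    by apply: nsmoothM => //; exact: nsmooth_cst.
  apply: (ih A (fun y => v.2 * B' y)); first exact: nsmoothW.
  by apply: nsmoothM => //; exact: nsmooth_cst.
by apply/funext => p; rewrite (is_diff_derive _ (df p)).
Qed.

Lemma Ccoo_kern2 (D : set (R * R)) (x y h h' : R) : 0 < h -> 0 < h' ->
  `[x, x + h] `*` `[y, y + h'] `<=` D ->
  Ccoo D (fun p : R * R => kern x h p.1 * kern y h' p.2).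
Proof.
move=> h0 h'0 sub; split=> [k|].
  by apply: Ck_tensor; exact: nsmooth_kern.
exists (`[x, x + h] `*` `[y, y + h']); split => //.
  by apply: compact_setX; exact: segment_compact.
move=> p np; have [p1|p1] := boolP (p.1 \in `[x, x + h]); last by rewrite kern_out ?mul0r.
have [p2|p2] := boolP (p.2 \in `[y, y + h']); last by rewrite [X in _ * X]kern_out ?mulr0.
by exfalso; apply: np.
Qed.

(** Supplies widths for the kernels: a positive null sequence whose terms are all small enough to
    keep the supports inside a given interval. *)
Lemma harmonic_small (d : R) : 0 < d -> exists N : nat,
  (fun n => @harmonic R (n + N)) @ \oo --> (0 : R) /\ (forall n, @harmonic R (n + N) < d).
Proof.
move=> d0; have [N _ hN] : \forall n \near \oo, `|@harmonic R n| < d.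
  by move/cvgr0Pnorm_lt : (@cvg_harmonic R); apply.
exists N; split.
  by have := @cvg_harmonic R; rewrite -(cvg_shiftn N).
move=> n; apply: le_lt_trans (ler_norm _) _; apply: hN => /=; exact: leq_addl.
Qed.

Lemma kern_bounded (x h : R) : exists2 M, 0 < M & forall y, `|kern x h y| <= M.
Proof.
have [M M0 hM] := @dstep_bounded R.
exists (M * (`|h^-1| + 1)); first by rewrite mulr_gt0// ltr_wpDl.
by move=> y; rewrite /kern normrM ler_pM// lerDl.
Qed.

Lemma cvg_zero_eq (u : R^nat) (l : R) : u @ \oo --> l -> (forall n, u n = 0) -> l = 0.
Proof.
move=> ul u0; have : u = cst 0 by apply/funext.
move=> E; move: ul; rewrite E => h.
exact: (cvg_unique _ h (cvg_cst 0)).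
Qed.

End SmoothProducts.

Section AlmostEverywhere.
Context d (T : measurableType d) (R : realType) (m : {measure set T -> \bar R}).

Lemma ae_mono (P Q : T -> Prop) : (forall x, P x -> Q x) ->
  {ae m, forall x, P x} -> {ae m, forall x, Q x}.
Proof. by move=> PQ; apply: filterS. Qed.

Lemma ae_and (P Q : T -> Prop) :
  {ae m, forall x, P x} -> {ae m, forall x, Q x} -> {ae m, forall x, P x /\ Q x}.
Proof. exact: filterI. Qed.

Lemma ae_countable (C : countType) (P : C -> T -> Prop) :
  (forall c, {ae m, forall x, P c x}) -> {ae m, forall x, forall c, P c x}.
Proof.
move=> h.
have : {ae m, forall x, forall n, if unpickle n is Some c then P c x else True}.
  apply/ae_foralln => n; case: (unpickle n) => [c|]; first exact: h.
  exact: nearW.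
by apply: filterS => x hx c; have := hx (pickle c); rewrite pickleK.
Qed.

Lemma integrable_fine (f : T -> \bar R) : m.-integrable setT f ->
  m.-integrable setT (EFin \o (fine \o f)).
Proof.
move=> fi; apply: le_integrable (fi) => //.
  apply/measurable_EFinP; apply: (measurableT_comp _ (measurable_int _ fi)).
  exact: fine_measurable.
by move=> x _ /=; case: (f x) => //= ; rewrite ?normr0 ?lee_fin ?leey.
Qed.

End AlmostEverywhere.

(** * The fundamental lemma of the calculus of variations, on a line and in a rectangle *)

Section DuBoisReymond.
Context {R : realType}.
Local Notation mu := (@lebesgue_measure R).

Lemma lebesgue_pt_ae (g : R -> R) : mu.-integrable setT (EFin \o g) ->
  {ae mu, forall x, lebesgue_pt g x}.
Proof.
move=> gi; apply: lebesgue_differentiation.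
by apply: open_integrable_locally => //; exact: openT.
Qed.

Lemma du_bois_reymond1 (g : R -> R) (a b : R) :
  mu.-integrable setT (EFin \o g) ->
  (forall x h, 0 < h -> a < x -> x + h < b -> \int[mu]_y (g y * kern x h y) = 0) ->
  {ae mu, forall x, a < x < b -> g x = 0}.
Proof.
move=> gi g0; have := lebesgue_pt_ae gi.
apply: ae_mono => x lx /andP[ax xb].
have d0 : 0 < b - x by rewrite subr_gt0.
have [N [hc hs]] := harmonic_small d0.
have := @integral_kern_cvg R g x (cst x) (fun n => harmonic (n + N)) gi lx.
move=> /(_ (fun n => @harmonic_gt0 _ _) hc).
have h1 n : `|cst x n - x| <= @harmonic R (n + N) by rewrite /cst subrr normr0 harmonic_ge0.
move=> /(_ h1) /cvg_zero_eq; apply => n.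
by apply: g0 => //; [exact: harmonic_gt0|rewrite /cst -ltrBrDl].
Qed.

(** Only countably many kernels are tested, so that in the plane the exceptional null sets of all
    the tests can be united. The rational base point is chosen between x and x + h, hence the factor
    1 / 2 in the bound on the widths. *)
Lemma du_bois_reymond1_rat (g : R -> R) (a b : R) :
  mu.-integrable setT (EFin \o g) ->
  (forall (q : rat) (j : nat), a < ratr q -> ratr q + harmonic j < b ->
     \int[mu]_y (g y * kern (ratr q) (harmonic j) y) = 0) ->
  {ae mu, forall x, a < x < b -> g x = 0}.
Proof.
move=> gi g0; have := lebesgue_pt_ae gi.
apply: ae_mono => x lx /andP[ax xb].
have d0 : 0 < (b - x) / 2 by rewrite divr_gt0// subr_gt0.
have [N [hc hs]] := harmonic_small d0.
have hq n : exists q : rat, ratr q \in `]x, x + @harmonic R (n + N)[.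
  by apply: rat_in_itvoo; rewrite ltrDl harmonic_gt0.
pose q n := projT1 (cid (hq n)).
have qP n : x < ratr (q n) < x + @harmonic R (n + N).
  by rewrite /q; case: cid => r /=; rewrite in_itv.
have := @integral_kern_cvg R g x (fun n => ratr (q n)) (fun n => harmonic (n + N)) gi lx.
move=> /(_ (fun n => @harmonic_gt0 _ _) hc).
have h1 n : `|ratr (q n) - x| <= @harmonic R (n + N).
  by have /andP[q1 q2] := qP n; rewrite ger0_norm; lra.
move=> /(_ h1) /cvg_zero_eq; apply => n.
have /andP[q1 q2] := qP n; have := hs n => hsn.
by apply: g0; lra.
Qed.

(** Tested with products of kernels. For a fixed kernel in the second variable, the partial integral
    [phi] vanishes for almost every x by the one-dimensional lemma; uniting over the rational
    kernels, almost every slice of e is tested by all of them and hence vanishes. Fubini then gives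
    that the integral of |e| is 0. *)
Lemma du_bois_reymond2 (e : R * R -> R) (a b c d : R) :
  let Q := [set p : R * R | a < p.1 < b /\ c < p.2 < d] in
  area.-integrable Q (EFin \o e) ->
  (forall P, Ccoo Q P -> \int[area]_(p in Q) (e p * P p) = 0) ->
  {ae area, forall p, Q p -> e p = 0}.
Proof.
move=> Q ei eP.
have mQ : measurable (Q : set (measurableTypeR R * measurableTypeR R)).
  rewrite (_ : Q = `]a, b[ `*` `]c, d[).
    by apply: measurableX; exact: measurable_itv.
  by apply/seteqP; split=> p /=; rewrite !in_itv/=.
pose g : R * R -> R := e \_ Q.
have gE : EFin \o g = (EFin \o e) \_ Q by rewrite /g restrict_EFin.
have gi : area.-integrable setT (EFin \o g) by rewrite gE; apply/(integrable_mkcond _ mQ).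
have mg : measurable_fun setT g by move/integrableP : gi => [/measurable_EFinP].
have g0 p : ~ Q p -> g p = 0 by move=> np; rewrite /g patchE; case: ifPn => //; rewrite inE.
pose f (B : R -> R) (p : R * R) := g p * B p.2.
have fi x h : area.-integrable setT (EFin \o f (kern x h)).
  have [M M0 hM] := kern_bounded x h.
  apply: (@integrable_mulr R _ (measurableTypeR R * measurableTypeR R)%type area setT g
    (fun p => kern x h p.2) M) => //.
  apply: measurableT_comp; first exact: measurable_kern.
  exact: measurable_snd.
pose phi B x := fine (fubini_F mu (EFin \o f B) x).
have phii x h : mu.-integrable setT (EFin \o phi (kern x h)).
  exact: integrable_fine (integrable_fubini_F (fi x h)).
have gae := ae_integrable1 gi.
have phi0 y h : 0 < h -> c < y -> y + h < d ->
    {ae mu, forall x, a < x < b -> phi (kern y h) x = 0}.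
  move=> h0 cy yd; apply: du_bois_reymond1 => // x h' h'0 ax xb.
  have [M M0 hM] := kern_bounded x h'.
  have fAi : area.-integrable setT (EFin \o (fun p => f (kern y h) p * kern x h' p.1)).
    apply: (@integrable_mulr R _ (measurableTypeR R * measurableTypeR R)%type area setT
      (f (kern y h)) (fun p => kern x h' p.1) M) => //.
    apply: measurableT_comp; first exact: measurable_kern.
    exact: measurable_fst.
  have <- : \int[area]_(p in Q) (e p * (kern x h' p.1 * kern y h p.2)) = 0.
    apply: eP; apply: Ccoo_kern2 => // p [] /=; rewrite !in_itv/= => /andP[p1 p2] /andP[p3 p4].
    by rewrite /Q /=; split; apply/andP; split; lra.
  rewrite [RHS]Rintegral_mkcond /Rintegral; congr fine.
  transitivity (\int[area]_p ((f (kern y h) p * kern x h' p.1)%R)%:E)%E; last first.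
    apply: eq_integral => p _; congr EFin.
    rewrite /f /g !patchE; case: ifP => _; last by rewrite !mul0r.
    by ring.
  rewrite -(integral12_prod_meas1 fAi).
  have mphik : mu.-integrable setT (EFin \o (fun x0 => phi (kern y h) x0 * kern x h' x0)).
    by apply: (integrable_mulr (M := M) _ (phii y h)) => //; exact: measurable_kern.
  apply: ae_eq_integral => //.
  - exact: measurable_int mphik.
  - exact: measurable_int (integrable_fubini_F fAi).
  apply: ae_mono (ae_integrable1 (fi y h)) => z zi _.
  rewrite /fubini_F /phi /fubini_F /=.
  under [RHS]eq_integral do rewrite mulrC EFinM.
  rewrite integralZl//; rewrite EFinM muleC; congr (_ * _)%E.
  by rewrite fineK// integrable_fin_num.
have gx0 : {ae mu, forall x, (\int[mu]_y `|(g (x, y))%:E| = 0)%E}.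
  have hphi : {ae mu, forall x, forall qj : rat * nat, a < x < b ->
      c < ratr qj.1 -> ratr qj.1 + harmonic qj.2 < d ->
      phi (kern (ratr qj.1) (harmonic qj.2)) x = 0}.
    apply: ae_countable => -[q j] /=.
    have [cq|] := ltP c (ratr q); last by move=> cq; apply: nearW.
    have [qd|] := ltP (ratr q + harmonic j) d; last first.
      by move=> qd; apply: nearW.
    by apply: ae_mono (phi0 _ _ (harmonic_gt0 j) cq qd) => x hx xab _ _; exact: hx.
  apply: ae_mono (ae_and hphi gae) => x [hx gxi].
  have mgx : measurable_fun setT (fun y => g (x, y)).
    by move/integrableP : gxi => [/measurable_EFinP].
  apply/ae_eq_integral_abs => //; first exact/measurable_EFinP.
  have [xab|xab] := boolP (a < x < b); last first.
    by apply: nearW => y _; rewrite g0// => -[/= h _]; rewrite h in xab.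
  have := @du_bois_reymond1_rat (fun y => g (x, y)) c d gxi.
  move=> H; apply: ae_mono (H _); last first.
    by move=> q j cq qd; have := hx (q, j) xab cq qd.
  move=> y hy _; have [ycd|ycd] := boolP (c < y < d); first by rewrite hy.
  by rewrite g0// => -[/= _ h]; rewrite h in ycd.
have : (\int[area]_p `|(g p)%:E| = 0)%E.
  have gai := integrable_abse gi.
  transitivity (\int[area]_p (abse \o (EFin \o g)) p)%E; first exact: eq_integral.
  rewrite -(integral12_prod_meas1 gai) -(@integral0 _ _ _ mu setT).
  apply: ae_eq_integral => //; first exact: measurable_int (integrable_fubini_F gai).
  by apply: ae_mono gx0 => x hx _; rewrite /fubini_F.
move=> gint; have meg : measurable_fun setT (EFin \o g) by exact/measurable_EFinP.
have /(ae_eq_integral_abs area measurableT meg) := gint.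
apply: ae_mono => p hp Qp; have := hp I; rewrite /g /= patchE mem_set// => -[].
by [].
Qed.

End DuBoisReymond.

Section RealDominatedConvergence.
Context d (T : measurableType d) (R : realType) (m : {measure set T -> \bar R}).

Lemma Rintegral_dominated_cvg (D : set T) (f_ : nat -> T -> R) (f g : T -> R) :
  measurable D -> (forall n, measurable_fun D (f_ n)) -> measurable_fun D f ->
  m.-integrable D (EFin \o g) ->
  {ae m, forall x, D x -> (fun n => f_ n x) @ \oo --> f x} ->
  (forall n x, D x -> `|f_ n x| <= g x) ->
  (fun n => \int[m]_(x in D) f_ n x) @ \oo --> \int[m]_(x in D) f x.
Proof.
move=> mD mf_ mf gi ff fg.
have [fi _ cv] : [/\ m.-integrable D (EFin \o f),
  [sequence \int[m]_(x in D) `|(EFin \o f_ n) x - (EFin \o f) x|%E]_n @ \oo --> 0%E &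
  [sequence \int[m]_(x in D) (EFin \o f_ n) x]_n @ \oo --> \int[m]_(x in D) (EFin \o f) x]%E.
  apply: (@dominated_convergence _ T R m D mD (fun n => EFin \o f_ n) _ (EFin \o g)) => //.
  - by move=> n; apply/measurable_EFinP.
  - exact/measurable_EFinP.
  - by apply: ae_mono ff => x ff Dx; apply: cvg_EFin; [exact: nearW|exact: ff].
  - by apply: aeW => x Dx n; rewrite lee_fin fg.
rewrite /Rintegral; apply: fine_cvg; rewrite fineK//.
exact: integrable_fin_num.
Qed.

Lemma integrable_restrict (D : set T) (f : T -> R) : measurable D ->
  m.-integrable D (EFin \o f) -> m.-integrable setT (EFin \o (f \_ D)).
Proof. by move=> mD fi; rewrite -restrict_EFin; apply/(integrable_mkcond _ mD). Qed.

(** Cauchy-Schwarz against the constant 1, from the nonnegativity of the integral of (g - l)^2 at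
    the optimal l = I / a. *)
Lemma Rintegral_sqr_le (A : set T) (a : R) (g : T -> R) : measurable A -> m A = a%:E ->
  m.-integrable A (EFin \o g) -> m.-integrable A (fun x => (g x ^+ 2)%:E) ->
  (\int[m]_(x in A) g x) ^+ 2 <= a * \int[m]_(x in A) g x ^+ 2.
Proof.
move=> mA Aa gi g2i; have Afin : (m A < +oo)%E by rewrite Aa ltry.
set I := \int[m]_(x in A) g x; set J := \int[m]_(x in A) _.
have a0 : 0 <= a by rewrite -lee_fin -Aa.
have ci (c : R) : m.-integrable A (EFin \o (fun=> c)).
  apply: measurable_bounded_integrable => //.
  exact: (@bounded_fun_in _ _ _ _ `|c|).
have key (l : R) : 0 <= J - 2 * l * I + l ^+ 2 * a.
  have : 0 <= \int[m]_(x in A) (g x - l) ^+ 2 by apply: Rintegral_ge0 => x _; exact: sqr_ge0.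
  under eq_Rintegral do rewrite sqrrB.
  have gli : m.-integrable A (EFin \o (fun x => g x * l *+ 2)).
    have := integrableZl mA (l *+ 2) gi; apply: eq_integrable => // x _ /=.
    by rewrite -EFinM; congr EFin; rewrite mulrnAl mulrC.
  rewrite RintegralD//; last exact: (integrable_sub mA g2i gli).
  rewrite RintegralB// Rintegral_cst// Aa -/J.
  rewrite (_ : \int[m]_(x in A) (g x * l *+ 2) = 2 * l * I)//.
  rewrite -RintegralZl//; apply: eq_Rintegral => x _.
  by rewrite mulr2n; ring.
(* For a = 0 the quadratic in l degenerates to the affine function J - 2 l I, which can be
   nonnegative for every l only if I = 0; l = (J + 1) / I exhibits a negative value. *)
have [a00|an0] := eqVneq a 0.
  rewrite a00 mul0r -(mulr0 0) expr2; have := key I; have := key (- I).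
  have J0 : 0 <= J by apply: Rintegral_ge0 => x _; exact: sqr_ge0.
  suff -> : I = 0 by rewrite !mulr0.
  apply/eqP/negPn/negP => I0.
  have := key ((J + 1) / I); rewrite a00 mulr0 addr0 -mulrA divfK//; lra.
have a1 : 0 < a by rewrite lt_def an0.
have := key (I / a).
rewrite (_ : J - _ + _ = (a * J - I ^+ 2) / a); last by field.
by rewrite pmulr_lge0 ?invr_gt0// subr_ge0.
Qed.

End RealDominatedConvergence.

(** * Weak derivatives on an interval and their primitives *)

Section WeakDerivatives.
Context {R : realType}.
Local Notation mu := (@lebesgue_measure R).

Lemma Ck_nsmooth k (f : R -> R) : nsmooth k f -> Ck k f.
Proof.
elim: k f => [|k ih] f //= [g [dg sg]].
split=> [x|v]; first by apply/derivable1_diffP; case: (dg x).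
rewrite (_ : 'D_v f = fun x => v * g x); first by apply: ih; apply: nsmoothM => //; exact: nsmooth_cst.
apply/funext => x; have df : differentiable f x by apply/derivable1_diffP; case: (dg x).
by rewrite deriveE// diff1E// (derive1_is_derive (dg x)).
Qed.

Lemma ae_pick (P : R -> Prop) (a b : R) : a < b ->
  {ae mu, forall t, a < t < b -> P t} -> exists2 t, a < t < b & P t.
Proof.
move=> ab [N [mN N0 sN]]; apply: contrapT => nex.
have : (mu `]a, b[ <= mu N)%E.
  apply: le_measure; [by rewrite inE; exact: measurable_itv|by rewrite inE|].
  move=> t; rewrite /= in_itv/= => tab; apply: sN => /= h.
  by apply: nex; exists t => //; exact: h.
rewrite N0 lebesgue_measure_itv/= lte_fin ab -EFinB lee_fin subr_le0.
by rewrite leNgt ab.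
Qed.

Lemma eq_seq_cvg (u v : R^nat) (l : R) : u @ \oo --> l -> (forall n, u n = v n) ->
  v @ \oo --> l.
Proof. by move=> ul uv; rewrite (_ : v = u)//; apply/funext. Qed.

Lemma measurable_ltr_cst (D : set R) (x : R) :
  measurable_fun D (fun y : R => (x < y)%R%:R : R).
Proof.
rewrite (_ : (fun y => _) = \1_`]x, +oo[).
  by apply: measurable_indic; exact: measurable_itv.
by apply/funext => y; rewrite indicE mem_setE in_itv/= andbT.
Qed.

Lemma ramp_cvg (h : R^nat) x y : (forall n, 0 < h n) -> h @ \oo --> (0 : R) ->
  (fun n => ramp x (h n) y) @ \oo --> ((x < y)%R%:R : R).
Proof.
move=> h0 hc; have [xy|yx] := ltP x y.
  have : \forall n \near \oo, `|h n| < y - x.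
    by move/cvgr0Pnorm_lt : hc; apply; rewrite subr_gt0.
  move=> H; apply: cvg_near_cst; apply: filterS H => n hn.
  apply: ramp1 => //; move: hn; rewrite gtr0_norm//; lra.
by apply: cvg_near_cst; apply: nearW => n; rewrite ramp0.
Qed.

Lemma Ccoo_support (D : set R) (P : R -> R) x y :
  (forall k, nsmooth k P) -> `[x, y] `<=` D -> (forall z, z \notin `[x, y] -> P z = 0) ->
  Ccoo D P.
Proof.
move=> sP xyD P0; split=> [k|]; first exact: Ck_nsmooth.
exists `[x, y]%classic; split => //; first exact: segment_compact.
by move=> z nz; apply: P0; apply/negP.
Qed.

Lemma integral_restrict_kern (D : set R) (f k : R -> R) :
  \int[mu]_(y in D) (f y * k y) = \int[mu]_y ((f \_ D) y * k y).
Proof.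
rewrite Rintegral_mkcond; apply: eq_Rintegral => y _.
by rewrite !patchE; case: ifP => //; rewrite mul0r.
Qed.

(** Tested with the trapezoid that rises right of x and falls right of x'. As the width tends to 0,
    the left side of the weak formulation tends to f x - f x' because both are Lebesgue points, and
    the trapezoid tends to the indicator of ]x, x']. *)
Lemma weak_derivative_increment (a b x x' : R) (f g : R -> R) :
  mu.-integrable `]a, b[ (EFin \o f) -> mu.-integrable `]a, b[ (EFin \o g) ->
  weak_derivative `]a, b[ f g ->
  a < x -> x < x' -> x' < b ->
  lebesgue_pt (f \_ `]a, b[) x -> lebesgue_pt (f \_ `]a, b[) x' ->
  f x' - f x = \int[mu]_(y in `]x, x']) g y.
Proof.
move=> fi gi wfg ax xx' x'b lx lx'.
set D := `]a, b[%classic in fi gi wfg lx lx'.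
have mD : measurable D by exact: measurable_itv.
have d0 : 0 < b - x' by rewrite subr_gt0.
have [N [hc hs]] := harmonic_small d0.
pose h n := @harmonic R (n + N).
have h0 n : 0 < h n by exact: harmonic_gt0.
pose P n y := ramp x (h n) y - ramp x' (h n) y.
have sP k n : nsmooth k (P n).
  rewrite (_ : P n = fun y => ramp x (h n) y + (-1) * ramp x' (h n) y).
    apply: nsmoothD; first exact: nsmooth_ramp.
    by apply: nsmoothM; [exact: nsmooth_cst|exact: nsmooth_ramp].
  by apply/funext => y; rewrite /P mulN1r.
have CP n : Ccoo D (P n).
  apply: (@Ccoo_support _ _ x (x' + h n)) => // y.
    rewrite /D /= !in_itv/= => /andP[y1 y2]; have := hs n; rewrite -/(h n) => hn.
    by apply/andP; split; lra.
  rewrite in_itv/= negb_and -!ltNge => /orP[y1|y1]; have hn := h0 n; rewrite /P.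
    by rewrite !ramp0 ?subrr//; lra.
  by rewrite !ramp1 ?subrr//; lra.
have dP n : derive1 (P n) = fun y => kern x (h n) y - kern x' (h n) y.
  apply/funext => y; apply: derive1_is_derive.
  exact: (is_deriveB (is_derive_ramp _ _ _) (is_derive_ramp _ _ _)).
have fDi : mu.-integrable setT (EFin \o (f \_ D)).
  exact: (integrable_restrict _ fi).
have fkc z : lebesgue_pt (f \_ D) z ->
    (fun n => \int[mu]_y ((f \_ D) y * kern z (h n) y)) @ \oo --> (f \_ D) z.
  move=> lz; apply: (@integral_kern_cvg R _ z (cst z) h) => // n.
  by rewrite /cst subrr normr0 ltW.
have fkI z n : mu.-integrable setT (EFin \o (fun y => (f \_ D) y * kern z (h n) y)).
  have [M M0 hM] := kern_bounded z (h n).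
  by apply: (integrable_mulr (M := M) _ fDi) => //; exact: measurable_kern.
have L : (fun n => \int[mu]_(y in D) (f y * derive1 (P n) y)) @ \oo --> f x - f x'.
  rewrite (_ : f x = (f \_ D) x); last first.
    by rewrite patchE mem_set// /D /= in_itv/=; apply/andP; split; lra.
  rewrite (_ : f x' = (f \_ D) x'); last first.
    by rewrite patchE mem_set// /D /= in_itv/=; apply/andP; split; lra.
  apply: (@eq_seq_cvg (fun n => \int[mu]_y ((f \_ D) y * kern x (h n) y) -
      \int[mu]_y ((f \_ D) y * kern x' (h n) y))).
    by apply: cvgB; exact: fkc.
  move=> n.
  rewrite [RHS]integral_restrict_kern -RintegralB//; apply: eq_Rintegral => y _.
  by rewrite dP mulrBr.
have mg : measurable_fun D g by move/integrableP : gi => [/measurable_EFinP].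
have M : (fun n => \int[mu]_(y in D) (g y * P n y)) @ \oo -->
    \int[mu]_(y in D) (g y * ((x < y)%R%:R - (x' < y)%R%:R)).
  apply: (@Rintegral_dominated_cvg _ _ R mu D (fun n y => g y * P n y)
    (fun y => g y * ((x < y)%R%:R - (x' < y)%R%:R)) (fun y => `|g y|)) => //.
  - move=> n; apply: measurable_funM => //.
    by apply: measurable_funB; exact: measurable_ramp.
  - apply: measurable_funM => //; by apply: measurable_funB; exact: measurable_ltr_cst.
  - have := integrable_abse gi; by apply: eq_integrable.
  - apply: aeW => y _; apply: cvgM; first exact: cvg_cst.
    by apply: cvgB; exact: ramp_cvg.
  - move=> n y _; rewrite normrM ler_piMr// /P ler_norml.
    have := ramp_ge0 x (h n) y; have := ramp_le1 x (h n) y.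
    have := ramp_ge0 x' (h n) y; have := ramp_le1 x' (h n) y.
    by move=> *; apply/andP; split; lra.
have E : f x - f x' = - \int[mu]_(y in D) (g y * ((x < y)%R%:R - (x' < y)%R%:R)).
  have Mn : (fun n => - \int[mu]_(y in D) (g y * P n y)) @ \oo -->
      - \int[mu]_(y in D) (g y * ((x < y)%R%:R - (x' < y)%R%:R)) by exact: cvgN.
  have L2 : (fun n => \int[mu]_(y in D) (f y * derive1 (P n) y)) @ \oo -->
      - \int[mu]_(y in D) (g y * ((x < y)%R%:R - (x' < y)%R%:R)).
    by apply: (eq_seq_cvg Mn) => n; rewrite -wfg.
  exact: (cvg_unique _ L L2).
rewrite -opprB E opprK [in LHS]Rintegral_mkcond [RHS]Rintegral_mkcond.
apply: eq_Rintegral => y _; rewrite !patchE /D !mem_setE /= !in_itv/=.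
have [|] := ltP x y; have [|] := ltP x' y => h1 h2 /=.
- by rewrite subrr mulr0; case: ifP => //; rewrite andbF.
- by rewrite subr0 mulr1 (_ : a < y) 1?(_ : y < b)//; lra.
- by exfalso; lra.
- by rewrite subrr mulr0; case: ifP.
Qed.

End WeakDerivatives.

Section Primitive.
Context {R : realType}.
Local Notation mu := (@lebesgue_measure R).
Variables (H : R) (f g : R -> R).
Hypothesis H0 : 0 < H.
Local Notation D := (`]-H, H[%classic : set R).
Hypothesis gi : mu.-integrable D (EFin \o g).
Hypothesis g2i : mu.-integrable D (fun y => (g y ^+ 2)%:E).

(** The continuous representative of f. Extending g by 0 outside the interval allows the two end
    points as arguments. *)
Definition primitive (y : R) : R := \int[mu]_(z in `]-H, y]) (g \_ D) z.
Local Notation v := primitive.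

Let G := g \_ D.

Let GiT : mu.-integrable setT (EFin \o G).
Proof. by apply: (integrable_restrict _ gi); exact: measurable_itv. Qed.

Let G2iT : mu.-integrable setT (EFin \o (fun y => G y ^+ 2)).
Proof.
have : mu.-integrable setT (EFin \o ((fun y => g y ^+ 2) \_ D)).
  by apply: (integrable_restrict _ g2i); exact: measurable_itv.
apply: eq_integrable => // y _ /=; rewrite /G !patchE.
by case: ifP => // _; rewrite expr0n.
Qed.

Let Gi (i : interval R) : mu.-integrable [set` i] (EFin \o G).
Proof. by apply: integrableS GiT => //; exact: measurable_itv. Qed.

Let G2i (i : interval R) : mu.-integrable [set` i] (EFin \o (fun y => G y ^+ 2)).
Proof. by apply: integrableS G2iT => //; exact: measurable_itv. Qed.

Lemma primitiveB x y : - H <= x -> x <= y -> v y - v x = \int[mu]_(z in `]x, y]) G z.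
Proof.
by move=> Hx xy; rewrite /v -(@Rintegral_itvB R G (BRight (- H)) (BRight y) x (Gi _)) ?bnd_simp.
Qed.

Lemma primitive_left : v (- H) = 0.
Proof. by rewrite /v set_itvoc0 ?Rintegral_set0. Qed.

Let e2 x y := \int[mu]_(z in `]x, y]) (G z ^+ 2).

Let e2D x y z : x <= y -> y <= z -> e2 x z = e2 x y + e2 y z.
Proof.
move=> xy yz; rewrite /e2 -(@Rintegral_itvB R (fun y => G y ^+ 2) (BRight x) (BRight z) y (G2i _)) ?bnd_simp//.
by rewrite addrC subrK.
Qed.

Let e2_ge0 x y : 0 <= e2 x y.
Proof. by apply: Rintegral_ge0 => z _; exact: sqr_ge0. Qed.

Lemma energyE : e2 (- H) H = \int[mu]_(y in D) (g y ^+ 2).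
Proof.
rewrite /e2 -Rintegral_itv_bndo_bndc//.
by apply: eq_Rintegral => z zD; rewrite /G patchE zD.
Qed.

Let cs x y : - H <= x -> x <= y -> (v y - v x) ^+ 2 <= (y - x) * e2 x y.
Proof.
move=> Hx xy; rewrite primitiveB//.
have m1 : mu `]x, y] = (y - x)%:E.
  rewrite lebesgue_measure_itv/= lte_fin; have [|yx] := ltP x y; first by rewrite EFinB.
  by rewrite (_ : y = x) ?subrr//; apply/eqP; rewrite eq_le xy yx.
by apply: (Rintegral_sqr_le _ m1) => //; exact: measurable_itv.
Qed.

Let E := \int[mu]_(y in D) (g y ^+ 2).

Let e2_le x y : - H <= x -> x <= y -> y <= H -> e2 x y <= E.
Proof.
move=> Hx xy yH; rewrite /E -energyE (e2D Hx (le_trans xy yH)) (e2D xy yH).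
by have := e2_ge0 (- H) x; have := e2_ge0 y H; lra.
Qed.

Lemma primitive_holder x y : - H <= x -> x <= y -> y <= H ->
  (v y - v x) ^+ 2 <= (y - x) * E.
Proof.
move=> Hx xy yH; apply: (le_trans (cs Hx xy)).
by rewrite ler_wpM2l ?subr_ge0// e2_le.
Qed.

Let E_ge0 : 0 <= E. Proof. by apply: Rintegral_ge0 => y _; exact: sqr_ge0. Qed.

Lemma primitive_close (e : R) : 0 < e -> exists2 d, 0 < d & forall x y,
  - H <= x -> x <= y -> y <= H -> y - x <= d -> `|v y - v x| <= e.
Proof.
move=> e0; have E1 : 0 < E + 1 by rewrite ltr_wpDl.
exists (e ^+ 2 / (E + 1)); first by rewrite divr_gt0// exprn_gt0.
move=> x y Hx xy yH yx; rewrite -ler_sqr ?nnegrE ?normr_ge0 ?(ltW e0)// real_normK ?num_real//.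
apply: (le_trans (primitive_holder Hx xy yH)).
apply: (@le_trans _ _ (e ^+ 2 / (E + 1) * E)); first by rewrite ler_wpM2r.
by rewrite -mulrA ler_piMr ?sqr_ge0// mulrC ler_pdivrMr// mul1r lerDl.
Qed.

Hypothesis fi : mu.-integrable D (EFin \o f).
Hypothesis fg : weak_derivative D f g.
Hypothesis fl : right_limit f (- H) 0.
Hypothesis fr : left_limit f H 0.

(** By [weak_derivative_increment] the difference f - v takes the same value at all Lebesgue points.
    The essential limit of f at -H, together with the continuity of v and v (-H) = 0, shows that
    this value is 0. *)
Lemma ae_primitive : {ae mu, forall y, - H < y < H -> f y = v y}.
Proof.
have fDi : mu.-integrable setT (EFin \o (f \_ D)).
  by apply: (integrable_restrict _ fi); exact: measurable_itv.
have lae := lebesgue_pt_ae fDi.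
have inc x y : - H < x -> x < y -> y < H -> lebesgue_pt (f \_ D) x ->
    lebesgue_pt (f \_ D) y -> f y - v y = f x - v x.
  move=> Hx xy yH lx ly.
  have := weak_derivative_increment fi gi fg Hx xy yH lx ly.
  have : v y - v x = \int[mu]_(z in `]x, y]) g z.
    rewrite primitiveB ?ltW//; apply: eq_Rintegral => z; rewrite inE/= in_itv/= => /andP[z1 z2].
    by rewrite /G patchE mem_set//= in_itv/=; apply/andP; split; lra.
  by move=> <-; lra.
apply: ae_mono lae => y ly /andP[Hy yH].
suff : forall e : R, 0 < e -> `|f y - v y| <= e.
  move=> h; apply/eqP; rewrite -subr_eq0 -normr_le0; apply/ler_addgt0Pl => e e0.
  by rewrite addr0; exact: h.
move=> e e0; have e20 : 0 < e / 2 by rewrite divr_gt0.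
have [d d0 hd] := fl e20; have [d' d'0 hd'] := primitive_close e20.
pose r := Num.min (y + H) (Num.min d d').
have r0 : 0 < r by rewrite !lt_min d0 d'0 andbT; lra.
have [t] : exists2 t, - H < t < - H + r & lebesgue_pt (f \_ D) t /\ `|f t - 0| < e / 2.
  apply: ae_pick; first by rewrite ltrDl.
  apply: ae_mono (ae_and (lebesgue_pt_ae fDi) hd) => t [lt1 lt2] /andP[t1 t2].
  split => //; apply: lt2; rewrite t1 (lt_le_trans t2)// lerD2l.
  by rewrite /r !ge_min lexx !orbT.
move=> /andP[t1 t2] [lt1 lt2].
have ry : r <= y + H by rewrite /r ge_min lexx.
have rd' : r <= d' by rewrite /r !ge_min lexx !orbT.
rewrite (inc t y)//; last by lra.
have vt : `|v t - v (- H)| <= e / 2 by apply: hd' => //; lra.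
move: vt; rewrite primitive_left subr0 => vt; rewrite subr0 in lt2.
apply: (le_trans (ler_normB _ _)); lra.
Qed.

Lemma primitive_right : v H = 0.
Proof.
apply/eqP; rewrite -normr_le0; apply/ler_addgt0Pl => e e0; rewrite addr0.
have e20 : 0 < e / 2 by rewrite divr_gt0.
have [d d0 hd] := fr e20; have [d' d'0 hd'] := primitive_close e20.
pose r := Num.min H (Num.min d d').
have r0 : 0 < r by rewrite !lt_min d0 d'0 H0.
have [t] : exists2 t, H - r < t < H & f t = v t /\ `|f t - 0| < e / 2.
  apply: ae_pick; first by rewrite gtrBl.
  apply: ae_mono (ae_and ae_primitive hd) => t [lt1 lt2] /andP[t1 t2].
  have rH : r <= H by rewrite /r ge_min lexx.
  have rd : r <= d by rewrite /r !ge_min lexx !orbT.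
  by split; [apply: lt1|apply: lt2]; apply/andP; split; lra.
move=> /andP[t1 t2] [-> lt2]; rewrite subr0 in lt2.
have rH : r <= H by rewrite /r ge_min lexx.
have rd' : r <= d' by rewrite /r !ge_min lexx !orbT.
have vt : `|v H - v t| <= e / 2 by apply: hd'; lra.
have -> : v H = (v H - v t) + v t by rewrite subrK.
apply: (le_trans (ler_normD _ _)); lra.
Qed.

(** Cauchy-Schwarz from both ends: v^2 <= (H + y) e and v^2 <= (H - y) e', where e + e' = E.
    Weighting by H - y and H + y and adding gives 2 H v^2 <= (H^2 - y^2) E. This is the elastic cost
    of raising |u_2| to a given height and lowering it again. *)
Lemma primitive_sqr_le y : - H <= y -> y <= H -> v y ^+ 2 * 2 <= H * E.
Proof.
move=> Hy yH.
have := cs (lexx (- H)) Hy; rewrite primitive_left subr0 => h1.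
have := cs Hy yH; rewrite primitive_right sub0r sqrrN => h2.
have := e2D Hy yH; rewrite energyE -/E => h3.
have p1 : 0 <= e2 (- H) y := e2_ge0 _ _.
have p2 : 0 <= e2 y H := e2_ge0 _ _.
have k1 : (H - y) * v y ^+ 2 <= (H - y) * ((y + H) * e2 (- H) y).
  by rewrite ler_wpM2l ?subr_ge0//; move: h1; rewrite opprK.
have k2 : (H + y) * v y ^+ 2 <= (H + y) * ((H - y) * e2 y H).
  by rewrite ler_wpM2l//; lra.
have k3 : (H - y) * (H + y) * E <= H ^+ 2 * E.
  by rewrite ler_wpM2r//; nra.
rewrite -(ler_pM2l H0); rewrite h3 in k3 *; nra.
Qed.

End Primitive.

Section KernelMass.
Context {R : realType}.
Local Notation mu := (@lebesgue_measure R).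

Lemma lebesgue_itv_lty (a b : R) (x y : bool) :
  (mu [set` Interval (BSide x a) (BSide y b)] < +oo)%E.
Proof. by rewrite lebesgue_measure_itv/=; case: ifP => // _; rewrite -EFinB ltry. Qed.

Lemma integrable_kern x h : 0 < h -> mu.-integrable setT (EFin \o @kern R x h).
Proof.
move=> h0; have [M M0 hM] := kern_bounded x h.
have ki : mu.-integrable `[x, x + h] (EFin \o @kern R x h).
  apply: measurable_bounded_integrable.
  - exact: measurable_itv.
  - exact: lebesgue_itv_lty.
  - exact: measurable_kern.
  - by apply: (@bounded_fun_in _ _ _ _ M).
have : mu.-integrable setT (EFin \o (@kern R x h \_ `[x, x + h])).
  by apply: (integrable_restrict _ ki); exact: measurable_itv.
apply: eq_integrable => // y _ /=; rewrite patchE; case: ifPn => //.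
by rewrite mem_setE => /(kern_out h0) ->.
Qed.

Lemma kern_integralT x h : 0 < h -> \int[mu]_y @kern R x h y = 1.
Proof.
move=> h0; rewrite -(kern_integral x h0) [RHS]Rintegral_mkcond.
apply: eq_Rintegral => y _; rewrite patchE; case: ifPn => //.
by rewrite mem_setE => /(kern_out h0) ->.
Qed.

Lemma integral_kern_cst (g : R -> R) (c x h : R) : 0 < h ->
  mu.-integrable setT (EFin \o g) ->
  {ae mu, forall t, x < t < x + h -> g t = c} ->
  \int[mu]_y (g y * kern x h y) = c.
Proof.
move=> h0 gi gc.
have [M M0 hM] := kern_bounded x h.
transitivity (\int[mu]_y (c * kern x h y)); last first.
  by rewrite RintegralZl// ?kern_integralT ?mulr1//; exact: integrable_kern.
rewrite /Rintegral; congr fine; apply: ae_eq_integral => //.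
- have mg : measurable_fun setT g by move/integrableP : gi => [/measurable_EFinP].
  by apply/measurable_EFinP; apply: measurable_funM => //; exact: measurable_kern.
- by apply/measurable_EFinP; apply: measurable_funM => //; exact: measurable_kern.
have nx (z : R) : {ae mu, forall t, t <> z}.
  exists [set z]; split; [exact: measurable_set1|exact: lebesgue_measure_set1|].
  by move=> t /= /contrapT ->.
apply: ae_mono (ae_and gc (ae_and (nx x) (nx (x + h)))) => t [ht [tx txh]] _.
congr EFin; have [|out] := boolP (t \in `[x, x + h]); last by rewrite kern_out ?mulr0.
rewrite in_itv/= => /andP[t1 t2]; rewrite ht// !lt_neqAle t1 t2 !andbT.
by apply/andP; split; apply/eqP => // /esym.
Qed.

(** Kernels based at x charge only the right of x, so a value taken almost everywhere on one side
    passes to a Lebesgue point. *)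
Lemma lebesgue_pt_right (g : R -> R) (c x d : R) : 0 < d ->
  mu.-integrable setT (EFin \o g) -> lebesgue_pt g x ->
  {ae mu, forall t, x < t < x + d -> g t = c} -> g x = c.
Proof.
move=> d0 gi lx gc; have [N [hc hs]] := harmonic_small d0.
have h0 n : 0 < @harmonic R (n + N) by exact: harmonic_gt0.
have := @integral_kern_cvg R g x (cst x) (fun n => harmonic (n + N)) gi lx h0 hc.
have h1 n : `|cst x n - x| <= @harmonic R (n + N) by rewrite /cst subrr normr0 ltW.
move=> /(_ h1) L.
have L2 : (fun n => \int[mu]_y (g y * kern (cst x n) (harmonic (n + N)) y)) @ \oo --> c.
  apply: (@eq_seq_cvg _ (cst c)); first exact: cvg_cst.
  move=> n; apply/esym/integral_kern_cst => //.
  apply: ae_mono gc => t ht /andP[t1 t2]; apply: ht; rewrite t1/=.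
  by apply: (lt_trans t2); rewrite ltrD2l hs.
exact: (cvg_unique _ L L2).
Qed.

Lemma lebesgue_pt_left (g : R -> R) (c x d : R) : 0 < d ->
  mu.-integrable setT (EFin \o g) -> lebesgue_pt g x ->
  {ae mu, forall t, x - d < t < x -> g t = c} -> g x = c.
Proof.
move=> d0 gi lx gc; have [N [hc hs]] := harmonic_small d0.
have h0 n : 0 < @harmonic R (n + N) by exact: harmonic_gt0.
have := @integral_kern_cvg R g x (fun n => x - harmonic (n + N)) (fun n => harmonic (n + N)) gi lx h0 hc.
have h1 n : `|x - harmonic (n + N) - x| <= @harmonic R (n + N).
  by rewrite addrAC subrr add0r normrN ger0_norm// ltW.
move=> /(_ h1) L.
have L2 : (fun n => \int[mu]_y (g y * kern (x - harmonic (n + N)) (harmonic (n + N)) y)) @ \oo --> c.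
  apply: (@eq_seq_cvg _ (cst c)); first exact: cvg_cst.
  move=> n; apply/esym/integral_kern_cst => //.
  apply: ae_mono gc => t ht /andP[t1 t2]; apply: ht; move: t2; rewrite subrK => ->.
  by rewrite andbT (lt_trans _ t1)// ltrD2l ltrN2 hs.
exact: (cvg_unique _ L L2).
Qed.

End KernelMass.

(** * Sign changes of a BV function that is bounded away from 0 *)

Section Jumps.
Context {R : realType}.
Local Notation mu := (@lebesgue_measure R).
Variables (H kap C : R) (f : R -> R) (G : R -> Prop).
Local Notation D := (`]-H, H[%classic : set R).
Let b := (fun t => (0 < f t)%R%:R : R) \_ D.
Hypothesis kap0 : 0 < kap.
Hypothesis fi : mu.-integrable D (EFin \o f).
Hypothesis fC : forall P, Cc1 D P -> (forall y, `|P y| <= 1) ->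
  \int[mu]_(y in D) (f y * derive1 P y) <= C.
Hypothesis GP : forall x, G x -> [/\ - H < x < H, lebesgue_pt (f \_ D) x,
  lebesgue_pt b x & kap <= `|f x|].
Hypothesis Gae : {ae mu, forall x, - H < x < H -> G x}.

Let pos x := 0 < f x.

Let fDi : mu.-integrable setT (EFin \o (f \_ D)).
Proof. by apply: (integrable_restrict _ fi); exact: measurable_itv. Qed.

Let bi : mu.-integrable setT (EFin \o b).
Proof.
have mf : measurable_fun D f by move/integrableP : fi => [/measurable_EFinP].
have bDi : mu.-integrable D (EFin \o (fun t => (0 < f t)%R%:R : R)).
  apply: measurable_bounded_integrable.
  - exact: measurable_itv.
  - exact: lebesgue_itv_lty.
  - exact: (measurableT_comp (measurable_ltr_cst (D := setT) 0) mf).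
  - by apply: (@bounded_fun_in _ _ _ _ 1) => t _; case: (0 < f t); rewrite ?normr1 ?normr0.
by apply: (integrable_restrict _ bDi); exact: measurable_itv.
Qed.

Let bE x : - H < x < H -> b x = (pos x)%:R.
Proof. by move=> xH; rewrite /b patchE mem_set//= in_itv. Qed.

Let test (P p : R -> R) := [/\ forall k, nsmooth k P, forall y, is_derive y (1 : R) P (p y),
  mu.-integrable D (EFin \o (fun y => f y * p y)) & forall y, `|P y| <= 1].

(** The test function ramps up just right of x and down just left of x'. As the width shrinks, its
    integral against f tends to the signed difference of f x and f x', which is at least 2 [kap]
    because the signs differ; a loss of [kap] is allowed to reach an actual width. *)
Let bump x x' : G x -> G x' -> x < x' -> pos x != pos x' -> exists P p,
  [/\ test P p, forall y, y <= x -> P y = 0, forall y, x' <= y -> P y = 0 &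
      kap <= \int[mu]_(y in D) (f y * p y)].
Proof.
move=> Gx Gx' xx' px.
have [/andP[x1 x2] lx _ kx] := GP Gx; have [/andP[x'1 x'2] lx' _ kx'] := GP Gx'.
pose e : R := if pos x then 1 else -1.
have e1 : `|e| = 1 by rewrite /e; case: ifP; rewrite ?normrN normr1.
have ek : 2 * kap <= e * (f x - f x').
  move: px kx kx'; rewrite /e /pos.
  have [fx|fx] := ltP 0 (f x); have [fx'|fx'] //= := ltP 0 (f x') => _.
    by rewrite (gtr0_norm fx) (ler0_norm fx') => *; lra.
  by rewrite (gtr0_norm fx') (ler0_norm fx) => *; lra.
have d0 : 0 < (x' - x) / 2 by rewrite divr_gt0// subr_gt0.
have [N [hc hs]] := harmonic_small d0.
pose h n := @harmonic R (n + N).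
have h0 n : 0 < h n by exact: harmonic_gt0.
have L1 := @integral_kern_cvg R _ x (cst x) h fDi lx h0 hc.
have L2 := @integral_kern_cvg R _ x' (fun n => x' - h n) h fDi lx' h0 hc.
have {}L1 := L1 (fun n => _).
have {}L2 := L2 (fun n => _).
have h1 n : `|cst x n - x| <= h n by rewrite /cst subrr normr0 ltW.
have h2 n : `|x' - h n - x'| <= h n by rewrite addrAC subrr add0r normrN ger0_norm// ltW.
have {}L1 := L1 h1; have {}L2 := L2 h2.
pose k n y := e * (kern x (h n) y - kern (x' - h n) (h n) y).
have fkI z n : mu.-integrable setT (EFin \o (fun y => (f \_ D) y * kern z (h n) y)).
  have [M M0 hM] := kern_bounded z (h n).
  by apply: (integrable_mulr (M := M) _ fDi) => //; exact: measurable_kern.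
have IE n : \int[mu]_(y in D) (f y * k n y) =
    e * (\int[mu]_y ((f \_ D) y * kern x (h n) y) -
         \int[mu]_y ((f \_ D) y * kern (x' - h n) (h n) y)).
  rewrite [LHS]integral_restrict_kern -RintegralB// -RintegralZl//; last exact: integrable_sub.
  by apply: eq_Rintegral => y _; rewrite /k mulrCA mulrBr.
have fxD : (f \_ D) x = f x by rewrite patchE mem_set//= in_itv/= x1 x2.
have fxD' : (f \_ D) x' = f x' by rewrite patchE mem_set//= in_itv/= x'1 x'2.
have L : (fun n => \int[mu]_(y in D) (f y * k n y)) @ \oo --> e * (f x - f x').
  apply: (@eq_seq_cvg _ (fun n => e * (\int[mu]_y ((f \_ D) y * kern x (h n) y) -
         \int[mu]_y ((f \_ D) y * kern (x' - h n) (h n) y)))).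
    by apply: cvgM; [exact: cvg_cst|rewrite -fxD -fxD'; exact: cvgB].
  by move=> n; rewrite IE.
have [n _ hn] : \forall n \near \oo, `|e * (f x - f x') - \int[mu]_(y in D) (f y * k n y)| < kap.
  by move/cvgrPdist_lt : L; apply.
have {}hn := hn n (leqnn n).
have hsn := hs n; rewrite -/(h n) in hsn.
exists (fun y => e * (ramp x (h n) y - ramp (x' - h n) (h n) y)), (k n).
have hn0 := h0 n.
split.
- split.
  + move=> j; apply: nsmoothM; first exact: nsmooth_cst.
    rewrite (_ : (fun y => _) = fun y => ramp x (h n) y + (-1) * ramp (x' - h n) (h n) y).
      apply: nsmoothD; first exact: nsmooth_ramp.
      by apply: nsmoothM; [exact: nsmooth_cst|exact: nsmooth_ramp].
    by apply/funext => y; rewrite mulN1r.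
  + move=> y.
    have dd := is_deriveB (is_derive_ramp x (h n) y) (is_derive_ramp (x' - h n) (h n) y).
    exact: (is_deriveZ e dd).
  + have [M M0 hM] := kern_bounded x (h n); have [M' M'0 hM'] := kern_bounded (x' - h n) (h n).
    apply: (integrable_mulr (M := M + M') _ fi); first exact: measurable_itv.
      apply: measurable_funM => //; apply: measurable_funB; exact: measurable_kern.
    by move=> y _; rewrite /k normrM e1 mul1r (le_trans (ler_normB _ _))// lerD.
  + move=> y; rewrite normrM e1 mul1r ler_norml.
    have := ramp_ge0 x (h n) y; have := ramp_le1 x (h n) y.
    have := ramp_ge0 (x' - h n) (h n) y; have := ramp_le1 (x' - h n) (h n) y.
    by move=> *; apply/andP; split; lra.
- by move=> y yx; rewrite !ramp0 ?subrr ?mulr0//; lra.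
- by move=> y yx; rewrite !ramp1 ?subrr ?mulr0//; lra.
- by move: hn; rewrite ltr_norml => /andP[_]; lra.
Qed.

Let alt x s := path (fun a b => (a < b) && (pos a != pos b)) x s /\
  forall y, y \in x :: s -> G y.

Let alt_last x s : alt x s -> x <= last x s.
Proof.
move=> [ps _]; elim: s x ps => //= y s ih x /andP[/andP[xy _] ps].
exact: (le_trans (ltW xy) (ih _ ps)).
Qed.

(** The bumps of consecutive pairs live on adjacent intervals, so the sum is still bounded by 1
    while the integrals add up. *)
Let bumps x s : alt x s -> exists P p,
  [/\ test P p, forall y, y <= x -> P y = 0, forall y, last x s <= y -> P y = 0 &
      kap *+ size s <= \int[mu]_(y in D) (f y * p y)].
Proof.
elim: s x => [|y s ih] x hs.
  exists (cst 0), (cst 0); split => //; last first.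
    rewrite mulr0n (_ : \int[mu]_(y in D) _ = 0)//.
    by rewrite -[RHS](Rintegral_set0 mu (cst 0)) /Rintegral; under eq_integral do rewrite mulr0; rewrite integral0 integral_set0.
  split; first by move=> k; exact: nsmooth_cst.
  - by move=> y; exact: is_derive_cst.
  - rewrite (_ : EFin \o _ = cst 0%E); first exact: integrable0.
    by apply/funext => y /=; rewrite mulr0.
  - by move=> y; rewrite normr0.
have [/= /andP[/andP[xy pxy] ps] Gs] := hs.
have as' : alt y s by split => // z zs; apply: Gs; rewrite inE zs orbT.
have [P [p [[sP dP fPi P1] P0 Pl Pk]]] := ih _ as'.
have Gx : G x by apply: Gs; rewrite mem_head.
have Gy : G y by apply: Gs; rewrite !inE eqxx orbT.
have [Q [q [[sQ dQ fQi Q1] Q0 Ql Qk]]] := bump Gx Gy xy pxy.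
exists (fun z => Q z + P z), (fun z => q z + p z); split.
- split.
  + by move=> k; exact: nsmoothD.
  + by move=> z; exact: (is_deriveD (dQ z) (dP z)).
  + rewrite (_ : (fun y0 => _) = fun z => f z * q z + f z * p z).
      by apply: integrable_add => //; exact: measurable_itv.
    by apply/funext => z; rewrite mulrDr.
  + move=> z; have [zy|yz] := leP z y; first by rewrite P0// addr0.
    by rewrite Ql ?add0r// ltW.
- by move=> z zx; rewrite Q0// P0 ?addr0// (le_trans zx)// ltW.
- move=> z lz; rewrite Pl// Ql ?addr0//.
  exact: (le_trans (alt_last as')).
- under eq_Rintegral do rewrite mulrDr.
  by rewrite RintegralD// mulrS lerD.
Qed.

Let alt_size x s : alt x s -> kap *+ size s <= C.
Proof.
move=> hs; have [P [p [[sP dP fPi P1] P0 Pl Pk]]] := bumps hs.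
apply: (le_trans Pk).
have -> : p = derive1 P by apply/funext => y; rewrite (derive1_is_derive (dP y)).
have [_ Gs] := hs.
have Gx : G x by apply: Gs; rewrite mem_head.
have Gl : G (last x s) by apply: Gs; exact: mem_last.
apply: fC => //; split; first exact: Ck_nsmooth.
exists `[x, last x s]%classic; split; first exact: segment_compact.
  have [/andP[? ?] _ _ _] := GP Gx; have [/andP[? ?] _ _ _] := GP Gl.
  by move=> y /=; rewrite !in_itv/= => /andP[? ?]; apply/andP; split; lra.
move=> y /= /negP; rewrite in_itv/= negb_and -!ltNge => /orP[h|h].
  by rewrite P0// ltW.
by rewrite Pl// ltW.
Qed.

(** The BV constant bounds the length of an alternating chain of good points by C / [kap], so a
    longest chain exists. Between its first two points no further alternation fits: the sign changes
    exactly once, at the supremum y of the points carrying the sign of x0. *)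
Lemma exists_sign_change (x x' : R) : G x -> G x' -> pos x != pos x' ->
  exists e y0 y y1, [/\ - H < y0, y0 < y, y < y1 & y1 < H] /\
    (forall t, G t -> y0 < t < y -> pos t = e) /\
    (forall t, G t -> y < t < y1 -> pos t = ~~ e).
Proof.
move=> Gx Gx' pxx'.
pose A n : bool := `[< exists x s, alt x s /\ size s = n >].
have A1 : exists n, A n && (0 < n)%N.
  exists 1%N; rewrite andbT; apply/asboolP.
  have nx : x != x' by apply: contra_neq pxx' => ->.
  have [lt|lt|eq] := ltgtP x x'; last by rewrite eq eqxx in nx.
    exists x, [:: x']; split => //; split; first by rewrite /= lt pxx'.
    by move=> y; rewrite !inE => /orP[]/eqP ->.
  exists x', [:: x]; split => //; split; first by rewrite /= lt eq_sym pxx'.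
  by move=> y; rewrite !inE => /orP[]/eqP ->.
have Ab n : A n && (0 < n)%N -> (n <= Num.bound (C / kap))%N.
  move=> /andP[/asboolP[z [s [hs <-]]] _].
  have h := alt_size hs; rewrite -(ler_nat R).
  have h2 : (size s)%:R <= C / kap by rewrite ler_pdivlMr// mulr_natl.
  apply: (le_trans h2); apply/ltW/archi_boundP.
  by apply: le_trans h2.
have [N /andP[/asboolP[x0 [s [hs sN]]] N0] Nmax] := ex_maxnP A1 Ab.
case: s hs sN => [|x1 s]; first by move=> _ sN; rewrite -sN in N0.
move=> hs sN; have [/= /andP[/andP[x01 px01] ps] Gs] := hs.
have Gx0 : G x0 by apply: Gs; rewrite mem_head.
have Gx1 : G x1 by apply: Gs; rewrite !inE eqxx orbT.
pose e := pos x0.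
have px1 : pos x1 = ~~ e by move: px01; rewrite /e; case: (pos x0); case: (pos x1).
(* A point of the second sign followed by one of the first sign could be inserted, giving an
   alternating chain longer by two. *)
have ins z z' : G z -> G z' -> x0 < z -> z < z' -> z' < x1 -> pos z = ~~ e -> pos z' = e -> False.
  move=> Gz Gz' x0z zz' z'x1 pz pz'.
  have : A N.+2 && (0 < N.+2)%N.
    rewrite andbT; apply/asboolP; exists x0, [:: z, z', x1 & s]; split; last by rewrite -sN.
    split; first by rewrite /= x0z zz' z'x1 ps pz pz' px1 -/e; case: (e).
    move=> y; rewrite !inE => /or4P[/eqP->//|/eqP->//|/eqP->//|ys].
    by apply: Gs; rewrite !inE ys orbT.
  by move/Nmax; rewrite ltnNge leqnSn.
pose S := [set z | [/\ G z, x0 <= z, z < x1 & pos z = e]].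
have Sx0 : S x0 by split.
have Sub : ubound S x1 by move=> z [_ _ /ltW].
have supS : has_sup S by split; [exists x0|exists x1].
pose y := sup S.
have x0y : x0 <= y by apply: (ub_le_sup _ Sx0); exists x1.
have yx1 : y <= x1 by apply: ge_sup => //; exists x0.
have left t : G t -> x0 < t < y -> pos t = e.
  move=> Gt /andP[x0t ty]; have ty0 : 0 < y - t by rewrite subr_gt0.
  have [z [Gz x0z zx1 pz]] := sup_adherent ty0 supS; rewrite -/y subKr => tz.
  case: (eqVneq (pos t) e) => // pt; exfalso.
  apply: (ins t z) => //.
  by move: pt; rewrite /e; case: (pos t); case: (pos x0).
have right t : G t -> y < t < x1 -> pos t = ~~ e.
  move=> Gt /andP[yt tx1]; case: (eqVneq (pos t) e) => pt.
    have : t <= y by apply: ub_le_sup; [exists x1|split => //; lra].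
    by rewrite leNgt yt.
  by move: pt; case: (pos t); case: (e).
have [Hx0 lx0 bx0 _] := GP Gx0; have [Hx1 lx1 bx1 _] := GP Gx1.
have /andP[Hx01 Hx02] := Hx0; have /andP[Hx11 Hx12] := Hx1.
have d0 : 0 < x1 - x0 by rewrite subr_gt0.
exists e, x0, y, x1; split; last by split.
split => //.
(* If y were x0, the sign indicator [b] would have the opposite constant value almost everywhere
   just right of x0, against its value at the Lebesgue point x0. The same argument from the left
   excludes x1. *)
- rewrite lt_neqAle x0y andbT; apply/eqP => yE.
  have : b x0 = (~~ e)%:R.
    apply: (lebesgue_pt_right d0 bi) => //.
    apply: ae_mono Gae => t Gt; rewrite subrKC => /andP[t1 t2].
    have tH : - H < t < H by apply/andP; split; lra.
    by rewrite bE// right//; [exact: Gt|rewrite -yE t1].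
  by rewrite bE// -/e => /eqP; case: (e); rewrite /= ?oner_eq0// eq_sym oner_eq0.
- rewrite lt_neqAle yx1 andbT; apply/eqP => yE.
  have : b x1 = e%:R.
    apply: (lebesgue_pt_left d0 bi) => //.
    apply: ae_mono Gae => t Gt; rewrite subKr => /andP[t1 t2].
    have tH : - H < t < H by apply/andP; split; lra.
    by rewrite bE// left//; [exact: Gt|rewrite t1 yE].
  by rewrite bE// px1 => /eqP; case: (e); rewrite /= ?oner_eq0// eq_sym oner_eq0.
Qed.

End Jumps.

Ltac flra := clear; move=> *; lra.

Section EssentialLimits.
Context {R : realType}.
Local Notation mu := (@lebesgue_measure R).

Lemma right_limit_unique (f : R -> R) y a b :
  right_limit f y a -> right_limit f y b -> a = b.
Proof.
move=> fa fb; apply/eqP; rewrite -subr_eq0 -normr_le0; apply/ler_addgt0Pl => e e0.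
have e2 : 0 < e / 2 by rewrite divr_gt0.
have [d d0 hd] := fa _ e2; have [d' d'0 hd'] := fb _ e2.
have [t] : exists2 t, y < t < y + Num.min d d' & `|f t - a| < e / 2 /\ `|f t - b| < e / 2.
  apply: ae_pick; first by rewrite ltrDl lt_min d0.
  apply: ae_mono (ae_and hd hd') => t [h1 h2] /andP[t1].
  by rewrite -ltrBlDl lt_min !ltrBlDl => /andP[t2 t3]; rewrite h1 ?h2// t1.
move=> _ [h1 h2]; rewrite addr0 (_ : a - b = (f t - b) - (f t - a)); last by lra.
by apply: (le_trans (ler_normB _ _)); lra.
Qed.

Lemma left_limit_unique (f : R -> R) y a b :
  left_limit f y a -> left_limit f y b -> a = b.
Proof.
move=> fa fb; apply/eqP; rewrite -subr_eq0 -normr_le0; apply/ler_addgt0Pl => e e0.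
have e2 : 0 < e / 2 by rewrite divr_gt0.
have [d d0 hd] := fa _ e2; have [d' d'0 hd'] := fb _ e2.
have [t] : exists2 t, y - Num.min d d' < t < y & `|f t - a| < e / 2 /\ `|f t - b| < e / 2.
  apply: ae_pick; first by rewrite gtrBl lt_min d0.
  apply: ae_mono (ae_and hd hd') => t [h1 h2] /andP[t1 t2].
  have : y - t < Num.min d d' by lra.
  by rewrite lt_min => /andP[t3 t4]; split; [apply: h1|apply: h2]; rewrite t2 andbT; lra.
move=> _ [h1 h2]; rewrite addr0 (_ : a - b = (f t - b) - (f t - a)); last by lra.
by apply: (le_trans (ler_normB _ _)); lra.
Qed.

Lemma right_valueE (f : R -> R) y a : right_limit f y a -> right_value f y = a.
Proof.
move=> h; apply: (right_limit_unique _ h).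
exact: (@xgetPex _ (0 : R) [set a | right_limit f y a] (ex_intro _ a h)).
Qed.

Lemma left_valueE (f : R -> R) y a : left_limit f y a -> left_value f y = a.
Proof.
move=> h; apply: (left_limit_unique _ h).
exact: (@xgetPex _ (0 : R) [set a | left_limit f y a] (ex_intro _ a h)).
Qed.

Lemma point_valueE (f : R -> R) y a : left_limit f y a -> right_limit f y a ->
  point_value f y = a.
Proof.
move=> h h'; apply: (left_limit_unique _ h).
by have [] := @xgetPex _ (0 : R) [set a | left_limit f y a /\ right_limit f y a]
  (ex_intro _ a (conj h h')).
Qed.

Lemma sqrt_dist (a b : R) : 0 <= a -> 0 <= b ->
  (Num.sqrt a - Num.sqrt b) ^+ 2 <= `|a - b|.
Proof.
wlog ab : a b / b <= a.
  move=> h a0 b0; have [|/ltW] := leP b a => ab; first exact: h.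
  by rewrite -opprB sqrrN distrC h.
move=> a0 b0; have sa := sqr_sqrtr a0; have sb := sqr_sqrtr b0.
have := sqrtr_ge0 b; have : Num.sqrt b <= Num.sqrt a by rewrite ler_sqrt.
rewrite ger0_norm ?subr_ge0//; move: sa sb.
by set x := Num.sqrt a; set y := Num.sqrt b => sa sb yx y0; nra.
Qed.

Lemma L2_integrable (H : R) (g : R -> R) : L2 `]-H, H[ g ->
  mu.-integrable `]-H, H[ (EFin \o g).
Proof.
move=> [mg g2]; have ci : mu.-integrable `]-H, H[ (EFin \o (fun=> 1 : R)).
  apply: measurable_bounded_integrable => //; first exact: lebesgue_itv_lty.
  exact: (@bounded_fun_in _ _ _ _ `|1|).
have sumi : mu.-integrable `]-H, H[ (EFin \o (fun y => 1 + g y ^+ 2)).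
  by apply: (integrable_add _ ci g2); exact: measurable_itv.
apply: (le_integrable _ _ _ sumi) => //.
  exact/measurable_EFinP.
move=> x _ /=; rewrite lee_fin [X in _ <= X]ger0_norm ?addr_ge0 ?sqr_ge0//.
by rewrite ler_norml; apply/andP; split; nra.
Qed.

End EssentialLimits.

(** * The lower bound for the one-dimensional energy *)

Section LowerBound.
Context {R : realType}.
Local Notation mu := (@lebesgue_measure R).

(** Three cases. If v^2 comes arbitrarily close to 1, the elastic term alone is at least l.
    Otherwise |u_1| is bounded below. If u_1 then keeps one sign, the trace at one end is wrong and
    costs 4/3; if not, [exists_sign_change] yields a point y where u_1 jumps between s y and - s y,
    and the elastic and jump terms are minimised jointly over s y. *)
Lemma E1D_ge (L H : R) (u : R -> R * R) : 0 < L -> 0 < H -> A0 H u ->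
  ((L / H - (L / H) ^+ 3 / 12)%:E <= E1D L H u)%E.
Proof.
move=> L0 H0 [[fui [C fuC]] [f2L [g' [g'L g'w]]] fl fr u1].
set D := cross_section H in fui fuC f2L g'L g'w *.
pose f1 := fst \o u; pose f2 := snd \o u; pose l := L / H.
have l0 : 0 < l by rewrite divr_gt0.
pose g := wderive D f2.
have [gL gw] : L2 D g /\ weak_derivative D f2 g.
  exact: (@xgetPex _ (fun=> 0 : R) [set f' | L2 D f' /\ weak_derivative D f2 f']
    (ex_intro _ g' (conj g'L g'w))).
have gi : mu.-integrable D (EFin \o g) by exact: L2_integrable.
have f2i : mu.-integrable D (EFin \o f2) by exact: L2_integrable.
have [mg g2] := gL.
pose v := primitive H g.
pose E := \int[mu]_(y in D) (g y ^+ 2).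
have vae := ae_primitive gi g2 f2i gw fl.
have vE y : - H <= y -> y <= H -> l * v y ^+ 2 <= L / 2 * E.
  move=> Hy yH; have := primitive_sqr_le H0 gi g2 f2i gw fl fr Hy yH.
  rewrite -/(v y) -/E /l => h; rewrite mulrAC ler_pdivrMr//; nra.
pose S := (\esum_(y in jump_set1 D f1) (Num.sqrt (1 - point_value f2 y ^+ 2) ^+ 3)%:E)%E.
pose A := 6^-1 * `|right_value f1 (- H) + 1| ^+ 3.
pose B := 6^-1 * `|left_value f1 H - 1| ^+ 3.
have A0' : 0 <= A by rewrite mulr_ge0// exprn_ge0.
have B0' : 0 <= B by rewrite mulr_ge0// exprn_ge0.
have key q : (q%:E <= S)%E -> ((L / 2 * E + 4 / 3 * q + A + B)%:E <= E1D L H u)%E.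
  move=> qS; rewrite /E1D -/D -/f2 -/f1 -/S -/g !EFinD -/A -/B.
  rewrite leeD// leeD// leeD//; last first.
    by rewrite EFinM lee_pmul2l// lte_fin.
  rewrite EFinM /E /Rintegral fineK//; apply: integrable_fin_num => //.
  exact: measurable_itv.
have S0 : (0%:E <= S)%E.
  by apply: esum_ge0 => y _; rewrite lee_fin exprn_ge0// sqrtr_ge0.
have l3 : 0 <= l ^+ 3 / 12 by rewrite divr_ge0// exprn_ge0// ltW.
have [hsup|] := pselect (forall e, 0 < e -> exists y, [/\ - H <= y, y <= H & 1 - e < v y ^+ 2]).
  apply: le_trans (key 0 S0); rewrite lee_fin.
  have : l <= L / 2 * E.
    apply/ler_addgt0Pl => e e0; have el0 : 0 < e / l by rewrite divr_gt0.
    have [y [Hy yH vy]] := hsup _ el0; have := vE y Hy yH.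
    have : l * (1 - e / l) <= l * v y ^+ 2 by rewrite ler_pM2l// ltW.
    rewrite mulrBr mulrCA divff ?gt_eqF// !mulr1; flra.
  by rewrite -/l; move: l3 A0' B0'; flra.
move=> nsup; have [e0 e0_gt0 ve] : exists2 e0, 0 < e0 & forall y, - H <= y -> y <= H ->
    v y ^+ 2 <= 1 - e0.
  apply: contrapT => h; apply: nsup => e e_gt0; apply: contrapT => h2; apply: h.
  exists e => // y Hy yH; rewrite leNgt; apply/negP => h3; apply: h2; by exists y.
pose s y := Num.sqrt (1 - v y ^+ 2).
have s_gt0 y : - H <= y -> y <= H -> 0 < s y.
  by move=> Hy yH; rewrite sqrtr_gt0; move: (ve y Hy yH) e0_gt0; flra.
have sclose (e : R) : 0 < e -> exists2 d, 0 < d & forall x y,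
    - H <= x -> x <= y -> y <= H -> y - x <= d -> `|s y - s x| < e /\ `|v y - v x| < e.
  move=> e_gt0; pose e' := Num.min (e / 2) (e ^+ 2 / 4).
  have e'0 : 0 < e' by rewrite lt_min !divr_gt0// exprn_gt0.
  have [d d0 hd] := primitive_close gi g2 e'0; exists d => // x y Hx xy yH yxd.
  have := hd x y Hx xy yH yxd; rewrite -/(v y) -/(v x) le_min => /andP[h1 h2].
  split; last by move: h1 e_gt0; flra.
  have vx := ve x Hx (le_trans xy yH); have vy := ve y (le_trans Hx xy) yH.
  have vx1 : `|v x| <= 1 by rewrite -(@ler_pXn2r _ 2) ?nnegrE// real_normK ?num_real// expr1n; move: vx e0_gt0; flra.
  have vy1 : `|v y| <= 1 by rewrite -(@ler_pXn2r _ 2) ?nnegrE// real_normK ?num_real// expr1n; move: vy e0_gt0; flra.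
  rewrite -(@ltr_pXn2r _ 2) ?nnegrE ?(ltW e_gt0)// real_normK ?num_real//.
  apply: (le_lt_trans (sqrt_dist _ _)); [by move: vy e0_gt0; flra|by move: vx e0_gt0; flra|].
  rewrite (_ : 1 - v y ^+ 2 - (1 - v x ^+ 2) = - ((v y - v x) * (v y + v x))); last by ring.
  rewrite normrN normrM.
  have h3 : `|v y + v x| <= 2 by apply: (le_trans (ler_normD _ _)); move: vx1 vy1; flra.
  apply: (@le_lt_trans _ _ (e ^+ 2 / 4 * 2)); first by rewrite ler_pM.
  by move: (exprn_gt0 2 e_gt0); flra.
pose fu y := f1 y ^+ 3.
have mD : measurable (D : set (g_sigma_algebraType R.-ocitv.-measurable)) by exact: measurable_itv.
pose b := (fun t => (0 < fu t)%R%:R : R) \_ D.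
pose G x := [/\ - H < x < H, lebesgue_pt (fu \_ D) x, lebesgue_pt b x,
  f2 x = v x & enorm (u x) = 1].
(* A lower bound for |u_1|^3 at good points; the membership of u_1^3 in BV is what bounds the number
   of its sign changes. *)
pose kap := Num.sqrt e0 ^+ 3.
have kap0 : 0 < kap by rewrite exprn_gt0// sqrtr_gt0.
have Gf1 x : G x -> f1 x ^+ 2 = 1 - v x ^+ 2.
  move=> [_ _ _ fv un]; rewrite -fv /f1 /f2 /=; move: un; rewrite /enorm => un.
  have : Num.sqrt ((u x).1 ^+ 2 + (u x).2 ^+ 2) ^+ 2 = 1 by rewrite un expr1n.
  by rewrite sqr_sqrtr ?addr_ge0 ?sqr_ge0// => <-; ring.
have GH x : G x -> - H < x < H by case.
have Gpos x : G x -> 0 < fu x -> f1 x = s x.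
  move=> Gx; rewrite /fu /s -Gf1// exprn_odd_gt0// => f0.
  by rewrite sqrtr_sqr gtr0_norm.
have Gneg x : G x -> (0 < fu x) = false -> f1 x = - s x.
  move=> Gx; rewrite /fu /s -Gf1// exprn_odd_gt0// => /negbT; rewrite -leNgt => f0.
  by rewrite sqrtr_sqr ler0_norm// opprK.
have fuDi : mu.-integrable setT (EFin \o (fu \_ D)) by exact: (integrable_restrict _ fui).
have bi : mu.-integrable setT (EFin \o b).
  have mf : measurable_fun D fu by move/integrableP : fui => [/measurable_EFinP].
  have bDi : mu.-integrable D (EFin \o (fun t => (0 < fu t)%R%:R : R)).
    apply: measurable_bounded_integrable.
    - exact: measurable_itv.
    - exact: lebesgue_itv_lty.
    - exact: (measurableT_comp (measurable_ltr_cst (D := setT) 0) mf).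
    - by apply: (@bounded_fun_in _ _ _ _ 1) => t _; case: (0 < fu t); rewrite ?normr1 ?normr0.
  exact: (integrable_restrict _ bDi).
have Gae : {ae mu, forall x, - H < x < H -> G x}.
  apply: ae_mono (ae_and (ae_and (lebesgue_pt_ae fuDi) (lebesgue_pt_ae bi)) (ae_and vae u1)).
  by move=> x [[h1 h2] [h3 h4]] xH; split=> //; [exact: h3|exact: h4].
have GP x : G x -> [/\ - H < x < H, lebesgue_pt (fu \_ D) x,
    lebesgue_pt b x & kap <= `|fu x|].
  move=> Gx; have := Gf1 x Gx; have [xH l1 l2 _ _] := Gx => fE.
  split => //; rewrite /kap /fu normrX lerXn2r ?nnegrE ?sqrtr_ge0//.
  rewrite -sqrtr_sqr ler_sqrt ?sqr_ge0// fE.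
  by case/andP: xH => /ltW h1 /ltW h2; move: (ve x h1 h2) e0_gt0; flra.
have limr (c : R) y y1 : - H <= y -> y < y1 -> y1 <= H -> `|c| = 1 ->
    (forall t, G t -> y < t < y1 -> f1 t = c * s t) -> right_limit f1 y (c * s y).
  move=> Hy yy1 y1H c1 hG e e_gt0; have [d d0 hd] := sclose e e_gt0.
  exists (Num.min d (y1 - y)); first by rewrite lt_min d0 subr_gt0.
  apply: ae_mono Gae => t Gt /andP[yt]; rewrite -ltrBlDl lt_min => /andP[t1 t2].
  have ty1 : t < y1 by move: t2; flra.
  have tH : - H < t < H by rewrite (le_lt_trans Hy yt) (lt_le_trans ty1 y1H).
  rewrite hG; [|exact: Gt|by rewrite yt ty1].
  by rewrite -mulrBr normrM c1 mul1r; have [] := hd y t Hy (ltW yt) (ltW (lt_le_trans ty1 y1H)) (ltW t1).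
have liml (c : R) y y0 : y <= H -> y0 < y -> - H <= y0 -> `|c| = 1 ->
    (forall t, G t -> y0 < t < y -> f1 t = c * s t) -> left_limit f1 y (c * s y).
  move=> yH y0y Hy0 c1 hG e e_gt0; have [d d0 hd] := sclose e e_gt0.
  exists (Num.min d (y - y0)); first by rewrite lt_min d0 subr_gt0.
  apply: ae_mono Gae => t Gt /andP[t0 ty].
  have : y - t < Num.min d (y - y0) by move: t0; flra.
  rewrite lt_min => /andP[t1 t2].
  have y0t : y0 < t by move: t2; flra.
  have tH : - H < t < H by rewrite (le_lt_trans Hy0 y0t) (lt_le_trans ty yH).
  rewrite hG; [|exact: Gt|by rewrite y0t ty].
  rewrite -mulrBr normrM c1 mul1r distrC.
  by have [] := hd t y (ltW (le_lt_trans Hy0 y0t)) (ltW ty) yH (ltW t1).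
(* The left side has its maximum over l > 0 at l = 2, whence the double root; the maximum 4/3 is
   exactly the penalty 2^3 / 6 of a wall at the boundary. *)
have small : l - l ^+ 3 / 12 <= 4 / 3.
  have : 0 <= (l - 2) ^+ 2 * (l + 4) by rewrite mulr_ge0 ?sqr_ge0//; move: l0; flra.
  rewrite (_ : (l - 2) ^+ 2 * (l + 4) = l ^+ 3 - 12 * l + 16); [flra|ring].
have E0' : 0 <= L / 2 * E.
  by rewrite mulr_ge0 ?divr_ge0 ?(ltW L0)//; apply: Rintegral_ge0 => y _; exact: sqr_ge0.
have HH : - H < H by move: H0; flra.
have sH : s (- H) = 1 by rewrite /s /v primitive_left expr0n subr0 sqrtr1.
have sH' : s H = 1.
  by rewrite /s /v (primitive_right H0 gi g2 f2i gw fl fr) expr0n subr0 sqrtr1.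
have [allp|/existsNP[x /not_implyP[Gx /negP/negbTE px]]] :=
    pselect (forall x, G x -> 0 < fu x).
  apply: le_trans (key 0 S0); rewrite lee_fin -/l.
  have rl : right_limit f1 (- H) (1 * s (- H)).
    apply: (@limr 1 (- H) H) => //; first exact: normr1.
    by move=> t Gt _; rewrite mul1r; exact: Gpos (allp t Gt).
  have AE : A = 4 / 3.
    rewrite /A (right_valueE rl) sH mulr1 ger0_norm; [by field|clear; lra].
  by rewrite AE; move: small E0' B0'; flra.
have [alln|/existsNP[x' /not_implyP[Gx' /contrapT px']]] :=
    pselect (forall x, G x -> ~ (0 < fu x)).
  apply: le_trans (key 0 S0); rewrite lee_fin -/l.
  have rl : left_limit f1 H (- 1 * s H).
    apply: (@liml (- 1) H (- H)) => //; first by rewrite normrN normr1.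
    by move=> t Gt _; rewrite mulN1r; apply: Gneg => //; apply/negbTE/negP/alln.
  have BE : B = 4 / 3.
    rewrite /B (left_valueE rl) sH' mulr1 ler0_norm; [by field|clear; lra].
  by rewrite BE; move: small E0' A0'; flra.
have pxx : (0 < fu x) != (0 < fu x') by rewrite px px'.
have [e [y0 [y [y1 [[Hy0 y0y yy1 y1H] [hl hr]]]]]] :=
  exists_sign_change kap0 fui fuC GP Gae Gx Gx' pxx.
have Hy : - H < y by exact: lt_trans y0y.
have yH : y < H by exact: lt_trans y1H.
have {}Hy0 := ltW Hy0; have {}y1H := ltW y1H.
pose c : R := if e then 1 else -1.
have c1 : `|c| = 1 by rewrite /c; case: (e); rewrite ?normrN normr1.
have ll : left_limit f1 y (c * s y).
  apply: (@liml c y y0 (ltW yH)) => //.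
  move=> t Gt ht; have := hl t Gt ht; rewrite /c; case: (e) => h.
    by rewrite mul1r Gpos.
  by rewrite mulN1r Gneg.
have lr : right_limit f1 y (- c * s y).
  apply: (@limr (- c) y y1 (ltW Hy)) => //; first by rewrite normrN.
  move=> t Gt ht; have := hr t Gt ht; rewrite /c; case: (e) => h.
    by rewrite mulN1r Gneg.
  by rewrite opprK mul1r Gpos.
have sy := s_gt0 y (ltW Hy) (ltW yH).
have vc (e' : R) : 0 < e' -> exists2 d, 0 < d & forall t, f2 t = v t -> -H <= t <= H ->
    `|t - y| <= d -> `|f2 t - v y| < e'.
  move=> e'0; have [d d0 hd] := sclose e' e'0; exists d => // t -> /andP[Ht tH].
  rewrite ler_norml => /andP[t1 t2]; have [ty|/ltW yt] := leP t y.
    by rewrite distrC; have [] := hd t y Ht ty (ltW yH) _ => //; move: t1; flra.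
  by have [] := hd y t (ltW Hy) yt tH _.
have l2 : left_limit f2 y (v y).
  move=> e' e'0; have [d d0 hd] := vc e' e'0.
  exists (Num.min d (y + H)); first by rewrite lt_min d0; move: Hy; flra.
  apply: ae_mono vae => t ht /andP[t1 t2].
  have : y - t < Num.min d (y + H) by move: t1; flra.
  rewrite lt_min => /andP[t3 t4].
  have Ht : - H < t by move: t4; flra.
  have tH := lt_trans t2 yH; apply: hd; first by apply: ht; rewrite Ht tH.
    by rewrite !ltW.
  by rewrite distrC ger0_norm ?subr_ge0 ltW.
have r2 : right_limit f2 y (v y).
  move=> e' e'0; have [d d0 hd] := vc e' e'0.
  exists (Num.min d (H - y)); first by rewrite lt_min d0 subr_gt0.
  apply: ae_mono vae => t ht /andP[t1 t2].
  have : t - y < Num.min d (H - y) by move: t2; flra.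
  rewrite lt_min => /andP[t3 t4].
  have tH : t < H by move: t4; flra.
  have Ht := lt_trans Hy t1; apply: hd; first by apply: ht; rewrite Ht tH.
    by rewrite !ltW.
  by rewrite ger0_norm ?subr_ge0 ltW.
have Jy : jump_set1 D f1 y.
  split; first by rewrite /D /cross_section /= in_itv/= Hy yH.
  exists (c * s y), (- c * s y); split => //.
  move=> h; have : c * s y = 0 by move: h; rewrite mulNr; flra.
  move/eqP; by rewrite mulf_eq0 (gt_eqF sy) orbF -normr_eq0 c1 oner_eq0.
have Sy : ((s y ^+ 3)%:E <= S)%E.
  apply: esum_ge; exists [set y]; first by split => // z /= ->.
  by rewrite fsbig_set1 (point_valueE l2 r2).
apply: le_trans (key _ Sy); rewrite lee_fin -/l.
have := vE y (ltW Hy) (ltW yH).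
have sv : v y ^+ 2 = 1 - s y ^+ 2.
  by rewrite /s sqr_sqrtr; [ring|move: (ve y (ltW Hy) (ltW yH)) e0_gt0; flra].
rewrite sv => h.
(* The sum l (1 - s^2) + (4/3) s^3 is minimal at s = l / 2 with value l - l^3 / 12; the product is
   the difference, with its double root. *)
have : 0 <= (s y - l / 2) ^+ 2 * (4 / 3 * s y + l / 3).
  by rewrite mulr_ge0 ?sqr_ge0//; move: sy l0; flra.
rewrite (_ : (s y - _) ^+ 2 * _ = 4 / 3 * s y ^+ 3 - l * s y ^+ 2 + l ^+ 3 / 12); last by field.
by move: h A0' B0'; flra.
Qed.

End LowerBound.

(** * Integration by parts in the plane *)

Section Shift.
Context {R : realType}.
Local Notation mu := (@lebesgue_measure R).

(** The image of Lebesgue measure under a translation agrees with it on half-open intervals, hence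
    everywhere. *)
Lemma Rintegral_shift (g : R -> R) (h : R) : mu.-integrable setT (EFin \o g) ->
  \int[mu]_x g (x + h) = \int[mu]_x g x.
Proof.
move=> gi.
have mg : measurable_fun setT g by move/integrableP : gi => [/measurable_EFinP].
have mphi c : measurable_fun setT (fun x : R => x + c) by apply: measurable_funD.
have mf : measurable_fun setT (EFin \o (fun x => g (x + h))).
  by apply/measurable_EFinP; apply: (measurableT_comp mg); exact: mphi.
have gE : (EFin \o (fun x => g (x + h))) \o (fun x => x + (- h)) = EFin \o g.
  by apply/funext => x /=; rewrite subrK.
have := @integral_pushforward _ _ (measurableTypeR R) (measurableTypeR R) R (fun x : R => x + (- h)) (mphi (- h)) mu setT
  (EFin \o (fun x => g (x + h))) mf.
rewrite preimage_setT gE => /(_ gi measurableT) H.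
rewrite /Rintegral -H; congr fine.
apply: eq_measure_integral => [|mp A mA _]; first exact: mphi.
apply: lebesgue_measure_unique => // X [[a b] _ <-].
rewrite /= /pushforward (_ : (fun x : R => x + - h) @^-1` `]a, b] = `]a + h, b + h]%classic).
  rewrite !lebesgue_measure_itv/= !lte_fin ltrD2r.
  by case: ifP => // _; rewrite -!EFinB; congr EFin; ring.
apply/seteqP; split=> x /=; rewrite !in_itv/=; move=> /andP[h1 h2]; apply/andP; split; lra.
Qed.

Lemma indic_itv_integral (a b : R) : a <= b -> \int[mu]_x (\1_`[a, b] x : R) = b - a.
Proof.
move=> ab; have : (\int[mu]_x (\1_`[a, b] x)%:E = (b - a)%:E)%E.
  rewrite integral_indic//= setIT lebesgue_measure_itv/= lte_fin.
  by move: ab; rewrite le_eqVlt => /predU1P[->|->]; rewrite ?ltxx ?subrr// EFinB.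
by rewrite /Rintegral => ->.
Qed.

Lemma seq_cvg_le (u : R^nat) (l c : R) : u @ \oo --> l ->
  (\forall n \near \oo, u n <= c) -> l <= c.
Proof.
move=> ul uc; apply/ler_addgt0Pr => e e0.
have ue : \forall n \near \oo, `|l - u n| < e by move/cvgrPdist_lt : ul; apply.
have [n [h1 h2]] := filter_ex (filterI ue uc).
by move: h1; rewrite ltr_norml => /andP[_ ?]; lra.
Qed.

Lemma integrable_bounded_itv (g : R -> R) (a b M : R) : measurable_fun setT g ->
  (forall x, `|g x| <= M) -> (forall x, x \notin `[a, b] -> g x = 0) ->
  mu.-integrable setT (EFin \o g).
Proof.
move=> mg gM g0.
have gi : mu.-integrable `[a, b] (EFin \o g).
  apply: measurable_bounded_integrable.
  - exact: measurable_itv.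
  - exact: lebesgue_itv_lty.
  - exact: measurable_funTS.
  - by apply: (@bounded_fun_in _ _ _ _ M).
have := integrable_restrict _ gi; rewrite (_ : g \_ `[a, b] = g).
  by apply; exact: measurable_itv.
apply/funext => x; rewrite patchE; case: ifPn => //.
by rewrite mem_setE => /g0 ->.
Qed.

End Shift.

(** * Difference quotients of a slice against a test function *)

Section DifferenceQuotients.
Context {R : realType}.
Local Notation mu := (@lebesgue_measure R).
Variables (f P p : R -> R) (a b B M N : R).
Hypothesis mf : measurable_fun setT f.
Hypothesis fB : forall x, `|f x| <= B.
Hypothesis dP : forall x, is_derive x (1 : R) P (p x).
Hypothesis mp : measurable_fun setT p.
Hypothesis pM : forall x, `|p x| <= M.
Hypothesis PN : forall x, `|P x| <= N.
Hypothesis P0 : forall x, x \notin `[a, b] -> P x = 0.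

Let cP : continuous P. Proof. exact: is_derive_continuous dP. Qed.

Let mP : measurable_fun setT P. Proof. exact: continuous_measurable_fun. Qed.

Let mPs h : measurable_fun setT (fun x : R => P (x + h)).
Proof. by apply: (measurableT_comp mP); apply: measurable_funD. Qed.

Let mfs h : measurable_fun setT (fun x : R => f (x + h)).
Proof. by apply: (measurableT_comp mf); apply: measurable_funD. Qed.

Let B0 : 0 <= B. Proof. exact: le_trans (fB 0). Qed.
Let M0 : 0 <= M. Proof. exact: le_trans (pM 0). Qed.
Let N0 : 0 <= N. Proof. exact: le_trans (PN 0). Qed.

Let lipP x y : `|P y - P x| <= M * `|y - x|.
Proof.
wlog xy : x y / x <= y.
  move=> h; have [|/ltW] := leP x y => xy; first exact: h.
  by rewrite distrC [X in _ * X]distrC h.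
have [xy'|xy'|->] := ltgtP x y; last by rewrite !subrr normr0 mulr0.
  have [|c _ ->] := @MVT R P p x y xy'; first exact: continuous_subspaceT.
  by rewrite normrM ler_wpM2r.
by move: xy; rewrite leNgt xy'.
Qed.

Lemma difference_identity h :
  \int[mu]_x (f x * (P (x + h) - P x)) = \int[mu]_x ((f (x - h) - f x) * P x).
Proof.
have i1 c : mu.-integrable setT (EFin \o (fun x => f (x + c) * P x)).
  apply: (@integrable_bounded_itv R _ a b (B * N)).
  - by apply: measurable_funM.
  - by move=> x; rewrite normrM ler_pM.
  - by move=> x /P0 ->; rewrite mulr0.
have i2 : mu.-integrable setT (EFin \o (fun x => f x * P (x + h))).
  apply: (@integrable_bounded_itv R _ (a - h) (b - h) (B * N)).
  - by apply: measurable_funM.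
  - by move=> x; rewrite normrM ler_pM.
  - move=> x xn; rewrite P0 ?mulr0//; move: xn; apply: contra; rewrite !in_itv/=.
    by move=> /andP[? ?]; apply/andP; split; lra.
have i0 : mu.-integrable setT (EFin \o (fun x => f x * P x)).
  by have := i1 0; under [X in EFin \o X]eq_fun do rewrite addr0.
under eq_Rintegral do rewrite mulrBr.
under [RHS]eq_Rintegral do rewrite mulrBl.
rewrite RintegralB// RintegralB//; congr (_ - _).
rewrite -(Rintegral_shift h (i1 (- h))); apply: eq_Rintegral => x _.
by rewrite addrK.
Qed.

Let dq_cvg (F : R -> R) x d : is_derive x (1 : R) F d -> forall c : R^nat,
  (forall n, c n != 0) -> c @ \oo --> (0 : R) ->
  (fun n => (F (x + c n) - F x) / c n) @ \oo --> d.
Proof.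
move=> [dF <-] c c0 cc.
have : (fun n => (c n)^-1 *: (F (c n *: (1 : R) + x) - F x)) @ \oo --> 'D_1 F x.
  have := dF; rewrite /derivable => /cvg_ex[l hl].
  have -> : 'D_1 F x = l by apply: cvg_lim => //; exact: hl.
  apply: cvg_trans hl => A [e /= e0 hA] /=.
  have : \forall n \near \oo, `|c n| < e by move/cvgr0Pnorm_lt : cc; apply.
  by apply: filterS => n cn; apply: hA => /=; rewrite ?sub0r ?normrN//; exact: c0.
move=> H; apply: (eq_seq_cvg H) => n.
by rewrite /GRing.scale/= mulr1 [LHS]mulrC [c n + x]addrC.
Qed.

Let h n := @harmonic R n.
Let h_gt0 n : 0 < h n. Proof. exact: harmonic_gt0. Qed.
Let h_le1 n : h n <= 1.
Proof. by rewrite /h /harmonic invf_le1// ler1n. Qed.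
Let h_cvg : h @ \oo --> (0 : R). Proof. exact: cvg_harmonic. Qed.

Let I n := \int[mu]_x (f x * ((P (x + h n) - P x) / h n)).

Lemma difference_quotient_cvg : I @ \oo --> \int[mu]_x (f x * p x).
Proof.
pose g : R -> R := (fun=> B * M) \_ `[a - 1, b].
have gi : mu.-integrable setT (EFin \o g).
  apply: integrable_restrict; first exact: measurable_itv.
  apply: measurable_bounded_integrable => //; first exact: lebesgue_itv_lty.
  by apply: (@bounded_fun_in _ _ _ _ `|B * M|).
apply: (@Rintegral_dominated_cvg _ _ R mu setT (fun n x => f x * ((P (x + h n) - P x) / h n))
  (fun x => f x * p x) g) => //.
- move=> n; apply: measurable_funM => //; apply: measurable_funM => //.
  by apply: measurable_funB => //; exact: mPs.
- by apply: measurable_funM.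
- apply: aeW => x _; apply: cvgM; first exact: cvg_cst.
  by apply: dq_cvg => // n; rewrite gt_eqF.
- move=> n x _; rewrite /g patchE; case: ifPn.
    move=> _; rewrite normrM ler_pM// normrM normfV (gtr0_norm (h_gt0 n)) ler_pdivrMr//.
    by apply: (le_trans (lipP _ _)); rewrite addrAC subrr add0r (gtr0_norm (h_gt0 n)).
  rewrite mem_setE => xn; rewrite !P0 ?subrr ?mul0r ?mulr0 ?normr0//.
    by move: xn; apply: contra; rewrite !in_itv/= => /andP[? ?]; apply/andP; split; lra.
  move: xn; apply: contra; rewrite !in_itv/=; have := h_le1 n; have := h_gt0 n.
  by move=> ? ? /andP[? ?]; apply/andP; split; lra.
Qed.

Let IE n : I n = - \int[mu]_x ((f (x - h n) - f x) / - h n * P x).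
Proof.
have hn0 : h n != 0 by rewrite gt_eqF.
have : \int[mu]_x (f x * (P (x + h n) - P x)) = h n * I n.
  rewrite /I -RintegralZl//; first by apply: eq_Rintegral => x _; rewrite mulrCA [h n * _]mulrC divfK.
  have i1 c : mu.-integrable setT (EFin \o (fun x => f x * P (x + c))).
    apply: (@integrable_bounded_itv R _ (a - c) (b - c) (B * N)).
    - by apply: measurable_funM.
    - by move=> x; rewrite normrM ler_pM.
    - move=> x xn; rewrite P0 ?mulr0//; move: xn; apply: contra; rewrite !in_itv/=.
      by move=> /andP[? ?]; apply/andP; split; lra.
  have := integrableZr measurableT (h n)^-1 (integrable_sub measurableT (i1 (h n)) (i1 0)).
  apply: eq_integrable => // x _ /=; rewrite -EFinM addr0; congr EFin; ring.
rewrite difference_identity => E.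
have {E} -> : I n = (h n)^-1 * \int[mu]_x ((f (x - h n) - f x) * P x).
  by rewrite E mulKf.
have i3 : mu.-integrable setT (EFin \o (fun x => (f (x - h n) - f x) * P x)).
  apply: (@integrable_bounded_itv R _ a b ((B + B) * N)).
  - by apply: measurable_funM => //; apply: measurable_funB => //; exact: mfs.
  - move=> x; rewrite normrM ler_pM//; apply: (le_trans (ler_normB _ _)); exact: lerD.
  - by move=> x /P0 ->; rewrite mulr0.
rewrite -[X in _ = - X](_ : - (h n)^-1 * \int[mu]_x ((f (x - h n) - f x) * P x) = _).
  by rewrite mulNr opprK.
rewrite -RintegralZl//; apply: eq_Rintegral => x _.
by rewrite invrN; ring.
Qed.

(** Translation moves the difference quotient from P to f. The quotients of f are bounded by K and
    converge almost everywhere to f', those of P converge to p, and dominated convergence passes to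
    the limit on both sides. *)
Lemma lipschitz_integration_by_parts (f' : R -> R) (K : R) :
  (forall x y, `|f x - f y| <= K * `|x - y|) -> measurable_fun setT f' ->
  {ae mu, forall x, is_derive x (1 : R) f (f' x)} ->
  \int[mu]_x (f x * p x) = - \int[mu]_x (f' x * P x).
Proof.
move=> fK mf' df.
have L2 : (fun n => \int[mu]_x ((f (x - h n) - f x) / - h n * P x)) @ \oo -->
    \int[mu]_x (f' x * P x).
  pose g : R -> R := (fun=> K * N) \_ `[a, b].
  have gi : mu.-integrable setT (EFin \o g).
    apply: integrable_restrict; first exact: measurable_itv.
    apply: measurable_bounded_integrable => //; first exact: lebesgue_itv_lty.
    by apply: (@bounded_fun_in _ _ _ _ `|K * N|).
  apply: (@Rintegral_dominated_cvg _ _ R mu setT (fun n x => (f (x - h n) - f x) / - h n * P x)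
    (fun x => f' x * P x) g) => //.
  - move=> n; apply: measurable_funM => //; apply: measurable_funM => //.
    by apply: measurable_funB => //; exact: mfs.
  - by apply: measurable_funM.
  - apply: ae_mono df => x dx _; apply: cvgM; last exact: cvg_cst.
    apply: (dq_cvg dx) => [n|]; first by rewrite oppr_eq0 gt_eqF.
    by rewrite -oppr0; exact: cvgN.
  - move=> n x _; rewrite /g patchE; case: ifPn; last first.
      by rewrite mem_setE => /P0 ->; rewrite mulr0 normr0.
    move=> _; rewrite normrM ler_pM// normrM normfV normrN (gtr0_norm (h_gt0 n)) ler_pdivrMr//.
    apply: (le_trans (fK _ _)); rewrite addrAC subrr add0r normrN (gtr0_norm (h_gt0 n)).
    exact: lexx.
have L3 : I @ \oo --> - \int[mu]_x (f' x * P x).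
  by apply: (eq_seq_cvg (cvgN L2)) => n; rewrite IE.
exact: (cvg_unique _ difference_quotient_cvg L3).
Qed.

Let walls (s : seq R) (h : R) (x : R) : R := \sum_(w <- s) \1_`[w, w + h] x.

Let walls_integral s c : 0 < c -> mu.-integrable setT (EFin \o walls s c) /\
  \int[mu]_x walls s c x = c * (size s)%:R.
Proof.
move=> c0; elim: s => [|w s [ih1 ih2]].
  rewrite mulr0; have -> : walls [::] c = cst 0 by apply/funext => x; rewrite /walls big_nil.
  by split; [exact: integrable0|rewrite Rintegral_cst// mul0r].
have -> : walls (w :: s) c = fun x => \1_`[w, w + c] x + walls s c x.
  by apply/funext => x; rewrite /walls big_cons.
have i1 : mu.-integrable setT (EFin \o (\1_`[w, w + c] : R -> R)).
  apply: (@integrable_bounded_itv R _ w (w + c) 1).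
  - by apply: measurable_indic; exact: measurable_itv.
  - by move=> x; rewrite indicE; case: (_ \in _); rewrite ?normr1 ?normr0.
  - by move=> x xn; rewrite indicE mem_setE (negbTE xn).
split; first exact: integrable_add.
rewrite RintegralD// ih2 indic_itv_integral ?lerDl ?(ltW c0)//= mulrS mulrDr mulr1.
by congr (_ + _); ring.
Qed.

(** The backward quotient of f at x is at most K when [x - h, x] avoids the list s and at most 2 / h
    otherwise. The exceptional x lie in the intervals [w, w + h], so each listed point costs at most
    2, uniformly in h. *)
Lemma variation_bound (A B' K : R) (s : seq R) : A < a -> b < B' -> 0 <= K -> N <= 1 -> B <= 1 ->
  a <= b ->
  (forall x y, A < x -> x < y -> y < B' -> (forall w, w \in s -> ~~ (x <= w <= y)) ->
     `|f x - f y| <= K * (y - x)) ->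
  `|\int[mu]_x (f x * p x)| <= K * (b - a) + 2 * (size s)%:R.
Proof.
move=> Aa bB K0 N1 B1 ab fK.
have aA : 0 < a - A by rewrite subr_gt0.
have L : (fun n => `|I n|) @ \oo --> `|\int[mu]_x (f x * p x)|.
  by apply: cvg_norm; exact: difference_quotient_cvg.
have hA : \forall n \near \oo, h n < a - A.
  have : \forall n \near \oo, `|h n| < a - A by move/cvgr0Pnorm_lt : h_cvg; apply.
  by apply: filterS => n; rewrite (gtr0_norm (h_gt0 n)).
apply: (seq_cvg_le L); apply: filterS hA => n hnA.
rewrite IE normrN.
have hn0 := h_gt0 n.
have [wi wI] := walls_integral s (h_gt0 n).
pose g (x : R) : R := K * \1_`[a, b] x + 2 / h n * walls s (h n) x.
have i1 : mu.-integrable setT (EFin \o (\1_`[a, b] : R -> R)).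
  apply: (@integrable_bounded_itv R _ a b 1).
  - by apply: measurable_indic; exact: measurable_itv.
  - by move=> x; rewrite indicE; case: (_ \in _); rewrite ?normr1 ?normr0.
  - by move=> x xn; rewrite indicE mem_setE (negbTE xn).
have Zi c (F : R -> R) : mu.-integrable setT (EFin \o F) ->
    mu.-integrable setT (EFin \o (fun x => c * F x)).
  by move=> Fi; have := integrableZl measurableT c Fi; apply: eq_integrable.
have gi : mu.-integrable setT (EFin \o g) by apply: integrable_add => //; exact: Zi.
have gI : \int[mu]_x g x = K * (b - a) + 2 * (size s)%:R.
  rewrite RintegralD//; [|exact: Zi|exact: Zi].
  rewrite !RintegralZl// wI; congr (_ + _).
    by rewrite indic_itv_integral.
  by rewrite mulrA divfK ?gt_eqF.
rewrite -gI.
have i3 : mu.-integrable setT (EFin \o (fun x => (f (x - h n) - f x) / - h n * P x)).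
  apply: (@integrable_bounded_itv R _ a b ((B + B) / h n * N)).
  - apply: measurable_funM => //; apply: measurable_funM => //.
    by apply: measurable_funB => //; exact: mfs.
  - move=> x; rewrite normrM ler_pM// normrM normfV normrN (gtr0_norm hn0) ler_pM2r ?invr_gt0//.
    by apply: (le_trans (ler_normB _ _)); exact: lerD.
  - by move=> x /P0 ->; rewrite mulr0.
apply: (le_trans (le_normr_Rintegral _ i3)) => //.
apply: le_Rintegral => //.
  by have := integrable_abse i3; apply: eq_integrable.
move=> x _; rewrite /g.
have w0 : 0 <= walls s (h n) x.
  by apply: sumr_ge0 => w _; rewrite indicE; case: (_ \in _).
have [xab|xab] := boolP (x \in `[a, b]); last first.
  rewrite P0// mulr0 normr0; apply: addr_ge0; apply: mulr_ge0 => //.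
  by rewrite divr_ge0// ltW.
rewrite indicE mem_setE xab mulr1.
apply: (@le_trans _ _ (`|f (x - h n) - f x| / h n)).
  rewrite normrM normrM normfV normrN (gtr0_norm hn0) ler_piMr//.
    by rewrite divr_ge0// ltW.
  exact: (le_trans (PN x)).
rewrite ler_pdivrMr// (_ : (K + _) * h n = K * h n + 2 * walls s (h n) x); last first.
  by field; rewrite gt_eqF.
move: xab; rewrite in_itv/= => /andP[ax xb].
have [/hasP[w ws wx]|/hasPn nw] := boolP (has (fun w => x - h n <= w <= x) s).
  have : 1 <= walls s (h n) x.
    rewrite /walls (big_rem w)//= indicE mem_setE in_itv/=.
    move/andP: wx => [w1 w2]; rewrite w2/= (_ : x <= w + h n); last by lra.
    by rewrite lerDl; apply: sumr_ge0 => z _; rewrite indicE; case: (_ \in _).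
  have : `|f (x - h n) - f x| <= 2.
    by apply: (le_trans (ler_normB _ _)); have := fB x; have := fB (x - h n); lra.
  have : 0 <= K * h n by rewrite mulr_ge0// ltW.
  by lra.
have := fK (x - h n) x; rewrite subKr => /(_ _ _ _ nw).
move=> H; apply: (@le_trans _ _ (K * h n)); last by rewrite lerDl mulr_ge0.
by apply: H; lra.
Qed.

End DifferenceQuotients.

Section PlaneFubini.
Context {R : realType}.
Local Notation mu := (@lebesgue_measure R).
Implicit Types F G : R * R -> R.

Lemma integrable_fubini_G F : area.-integrable setT (EFin \o F) ->
  mu.-integrable setT (fubini_G mu (EFin \o F)).
Proof.
move=> Fi; have mF := measurable_int _ Fi.
have Fa := integrable_abse Fi.
apply/integrableP; split; first exact: (measurable_fubini_G Fi).
have hfin := (integrable21ltyP _ _ mF).1 Fi; apply: (le_lt_trans _ hfin).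
apply: ge0_le_integral => //.
- by apply: measurableT_comp => //; exact: (measurable_fubini_G Fi).
- exact: (measurable_fubini_G Fa).
- by move=> y _; apply: le_abse_integral => //; exact: measurable_fun_pair1.
Qed.

Lemma RintegralN d (X : measurableType d) (m : {measure set X -> \bar R}) (D : set X) (f : X -> R) :
  measurable D -> m.-integrable D (EFin \o f) ->
  \int[m]_(x in D) - f x = - \int[m]_(x in D) f x.
Proof.
by move=> mD fi; rewrite -mulN1r -RintegralZl//; apply: eq_Rintegral => x _; rewrite mulN1r.
Qed.

Lemma RFubini1 F : area.-integrable setT (EFin \o F) ->
  \int[area]_p F p = \int[mu]_x \int[mu]_y F (x, y).
Proof.
move=> Fi; rewrite /Rintegral -(integral12_prod_meas1 Fi); congr fine.
apply: ae_eq_integral => //.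
- exact: measurable_int (integrable_fubini_F Fi).
- exact: measurable_int (integrable_fine (integrable_fubini_F Fi)).
apply: ae_mono (ae_integrable1 Fi) => x xi _.
by rewrite /fubini_F fineK//; exact: integrable_fin_num.
Qed.

Lemma RFubini2 F : area.-integrable setT (EFin \o F) ->
  \int[area]_p F p = \int[mu]_y \int[mu]_x F (x, y).
Proof.
move=> Fi; rewrite /Rintegral -(integral21_prod_meas1 Fi); congr fine.
apply: ae_eq_integral => //.
- exact: measurable_int (integrable_fubini_G Fi).
- exact: measurable_int (integrable_fine (integrable_fubini_G Fi)).
apply: ae_mono (ae_integrable2 Fi) => x xi _.
by rewrite /fubini_G fineK//; exact: integrable_fin_num.
Qed.

Lemma eq_RFubini1 F G : area.-integrable setT (EFin \o F) ->
  area.-integrable setT (EFin \o G) ->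
  {ae mu, forall x, \int[mu]_y F (x, y) = \int[mu]_y G (x, y)} ->
  \int[area]_p F p = \int[area]_p G p.
Proof.
move=> Fi Gi FG; rewrite (RFubini1 Fi) (RFubini1 Gi); congr fine; apply: ae_eq_integral => //.
- exact: measurable_int (integrable_fine (integrable_fubini_F Fi)).
- exact: measurable_int (integrable_fine (integrable_fubini_F Gi)).
by apply: ae_mono FG => x h _; congr EFin.
Qed.

Lemma eq_RFubini2 F G : area.-integrable setT (EFin \o F) ->
  area.-integrable setT (EFin \o G) ->
  {ae mu, forall y, \int[mu]_x F (x, y) = \int[mu]_x G (x, y)} ->
  \int[area]_p F p = \int[area]_p G p.
Proof.
move=> Fi Gi FG; rewrite (RFubini2 Fi) (RFubini2 Gi); congr fine; apply: ae_eq_integral => //.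
- exact: measurable_int (integrable_fine (integrable_fubini_G Fi)).
- exact: measurable_int (integrable_fine (integrable_fubini_G Gi)).
by apply: ae_mono FG => x h _; congr EFin.
Qed.

Lemma Rintegral_le_itv (f : R -> R) (a b C : R) : a <= b ->
  mu.-integrable setT (EFin \o f) -> (forall x, f x <= C * \1_`[a, b] x) ->
  \int[mu]_x f x <= C * (b - a).
Proof.
move=> ab fi fC.
have i1 : mu.-integrable setT (EFin \o (\1_`[a, b] : R -> R)).
  apply: (@integrable_bounded_itv R _ a b 1).
  - by apply: measurable_indic; exact: measurable_itv.
  - by move=> x; rewrite indicE; case: (_ \in _); rewrite ?normr1 ?normr0.
  - by move=> x xn; rewrite indicE mem_setE (negbTE xn).
rewrite -(indic_itv_integral ab) -RintegralZl//; apply: le_Rintegral => //.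
by have := integrableZl measurableT C i1; apply: eq_integrable.
Qed.

Lemma RFubini1_le F (a b C : R) : a <= b -> area.-integrable setT (EFin \o F) ->
  (forall x, \int[mu]_y F (x, y) <= C * \1_`[a, b] x) -> \int[area]_p F p <= C * (b - a).
Proof.
move=> ab Fi FC; rewrite RFubini1//; apply: Rintegral_le_itv => //.
exact: (integrable_fine (integrable_fubini_F Fi)).
Qed.

Lemma RFubini2_le F (a b C : R) : a <= b -> area.-integrable setT (EFin \o F) ->
  (forall y, \int[mu]_x F (x, y) <= C * \1_`[a, b] y) -> \int[area]_p F p <= C * (b - a).
Proof.
move=> ab Fi FC; rewrite RFubini2//; apply: Rintegral_le_itv => //.
exact: (integrable_fine (integrable_fubini_G Fi)).
Qed.

(** The plane carries the product sigma-algebra, which contains an open set because the set is a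
    countable union of boxes with rational corners. *)
Lemma open_measurable2 (U : set (R * R)) : open U ->
  measurable (U : set (measurableTypeR R * measurableTypeR R)).
Proof.
move=> oU.
pose box (q : rat * rat * (rat * rat)) : set (R * R) :=
  `]ratr q.1.1, ratr q.1.2[ `*` `]ratr q.2.1, ratr q.2.2[.
pose A (q : rat * rat * (rat * rat)) : set (R * R) := [set p | box q `<=` U /\ box q p].
have -> : U = \bigcup_q A q.
  apply/seteqP; split => [p Up|p [q _ [qU qp]]]; last exact: qU.
  have := oU; rewrite openE => /(_ _ Up) [[/= s1 s2] [[r1 r10 h1] [r2 r20 h2]] be].
  pose e := Num.min r1 r2.
  have er1 : e <= r1 by rewrite /e ge_min lexx.
  have er2 : e <= r2 by rewrite /e ge_min lexx orbT.
  have e0 : 0 < e by rewrite lt_min r10.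
  have {}be z : `|p.1 - z.1| < e -> `|p.2 - z.2| < e -> U z.
    move=> z1 z2; apply: be; split => /=.
      by apply: h1; rewrite /ball/=; exact: lt_le_trans er1.
    by apply: h2; rewrite /ball/=; exact: lt_le_trans er2.
  clear h1 h2.
  have itv (z : R) : exists q : rat * rat, z - e < ratr q.1 /\ ratr q.1 < z /\ z < ratr q.2 /\ ratr q.2 < z + e.
    have [q1 h1] : exists q : rat, ratr q \in `]z - e, z[ by apply: rat_in_itvoo; rewrite gtrBl.
    have [q2 h2] : exists q : rat, ratr q \in `]z, z + e[ by apply: rat_in_itvoo; rewrite ltrDl.
    by exists (q1, q2); move: h1 h2; rewrite !in_itv/= => /andP[? ?] /andP[? ?].
  have [q1 [h1 [h2 [h3 h4]]]] := itv p.1; have [q2 [g1 [g2 [g3 g4]]]] := itv p.2.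
  have mem1 : ratr q1.1 < p.1 < ratr q1.2 by rewrite h2 h3.
  have mem2 : ratr q2.1 < p.2 < ratr q2.2 by rewrite g2 g3.
  exists (q1, q2); [by []|split; last by split; rewrite /= in_itv].
  move=> z [/=]; rewrite !in_itv/= => /andP[z1 z2] /andP[z3 z4].
  by apply: be; rewrite ltr_norml; apply/andP; split; lra.
apply: countable_bigcupT_measurable; first exact: countableP.
move=> q; have [qU|nU] := pselect (box q `<=` U).
  have -> : A q = box q by apply/seteqP; split=> z // -[].
  by apply: measurableX; exact: measurable_itv.
have -> : A q = set0 by apply/seteqP; split=> z // -[].
exact: measurable0.
Qed.

Lemma continuous_measurable2 (F : R * R -> R) : continuous F ->
  measurable_fun (setT : set (measurableTypeR R * measurableTypeR R)) F.
Proof.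
move=> cF; apply: (measurability _ (RGenOpens.measurableE R)) => _ [_ [a [b ->] <-]].
rewrite setTI; apply: open_measurable2.
by move/continuousP : cF; apply; exact: interval_open.
Qed.

Lemma integrable_bounded_rect (F : R * R -> R) (a b c d M : R) :
  measurable_fun (setT : set (measurableTypeR R * measurableTypeR R)) F ->
  (forall p, `|F p| <= M) ->
  (forall p, ~ ((a <= p.1 <= b) /\ (c <= p.2 <= d)) -> F p = 0) ->
  area.-integrable setT (EFin \o F).
Proof.
move=> mF FM F0.
pose Q : set (R * R) := `[a, b] `*` `[c, d].
have mQ : measurable (Q : set (measurableTypeR R * measurableTypeR R)).
  by apply: measurableX; exact: measurable_itv.
have Qfin : (area Q < +oo)%E.
  have -> : area Q = (mu `[a, b] * mu `[c, d])%E by apply: product_measure1E; exact: measurable_itv.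
  rewrite lte_mul_pinfty//; last exact: lebesgue_itv_lty.
  by rewrite ge0_fin_numE//; exact: lebesgue_itv_lty.
have FiQ : area.-integrable Q (EFin \o F).
  apply: measurable_bounded_integrable => //; first exact: measurable_funTS.
  by apply: (@bounded_fun_in _ _ _ _ M).
have := integrable_restrict mQ FiQ; rewrite (_ : F \_ Q = F)//.
apply/funext => p; rewrite patchE; case: ifPn => //.
rewrite notin_setE /Q/= => nQ; rewrite F0// => -[h1 h2]; apply: nQ; split; rewrite /= in_itv//.
Qed.

End PlaneFubini.

Section TestFunction2.
Context {R : realType}.
Variables (D : set (R * R)) (P : R * R -> R).
Hypothesis cP : Ck 1 P.
Hypothesis sP : compactly_supported D P.

Lemma test_slice1 x y : is_derive x (1 : R) (fun z => P (z, y)) (dx P (x, y)).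
Proof.
have dP : derivable P (x, y) (1, 0) by apply: diff_derivable; case: cP.
have E : (fun h : R => h^-1 *: (((fun z => P (z, y)) \o shift x) (h *: (1 : R)) - P (x, y))) =
    (fun h : R => h^-1 *: ((P \o shift (x, y)) (h *: ((1, 0) : R * R)) - P (x, y))).
  apply/funext => h /=; congr (_ *: (P _ - _)).
  by rewrite /shift /=; congr (_, _); rewrite /= ?scaler0 ?add0r.
by apply: DeriveDef; rewrite /derivable /derive ?E.
Qed.

Lemma test_slice2 x y : is_derive y (1 : R) (fun z => P (x, z)) (dy P (x, y)).
Proof.
have dP : derivable P (x, y) (0, 1) by apply: diff_derivable; case: cP.
have E : (fun h : R => h^-1 *: (((fun z => P (x, z)) \o shift y) (h *: (1 : R)) - P (x, y))) =
    (fun h : R => h^-1 *: ((P \o shift (x, y)) (h *: ((0, 1) : R * R)) - P (x, y))).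
  apply/funext => h /=; congr (_ *: (P _ - _)).
  by rewrite /shift /=; congr (_, _); rewrite /= ?scaler0 ?add0r.
by apply: DeriveDef; rewrite /derivable /derive ?E.
Qed.

Lemma test_bounded : exists A N : R, [/\ 0 < A, 0 <= N,
  forall p, ~ D p -> [/\ P p = 0, dx P p = 0 & dy P p = 0],
  forall p, ~ ((- A <= p.1 <= A) /\ (- A <= p.2 <= A)) ->
    [/\ P p = 0, dx P p = 0 & dy P p = 0] &
  forall p, [/\ `|P p| <= N, `|dx P p| <= N & `|dy P p| <= N]].
Proof.
have [K [cK KD P0]] := sP.
have [dP cdP] := cP.
have ctP : continuous P by move=> p; apply: differentiable_continuous; exact: dP.
have clK : closed K by apply: compact_closed => //; exact: norm_hausdorff.
have P0' p : ~ K p -> [/\ P p = 0, dx P p = 0 & dy P p = 0].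
  move=> nK; have nr : \near p, cst 0 p = P p.
    have : open (~` K) by exact: closed_openC.
    rewrite openE => /(_ _ nK); apply: filterS => q nq; rewrite /cst P0//.
  split; first exact: P0.
    have := near_eq_is_derive nr (is_derive_cst 0 p ((1, 0) : R * R)).
    by move=> h; rewrite /dx; exact: derive_val.
  have := near_eq_is_derive nr (is_derive_cst 0 p ((0, 1) : R * R)).
  by move=> h; rewrite /dy; exact: derive_val.
have bd (F : R * R -> R) : continuous F -> exists2 M, 0 <= M & forall p, K p -> `|F p| <= M.
  move=> cF; have : bounded_set (F @` K).
    apply: compact_bounded; apply: continuous_compact => //.
    exact: continuous_subspaceT.
  move=> [M [Mr hM]]; exists (`|M| + 1); first by rewrite addr_ge0.
  by move=> p Kp; apply: (hM (`|M| + 1)); [rewrite ltr_pwDr// ler_norm|exists p].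
have [N1 N10 hN1] := bd _ ctP; have [N2 N20 hN2] := bd _ (cdP (1, 0)).
have [N3 N30 hN3] := bd _ (cdP (0, 1)).
have [A1 A10 hA1] := bd fst (fun q => @cvg_fst _ _ _ _ _).
have [A2 A20 hA2] := bd snd (fun q => @cvg_snd _ _ _ _ _).
exists (A1 + A2 + 1), (N1 + N2 + N3); split.
- by rewrite ltr_wpDl// addr_ge0.
- by rewrite !addr_ge0.
- by move=> p nD; apply: P0' => /KD.
- move=> p np; apply: P0' => Kp; apply: np.
  have := hA1 p Kp; have := hA2 p Kp; rewrite !ler_norml => /andP[? ?] /andP[? ?].
  by split; apply/andP; split; lra.
- move=> p; have [Kp|nK] := pselect (K p).
    have h1 := hN1 p Kp; have h2 : `|dx P p| <= N2 := hN2 p Kp.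
    have h3 : `|dy P p| <= N3 := hN3 p Kp.
    split; rewrite -addrA.
    - by rewrite (le_trans h1)// lerDl addr_ge0.
    - by rewrite (le_trans h2)// addrCA lerDl addr_ge0.
    - by rewrite (le_trans h3)// addrA lerDr addr_ge0.
  by have [-> -> ->] := P0' p nK; rewrite normr0 !addr_ge0.
Qed.

Lemma continuous_test : [/\ continuous P, continuous (dx P) & continuous (dy P)].
Proof.
have [dP cdP] := cP; split; [|exact: (cdP (1, 0))|exact: (cdP (0, 1))].
by move=> p; apply: differentiable_continuous; exact: dP.
Qed.

End TestFunction2.

(** * Weak divergence of fields with tangential jumps *)

Section WeakDivergence.
Context {R : realType}.
Local Notation mu := (@lebesgue_measure R).
Local Notation mT := (setT : set (measurableTypeR R * measurableTypeR R)).
Variables (T H : R) (u1 u2 d1 d2 : R * R -> R) (K : R).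
Hypothesis mu1 : measurable_fun mT u1.
Hypothesis mu2 : measurable_fun mT u2.
Hypothesis md1 : measurable_fun mT d1.
Hypothesis md2 : measurable_fun mT d2.
Hypothesis u1B : forall p, `|u1 p| <= 1.
Hypothesis u2B : forall p, `|u2 p| <= 1.
Hypothesis d1B : forall p, `|d1 p| <= K.
Hypothesis d2B : forall p, `|d2 p| <= K.
Hypothesis lip1 : {ae mu, forall y, (forall x x', `|u1 (x, y) - u1 (x', y)| <= K * `|x - x'|) /\
  {ae mu, forall x, is_derive x (1 : R) (fun z => u1 (z, y)) (d1 (x, y))}}.
Hypothesis lip2 : {ae mu, forall x, (forall y y', `|u2 (x, y) - u2 (x, y')| <= K * `|y - y'|) /\
  {ae mu, forall y, is_derive y (1 : R) (fun z => u2 (x, z)) (d2 (x, y))}}.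

(** Integration by parts is done for u1 along horizontal lines and for u2 along vertical lines. A
    jump of u1 across a horizontal line, or of u2 across a vertical one, leaves the normal component
    continuous and adds nothing to the divergence. *)
Lemma lipschitz_weak_divergence :
  weak_divergence H (fun p => (u1 p, u2 p)) (fun p => d1 p + d2 p).
Proof.
move=> P [CP sP]; have CP1 := CP 1%N.
have [A [N [A0 N0 PD PA PN]]] := test_bounded CP1 sP.
have [ctP ctx cty] := continuous_test CP1.
have mP := continuous_measurable2 ctP; have mdx := continuous_measurable2 ctx.
have mdy := continuous_measurable2 cty.
have K0 : 0 <= K by exact: le_trans (d1B 0).
have int (u v : R * R -> R) (M : R) : measurable_fun mT u -> measurable_fun mT v ->
    (forall p, `|u p| <= M) -> (forall p, `|v p| <= N) ->
    (forall p, ~ ((- A <= p.1 <= A) /\ (- A <= p.2 <= A)) -> v p = 0) ->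
    area.-integrable setT (EFin \o (fun p => u p * v p)).
  move=> mu_ mv uM vN v0; apply: (@integrable_bounded_rect R _ (- A) A (- A) A (M * N)).
  - exact: measurable_funM.
  - by move=> p; rewrite normrM ler_pM.
  - by move=> p /v0 ->; rewrite mulr0.
have PN1 p : `|P p| <= N by case: (PN p).
have PN2 p : `|dx P p| <= N by case: (PN p).
have PN3 p : `|dy P p| <= N by case: (PN p).
have i1 : area.-integrable setT (EFin \o (fun p => u1 p * dx P p)).
  by apply: (int _ _ 1) => // p /PA[].
have i2 : area.-integrable setT (EFin \o (fun p => u2 p * dy P p)).
  by apply: (int _ _ 1) => // p /PA[].
have i3 : area.-integrable setT (EFin \o (fun p => d1 p * P p)).
  by apply: (int _ _ K) => // p /PA[].
have i4 : area.-integrable setT (EFin \o (fun p => d2 p * P p)).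
  by apply: (int _ _ K) => // p /PA[].
have neg (F : R * R -> R) : area.-integrable setT (EFin \o F) ->
    area.-integrable setT (EFin \o (fun p => - F p)).
  by move=> Fi; have := integrableN Fi; apply: eq_integrable.
have E1 : \int[area]_p (u1 p * dx P p) = \int[area]_p - (d1 p * P p).
  apply: eq_RFubini2; [exact: i1|exact: neg|].
  apply: ae_mono (ae_and lip1 (ae_integrable2 i3)) => y [[ly dy_] i3y].
  rewrite RintegralN//.
  apply: (@lipschitz_integration_by_parts R (fun x => u1 (x, y)) (fun x => P (x, y))
    (fun x => dx P (x, y)) (- A) A 1 N N) => //.
  - exact: measurable_fun_pair1.
  - by move=> x; exact: test_slice1.
  - exact: measurable_fun_pair1.
  - move=> x xn; have /PA[-> _ _] // : ~ (- A <= (x, y).1 <= A /\ - A <= (x, y).2 <= A).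
    by move=> /= -[xA _]; move: xn; rewrite in_itv/= xA.
  - exact: measurable_fun_pair1.
have E2 : \int[area]_p (u2 p * dy P p) = \int[area]_p - (d2 p * P p).
  apply: eq_RFubini1; [exact: i2|exact: neg|].
  apply: ae_mono (ae_and lip2 (ae_integrable1 i4)) => x [[lx dx_] i4x].
  rewrite RintegralN//.
  apply: (@lipschitz_integration_by_parts R (fun y => u2 (x, y)) (fun y => P (x, y))
    (fun y => dy P (x, y)) (- A) A 1 N N) => //.
  - exact: measurable_fun_pair2.
  - by move=> y; exact: test_slice2.
  - exact: measurable_fun_pair2.
  - move=> y yn; have /PA[-> _ _] // : ~ (- A <= (x, y).1 <= A /\ - A <= (x, y).2 <= A).
    by move=> /= -[_ yA]; move: yn; rewrite in_itv/= yA.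
  - exact: measurable_fun_pair2.
have stripE (F : R * R -> R) : (forall p, ~ strip H p -> F p = 0) ->
    \int[area]_(p in strip H) F p = \int[area]_p F p.
  move=> F0; rewrite Rintegral_mkcond; apply: eq_Rintegral => p _.
  by rewrite patchE; case: ifPn => //; rewrite notin_setE => /F0 ->.
rewrite !stripE.
- rewrite (RintegralD measurableT i1 i2) E1 E2 (RintegralN measurableT i3) (RintegralN measurableT i4).
rewrite -opprD -(RintegralD measurableT i3 i4); congr (- _).
  by apply: eq_Rintegral => p _; rewrite mulrDl.
- by move=> p /PD[-> _ _]; rewrite mulr0.
- by move=> p /PD[_ -> ->]; rewrite !mulr0 addr0.
Qed.

End WeakDivergence.

Section Rectangle.
Context {R : realType}.
Local Notation mu := (@lebesgue_measure R).
Local Notation mT := (setT : set (measurableTypeR R * measurableTypeR R)).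
Variables T H : R.
Local Notation Q := (rectangle T H).

Lemma rectangleE : Q = `]-T, T[ `*` `]-H, H[.
Proof. by apply/seteqP; split => p; rewrite /rectangle/= !in_itv. Qed.

Lemma measurable_rectangle : measurable (Q : set (measurableTypeR R * measurableTypeR R)).
Proof. by rewrite rectangleE; apply: measurableX; exact: measurable_itv. Qed.

Lemma area_rectangle_lty : (area Q < +oo)%E.
Proof.
rewrite rectangleE.
set I := `](- T)%R, T[%classic; set J := `](- H)%R, H[%classic.
have -> : area (I `*` J) = (mu I * mu J)%E.
  by apply: product_measure1E; exact: measurable_itv.
rewrite lte_mul_pinfty//; last exact: lebesgue_itv_lty.
by rewrite ge0_fin_numE//; exact: lebesgue_itv_lty.
Qed.

Lemma enorm_ge (x y : R) : `|x| <= enorm (x, y) /\ `|y| <= enorm (x, y).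
Proof.
rewrite /enorm/=; split; rewrite -sqrtr_sqr ler_wsqrtr//.
- by rewrite lerDl sqr_ge0.
- by rewrite lerDr sqr_ge0.
Qed.

(** [variation_bound] on every slice, then Fubini. The lists s1 and s2 contain the places where a
    horizontal or vertical slice may jump. The Lipschitz conditions extend by 1 beyond the rectangle
    to leave room for the shift in the difference quotient. *)
Lemma BV2_rectangle (f : R * R -> R) (K : R) (s1 s2 : seq R) : 0 < T -> 0 < H -> 0 <= K ->
  measurable_fun mT f -> (forall p, `|f p| <= 1) ->
  (forall y x x', - T - 1 < x -> x < x' -> x' < T + 1 ->
     (forall w, w \in s1 -> ~~ (x <= w <= x')) -> `|f (x, y) - f (x', y)| <= K * (x' - x)) ->
  (forall x y y', - H - 1 < y -> y < y' -> y' < H + 1 ->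
     (forall w, w \in s2 -> ~~ (y <= w <= y')) -> `|f (x, y) - f (x, y')| <= K * (y' - y)) ->
  BV2 Q f.
Proof.
move=> T0 H0 K0 mf f1 lip1 lip2.
have [ta tb tc] : [/\ - T - 1 < - T, T < T + 1 & - T <= T] by split; lra.
have [ha hb hc] : [/\ - H - 1 < - H, H < H + 1 & - H <= H] by split; lra.
split.
  apply: measurable_bounded_integrable.
  - exact: measurable_rectangle.
  - exact: area_rectangle_lty.
  - exact: measurable_funTS.
  - by apply: (@bounded_fun_in _ _ _ _ 1).
pose C1 := K * (T - - T) + 2 * (size s1)%:R; pose C2 := K * (H - - H) + 2 * (size s2)%:R.
exists (C1 * (H - - H) + C2 * (T - - T)) => P P' [CP sP] [CP' sP'] PP.
have [A [N [A0 N0 PD PA PN]]] := test_bounded CP sP.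
have [A' [N' [A'0 N'0 PD' PA' PN']]] := test_bounded CP' sP'.
have [ctP ctx _] := continuous_test CP; have [ctP' _ cty] := continuous_test CP'.
have mP := continuous_measurable2 ctP; have mdx := continuous_measurable2 ctx.
have mP' := continuous_measurable2 ctP'; have mdy := continuous_measurable2 cty.
have B1 p : `|P p| <= 1 by apply: le_trans (PP p); case: (enorm_ge (P p) (P' p)).
have B2 p : `|P' p| <= 1 by apply: le_trans (PP p); case: (enorm_ge (P p) (P' p)).
have i1 : area.-integrable setT (EFin \o (fun p => f p * dx P p)).
  apply: (@integrable_bounded_rect R _ (- A) A (- A) A (1 * N)).
  - exact: measurable_funM.
  - by move=> p; have [_ h _] := PN p; rewrite normrM ler_pM.
  - by move=> p /PA[_ -> _]; rewrite mulr0.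
have i2 : area.-integrable setT (EFin \o (fun p => f p * dy P' p)).
  apply: (@integrable_bounded_rect R _ (- A') A' (- A') A' (1 * N')).
  - exact: measurable_funM.
  - by move=> p; have [_ _ h] := PN' p; rewrite normrM ler_pM.
  - by move=> p /PA'[_ _ ->]; rewrite mulr0.
have -> : \int[area]_(p in Q) (f p * (dx P p + dy P' p)) =
    \int[area]_p (f p * dx P p + f p * dy P' p).
  rewrite Rintegral_mkcond; apply: eq_Rintegral => p _.
  rewrite patchE; case: ifPn => [_|]; first by rewrite mulrDr.
  by rewrite notin_setE => nQ; have [_ -> _] := PD p nQ; have [_ _ ->] := PD' p nQ; rewrite !mulr0 addr0.
rewrite RintegralD//; apply: lerD.
  apply: (RFubini2_le _ i1); first by lra.
  move=> y; rewrite indicE mem_setE; case: (boolP (y \in _)) => [_|yn]; last first.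
    rewrite mulr0 le_eqVlt; apply/orP; left; apply/eqP.
    transitivity (\int[mu]_x (0 : R)); last by rewrite Rintegral_cst// mul0r.
    apply: eq_Rintegral => x _; have nQ : ~ Q (x, y).
      by case=> _ /= /andP[h1 h2]; move: yn; rewrite in_itv/= !ltW.
    by have [_ -> _] := PD (x, y) nQ; rewrite mulr0.
  rewrite mulr1; apply: (le_trans (ler_norm _)).
  apply: (@variation_bound R (fun x => f (x, y)) (fun x => P (x, y)) (fun x => dx P (x, y))
    (- T) T 1 N 1 _ _ _ _ _ _ _ (- T - 1) (T + 1) K s1) => //.
  - exact: measurable_fun_pair1.
  - by move=> x; exact: test_slice1.
  - exact: measurable_fun_pair1.
  - by move=> x; case: (PN (x, y)).
  - move=> x xn; have nQ : ~ Q (x, y).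
      by case=> /= /andP[h1 h2] _; move: xn; rewrite in_itv/= !ltW.
    by have [-> _ _] := PD (x, y) nQ.
  - exact: lip1.
apply: (RFubini1_le _ i2); first by lra.
move=> x; rewrite indicE mem_setE; case: (boolP (x \in _)) => [_|xn]; last first.
  rewrite mulr0 le_eqVlt; apply/orP; left; apply/eqP.
  transitivity (\int[mu]_x (0 : R)); last by rewrite Rintegral_cst// mul0r.
  apply: eq_Rintegral => y _; have nQ : ~ Q (x, y).
    by case=> /= /andP[h1 h2] _; move: xn; rewrite in_itv/= !ltW.
  by have [_ _ ->] := PD' (x, y) nQ; rewrite mulr0.
rewrite mulr1; apply: (le_trans (ler_norm _)).
apply: (@variation_bound R (fun y => f (x, y)) (fun y => P' (x, y)) (fun y => dy P' (x, y))
  (- H) H 1 N' 1 _ _ _ _ _ _ _ (- H - 1) (H + 1) K s2) => //.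
- exact: measurable_fun_pair2.
- by move=> y; exact: test_slice2.
- exact: measurable_fun_pair2.
- by move=> y; case: (PN' (x, y)).
- move=> y yn; have nQ : ~ Q (x, y).
    by case=> /= _ /andP[h1 h2]; move: yn; rewrite in_itv/= !ltW.
  by have [-> _ _] := PD' (x, y) nQ.
- exact: lip2.
Qed.

Lemma L2_per_integrable (d : R * R -> R) : L2_per T H d -> area.-integrable Q (EFin \o d).
Proof.
move=> [_ md d2].
have md' : measurable_fun Q d.
  apply: (measurable_funS _ _ md); last by move=> p [].
  rewrite (_ : strip H = setT `*` `]-H, H[); last by apply/seteqP; split=> p /=; rewrite in_itv/= /strip/=; [|case].
  by apply: measurableX => //; exact: measurable_itv.
have mQ := measurable_rectangle.
have i1 : area.-integrable Q (EFin \o (fun p => 1 + d p ^+ 2)).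
  apply: integrable_add => //.
  apply: measurable_bounded_integrable => //; first exact: area_rectangle_lty.
  by apply: (@bounded_fun_in _ _ _ _ `|1|).
apply: le_integrable i1 => //; first exact/measurable_EFinP.
move=> p _ /=; rewrite lee_fin (ger0_norm (_ : 0 <= 1 + d p ^+ 2)) ?addr_ge0 ?sqr_ge0//.
by have := sqr_ge0 (`|d p| - 1); rewrite -(real_normK (num_real (d p))); move: `|d p|; clear => *; nra.
Qed.

(** [wdiv] is chosen among all weak divergences. Two of them agree almost everywhere in the
    rectangle by [du_bois_reymond2], since a test function on the rectangle is also one on the
    strip. *)
Lemma wdiv_sqr_integral u d : L2_per T H d -> weak_divergence H u d ->
  (\int[area]_(p in Q) (wdiv T H u p ^+ 2)%:E = \int[area]_(p in Q) (d p ^+ 2)%:E)%E.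
Proof.
move=> Ld wd; have mQ := measurable_rectangle.
have [Lw ww] : L2_per T H (wdiv T H u) /\ weak_divergence H u (wdiv T H u).
  by apply: (@xgetPex _ (fun=> 0) [set d | L2_per T H d /\ weak_divergence H u d]); exists d.
set w := wdiv T H u in Lw ww *.
have iw := L2_per_integrable Lw; have id := L2_per_integrable Ld.
have zero : {ae area, forall p, Q p -> w p - d p = 0}.
  apply: du_bois_reymond2; first exact: integrable_sub.
  move=> P CP; have cP1 : Ck 1 P by case: CP.
  have [cP _ _] := continuous_test cP1; have mP := continuous_measurable2 cP.
  have [A [N [A0 N0 PD PA PN]]] := test_bounded cP1 CP.2.
  have sP : Ccoo (strip H) P.
    case: CP => CkP [K [cK KD P0]]; split => //; exists K; split => //.
    by apply: subset_trans KD _ => p [].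
  have := wd _ sP; rewrite (ww _ sP) => /oppr_inj E.
  have stripQ (e : R * R -> R) : \int[area]_(p in strip H) (e p * P p) =
      \int[area]_(p in Q) (e p * P p).
    rewrite [LHS]Rintegral_mkcond [RHS]Rintegral_mkcond; apply: eq_Rintegral => p _.
    rewrite !patchE; case: (pselect (Q p)) => [Qp|nQ].
      by rewrite !mem_set//; case: Qp.
    by have [-> _ _] := PD p nQ; rewrite mulr0; do !case: ifP.
  rewrite !stripQ in E.
  have bP p : Q p -> `|P p| <= N by case: (PN p).
  have mPQ : measurable_fun Q P by exact: measurable_funTS.
  transitivity (\int[area]_(p in Q) (w p * P p - d p * P p)).
    by apply: eq_Rintegral => p _; rewrite mulrBl.
  rewrite RintegralB//.
  - by rewrite E subrr.
  - exact: (integrable_mulr (M := N)).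
  - exact: (integrable_mulr (M := N)).
apply: ae_eq_integral => //.
- by case: Lw => _ _ /measurable_int.
- by case: Ld => _ _ /measurable_int.
by apply: ae_mono zero => p h Qp; congr (_ ^+ 2)%:E; apply/eqP; rewrite -subr_eq0 h.
Qed.

End Rectangle.

(** * Affine changes of variable and folding of periodic integrands *)

Section AffineChange.
Context {R : realType}.
Local Notation mu := (@lebesgue_measure R).

Lemma ge0_integral_affine (g : R -> R) (a b : R) : a != 0 -> measurable_fun setT g ->
  (forall x, 0 <= g x) ->
  (\int[mu]_x (g x)%:E = `|a|%:E * \int[mu]_x (g (a * x + b))%:E)%E.
Proof.
move=> a0 mg g0.
have mphi : measurable_fun setT (fun x : R => a * x + b).
  by apply: measurable_funD => //; apply: measurable_funM.
have a0' : 0 < `|a| by rewrite normr_gt0.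
have mE : measurable_fun setT (EFin \o g) by exact/measurable_EFinP.
have gE0 (x : R) : (0 <= (EFin \o g) x)%E by rewrite lee_fin.
have := @ge0_integral_pushforward _ _ (measurableTypeR R) (measurableTypeR R) R
  (fun x : R => (a * x + b)%R) mphi mu setT (EFin \o g) measurableT mE (fun x _ => gE0 x).
rewrite preimage_setT => <-; rewrite -(@ge0_integral_mscale _ _ _ _ _ measurableT (NngNum (normr_ge0 a)))//.
apply: eq_measure_integral => A mA _.
  apply: lebesgue_measure_unique => // X [[c d] _ <-].
  rewrite /= /mscale /pushforward/= (lebesgue_measure_itv `]c, d])/= lte_fin.
  have [cd|dc] := ltP c d; last first.
    rewrite /pushforward (_ : _ @^-1` _ = set0) ?measure0 ?mule0//.
    by apply/seteqP; split=> x //=; rewrite in_itv/= => /andP[h1 h2]; lra.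
  have [a1|a1] : 0 < a \/ a < 0 by move: a0; rewrite neq_lt => /orP[]; [right|left].
    rewrite /pushforward (_ : _ @^-1` _ = `](c - b) / a, (d - b) / a]%classic); last first.
      apply/seteqP; split=> x /=; rewrite !in_itv/= ltr_pdivrMr// ler_pdivlMr// ?(mulrC x) ltrBlDr lerBrDr//.
    rewrite lebesgue_measure_itv/= lte_fin ltr_pM2r ?invr_gt0// ltrD2r cd gtr0_norm//.
    by rewrite -!EFinB -EFinM; congr EFin; field; rewrite gt_eqF.
  rewrite /pushforward (_ : _ @^-1` _ = `[(d - b) / a, (c - b) / a[%classic); last first.
    apply/seteqP; split=> x /=; rewrite !in_itv/= ltr_ndivlMr// ler_ndivrMr// ?(mulrC x) ltrBlDr lerBrDr andbC//.
  rewrite lebesgue_measure_itv/= lte_fin ltr_nM2r ?invr_lt0// ltrD2r cd ltr0_norm//.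
  by rewrite -!EFinB -EFinM; congr EFin; field; rewrite lt_eqF.
Qed.

Lemma Rintegral_affine (g : R -> R) (a b : R) : a != 0 -> measurable_fun setT g ->
  (forall x, 0 <= g x) ->
  \int[mu]_x g (a * x + b) = `|a|^-1 * \int[mu]_x g x.
Proof.
move=> a0 mg g0; rewrite /Rintegral (ge0_integral_affine b a0 mg g0) mulrC.
have a0' : 0 < `|a| by rewrite normr_gt0.
have : (0 <= \int[mu]_x (g (a * x + b)%R)%:E)%E by apply: integral_ge0 => x _; rewrite lee_fin.
case: (\int[mu]_x _)%E => [r _|_|//] /=; first by rewrite mulrAC divff ?mul1r// gt_eqF.
by rewrite gt0_muley ?lte_fin//= mul0r.
Qed.

(** On each piece of length tau * H the map [phi] is affine onto [0, tau] with slope 1 / H or -1 /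
    H. Either orientation contributes H times the same integral. *)
Lemma fold_integral (g phi : R -> R) (c tau H M : R) (n : nat) : 0 < H -> 0 < tau ->
  measurable_fun setT g -> measurable_fun setT phi ->
  (forall x, 0 <= x <= tau -> 0 <= g x <= M) -> (forall x, 0 <= phi x <= tau) ->
  (forall j, (j < n)%N ->
     (forall x, c + j%:R * (tau * H) <= x <= c + j.+1%:R * (tau * H) ->
        phi x = H^-1 * x - (c + j%:R * (tau * H)) / H) \/
     (forall x, c + j%:R * (tau * H) <= x <= c + j.+1%:R * (tau * H) ->
        phi x = - H^-1 * x + (c + j.+1%:R * (tau * H)) / H)) ->
  \int[mu]_(x in `[c, c + n%:R * (tau * H)]) g (phi x) = n%:R * H * \int[mu]_(x in `[0, tau]) g x.
Proof.
move=> H0 tau0 mg mphi gM phir hphi.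
have tH : 0 < tau * H by rewrite mulr_gt0.
have gi (i j : itv_bound R) : (exists x y a b, i = BSide x a /\ j = BSide y b) ->
    mu.-integrable [set` Interval i j] (EFin \o (g \o phi)).
  move=> [x [y [a [b [-> ->]]]]]; apply: measurable_bounded_integrable.
  - exact: measurable_itv.
  - exact: lebesgue_itv_lty.
  - exact: measurable_funTS (measurableT_comp mg mphi).
  - apply: (@bounded_fun_in _ _ _ _ M) => z _ /=; have /andP[g0 gm] := gM _ (phir z).
    by rewrite ger0_norm.
pose g' := g \_ `[0, tau].
have mg' : measurable_fun setT g'.
  by apply/(measurable_restrictT _ (measurable_itv _)); exact: measurable_funTS.
have g'0 x : 0 <= g' x.
  by rewrite /g' patchE; case: ifPn => //; rewrite mem_setE in_itv/= => /gM/andP[].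
elim: n hphi => [|n ih] hphi.
  by rewrite !mul0r addr0 set_itv1 Rintegral_set1.
have tn : n%:R * (tau * H) <= n.+1%:R * (tau * H) by rewrite ler_pM2r// ler_nat.
rewrite -natr1 !mulrDl -ih; last by move=> j jn; apply: hphi; rewrite ltnS ltnW.
rewrite -{1}[n%:R * (tau * H) + _]mulrDl natr1.
suff E : \int[mu]_(x in `[c, c + n.+1%:R * (tau * H)]) g (phi x) -
    \int[mu]_(x in `[c, c + n%:R * (tau * H)]) g (phi x) = H * \int[mu]_(x in `[0, tau]) g x.
  by rewrite mul1r -E [RHS]addrC subrK.
rewrite (@Rintegral_itvB R _ (BLeft c) (BRight (c + n.+1%:R * (tau * H))) (c + n%:R * (tau * H))); first last.
- by rewrite bnd_simp lerD2l.
- by rewrite bnd_simp lerDl mulr_ge0// ltW.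
- by apply: gi; do 4 eexists.
rewrite Rintegral_itv_obnd_cbnd; last by apply: gi; do 4 eexists.
have piece (a b : R) : a != 0 -> `|a| = H^-1 ->
   (forall x, c + n%:R * (tau * H) <= x <= c + n.+1%:R * (tau * H) -> phi x = a * x + b) ->
   (forall x, (0 <= a * x + b <= tau) = (c + n%:R * (tau * H) <= x <= c + n.+1%:R * (tau * H))) ->
   \int[mu]_(x in `[c + n%:R * (tau * H), c + n.+1%:R * (tau * H)]) g (phi x) = H * \int[mu]_(x in `[0, tau]) g x.
  move=> a0 aH hx hab; rewrite [in RHS]Rintegral_mkcond -/g'.
  have := Rintegral_affine b a0 mg' g'0; rewrite aH invrK => <-.
  rewrite Rintegral_mkcond; apply: eq_Rintegral => x _.
  rewrite /g' !patchE !mem_setE !in_itv/= hab; case: ifPn => // h.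
  by rewrite hx.
have [h|h] := hphi n (ltnSn n).
  apply: (piece H^-1 (- ((c + n%:R * (tau * H)) / H))) => //.
  - by rewrite invr_eq0 gt_eqF.
  - by rewrite gtr0_norm ?invr_gt0.
  move=> x; rewrite -natr1; set nt := n%:R.
  rewrite (_ : H^-1 * x - (c + nt * (tau * H)) / H = (x - (c + nt * (tau * H))) / H); last by rewrite mulrBl mulrC.
  rewrite pmulr_lge0 ?invr_gt0// subr_ge0 ler_pdivrMr// lerBlDr.
  by congr (_ && (_ <= _)); ring.
apply: (piece (- H^-1) ((c + n.+1%:R * (tau * H)) / H)) => //.
- by rewrite oppr_eq0 invr_eq0 gt_eqF.
- by rewrite normrN gtr0_norm ?invr_gt0.
move=> x; rewrite -natr1; set nt := n%:R.
rewrite (_ : - H^-1 * x + (c + (nt + 1) * (tau * H)) / H = ((c + (nt + 1) * (tau * H)) - x) / H); last by rewrite mulrBl mulNr addrC mulrC [x * _]mulrC.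
rewrite pmulr_lge0 ?invr_gt0// subr_ge0 ler_pdivrMr// andbC lerBlDr.
by congr (_ && _); rewrite -lerBlDl; congr (_ <= _); ring.
Qed.

End AffineChange.

From mathcomp Require Import zify.

(** * The triangle wave in the periodic direction *)

Section Wave.
Context {R : realType}.
Variables T P H : R.
Hypothesis P0 : 0 < P.
Hypothesis H0 : 0 < H.

Ltac slra := move: (P0) => ?; repeat (apply/andP; split); first [lra | rewrite ?intrD ?intrB; lra].

Definition cell (x : R) : int := Num.floor ((x + T) / P).
Definition phase (x : R) : R := x + T - P * (cell x)%:~R.
(** The distance from x to the nearest point of -T + P Z, divided by H. [slope] is the sign of its
    derivative, continuous from the right at the corners. *)
Definition wave (x : R) : R := Num.min (phase x) (P - phase x) / H.
Definition slope (x : R) : R := if phase x < P / 2 then 1 else -1.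

Lemma phase_itv x : 0 <= phase x < P.
Proof.
have /andP[h1 h2] := floor_itv ((x + T) / P); rewrite -/(cell x) in h1 h2.
rewrite /phase subr_ge0 ltrBlDr mulrC -ler_pdivlMr// h1/=.
by move: h2; rewrite intrD ltr_pdivrMr//; slra.
Qed.

Lemma phase_eq (n : int) x : 0 <= x + T - P * n%:~R < P -> phase x = x + T - P * n%:~R.
Proof.
move=> /andP[h1 h2]; rewrite /phase /cell (_ : Num.floor _ = n)//.
apply: floor_def; rewrite intrD ler_pdivlMr// ltr_pdivrMr//.
by slra.
Qed.

Lemma wave_up (n : int) x : 0 <= x + T - P * n%:~R <= P / 2 -> wave x = (x + T - P * n%:~R) / H.
Proof.
move=> /andP[h1 h2]; rewrite /wave (phase_eq (n := n)); last by slra.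
by rewrite min_l//; slra.
Qed.

Lemma wave_down (n : int) x : P / 2 <= x + T - P * n%:~R <= P ->
  wave x = (P - (x + T - P * n%:~R)) / H.
Proof.
move=> /andP[h1]; rewrite le_eqVlt => /predU1P[h2|h2]; last first.
  rewrite /wave (phase_eq (n := n)); last by slra.
  by rewrite min_r//; slra.
rewrite (@wave_up (n + 1)); last by rewrite intrD; slra.
by rewrite intrD; congr (_ / _); slra.
Qed.

Lemma slope_up (n : int) x : 0 <= x + T - P * n%:~R < P / 2 -> slope x = 1.
Proof.
move=> /andP[h1 h2]; rewrite /slope (phase_eq (n := n)) ?h2//.
by slra.
Qed.

Lemma slope_down (n : int) x : P / 2 <= x + T - P * n%:~R < P -> slope x = -1.
Proof.
move=> /andP[h1 h2]; rewrite /slope (phase_eq (n := n)); last by slra.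
by rewrite ltNge h1.
Qed.

Lemma cellP x : (exists n : int, 0 <= x + T - P * n%:~R < P / 2) \/
  (exists n : int, P / 2 <= x + T - P * n%:~R < P).
Proof.
have /andP[h1 h2] := phase_itv x.
have [h|h] := ltP (phase x) (P / 2); [left|right]; exists (cell x).
  by rewrite -/(phase x) h h1.
by rewrite -/(phase x) h h2.
Qed.

Lemma wave_itv x : 0 <= wave x <= P / 2 / H.
Proof.
have [[n h]|[n h]] := cellP x; move/andP: (h) => [h1 h2].
  rewrite (@wave_up n); last by rewrite h1 ltW.
  by rewrite divr_ge0 ?(ltW H0)//= ler_pM2r ?invr_gt0// ltW.
rewrite (@wave_down n); last by rewrite h1 ltW.
by rewrite divr_ge0 ?(ltW H0) ?subr_ge0 ?(ltW h2)//= ler_pM2r ?invr_gt0//; slra.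
Qed.

Lemma wave_le (n : int) x : wave x <= `|x + T - P * n%:~R| / H.
Proof.
rewrite /wave ler_pM2r ?invr_gt0//; have /andP[h1 h2] := phase_itv x.
have E : x + T - P * n%:~R = phase x + P * (cell x - n)%:~R by rewrite intrB /phase; ring.
rewrite E; have [hz|hz] := leP 0 (cell x - n).
  rewrite ge_min; apply/orP; left; apply: le_trans (ler_norm _).
  by rewrite lerDl mulr_ge0 ?ler0z// ltW.
rewrite ge_min; apply/orP; right; rewrite -normrN; apply: le_trans (ler_norm _).
have : (cell x - n)%:~R <= -1 :> R.
  have hz' : (cell x - n <= -1)%R by lia.
  by move: hz'; rewrite -(ler_int R) rmorphN.
by rewrite -(ler_pM2l P0); set z := P * _; rewrite mulrN1 => hz'; slra.
Qed.

Lemma wave_attained x : exists n : int, wave x = `|x + T - P * n%:~R| / H.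
Proof.
have [[n h]|[n h]] := cellP x; move/andP: (h) => [h1 h2].
  exists n; rewrite (@wave_up n); last by rewrite h1 ltW.
  by rewrite ger0_norm.
exists (n + 1); rewrite (@wave_down n); last by rewrite h1 ltW.
by rewrite intrD mulrDr mulr1 ler0_norm; [congr (_ / _); ring|lra].
Qed.

(** By [wave_le] and [wave_attained] the wave is a minimum of functions with Lipschitz constant 1 /
    H. *)
Lemma wave_lipschitz x y : `|wave x - wave y| <= H^-1 * `|x - y|.
Proof.
have half a b : wave a - wave b <= H^-1 * `|a - b|.
  have [n ->] := wave_attained b; rewrite lerBlDr.
  apply: (le_trans (wave_le n a)); rewrite [H^-1 * _]mulrC -mulrDl ler_pM2r ?invr_gt0//.
  by apply: le_trans (ler_normD _ _); rewrite le_eqVlt; apply/orP; left; apply/eqP; congr `| _ |; ring.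
by rewrite ler_norml; apply/andP; split; rewrite ?half// lerNl opprB distrC half.
Qed.

Lemma slope_right x0 : exists2 d : R, 0 < d & forall x, x0 <= x < x0 + d ->
  slope x = slope x0 /\ wave x = wave x0 + slope x0 / H * (x - x0).
Proof.
have [[n h]|[n h]] := cellP x0; move/andP: (h) => [h1 h2].
  exists (P / 2 - (x0 + T - P * n%:~R)); first by rewrite subr_gt0.
  move=> x /andP[x1 x2]; rewrite !(@slope_up n)//; last by slra.
  split=> //; rewrite !(@wave_up n); [|by slra|by slra].
  by field; rewrite gt_eqF.
exists (P - (x0 + T - P * n%:~R)); first by rewrite subr_gt0.
move=> x /andP[x1 x2]; rewrite !(@slope_down n)//; last by slra.
split=> //; rewrite !(@wave_down n); [|by slra|by slra].
by field; rewrite gt_eqF.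
Qed.

(** The corners of the wave, minima and maxima alike; at these the second component of the field
    changes sign. *)
Definition wall (x : R) := exists n : int, x = - T + P * n%:~R \/ x = - T + P * n%:~R + P / 2.

(** Since [slope] takes at a wall its value from the right, the sign s on the left has to be named
    separately; off the walls the two agree. *)
Lemma slope_left x0 : exists2 d : R, 0 < d & exists s : R, [/\ s = 1 \/ s = -1,
  ~ wall x0 -> s = slope x0 & forall x, x0 - d < x < x0 ->
  slope x = s /\ wave x = wave x0 + s / H * (x - x0)].
Proof.
have [[n h]|[n h]] := cellP x0; move/andP: (h) => [h1 h2].
  have [h0|h0] := eqVneq (x0 + T - P * n%:~R) 0.
    exists (P / 2); first by slra.
    exists (-1); split; [by right| |].
      by move=> nw; exfalso; apply: nw; exists n; left; slra.
    move=> x /andP[x1 x2]; rewrite (@slope_down (n - 1)); last by rewrite intrB; slra.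
    split=> //; rewrite (@wave_up n x0); last by slra.
    rewrite (@wave_down (n - 1)); last by rewrite intrB; slra.
    have -> : x0 = - T + P * n%:~R by slra.
    by rewrite intrB; field; rewrite gt_eqF.
  exists (x0 + T - P * n%:~R); first by rewrite lt_def h0.
  exists 1; split; [by left|by rewrite (@slope_up n)|].
  move=> x /andP[x1 x2]; rewrite (@slope_up n)//; last by slra.
  split=> //; rewrite !(@wave_up n); [|by slra|by slra].
  by field; rewrite gt_eqF.
have [h0|h0] := eqVneq (x0 + T - P * n%:~R) (P / 2).
  exists (P / 2); first by slra.
  exists 1; split; [by left| |].
    by move=> nw; exfalso; apply: nw; exists n; right; slra.
  move=> x /andP[x1 x2]; rewrite (@slope_up n); last by slra.
  split=> //; rewrite (@wave_up n x0); last by slra.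
  rewrite (@wave_up n); last by slra.
  by field; rewrite gt_eqF.
exists (x0 + T - P * n%:~R - P / 2); first by rewrite subr_gt0 lt_def h0.
exists (-1); split; [by right|by rewrite (@slope_down n)|].
move=> x /andP[x1 x2]; rewrite (@slope_down n)//; last by slra.
split=> //; rewrite !(@wave_down n); [|by slra|by slra].
by field; rewrite gt_eqF.
Qed.

Lemma slope_sign x : slope x = 1 \/ slope x = -1.
Proof. by rewrite /slope; case: ifP => _; [left|right]. Qed.

Lemma measurable_phase : measurable_fun setT phase.
Proof.
apply: measurable_funB; first by apply: measurable_funD.
apply: measurable_funM => //; apply: nondecreasing_measurable => // x y xy.
rewrite ler_int /cell floor_ge_int; apply: (le_trans (floor_le _)).
by rewrite ler_pM2r ?invr_gt0// lerD2r.
Qed.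

Lemma measurable_wave : measurable_fun setT wave.
Proof.
apply: measurable_funM => //; apply: measurable_minr; first exact: measurable_phase.
by apply: measurable_funB => //; exact: measurable_phase.
Qed.

Lemma measurable_slope : measurable_fun setT slope.
Proof.
apply: measurable_fun_ifT => //.
by apply: measurable_fun_ltr => //; exact: measurable_phase.
Qed.

Lemma phase_periodic (k : nat) x : phase (x + k%:R * P) = phase x.
Proof.
have E : x + k%:R * P + T - P * (cell x + k%:Z)%:~R = phase x.
  by rewrite intrD -pmulrn /phase; ring.
by rewrite (@phase_eq (cell x + k%:Z)) E ?phase_itv.
Qed.

Lemma wave_periodic (k : nat) x : wave (x + k%:R * P) = wave x.
Proof. by rewrite /wave phase_periodic. Qed.

Lemma slope_periodic (k : nat) x : slope (x + k%:R * P) = slope x.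
Proof. by rewrite /slope phase_periodic. Qed.


(** [variation_bound] asks for a finite list of possible jumps, so the walls meeting a bounded range
    are enumerated. *)
Lemma wall_list (M : nat) : exists s : seq R,
  forall n : int, - P * M%:R <= P * n%:~R <= P * (M%:R + 1) ->
    (- T + P * n%:~R \in s) && (- T + P * n%:~R + P / 2 \in s).
Proof.
exists ([seq - T + P * (i%:Z - M%:Z)%:~R | i : nat <- iota 0 (M + M).+2] ++
    [seq - T + P * (i%:Z - M%:Z)%:~R + P / 2 | i : nat <- iota 0 (M + M).+2]).
move=> n; rewrite mulNr -mulrN !ler_pM2l// => /andP[h1 h2].
have h1' : (- M%:Z <= n) by rewrite -(ler_int R) rmorphN.
have h2' : (n <= M%:Z + 1) by rewrite -(ler_int R) intrD.
have E : n = `|(n + M%:Z)%R|%N%:Z - M%:Z by lia.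
have mem : `|(n + M%:Z)%R|%N \in iota 0 (M + M).+2 by rewrite mem_iota; lia.
by rewrite !mem_cat E; apply/andP; split; apply/orP; [left|right]; apply/mapP; exists `|(n + M%:Z)%R|%N.
Qed.

Lemma slope_interval : 0 < T -> exists s : seq R, forall x x', - T - 1 < x -> x < x' -> x' < T + 1 ->
  (forall w, w \in s -> ~~ (x <= w <= x')) -> slope x = slope x'.
Proof.
move=> T0; pose M := (Num.bound ((2 * T + 1) / P)).+1.
have M1 : 2 * T + 1 + P <= P * M%:R.
  have q0 : 0 <= (2 * T + 1) / P by rewrite divr_ge0 ?(ltW P0)//; slra.
  have := archi_boundP q0; rewrite ltr_pdivrMr// /M.
  by rewrite -(natr1 (Num.bound _)); set N := _%:R; slra.
have [s hs] := wall_list M; clearbody M; exists s => x x' x1 xx x2 hw.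
have [[n h]|[n h]] := cellP x; move/andP: (h) => [h1 h2].
  rewrite (@slope_up n)//; have [x'1|x'1] := ltP x' (- T + P * n%:~R + P / 2).
    by rewrite (@slope_up n)//; slra.
  have /andP[_ /hw] : (- T + P * n%:~R \in s) && (- T + P * n%:~R + P / 2 \in s).
    by apply: hs; rewrite mulNr mulrDr mulr1; slra.
  by rewrite x'1 andbT -ltNge; slra.
rewrite (@slope_down n)//; have [x'1|x'1] := ltP x' (- T + P * (n + 1)%:~R).
  by rewrite (@slope_down n)//; move: x'1; rewrite intrD; slra.
have /andP[/hw] : (- T + P * (n + 1)%:~R \in s) && (- T + P * (n + 1)%:~R + P / 2 \in s).
  by apply: hs; rewrite intrD mulNr !mulrDr !mulr1; slra.
by rewrite x'1 andbT -ltNge intrD; slra.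
Qed.

End Wave.

(** * Traces and jumps *)

Section Traces.
Context {R : realType}.
Local Notation mu := (@lebesgue_measure R).
Local Notation mT := (setT : set (measurableTypeR R * measurableTypeR R)).
Variable H : R.
Implicit Types (u : R * R -> R * R) (p nu a b : R * R).

Lemma measurable_enorm (f g : R * R -> R) : measurable_fun mT f -> measurable_fun mT g ->
  measurable_fun mT (fun q => enorm (f q, g q)).
Proof.
move=> mf mg; rewrite /enorm/=.
apply: (measurableT_comp (f := @Num.sqrt R)).
  by apply: continuous_measurable_fun => x; exact: sqrt_continuous.
by apply: measurable_funD; exact: measurable_funX.
Qed.

Lemma measurable_ltr_set (f g : R * R -> R) : measurable_fun mT f -> measurable_fun mT g ->
  measurable ([set q | f q < g q] : set (measurableTypeR R * measurableTypeR R)).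
Proof.
move=> mf mg; rewrite (_ : mkset _ = setT `&` ((fun q => f q < g q) @^-1` [set true])); last first.
  by rewrite setTI.
exact: (measurable_fun_ltr mf mg).
Qed.

Lemma measurable_coordinates : measurable_fun mT (fst : R * R -> R) /\ measurable_fun mT (snd : R * R -> R).
Proof. by split; [exact: measurable_fst|exact: measurable_snd]. Qed.

Lemma measurable_half_disc p nu (r : R) :
  measurable (half_disc H p nu r : set (measurableTypeR R * measurableTypeR R)).
Proof.
have [m1 m2] := measurable_coordinates.
have -> : half_disc H p nu r =
    ([set q | - H < q.2] `&` [set q | q.2 < H]) `&`
    ([set q | enorm (q.1 - p.1, q.2 - p.2) < r] `&` [set q | 0 < (q.1 - p.1) * nu.1 + (q.2 - p.2) * nu.2]).
  apply/seteqP; split => q /=; rewrite /half_disc /strip /= ?/edot/=.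
    by move=> [/andP[? ?] ? ?].
  by move=> [[h1 h2] [h3 h4]]; split => //; rewrite h1.
have m1' : measurable_fun mT (fun q : R * R => q.1 - p.1) by apply: measurable_funB.
have m2' : measurable_fun mT (fun q : R * R => q.2 - p.2) by apply: measurable_funB.
apply: measurableI; apply: measurableI; apply: measurable_ltr_set => //.
  exact: measurable_enorm.
by apply: measurable_funD; apply: measurable_funM.
Qed.

Lemma enorm_ge0 a : 0 <= enorm a. Proof. exact: sqrtr_ge0. Qed.

Lemma enorm_le a : enorm a <= `|a.1| + `|a.2|.
Proof.
rewrite /enorm -[leRHS]ger0_norm ?addr_ge0// -sqrtr_sqr ler_wsqrtr//.
rewrite sqrrD !real_normK ?num_real// -addrA lerD2l lerDr mulrn_wge0// mulr_ge0//.
Qed.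

Lemma enorm_eq0 a : enorm a = 0 -> a = 0.
Proof.
move=> h; have [h1 h2] := enorm_ge a.1 a.2; move: h1 h2; case: a h => a1 a2 /= -> h1 h2.
by congr (_, _); apply/eqP; rewrite -normr_le0.
Qed.

Lemma edist_triangle a b c : enorm (a - b) <= enorm (c - a) + enorm (c - b).
Proof.
rewrite /enorm /=.
set x1 := a.1; set x2 := a.2; set y1 := b.1; set y2 := b.2; set z1 := c.1; set z2 := c.2.
pose p1 := z1 - x1; pose p2 := z2 - x2; pose q1 := z1 - y1; pose q2 := z2 - y2.
rewrite -/p1 -/p2 -/q1 -/q2 (_ : x1 - y1 = q1 - p1); last by rewrite /p1 /q1; ring.
rewrite (_ : x2 - y2 = q2 - p2); last by rewrite /p2 /q2; ring.
set A := Num.sqrt (p1 ^+ 2 + _); set B := Num.sqrt (q1 ^+ 2 + _).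
have A0 : 0 <= A by exact: sqrtr_ge0.
have B0 : 0 <= B by exact: sqrtr_ge0.
have A2 : A ^+ 2 = p1 ^+ 2 + p2 ^+ 2 by rewrite sqr_sqrtr// addr_ge0// sqr_ge0.
have B2 : B ^+ 2 = q1 ^+ 2 + q2 ^+ 2 by rewrite sqr_sqrtr// addr_ge0// sqr_ge0.
rewrite -[leRHS]ger0_norm ?addr_ge0// -sqrtr_sqr ler_wsqrtr//.
have AB : `|p1 * q1 + p2 * q2| <= A * B.
  rewrite -[leRHS]ger0_norm ?mulr_ge0// -ler_sqr ?nnegrE// !real_normK ?num_real// exprMn A2 B2.
  by have := sqr_ge0 (p1 * q2 - p2 * q1); nra.
move: AB; rewrite ler_norml => /andP[AB _].
have -> : (A + B) ^+ 2 = A ^+ 2 + B ^+ 2 + 2 * (A * B) by ring.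
by rewrite A2 B2; move: AB; move: (A * B) => X; nra.
Qed.

(** Convergence at a linear rate in the open quadrant at p selected by the signs [al] and [be]. The
    constructed fields have such limits in all four quadrants, even where two walls cross, and every
    one-sided trace can be read off from them. *)
Definition quadrant_limit u p (al be : R) b := exists C d : R, [/\ 0 <= C, 0 < d &
  forall q, 0 < al * (q.1 - p.1) < d -> 0 < be * (q.2 - p.2) < d ->
    strip H q /\ enorm (u q - b) <= C * (`|q.1 - p.1| + `|q.2 - p.2|)].

Definition quadrant p (al be r : R) : set (R * R) :=
  [set q | 0 < al * (q.1 - p.1) < r /\ 0 < be * (q.2 - p.2) < r].

Lemma area_quadrant p (al be r : R) : al = 1 \/ al = -1 -> be = 1 \/ be = -1 -> 0 < r ->
  measurable (quadrant p al be r : set (measurableTypeR R * measurableTypeR R)) /\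
  area (quadrant p al be r) = (r ^+ 2)%:E.
Proof.
move=> hal hbe r0.
have itvE (x ga : R) : ga = 1 \/ ga = -1 -> exists i : interval R,
    [/\ measurable [set` i], mu [set` i] = r%:E & [set z | 0 < ga * (z - x) < r] = [set` i]].
  move=> [->|->].
    exists `]x, x + r[; split; first exact: measurable_itv.
      by rewrite lebesgue_measure_itv/= lte_fin ltrDl r0 -EFinB; congr EFin; ring.
    by apply/seteqP; split => z /=; rewrite in_itv/= mul1r => /andP[h1 h2]; apply/andP; split; lra.
  exists `]x - r, x[; split; first exact: measurable_itv.
    by rewrite lebesgue_measure_itv/= lte_fin gtrBl r0 -EFinB; congr EFin; ring.
  by apply/seteqP; split => z /=; rewrite in_itv/= mulN1r => /andP[h1 h2]; apply/andP; split; lra.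
have [i [mi ri Ei]] := itvE p.1 al hal; have [j [mj rj Ej]] := itvE p.2 be hbe.
have -> : quadrant p al be r = [set` i] `*` [set` j].
  by rewrite -Ei -Ej; apply/seteqP; split => q.
split; first exact: measurableX.
set I := [set` i] in mi ri *; set J := [set` j] in mj rj *.
have -> : area (I `*` J) = (mu I * mu J)%E by apply: product_measure1E.
by rewrite ri rj -EFinM expr2.
Qed.

Lemma quadrant_box p (al be r : R) q : al = 1 \/ al = -1 -> be = 1 \/ be = -1 -> 0 < r ->
  quadrant p al be (r / 2) q -> (p.1 - r <= q.1 <= p.1 + r) /\ (p.2 - r <= q.2 <= p.2 + r).
Proof.
have side (x y ga : R) : ga = 1 \/ ga = -1 -> 0 < r -> 0 < ga * (y - x) < r / 2 -> x - r <= y <= x + r.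
  by move=> [->|->] r0 /andP[? ?]; apply/andP; split; lra.
by move=> hal hbe r0 [h1 h2]; split; [exact: (side _ _ al)|exact: (side _ _ be)].
Qed.

Section TraceOf.
Variable u : R * R -> R * R.
Hypothesis mu1 : measurable_fun mT (fun q => (u q).1).
Hypothesis mu2 : measurable_fun mT (fun q => (u q).2).
Hypothesis uB : forall q, `|(u q).1| <= 1 /\ `|(u q).2| <= 1.

Let f a p nu r (q : R * R) : R := enorm (u q - a) * \1_(half_disc H p nu r) q.

Let f_integral a p nu r : \int[area]_(q in half_disc H p nu r) enorm (u q - a) = \int[area]_q f a p nu r q.
Proof.
rewrite Rintegral_mkcond; apply: eq_Rintegral => q _.
by rewrite patchE /f indicE; case: ifP => _; rewrite ?mulr1 ?mulr0.
Qed.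

Let f_ge0 a p nu r q : 0 <= f a p nu r q.
Proof. by rewrite mulr_ge0 ?enorm_ge0// indicE. Qed.

Let f_integrable a p nu r : area.-integrable setT (EFin \o f a p nu r).
Proof.
pose M := (1 + `|a.1|) + (1 + `|a.2|).
apply: (@integrable_bounded_rect R _ (p.1 - r) (p.1 + r) (p.2 - r) (p.2 + r) M).
- apply: measurable_funM.
    by apply: (@measurable_enorm (fun q => (u q).1 - a.1) (fun q => (u q).2 - a.2)); apply: measurable_funB.
  by apply: measurable_indic; exact: measurable_half_disc.
- move=> q; rewrite ger0_norm ?f_ge0//; have [b1 b2] := uB q.
  have uM : enorm (u q - a) <= M.
    apply: (le_trans (enorm_le _)); apply: lerD => /=.
      by apply: (le_trans (ler_normB _ _)); rewrite lerD2r.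
    by apply: (le_trans (ler_normB _ _)); rewrite lerD2r.
  by rewrite /f indicE; case: (_ \in _); rewrite ?mulr1// mulr0 (le_trans (enorm_ge0 _) uM).
- move=> q nq; rewrite /f indicE memNset ?mulr0// => -[_ h _]; apply: nq.
  have [h1 h2] := enorm_ge (q - p).1 (q - p).2.
  have : `|q.1 - p.1| < r by exact: le_lt_trans h1 h.
  have : `|q.2 - p.2| < r by exact: le_lt_trans h2 h.
  rewrite !ltr_norml => /andP[? ?] /andP[? ?].
  by split; apply/andP; split; lra.
Qed.

(** When nu points into the closed quadrant, the half disc of radius r contains the square of side r
    / 2 in that quadrant. If a and b were at distance D > 0, the scaled integral would stay above (D
    - C r) / 4 and could not tend to 0. *)
Lemma trace_quadrant p nu a b (al be : R) : al = 1 \/ al = -1 -> be = 1 \/ be = -1 ->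
  0 <= al * nu.1 -> 0 <= be * nu.2 -> enorm nu = 1 ->
  quadrant_limit u p al be b -> one_sided_trace H u p nu a -> a = b.
Proof.
move=> hal hbe nu1 nu2 nuE [C [d [C0 d0 hC]]] tr.
apply/eqP; rewrite -subr_eq0; apply/eqP; apply: enorm_eq0; apply/eqP.
rewrite eq_le enorm_ge0 andbT leNgt; apply/negP; set D := enorm (a - b) => D0.
have lb (r : R) : 0 < r -> r < d -> 4^-1 * (D - C * r) <= (r ^+ 2)^-1 * \int[area]_(q in half_disc H p nu r) enorm (u q - a).
  move=> r0 rd; have r2 : 0 < r / 2 by lra.
  have [mS aS] := area_quadrant p hal hbe r2.
  set S := quadrant p al be (r / 2) in mS aS *.
  have Sd q : S q -> half_disc H p nu r q /\ D - C * r <= enorm (u q - a).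
    move=> [h1 h2].
    have [sq uq] : strip H q /\ enorm (u q - b) <= C * (`|q.1 - p.1| + `|q.2 - p.2|).
      by apply: hC; [case/andP: h1|case/andP: h2] => h h'; rewrite h/=; lra.
    have n1 : `|q.1 - p.1| = al * (q.1 - p.1).
      have al1 : `|al| = 1 by case: hal => ->; rewrite ?normrN normr1.
      by rewrite -[LHS]mul1r -al1 -normrM gtr0_norm//; case/andP: h1.
    have n2 : `|q.2 - p.2| = be * (q.2 - p.2).
      have be1 : `|be| = 1 by case: hbe => ->; rewrite ?normrN normr1.
      by rewrite -[LHS]mul1r -be1 -normrM gtr0_norm//; case/andP: h2.
    have le1 : `|q.1 - p.1| + `|q.2 - p.2| < r.
      by rewrite n1 n2; case/andP: h1; case/andP: h2 => *; lra.
    split; last first.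
      have := edist_triangle a b (u q); rewrite -/D => tri.
      have : C * (`|q.1 - p.1| + `|q.2 - p.2|) <= C * r by rewrite ler_wpM2l// ltW.
      by lra.
    split => //; first by apply: le_lt_trans le1; exact: enorm_le.
    rewrite /edot /=.
    have -> : (q.1 - p.1) * nu.1 = (al * (q.1 - p.1)) * (al * nu.1) by case: hal => ->; ring.
    have -> : (q.2 - p.2) * nu.2 = (be * (q.2 - p.2)) * (be * nu.2) by case: hbe => ->; ring.
    case/andP: h1 => h1 _; case/andP: h2 => h2 _.
    have [z1|z1] := eqVneq (al * nu.1) 0; last first.
      rewrite ltr_pwDl//; first by rewrite mulr_gt0// lt_def z1.
      by rewrite mulr_ge0// ltW.
    have [z2|z2] := eqVneq (be * nu.2) 0; last first.
      by rewrite z1 mulr0 add0r mulr_gt0// lt_def z2.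
    exfalso; have nu10 : nu.1 = 0 by move: z1; case: hal => -> /eqP; rewrite ?mulN1r ?mul1r ?oppr_eq0 => /eqP.
    have nu20 : nu.2 = 0 by move: z2; case: hbe => -> /eqP; rewrite ?mulN1r ?mul1r ?oppr_eq0 => /eqP.
    by move: nuE; rewrite /enorm nu10 nu20 expr0n addr0 sqrtr0 => /eqP; rewrite eq_sym oner_eq0.
  rewrite f_integral.
  have iS : area.-integrable setT (EFin \o (fun q => (D - C * r) * \1_S q)).
    apply: (@integrable_bounded_rect R _ (p.1 - r) (p.1 + r) (p.2 - r) (p.2 + r) `|D - C * r|).
    - by apply: measurable_funM => //; exact: measurable_indic.
    - by move=> q; rewrite normrM indicE; case: (_ \in _); rewrite ?normr1 ?normr0 ?mulr1 ?mulr0.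
    - move=> q nq; rewrite indicE memNset ?mulr0// => hS; apply: nq.
      by apply: (quadrant_box hal hbe _ hS).
  have : \int[area]_q ((D - C * r) * \1_S q) <= \int[area]_q f a p nu r q.
    apply: le_Rintegral => // q _; rewrite /f !indicE.
    case: (pselect (S q)) => [Sq|nS].
      by have [hd le] := Sd q Sq; rewrite !mem_set// !mulr1.
    by rewrite (memNset nS) mulr0 mulr_ge0 ?enorm_ge0.
  have -> : \int[area]_q ((D - C * r) * \1_S q) = (D - C * r) * (r / 2) ^+ 2.
    have : (\int[area]_q ((D - C * r)%:E * (\1_S q)%:E) = ((D - C * r) * (r / 2) ^+ 2)%:E)%E.
      rewrite integralZl//; last first.
        apply: (@integrable_bounded_rect R (\1_S) (p.1 - r) (p.1 + r) (p.2 - r) (p.2 + r) 1).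
        - exact: measurable_indic.
        - by move=> q; rewrite indicE; case: (_ \in _); rewrite ?normr1 ?normr0.
        - move=> q nq; rewrite indicE memNset// => hS; apply: nq.
          by apply: (quadrant_box hal hbe _ hS).
      by rewrite integral_indic//= setIT [X in (_ * X)%E]aS EFinM.
    by rewrite /Rintegral => ->.
  move=> h; rewrite [leRHS]mulrC ler_pdivlMr ?exprn_gt0//; apply: le_trans h.
  by rewrite le_eqVlt; apply/orP; left; apply/eqP; field.
have e0 : 0 < D / 8 by rewrite divr_gt0.
have near1 : \forall r \near 0^'+, `|(r ^+ 2)^-1 * \int[area]_(q in half_disc H p nu r) enorm (u q - a)| < D / 8.
  by move/cvgr0Pnorm_lt : tr; apply.
have near2 : \forall r \near 0^'+, 0 < r < Num.min d (D / (2 * (C + 1))).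
  apply: filterS2 (nbhs_right_gt (0 : R)) (nbhs_right_lt (_ : 0 < Num.min d (D / (2 * (C + 1))))).
    by move=> r -> ->.
  by rewrite lt_min d0 divr_gt0// mulr_gt0// ltr_wpDl.
have [r [n1 /andP[r0]]] := filter_ex (filterI near1 near2).
rewrite lt_min => /andP[rd rD].
have := lb r r0 rd; move/ltr_normlW : n1 => n1 n2.
have : r * (2 * (C + 1)) < D by rewrite -ltr_pdivlMr// mulr_gt0// ltr_wpDl.
by move: n1 n2 r0; set X := (r ^- 2 * _); clear; move=> *; lra.
Qed.

(** On the half disc the integrand is at most 2 C r, and the half disc lies in a square of side 2 r;
    the scaled integral is at most 8 C r. *)
Lemma trace_limit p nu a (C d : R) : 0 <= C -> 0 < d ->
  (forall q, strip H q -> `|q.2 - p.2| < d -> enorm (u q - a) <= C * (`|q.1 - p.1| + `|q.2 - p.2|)) ->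
  one_sided_trace H u p nu a.
Proof.
move=> C0 d0 hC; apply/cvgr0Pnorm_lt => e e0.
have near2 : \forall r \near 0^'+, 0 < r < Num.min d (e / (8 * (C + 1))).
  apply: filterS2 (nbhs_right_gt (0 : R)) (nbhs_right_lt (_ : 0 < Num.min d (e / (8 * (C + 1))))).
    by move=> r -> ->.
  by rewrite lt_min d0 divr_gt0// mulr_gt0// ltr_wpDl.
apply: filterS near2 => r /andP[r0]; rewrite lt_min => /andP[rd re].
have re' : r * (8 * (C + 1)) < e by rewrite -ltr_pdivlMr// mulr_gt0// ltr_wpDl.
have I0 : 0 <= \int[area]_q f a p nu r q by apply: Rintegral_ge0 => q _; exact: f_ge0.
rewrite f_integral ger0_norm; last by rewrite mulr_ge0// invr_ge0 sqr_ge0.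
apply: le_lt_trans (_ : 8 * C * r < e); last by move: re' C0 r0; nra.
rewrite mulrC ler_pdivrMr ?exprn_gt0//.
apply: (@le_trans _ _ (4 * C * r * r * ((p.1 + r) - (p.1 - r)))); last by rewrite le_eqVlt; apply/orP; left; apply/eqP; ring.
apply: (RFubini1_le _ (f_integrable a p nu r)); first by lra.
move=> x; rewrite indicE mem_setE; case: (boolP (x \in _)) => [_|xn]; last first.
  rewrite mulr0 le_eqVlt; apply/orP; left; apply/eqP.
  transitivity (\int[mu]_x (0 : R)); last by rewrite Rintegral_cst// mul0r.
  apply: eq_Rintegral => y _; rewrite /f indicE memNset ?mulr0// => -[_ h _].
  have [h1 _] := enorm_ge (x - p.1) (y - p.2).
  have : `|x - p.1| < r by exact: le_lt_trans h1 h.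
  by rewrite ltr_norml => /andP[? ?]; move: xn; rewrite in_itv/= => /negP; apply; apply/andP; split; lra.
rewrite mulr1 -(_ : 2 * C * r * ((p.2 + r) - (p.2 - r)) = 4 * C * r * r); last by ring.
have fle y : f a p nu r (x, y) <= 2 * C * r * \1_`[p.2 - r, p.2 + r] y.
  rewrite /f !indicE; case: (pselect (half_disc H p nu r (x, y))) => [hd|nhd]; last first.
    by rewrite (memNset nhd) mulr0 mulr_ge0 ?mulr_ge0// ltW.
  case: (hd) => sq h _; have [h1 h2] := enorm_ge (x - p.1) (y - p.2).
  have {}h1 : `|x - p.1| < r by exact: le_lt_trans h1 h.
  have {}h2 : `|y - p.2| < r by exact: le_lt_trans h2 h.
  rewrite (mem_set hd) mem_set; last first.
    by move: h2; rewrite /= in_itv/= ltr_norml => /andP[? ?]; apply/andP; split; lra.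
  rewrite !mulr1; apply: (le_trans (hC (x, y) sq _)) => /=; first by apply: (lt_trans h2).
  have : C * (`|x - p.1| + `|y - p.2|) <= C * (r + r) by rewrite ler_wpM2l// lerD// ltW.
  by move=> hh; apply: (le_trans hh); rewrite le_eqVlt; apply/orP; left; apply/eqP; ring.
apply: Rintegral_le_itv => //; first by lra.
apply: (@integrable_bounded_itv R _ (p.2 - r) (p.2 + r) (2 * C * r)).
- have /integrableP[/measurable_EFinP mf _] := f_integrable a p nu r.
  exact: measurable_fun_pair2.
- move=> y; rewrite ger0_norm ?f_ge0//; apply: (le_trans (fle y)).
  by rewrite indicE; case: (_ \in _); rewrite ?mulr1// mulr0 !mulr_ge0// ltW.
- move=> y yn; apply/eqP; rewrite eq_le f_ge0 andbT; apply: (le_trans (fle y)).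
  by rewrite indicE mem_setE (negbTE yn) mulr0.
Qed.

(** Each of nu and -nu lies in some closed quadrant, so both traces of a jump pair are quadrant
    limits. The unknown normal is thus replaced by finitely many cases. *)
Lemma jump_quadrants p (b : R -> R -> R * R) c :
  (forall al be : R, al = 1 \/ al = -1 -> be = 1 \/ be = -1 -> quadrant_limit u p al be (b al be)) ->
  jump_pair H u p c -> c.1 <> c.2 /\
  exists al be al' be' : R, [/\ al = 1 \/ al = -1, be = 1 \/ be = -1, al' = 1 \/ al' = -1,
    be' = 1 \/ be' = -1 & c.1 = b al be /\ c.2 = b al' be'].
Proof.
move=> hb [cc [nu [nuE t1 t2]]]; split => //.
have sgP (x : R) : exists2 al : R, al = 1 \/ al = -1 & 0 <= al * x.
  by have [x0|/ltW x0] := leP 0 x; [exists 1|exists (-1)]; rewrite ?mul1r ?mulN1r ?oppr_ge0//; [left|right].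
have [al hal al0] := sgP nu.1; have [be hbe be0] := sgP nu.2.
have [al' hal' al'0] := sgP (- nu.1); have [be' hbe' be'0] := sgP (- nu.2).
have nuN : enorm (- nu) = 1 by rewrite -nuE /enorm /= !sqrrN.
exists al, be, al', be'; split => //; split.
- exact: (trace_quadrant hal hbe al0 be0 nuE (hb _ _ hal hbe) t1).
- exact: (trace_quadrant (nu := - nu) hal' hbe' al'0 be'0 nuN (hb _ _ hal' hbe') t2).
Qed.

End TraceOf.

End Traces.

(** * One-dimensional Hausdorff measure *)

Section Covers.
Context {R : realType}.
Local Open Scope ereal_scope.
Notation mu := (@hausdorff1 R).

(* [cover_sum f D r]: the set D is a finite union of sets on each of which f is
   bounded by a constant, and r is the corresponding upper sum. *)
Inductive cover_sum (f : R * R -> R) : set (R * R) -> R -> Prop :=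
| cover_sum0 : cover_sum f set0 0
| cover_sumS D S m c r : cover_sum f D r -> mu S <= m%:E -> (0 <= c)%R ->
    (forall p, S p -> (f p <= c)%R) -> cover_sum f (D `|` S) (r + c * m).

Lemma cover_sumU f D D' r r' : cover_sum f D r -> cover_sum f D' r' ->
  cover_sum f (D `|` D') (r + r').
Proof.
move=> h; elim => [|D1 S m c r1 _ ih mS c0 fc]; first by rewrite setU0 addr0.
by rewrite setUA addrA; exact: cover_sumS.
Qed.

(** Induction on the cover. For one piece S the sets A_i are Caratheodory measurable and disjoint,
    so the measures of their intersections with S add up to at most that of S, whatever S is; and
    x_i <= c as soon as A_i meets S. *)
Lemma cover_sum_bound f D r (n : nat) (A : (set (R * R))^nat) (x : R^nat) :
  cover_sum f D r ->
  (forall i, caratheodory_measurable (@hausdorff1_outer R) (A i)) -> trivIset setT A ->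
  (forall i, (0 <= x i)%R) -> (forall i p, A i p -> (x i <= f p)%R) ->
  \sum_(i < n) (x i)%:E * mu (A i `&` D) <= r%:E.
Proof.
move=> h mA tA x0 xf; elim: h => [|D1 S m c r1 _ ih mS c0 fc].
  by rewrite big1// => i _; rewrite setI0 hausdorff1_0 mule0.
have le i : (x i)%:E * mu (A i `&` (D1 `|` S)) <=
    (x i)%:E * mu (A i `&` D1) + c%:E * mu (S `&` A i).
  rewrite setIUr.
  apply: (@le_trans _ _ ((x i)%:E * (mu (A i `&` D1) + mu (A i `&` S)))).
    by rewrite lee_wpmul2l ?lee_fin//; exact: (outer_measureU2 hausdorff1_outer).
  rewrite ge0_muleDr ?hausdorff1_ge0// leeD2l// [S `&` _]setIC.
  have [->|/set0P[p [Ap Sp]]] := eqVneq (A i `&` S) set0.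
    by rewrite hausdorff1_0 !mule0.
  rewrite lee_wpmul2r ?hausdorff1_ge0// lee_fin.
  exact: le_trans (xf _ _ Ap) (fc _ Sp).
apply: (@le_trans _ _ (\sum_(i < n) ((x i)%:E * mu (A i `&` D1) + c%:E * mu (S `&` A i)))).
  by apply: lee_sum => i _; exact: le.
rewrite big_split/= EFinD leeD//.
rewrite -ge0_sume_distrr; last by move=> i _; exact: hausdorff1_ge0.
rewrite EFinM lee_wpmul2l ?lee_fin//.
rewrite -(caratheodory_additive mA tA n S); apply: le_trans mS.
by apply: le_hausdorff1; exact: subIsetl.
Qed.

Import HBNNSimple.

(** The integral is a supremum over simple functions below f on D. Their level sets are Caratheodory
    measurable, and this is all that [cover_sum_bound] asks for; the jump set can therefore be
    treated by covers directly. *)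
Lemma integral_Hone_le (f : R * R -> R) (D : set (R * R)) (r : R) :
  (forall p, D p -> (0 <= f p)%R) ->
  (forall e : R, (0 < e)%R -> exists2 D', D `<=` D' & cover_sum f D' (r + e)) ->
  \int[Hone]_(p in D) (f p)%:E <= r%:E.
Proof.
move=> f0 hc; rewrite ge0_integralE; last by move=> p Dp; rewrite lee_fin f0.
apply: ge_ereal_sup => _ [h /= hf <-].
apply/lee_addgt0Pr => e e0; have [D' DD' cs] := hc e e0.
rewrite -EFinD.
have hfin : finite_set (range h) by exact: fimfunP.
apply: (@le_trans _ _ (\sum_(z \in range h) z%:E * Hone (h @^-1` [set z]))).
  by rewrite -(sintegralE Hone h).
have [s0 sE] := (finite_seqP _).1 hfin.
pose s := undup s0.
have us : uniq s by exact: undup_uniq.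
have sE' : range h = [set` s] by rewrite sE; apply/seteqP; split=> z /=; rewrite mem_undup.
have sP z : z \in s -> (range h) z by rewrite sE'.
rewrite sE' -fsbig_seq//=.
have h0 p : (0 <= h p)%R by [].
have hD p : (0 < h p)%R -> D p /\ (h p <= f p)%R.
  move=> hp; have := hf p; rewrite patchE; case: ifPn => [|nD].
    by move=> /set_mem Dp; rewrite lee_fin.
  by rewrite lee_fin leNgt hp.
pose s' := [seq z <- s | (0 < z)%R].
have us' : uniq s' by exact: filter_uniq.
pose A i : set (R * R) := if (i < size s')%N then h @^-1` [set nth 0%R s' i] else set0.
pose x i : R := nth 0%R s' i.
have x0 i : (0 <= x i)%R.
  have [ilt|ige] := ltnP i (size s'); last by rewrite /x nth_default.
  by have := mem_nth 0%R ilt; rewrite mem_filter => /andP[/ltW].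
have xp i p : A i p -> (0 < x i)%R /\ h p = x i.
  rewrite /A; case: ifPn => // ilt /= ->; split => //.
  by have := mem_nth 0%R ilt; rewrite mem_filter => /andP[].
have -> : \sum_(z <- s) z%:E * Hone (h @^-1` [set z]) =
    \sum_(i < size s') (x i)%:E * mu (A i `&` D').
  rewrite (bigID (fun z => (0 < z)%R))/= [X in _ + X]big1_seq ?adde0; last first.
    move=> z /andP[z0 zs]; have [p _ pz] := sP _ zs.
    have -> : z = 0%R by apply/eqP; rewrite eq_le -pz h0 pz leNgt z0.
    by rewrite mul0e.
  rewrite -big_filter -/s' (big_nth 0%R) big_mkord; apply: eq_bigr => i _.
  congr (_ * _); rewrite /Hone /= (_ : A i `&` D' = h @^-1` [set nth 0%R s' i])//.
  apply/seteqP; split => [p [Ap _]|p hp]; first by move: Ap; rewrite /A ltn_ord.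
  have Ap : A i p by rewrite /A ltn_ord.
  split => //; apply: DD'; have [x1 x2] := xp i p Ap.
  by have [] := hD p; rewrite ?x2.
apply: (@cover_sum_bound f D' _ (size s') A x) => //.
- move=> i; rewrite /A; case: ifP => _; last exact: caratheodory_measurable_set0.
  exact: (measurable_sfunP h (measurable_set1 _)).
- apply/trivIsetP => i j _ _ ij; apply/seteqP; split => // p [Ai Aj].
  have [_ hi] := xp _ _ Ai; have [_ hj] := xp _ _ Aj.
  move: Ai Aj; rewrite /A; case: ifPn => // ilt _; case: ifPn => // jlt _.
  by move/eqP: ij; apply; apply/eqP; rewrite -(nth_uniq 0%R ilt jlt us') -/(x i) -/(x j) -hi -hj.
- move=> i p Ap; have [x1 x2] := xp _ _ Ap.
  by have [] := hD p; rewrite x2.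
Qed.

End Covers.

Section Segments.
Context {R : realType}.
Local Open Scope ereal_scope.

Definition vsegment (x a b : R) : set (R * R) := [set p | p.1 = x /\ (a <= p.2 <= b)%R].
Definition hsegment (y a b : R) : set (R * R) := [set p | p.2 = y /\ (a <= p.1 <= b)%R].

Lemma hausdorff1_le (S : set (R * R)) (l : R) :
  (forall N : nat, (0 < N)%N -> exists A : (set (R * R))^nat,
     [/\ forall i, measurable (A i : set (measurableTypeR R * measurableTypeR R)),
         S `<=` \bigcup_(i < N) A i &
         forall i p q, A i p -> A i q -> (enorm (p - q) <= l / N%:R)%R]) ->
  (0 <= l)%R -> hausdorff1 S <= l%:E.
Proof.
move=> hA l0; apply: ge_ereal_sup => _ [d /= d0 <-].
have [N N0 Nd] : exists2 N, (0 < N)%N & (l / N%:R <= d)%R.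
  exists (Num.bound (l / d)).+1 => //; rewrite ler_pdivrMr// mulrC -ler_pdivrMr//.
  have := archi_boundP (divr_ge0 l0 (ltW d0)) => /ltW h.
  by apply: (le_trans h); rewrite ler_nat.
have [A [mA SA dA]] := hA N N0.
pose B i := if (i < N)%N then A i else set0.
apply: (@le_trans _ _ (\sum_(k <oo) gauge d (B k))).
  apply: ereal_inf_lbound; exists B => //; split.
    by move=> i; rewrite /B; case: ifP => // _; exact: measurable0.
  by move=> p /SA [i /= iN Ap]; exists i => //; rewrite /B iN.
have ed i : ediam (A i) <= (l / N%:R)%:E.
  apply: ge_ereal_sup => z [->|[p [q [Ap Aq ->]]]]; last by rewrite lee_fin (dA i).
  by rewrite lee_fin divr_ge0.
have gB i : gauge d (B i) <= if (i < N)%N then (l / N%:R)%:E else 0.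
  rewrite /B; case: ifPn => _; last by rewrite gauge0.
  by rewrite /gauge ifT// (le_trans (ed i))// lee_fin.
rewrite (nneseries_split 0 N) => [|k _]; last exact: gauge_ge0.
rewrite add0n [X in _ + X]eseries0 ?adde0; last first.
  by move=> i Ni _; apply/eqP; rewrite eq_le gauge_ge0 andbT (le_trans (gB i))// ltnNge Ni.
rewrite big_mkord; apply: (@le_trans _ _ (\sum_(i < N) (l / N%:R)%:E)).
  by apply: lee_sum => i _; have := gB i; rewrite ltn_ord.
by rewrite sumEFin lee_fin sumr_const card_ord -[X in (X <= _)%R]mulr_natr divfK// pnatr_eq0 -lt0n.
Qed.

Lemma subdivision (a b y : R) (N : nat) : (0 < N)%N -> (a <= y <= b)%R ->
  exists2 i, (i < N)%N & (a + (b - a) / N%:R * i%:R <= y <= a + (b - a) / N%:R * i.+1%:R)%R.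
Proof.
move=> N0 /andP[ay yb]; have N0' : (0 < N%:R :> R)%R by rewrite ltr0n.
have d0 : (0 <= (b - a) / N%:R)%R by rewrite divr_ge0 ?subr_ge0// (le_trans ay).
have : exists i, (y <= a + (b - a) / N%:R * i.+1%:R)%R.
  exists N.-1; rewrite prednK// divfK ?gt_eqF//; lra.
move=> ex; case: (ex_minnP ex) => i hi imin; exists i.
  rewrite ltnNge; apply/negP => Ni; have := imin N.-1.
  rewrite prednK// divfK ?gt_eqF// (_ : y <= a + (b - a))%R; last by lra.
  by move=> /(_ isT); rewrite leqNgt => /negP; apply; rewrite prednK.
rewrite hi andbT; case: i hi imin => [|i] hi imin; first by rewrite mulr0 addr0.
rewrite leNgt; apply/negP => /ltW h; have := imin i h.
by rewrite ltnn.
Qed.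

Lemma enorm_vert (x y y' : R) : enorm ((x, y) - (x, y'))%R = `|y - y'|%R.
Proof. by rewrite /enorm /= subrr expr0n add0r sqrtr_sqr. Qed.

Lemma enorm_hor (x x' y : R) : enorm ((x, y) - (x', y))%R = `|x - x'|%R.
Proof. by rewrite /enorm /= subrr expr0n addr0 sqrtr_sqr. Qed.

Lemma hausdorff1_vsegment (x a b : R) : (a <= b)%R ->
  hausdorff1 (vsegment x a b) <= (b - a)%:E.
Proof.
move=> ab; apply: hausdorff1_le; last by rewrite subr_ge0.
move=> N N0; exists (fun i => [set x] `*`
  `[(a + (b - a) / N%:R * i%:R)%R, (a + (b - a) / N%:R * i.+1%:R)%R]%classic); split.
- by move=> i; apply: measurableX; [exact: measurable_set1|exact: measurable_itv].
- move=> [p1 p2] [/= -> /(subdivision N0)[i iN hi]]; exists i => //.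
- move=> i [p1 p2] [q1 q2] [/= -> hp] [/= -> hq]; rewrite enorm_vert.
  move: hp hq; rewrite !in_itv/= -natr1 => /andP[? ?] /andP[? ?].
  by rewrite ler_norml; apply/andP; split; lra.
Qed.

Lemma hausdorff1_hsegment (y a b : R) : (a <= b)%R ->
  hausdorff1 (hsegment y a b) <= (b - a)%:E.
Proof.
move=> ab; apply: hausdorff1_le; last by rewrite subr_ge0.
move=> N N0; exists (fun i =>
  `[(a + (b - a) / N%:R * i%:R)%R, (a + (b - a) / N%:R * i.+1%:R)%R]%classic `*` [set y]); split.
- by move=> i; apply: measurableX; [exact: measurable_itv|exact: measurable_set1].
- move=> [p1 p2] [/= -> /(subdivision N0)[i iN hi]]; exists i => //.
- move=> i [p1 p2] [q1 q2] [/= hp ->] [/= hq ->]; rewrite enorm_hor.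
  move: hp hq; rewrite !in_itv/= -natr1 => /andP[? ?] /andP[? ?].
  by rewrite ler_norml; apply/andP; split; lra.
Qed.

End Segments.

(** * Riemann sums along a wall *)

Section Walls.
Context {R : realType}.
Local Notation mu := (@lebesgue_measure R).

(** An empty piece may be charged any nonnegative amount, here r' - r. *)
Lemma cover_sum_le (f : R * R -> R) D r r' : cover_sum f D r -> r <= r' -> cover_sum f D r'.
Proof.
move=> h rr'; have -> : r' = r + 0 * 0 + 1 * (r' - r) by ring.
have -> : D = D `|` set0 `|` (set0 `&` [set p | f p <= 1]) by rewrite set0I !setU0.
apply: cover_sumS => //.
- by apply: cover_sumS => //; rewrite hausdorff1_0.
- by rewrite set0I hausdorff1_0 lee_fin subr_ge0.
- by move=> p [].
Qed.

Lemma lipschitz_increment (g : R -> R) (a b K t t' : R) :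
  mu.-integrable `[a, b] (EFin \o g) ->
  (forall x y, a <= x <= b -> a <= y <= b -> `|g x - g y| <= K * `|x - y|) ->
  a <= t -> t <= t' -> t' <= b ->
  (g t - K * (t' - t)) * (t' - t) <=
  \int[mu]_(x in `[a, t']) g x - \int[mu]_(x in `[a, t]) g x.
Proof.
move=> gi gK at_ tt' t'b.
have K0 : a < b -> 0 <= K.
  move=> ab; have := gK a b; rewrite !lexx !(ltW ab) => /(_ isT isT) h.
  have : 0 <= K * `|a - b| by exact: le_trans (normr_ge0 _) h.
  by rewrite pmulr_lge0// normr_gt0 subr_eq0 lt_eqF.
have sub (i j : itv_bound R) : [set` Interval i j] `<=` `[a, b] ->
    mu.-integrable [set` Interval i j] (EFin \o g).
  move=> s; apply: integrableS gi => //; exact: measurable_itv.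
rewrite (@Rintegral_itvB R g (BLeft a) (BRight t') t) ?bnd_simp//; last first.
  apply: sub => x /=; rewrite !in_itv/= => /andP[-> h] /=; exact: le_trans t'b.
rewrite -(_ : \int[mu]_(x in `]t, t']) (g t - K * (t' - t)) = (g t - K * (t' - t)) * (t' - t)).
  apply: le_Rintegral.
  - exact: measurable_itv.
  - apply: measurable_bounded_integrable => //.
    + exact: lebesgue_itv_lty.
    + exact: (@bounded_fun_in _ _ _ _ `|g t - K * (t' - t)|).
  - apply: sub => x /=; rewrite !in_itv/= => /andP[h1 h2].
    by apply/andP; split; lra.
  - move=> x /=; rewrite in_itv/= => /andP[tx xt'].
    have ab : a < b by lra.
    have := gK t x; rewrite (_ : a <= t <= b); last by apply/andP; split; lra.
    rewrite (_ : a <= x <= b); last by apply/andP; split; lra.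
    move=> /(_ isT isT); rewrite (ltr0_norm (_ : t - x < 0)); last by lra.
    rewrite ler_norml => /andP[_ h].
    have : K * - (t - x) <= K * (t' - t) by rewrite ler_wpM2l ?K0//; lra.
    lra.
rewrite Rintegral_cst; last exact: measurable_itv.
congr (_ * _); transitivity (fine (mu `]t, t'])) => //.
rewrite lebesgue_measure_itv/= lte_fin; move: tt'; rewrite le_eqVlt => /predU1P[->|->].
  by rewrite ltxx subrr.
by rewrite -EFinB.
Qed.

(** Upper Riemann sums of a Lipschitz function: with N equal pieces the excess over the integral is
    at most 2 K (b - a)^2 / N. The curve c enters only through its parameter [pr], whose length
    bounds the Hausdorff measure of each piece. *)
Lemma wall_cover (f : R * R -> R) (c : set (R * R)) (pr : R * R -> R) (S : set (R * R))
    (g : R -> R) (a b K e : R) :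
  (forall s t, s <= t -> (hausdorff1 [set p | c p /\ (s <= pr p <= t)%R] <= (t - s)%:E)%E) ->
  a < b -> mu.-integrable `[a, b] (EFin \o g) ->
  (forall x y, a <= x <= b -> a <= y <= b -> `|g x - g y| <= K * `|x - y|) ->
  (forall x, a <= x <= b -> 0 <= g x) ->
  (forall p, S p -> [/\ c p, a <= pr p <= b & f p <= g (pr p)]) -> 0 < e ->
  cover_sum f S (\int[mu]_(x in `[a, b]) g x + e).
Proof.
move=> Hm ab gi gK g0 fS e0.
have K0 : 0 <= K.
  have := gK a b; rewrite !lexx !(ltW ab) => /(_ isT isT) h.
  have : 0 <= K * `|a - b| by exact: le_trans (normr_ge0 _) h.
  by rewrite pmulr_lge0// normr_gt0 subr_eq0 lt_eqF.
pose C := 2 * K * (b - a) ^+ 2.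
have C0 : 0 <= C by rewrite mulr_ge0 ?sqr_ge0// mulr_ge0.
pose N := (Num.bound (C / e)).+1.
have N0 : 0 < N%:R :> R by rewrite ltr0n.
have CN : C / N%:R <= e.
  rewrite ler_pdivrMr// mulrC -ler_pdivrMr//.
  have := archi_boundP (divr_ge0 C0 (ltW e0)) => /ltW h.
  by apply: (le_trans h); rewrite ler_nat.
pose d := (b - a) / N%:R.
have d0 : 0 < d by rewrite divr_gt0// subr_gt0.
have Nd : d * N%:R = b - a by rewrite /d divfK// gt_eqF.
pose t i := a + d * i%:R.
have tN : t N = b by rewrite /t Nd; ring.
have tS i : t i.+1 = t i + d by rewrite /t -natr1; ring.
have tle i : (i <= N)%N -> t i <= b.
  by move=> iN; rewrite -tN /t lerD2l ler_pM2l// ler_nat.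
have at_ i : a <= t i by rewrite /t lerDl mulr_ge0// ltW.
have key i : (i <= N)%N -> cover_sum f (S `&` [set p | pr p <= t i])
    (\int[mu]_(x in `[a, t i]) g x + 2 * K * d ^+ 2 * i%:R).
  elim: i => [|i ih] iN.
    have S0 : cover_sum f (set0 `|` (S `&` [set p | pr p <= t 0%N])) (0 + (g a + K * d) * 0).
      apply: cover_sumS; first exact: cover_sum0.
      - apply: (le_trans (le_hausdorff1 (_ : _ `<=` [set p | c p /\ a <= pr p <= a]))).
          move=> p [Sp /=]; rewrite /t mulr0 addr0 => h; have [cp /andP[p1 p2] _] := fS p Sp.
          by rewrite p1 h.
        by apply: (le_trans (Hm a a (lexx a))); rewrite subrr.
      - by rewrite addr_ge0 ?g0 ?lexx ?(ltW ab)// mulr_ge0// ltW.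
      - move=> p [Sp /=]; rewrite /t mulr0 addr0 => h; have [cp /andP[p1 p2] fp] := fS p Sp.
        have pa : pr p = a by apply/eqP; rewrite eq_le h p1.
        by apply: (le_trans fp); rewrite pa lerDl mulr_ge0// ltW.
    rewrite set0U in S0; apply: (cover_sum_le S0).
    rewrite mulr0 add0r mulr0 addr0; apply: Rintegral_ge0 => x /=.
    by rewrite in_itv/= /t mulr0 addr0 => /andP[x1 x2]; apply: g0; rewrite x1 (le_trans x2)// ltW.
  have ti : a <= t i <= b by rewrite at_ tle// ltnW.
  have step : cover_sum f ((S `&` [set p | pr p <= t i]) `|` (S `&` [set p | t i <= pr p <= t i.+1]))
      (\int[mu]_(x in `[a, t i]) g x + 2 * K * d ^+ 2 * i%:R + (g (t i) + K * d) * d).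
    apply: cover_sumS; first exact/ih/ltnW.
    - apply: (le_trans (le_hausdorff1 (_ : _ `<=` [set p | c p /\ t i <= pr p <= t i.+1]))).
        by move=> p [Sp /= h]; have [cp _ _] := fS p Sp.
      by apply: (le_trans (Hm _ _ _)); rewrite tS ?lerDl ?(ltW d0)// addrAC subrr add0r.
    - by rewrite addr_ge0 ?g0// mulr_ge0// ltW.
    - move=> p [Sp /= /andP[h1 h2]]; have [cp pab fp] := fS p Sp.
      have : K * `|pr p - t i| <= K * d.
        by rewrite ler_wpM2l// ger0_norm ?subr_ge0//; move: h2; rewrite tS; lra.
      have /ler_normlP[_ h'] := gK _ _ pab ti.
      by move=> hK; apply: (le_trans fp); lra.
  have := cover_sum_le step; rewrite (_ : _ `|` _ = S `&` [set p | pr p <= t i.+1]).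
    apply; have tii : t i <= t i.+1 by rewrite tS lerDl ltW.
    have := lipschitz_increment gi gK (at_ i) tii (tle _ iN).
    rewrite tS (_ : t i + d - t i = d); last by ring.
    rewrite -(natr1 i); set a1 := \int[mu]_(x in _) _; set a2 := \int[mu]_(x in _) _.
    set ni := i%:R; set gt := g (t i); clear; move=> h.
    by rewrite (mulrDr _ ni) mulr1; move: h; rewrite expr2; lra.
  rewrite -setIUr; congr (_ `&` _); apply/seteqP; split=> p /=.
    by move=> [h|/andP[]//]; apply: (le_trans h); rewrite tS lerDl ltW.
  by move=> h; have [|/ltW h2] := leP (pr p) (t i); [left|right; rewrite h2].
have := key N (leqnn N); rewrite tN => kN.
have SE : S `&` [set p | pr p <= b] = S.
  by apply/seteqP; split => [p []//|p Sp]; split => //=; have [_ /andP[]] := fS p Sp.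
rewrite SE in kN; apply: (cover_sum_le kN); rewrite lerD2l; apply: le_trans CN.
by rewrite /C /d le_eqVlt; apply/orP; left; apply/eqP; field; rewrite gt_eqF.
Qed.

End Walls.

(** * Fields built from a profile *)

(* A profile w on [0, tau] x [0, 1] (first variable across a cell, second
   variable 1 at the centre line and 0 at the boundary), with its partial
   derivatives wx and wm. *)
Record profile {R : realType} (tau K v0 : R) (w wx wm : R -> R -> R) : Prop := Profile {
  profile_measurable : [/\ measurable_fun setT (fun p : R * R => w p.1 p.2),
     measurable_fun setT (fun p : R * R => wx p.1 p.2) &
     measurable_fun setT (fun p : R * R => wm p.1 p.2)];
  profile_lipschitz : forall a a' b b', 0 <= a <= tau -> 0 <= a' <= tau ->
     0 <= b <= 1 -> 0 <= b' <= 1 -> `|w a b - w a' b'| <= K * (`|a - a'| + `|b - b'|);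
  profile_lt1 : forall a b, 0 <= a <= tau -> 0 <= b <= 1 -> w a b ^+ 2 + v0 <= 1;
  profile_0 : forall a, 0 <= a <= tau -> w a 0 = 0;
  profile_wx : forall b, 0 < b < 1 -> exists s : seq R, forall a, 0 < a < tau -> a \notin s ->
     is_derive a (1 : R) (w ^~ b) (wx a b);
  profile_wm : forall a, 0 < a < tau -> exists s : seq R, forall b, 0 < b < 1 -> b \notin s ->
     is_derive b (1 : R) (w a) (wm a b);
  profile_bound : forall a b, 0 <= a <= tau -> 0 <= b <= 1 -> `|wx a b| <= K /\ `|wm a b| <= K
}.

Section Height.
Context {R : realType}.
Local Notation mu := (@lebesgue_measure R).
Variable H : R.
Hypothesis H0 : 0 < H.

(** Truncated at 0, so that the field is defined on the whole plane: beyond the strip it is the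
    constant (1, 0) above and (-1, 0) below. *)
Definition depth (y : R) : R := Num.max 0 (1 - `|y| / H).
Definition side (y : R) : R := if 0 <= y then 1 else -1.

Lemma side_sign y : side y = 1 \/ side y = -1.
Proof. by rewrite /side; case: ifP => _; [left|right]. Qed.

Lemma depth_itv y : 0 <= depth y <= 1.
Proof.
rewrite /depth le_max lexx/= ge_max ler01/= gerBl divr_ge0//; exact: ltW.
Qed.

Lemma depth_out y : H <= `|y| -> depth y = 0.
Proof. by move=> h; rewrite /depth max_l// subr_le0 ler_pdivlMr// mul1r. Qed.

Lemma depth_in y : `|y| <= H -> depth y = 1 - `|y| / H.
Proof. by move=> h; rewrite /depth max_r// subr_ge0 ler_pdivrMr// mul1r. Qed.

Lemma depth_lipschitz y y' : `|depth y - depth y'| <= H^-1 * `|y - y'|.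
Proof.
have half a b : depth a - depth b <= H^-1 * `|a - b|.
  rewrite lerBlDr {1}/depth ge_max; apply/andP; split.
    by rewrite addr_ge0 ?mulr_ge0 ?invr_ge0 ?(ltW H0)//; case/andP: (depth_itv b).
  have : 1 - `|b| / H <= depth b by rewrite /depth le_max lexx orbT.
  have : `|b| / H <= `|a| / H + H^-1 * `|a - b|.
    rewrite [H^-1 * _]mulrC -mulrDl ler_pM2r ?invr_gt0//.
    by have := ler_normD a (b - a); rewrite addrC subrK distrC.
  by lra.
by rewrite ler_norml; apply/andP; split; rewrite ?half// lerNl opprB distrC half.
Qed.

Lemma measurable_depth : measurable_fun setT depth.
Proof.
apply: measurable_maxr => //; apply: measurable_funB => //.
by apply: measurable_funM => //; exact: normr_measurable.
Qed.

Lemma measurable_side : measurable_fun setT side.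
Proof. by apply: measurable_fun_ifT => //; exact: measurable_fun_ler. Qed.

Lemma ae_neq (c : R) : {ae mu, forall x, x != c}.
Proof.
exists [set c]; split; [exact: measurable_set1|exact: lebesgue_measure_set1|].
by move=> x /= /negP; rewrite negbK => /eqP.
Qed.

Lemma ae_notin (f : R -> R) (s : seq R) : (forall b, {ae mu, forall x, f x != b}) ->
  {ae mu, forall x, f x \notin s}.
Proof.
move=> h; elim: s => [|b s ih]; first by apply: aeW.
by apply: ae_mono (ae_and (h b) ih) => x [h1 h2]; rewrite in_cons negb_or h1.
Qed.

Lemma ae_depth (b : R) : 0 < b -> {ae mu, forall y, depth y != b}.
Proof.
move=> b0; apply: ae_mono (ae_and (ae_neq ((1 - b) * H)) (ae_neq (- ((1 - b) * H)))) => y [h1 h2].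
apply/eqP => yb; have yH : `|y| < H.
  by rewrite ltNge; apply/negP => /depth_out h; move: b0; rewrite -yb h ltxx.
have ab : `|y| = (1 - b) * H by rewrite -yb depth_in ?(ltW yH)//; field; rewrite gt_eqF.
have [y0|y0] := leP 0 y.
  by move: h1; rewrite -ab ger0_norm// eqxx.
by move: h2; rewrite -ab ltr0_norm// opprK eqxx.
Qed.

Lemma depth_near (y : R) : y != 0 -> `|y| < H ->
  (\forall z \near y, 1 - side y / H * z = depth z) /\ (\forall z \near y, side z = side y).
Proof.
move=> y0 yH.
have sz (z : R) : `|z - y| < `|y| -> side z = side y /\ `|z| = side y * z.
  rewrite /side; have [y1|y1] := leP 0 y.
    rewrite (ger0_norm y1) ltr_norml => /andP[h1 h2].
    have z0 : 0 < z by lra.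
    by rewrite (ltW z0) gtr0_norm// mul1r.
  rewrite (ltr0_norm y1) ltr_norml => /andP[h1 h2].
  have z0 : z < 0 by lra.
  by rewrite leNgt z0/= ltr0_norm// mulN1r.
have near1 (r : R) : 0 < r -> \forall z \near y, `|z - y| < r.
  by move=> r0; near=> z; rewrite distrC; near: z; exact: nbhsx_ballx.
split; last by apply: filterS (near1 `|y| _) => [z /sz[]//|]; rewrite normr_gt0.
apply: filterS2 (near1 `|y| _) (near1 (H - `|y|) _) => [z /sz[_ z1] z2| |].
- rewrite depth_in; first by rewrite z1; ring.
  have := ler_normD (z - y) y; rewrite subrK => h.
  by apply: (le_trans h); rewrite -lerBrDr ltW.
- by rewrite normr_gt0.
- by rewrite subr_gt0.
Unshelve. all: by end_near.
Qed.

Lemma side_depth (be y : R) : be = 1 \/ be = -1 -> y != 0 \/ True -> exists2 d : R, 0 < d &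
  exists s : R, [/\ s = 1 \/ s = -1, y != 0 -> s = side y &
    forall z, 0 < be * (z - y) < d -> side z = s].
Proof.
move=> hbe _; have [->|y0] := eqVneq y 0.
  exists 1 => //; exists be; split => //.
  by move=> z; rewrite subr0 /side; case: hbe => ->; rewrite ?mul1r ?mulN1r => /andP[h _];
    [rewrite ltW|rewrite leNgt -oppr_gt0 h].
exists `|y|; first by rewrite normr_gt0.
exists (side y); split => //; first exact: side_sign.
move=> z h; have : `|z - y| < `|y|.
  by case: hbe h => ->; rewrite ?mul1r ?mulN1r => /andP[h1 h2]; [rewrite gtr0_norm|rewrite ltr0_norm -?oppr_gt0].
rewrite /side; have [y1|y1] := leP 0 y.
  by rewrite (ger0_norm y1) ltr_norml => /andP[h1 h2]; rewrite ifT//; lra.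
by rewrite (ltr0_norm y1) ltr_norml => /andP[h1 h2]; rewrite ifF//; apply/negbTE; rewrite -ltNge; lra.
Qed.

End Height.

Section WaveDerivative.
Context {R : realType}.
Local Notation mu := (@lebesgue_measure R).
Variables T P H : R.
Hypothesis P0 : 0 < P.
Hypothesis H0 : 0 < H.

(** By [wave_attained], a level set of the wave is contained in a countable set. *)
Lemma ae_wave (b : R) : {ae mu, forall x, wave T P H x != b}.
Proof.
have h (n : int) : {ae mu, forall x, x != - T + P * n%:~R + b * H /\ x != - T + P * n%:~R - b * H}.
  by apply: ae_and; exact: ae_neq.
apply: ae_mono (ae_countable h) => x hx; apply/eqP => xb.
have [n] := wave_attained T H P0 x; rewrite xb => /(congr1 (fun z => z * H)).
rewrite divfK ?gt_eqF// => e; have [/eqP h1 /eqP h2] := hx n.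
have [z0|z0] := leP 0 (x + T - P * n%:~R).
  by apply: h1; rewrite e ger0_norm//; ring.
by apply: h2; rewrite e ltr0_norm//; ring.
Qed.

Lemma wall_wave x : wall T P x -> wave T P H x = 0 \/ wave T P H x = P / 2 / H.
Proof.
have P1 := P0; move=> [n [->|->]]; [left|right].
  by rewrite (@wave_up _ T P H P0 n); [rewrite (_ : _ - _ = 0) ?mul0r//; ring|apply/andP; split; lra].
by rewrite (@wave_up _ T P H P0 n); [congr (_ / _); ring|apply/andP; split; lra].
Qed.

Lemma wave_near x : ~ wall T P x -> (\forall z \near x, slope T P z = slope T P x) /\
  (\forall z \near x, slope T P x / H * z + (wave T P H x - slope T P x / H * x) = wave T P H z).
Proof.
move=> nw; have [d1 d10 h1] := slope_right T P0 H0 x.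
have [d2 d20 [s [_ /(_ nw) -> h2]]] := slope_left T P0 H0 x.
have n1 : \forall z \near x, `|z - x| < Num.min d1 d2.
  near=> z; rewrite distrC; near: z; apply: nbhsx_ballx.
  by rewrite lt_min d10.
suff h z : `|z - x| < Num.min d1 d2 -> slope T P z = slope T P x /\
    slope T P x / H * z + (wave T P H x - slope T P x / H * x) = wave T P H z.
  by split; apply: filterS n1 => z /h[].
rewrite lt_min => /andP[]; rewrite !ltr_norml => /andP[a1 a2] /andP[a3 a4].
have [xz|zx] := leP x z.
  have zi : x <= z < x + d1 by apply/andP; split; lra.
  by have [-> ->] := h1 z zi; split=> //; ring.
have zi : x - d2 < z < x by apply/andP; split; lra.
by have [-> ->] := h2 z zi; split=> //; ring.
Unshelve. all: by end_near.
Qed.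

End WaveDerivative.

Section ProfileRegularity.
Context {R : realType}.
Variables (tau K v0 : R) (w wx wm : R -> R -> R).
Hypothesis v00 : 0 < v0.
Hypothesis hp : profile tau K v0 w wx wm.

(** The modulus of u_1 when |u_2| is the modulus of w. The constant v0 of [profile] keeps it away
    from 0, so that the root causes no loss of regularity. *)
Definition covar (a b : R) : R := Num.sqrt (1 - w a b ^+ 2).
Definition covar_x (a b : R) : R := - (w a b * wx a b / covar a b).

Lemma covar_ge0 a b : 0 <= covar a b. Proof. exact: sqrtr_ge0. Qed.

Lemma covar_sqr a b : 0 <= a <= tau -> 0 <= b <= 1 -> covar a b ^+ 2 = 1 - w a b ^+ 2.
Proof.
move=> ha hb; rewrite sqr_sqrtr// subr_ge0; have := profile_lt1 hp ha hb; move: v00; lra.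
Qed.

Lemma covar_gt a b : 0 <= a <= tau -> 0 <= b <= 1 -> Num.sqrt v0 <= covar a b.
Proof. by move=> ha hb; apply: ler_wsqrtr; have := profile_lt1 hp ha hb; lra. Qed.

Lemma profile_le1 a b : 0 <= a <= tau -> 0 <= b <= 1 -> `|w a b| <= 1.
Proof.
move=> ha hb; rewrite -ler_sqr ?nnegrE// real_normK ?num_real// expr1n.
by have := profile_lt1 hp ha hb; move: v00; lra.
Qed.

Lemma covar_le1 a b : covar a b <= 1.
Proof. by rewrite -[leRHS]sqrtr1 ler_wsqrtr// gerBl sqr_ge0. Qed.

Let r0 := Num.sqrt v0.
Let r00 : 0 < r0. Proof. by rewrite sqrtr_gt0. Qed.

(** The difference of the squares of the two roots equals, up to sign, that of the squares of w.
    Their sum is at least 2 sqrt v0, and |w| <= 1 bounds the other factor by 2. *)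
Lemma covar_lipschitz a a' b b' : 0 <= a <= tau -> 0 <= a' <= tau ->
  0 <= b <= 1 -> 0 <= b' <= 1 ->
  `|covar a b - covar a' b'| <= K / Num.sqrt v0 * (`|a - a'| + `|b - b'|).
Proof.
move=> ha ha' hb hb'; rewrite -/r0.
have c1 := covar_gt ha hb; have c2 := covar_gt ha' hb'; rewrite -/r0 in c1 c2.
have s1 := covar_sqr ha hb; have s2 := covar_sqr ha' hb'.
have w1 := profile_le1 ha hb; have w2 := profile_le1 ha' hb'.
have wK := profile_lipschitz hp ha ha' hb hb'.
set X := `|a - a'| + _ in wK *.
have e : (covar a b - covar a' b') * (covar a b + covar a' b') =
    - ((w a b - w a' b') * (w a b + w a' b')).
  by rewrite -!subr_sqr s1 s2; ring.
have /(congr1 Num.norm) := e; rewrite normrN !normrM (ger0_norm (_ : 0 <= covar a b + covar a' b')) ?addr_ge0 ?covar_ge0//.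
have w12 : `|w a b + w a' b'| <= 2 by apply: (le_trans (ler_normD _ _)); rewrite (_ : 2 = 1 + 1)// lerD.
move=> e'; rewrite mulrAC ler_pdivlMr//.
have h1 : `|covar a b - covar a' b'| * (2 * r0) <= `|covar a b - covar a' b'| * (covar a b + covar a' b').
  by apply: ler_wpM2l => //; lra.
have h2 : `|w a b - w a' b'| * `|w a b + w a' b'| <= K * X * 2.
  by apply: ler_pM.
by move: h1 h2; rewrite e'; clear; move=> *; lra.
Qed.

Lemma K_ge0 : 0 < tau -> 0 <= K.
Proof.
move=> t0; have h0 : 0 <= (0 : R) <= tau by rewrite lexx ltW.
have h1 : 0 <= (0 : R) <= 1 by rewrite lexx ler01.
by have [h _] := profile_bound hp h0 h1; exact: le_trans (normr_ge0 _) h.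
Qed.

Lemma covar_x_bound a b : 0 <= a <= tau -> 0 <= b <= 1 -> `|covar_x a b| <= K / Num.sqrt v0.
Proof.
move=> ha hb; rewrite normrN !normrM; have [h1 _] := profile_bound hp ha hb.
have w1 := profile_le1 ha hb; have c1 := covar_gt ha hb.
apply: ler_pM => //.
- by rewrite -[leRHS]mul1r; apply: ler_pM.
- rewrite normfV ger0_norm ?covar_ge0// lef_pV2// posrE//.
  exact: lt_le_trans c1.
Qed.

Lemma covar_0 a : 0 <= a <= tau -> covar a 0 = 1.
Proof. by move=> ha; rewrite /covar (profile_0 hp ha) expr0n subr0 sqrtr1. Qed.

Lemma is_derive_covar a b : 0 <= a <= tau -> 0 <= b <= 1 ->
  is_derive a (1 : R) (w ^~ b) (wx a b) -> is_derive a (1 : R) (covar ^~ b) (covar_x a b).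
Proof.
move=> ha hb dw.
have c0 : 0 < covar a b by apply: lt_le_trans (covar_gt ha hb); rewrite sqrtr_gt0.
have p0 : 0 < 1 - w a b ^+ 2 by rewrite -(covar_sqr ha hb) exprn_gt0.
have ds := is_derive1_sqrt p0.
have di : is_derive a (1 : R) (fun z => 1 - w z b ^+ 2) (- (2 * w a b * wx a b)).
  have := is_deriveB (is_derive_cst (1 : R) a (1 : R)) (is_deriveX 2 dw).
  by rewrite sub0r /= expr1 => h; apply: is_derive_eq h _; rewrite /GRing.scale/=; ring.
have := @is_derive1_comp _ Num.sqrt (fun z => 1 - w z b ^+ 2) a _ _ ds di.
move=> h; apply: is_derive_eq h _; rewrite /covar_x /covar.
by field; rewrite gt_eqF//; move: c0; rewrite /covar.
Qed.

Lemma measurable_covar : measurable_fun setT (fun p : R * R => covar p.1 p.2).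
Proof.
have [mw _ _] := profile_measurable hp.
apply: (measurableT_comp (f := @Num.sqrt R)).
  by apply: continuous_measurable_fun => x; exact: sqrt_continuous.
by apply: measurable_funB => //; exact: measurable_funX.
Qed.

Lemma measurable_inv : measurable_fun setT (@GRing.inv R).
Proof.
rewrite (_ : setT = [set x : R | x != 0] `|` [set 0]); last first.
  by apply/seteqP; split=> x //= _; have [->|x0] := eqVneq x 0; [right|left].
have o0 : open [set x : R | x != 0] by exact: open_neq.
apply/measurable_funU; [exact: open_measurable|exact: measurable_set1|split]; last exact: measurable_fun_set1.
apply: open_continuous_measurable_fun => //.
by move=> x /set_mem /= x0; exact: inv_continuous.
Qed.

Lemma measurable_covar_x : measurable_fun setT (fun p : R * R => covar_x p.1 p.2).
Proof.
have [mw mwx _] := profile_measurable hp.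
apply: measurable_funN; apply: measurable_funM; first exact: measurable_funM.
exact: (measurableT_comp measurable_inv measurable_covar).
Qed.

End ProfileRegularity.

(** * The cross-tie field of a profile: regularity and admissibility *)

Section Field.
Context {R : realType}.
Local Notation mu := (@lebesgue_measure R).
Local Notation mT := (setT : set (measurableTypeR R * measurableTypeR R)).
Variables (tau K v0 H : R) (k : nat) (w wx wm : R -> R -> R).
Hypothesis tau0 : 0 < tau.
Hypothesis v00 : 0 < v0.
Hypothesis H0 : 0 < H.
Hypothesis k0 : (0 < k)%N.
Hypothesis hp : profile tau K v0 w wx wm.

(** Half a period holds k cells of width tau * H; the wave itself has period 2 tau H, so a full
    period of the cylinder is k periods of the wave. *)
Definition halfperiod : R := k%:R * (tau * H).
Local Notation T := halfperiod.
Local Notation P := (2 * (tau * H)).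
Local Notation xi := (wave T P H).
Local Notation sl := (slope T P).
Local Notation dep := (depth H).

(** [side] and [slope] are also the signs in the derivatives of [depth] (up to a minus) and of the
    wave. In the divergence both terms therefore acquire the same factor side * slope / H, and up to
    this sign every cell has the same divergence. *)
Definition field (p : R * R) : R * R :=
  (side p.2 * covar w (xi p.1) (dep p.2), - (sl p.1 * w (xi p.1) (dep p.2))).

Definition div1 (p : R * R) : R :=
  if `|p.2| < H then side p.2 * (sl p.1 / H) * covar_x w wx (xi p.1) (dep p.2) else 0.

Definition div2 (p : R * R) : R :=
  if `|p.2| < H then sl p.1 * (side p.2 / H) * wm (xi p.1) (dep p.2) else 0.

Let tH : 0 < tau * H. Proof. exact: mulr_gt0. Qed.
Let P0 : 0 < P. Proof. by rewrite mulr_gt0. Qed.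
Let k1 : 1 <= k%:R :> R. Proof. by rewrite ler1n. Qed.
Let T0 : 0 < T. Proof. by rewrite mulr_gt0// (lt_le_trans _ k1). Qed.

Lemma xi_itv x : 0 <= xi x <= tau.
Proof.
have := wave_itv T P0 H0 x; rewrite (_ : P / 2 / H = tau)//.
by field; rewrite gt_eqF.
Qed.

Let K0 : 0 <= K. Proof. exact: K_ge0 hp tau0. Qed.
Let r0 := Num.sqrt v0.
Let r00 : 0 < r0. Proof. by rewrite sqrtr_gt0. Qed.
Let dI := depth_itv H0.

Definition fieldK : R := (K + K / Num.sqrt v0) / H.
Let K1 : K / H <= fieldK.
Proof. by rewrite ler_pM2r ?invr_gt0// lerDl divr_ge0// ltW. Qed.
Let K2 : K / r0 / H <= fieldK.
Proof. by rewrite ler_pM2r ?invr_gt0// lerDr. Qed.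
Lemma fieldK_ge0 : 0 <= fieldK.
Proof. by rewrite divr_ge0 ?addr_ge0 ?divr_ge0// ltW. Qed.

Lemma field_w_lipschitz p q : `|w (xi p.1) (dep p.2) - w (xi q.1) (dep q.2)| <=
  fieldK * (`|p.1 - q.1| + `|p.2 - q.2|).
Proof.
have h := profile_lipschitz hp (xi_itv p.1) (xi_itv q.1) (dI p.2) (dI q.2).
apply: (le_trans h); apply: (@le_trans _ _ (K * (H^-1 * `|p.1 - q.1| + H^-1 * `|p.2 - q.2|))).
  apply: ler_wpM2l => //; apply: lerD; first exact: wave_lipschitz.
  exact: depth_lipschitz.
by rewrite -mulrDr mulrA ler_wpM2r// addr_ge0.
Qed.

Lemma field_v_lipschitz p q : `|covar w (xi p.1) (dep p.2) - covar w (xi q.1) (dep q.2)| <=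
  fieldK * (`|p.1 - q.1| + `|p.2 - q.2|).
Proof.
have h := covar_lipschitz v00 hp (xi_itv p.1) (xi_itv q.1) (dI p.2) (dI q.2).
apply: (le_trans h); apply: (@le_trans _ _ (K / Num.sqrt v0 * (H^-1 * `|p.1 - q.1| + H^-1 * `|p.2 - q.2|))).
  apply: ler_wpM2l; first by rewrite divr_ge0// ltW.
  by apply: lerD; [exact: wave_lipschitz|exact: depth_lipschitz].
by rewrite -mulrDr mulrA ler_wpM2r// addr_ge0.
Qed.

Let absl x : `|sl x| = 1. Proof. by case: (slope_sign T P x) => ->; rewrite ?normrN normr1. Qed.
Let absd y : `|side y : R| = 1. Proof. by case: (side_sign y) => ->; rewrite ?normrN normr1. Qed.

Lemma field_bounded p : `|(field p).1| <= 1 /\ `|(field p).2| <= 1.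
Proof.
rewrite /field/= normrN !normrM absl absd !mul1r ger0_norm ?covar_ge0//.
by split; [exact: covar_le1|exact: (profile_le1 v00 hp (xi_itv _) (dI _))].
Qed.

Lemma enorm_field p : enorm (field p) = 1.
Proof.
rewrite /enorm/field/= sqrrN !exprMn.
have sq (x : R) : x = 1 \/ x = -1 -> x ^+ 2 = 1 by case=> ->; rewrite ?sqrrN expr1n.
rewrite (sq _ (side_sign _)) (sq _ (slope_sign _ _ _)) !mul1r (covar_sqr v00 hp (xi_itv _) (dI _)).
by rewrite subrK sqrtr1.
Qed.

Lemma measurable_field_comp (g : R * R -> R) : measurable_fun setT g ->
  measurable_fun mT (fun p : R * R => g (xi p.1, dep p.2)).
Proof.
move=> mg; apply: (measurableT_comp mg); apply: measurable_fun_pair.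
  by apply: (measurableT_comp (measurable_wave T H P0)); exact: measurable_fst.
by apply: (measurableT_comp (measurable_depth H)); exact: measurable_snd.
Qed.

Let msl : measurable_fun mT (fun p : R * R => sl p.1).
Proof. exact: (measurableT_comp (measurable_slope T P0) measurable_fst). Qed.
Let mside : measurable_fun mT (fun p : R * R => side p.2 : R).
Proof. exact: (measurableT_comp measurable_side measurable_snd). Qed.

Lemma measurable_field : measurable_fun mT (fun p => (field p).1) /\ measurable_fun mT (fun p => (field p).2).
Proof.
have [mw _ _] := profile_measurable hp.
split; first by apply: measurable_funM => //; exact: (measurable_field_comp (measurable_covar hp)).
by apply: measurable_funN; apply: measurable_funM => //; exact: (measurable_field_comp mw).
Qed.

Lemma measurable_div : measurable_fun mT div1 /\ measurable_fun mT div2.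
Proof.
have [_ _ mwm] := profile_measurable hp.
have mif : measurable_fun mT (fun p : R * R => `|p.2| < H).
  by apply: measurable_fun_ltr => //; apply: (measurableT_comp _ measurable_snd); exact: normr_measurable.
split; apply: measurable_fun_ifT => //; apply: measurable_funM.
- by apply: measurable_funM => //; apply: measurable_funM.
- exact: (measurable_field_comp (measurable_covar_x hp)).
- by apply: measurable_funM => //; apply: measurable_funM.
- exact: (measurable_field_comp mwm).
Qed.

Lemma div_bounded p : `|div1 p| <= fieldK /\ `|div2 p| <= fieldK.
Proof.
have iH : `|H^-1| = H^-1 by rewrite gtr0_norm// invr_gt0.
rewrite /div1 /div2; case: ifP => _; last by rewrite normr0 fieldK_ge0.
rewrite !normrM absl absd iH !mul1r; split.
  by rewrite mulrC; apply: le_trans K2; rewrite ler_pM2r ?invr_gt0//; exact: (covar_x_bound v00 hp (xi_itv _) (dI _)).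
rewrite mulrC; apply: le_trans K1; rewrite ler_pM2r ?invr_gt0//.
by have [] := profile_bound hp (xi_itv p.1) (dI p.2).
Qed.

Lemma lip1 : {ae mu, forall y, (forall x x', `|(field (x, y)).1 - (field (x', y)).1| <= fieldK * `|x - x'|) /\
  {ae mu, forall x, is_derive x (1 : R) (fun z => (field (z, y)).1) (div1 (x, y))}}.
Proof.
apply: ae_mono (ae_and (ae_neq 0) (ae_and (ae_neq H) (ae_neq (- H)))) => y [y0 [yH yH']].
split=> [x x'|].
  rewrite /field/= -mulrBr normrM absd mul1r.
  by have := field_v_lipschitz (x, y) (x', y); rewrite /= subrr normr0 addr0.
have [hyH|hyH] := leP H `|y|.
  apply: aeW => x; rewrite /div1/= ltNge hyH/=.
  have -> : (fun z => (field (z, y)).1) = cst (side y).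
    by apply/funext => z; rewrite /field/= (depth_out H0 hyH) (covar_0 hp (xi_itv z)) mulr1.
  exact: is_derive_cst.
have di : 0 < dep y < 1.
  rewrite depth_in ?(ltW hyH)// subr_gt0 ltr_pdivrMr// mul1r hyH/= gtrBl divr_gt0//.
  by rewrite normr_gt0.
have [s hs] := profile_wx hp di.
have := ae_notin (0 :: tau :: s) (ae_wave T P0 H0).
apply: ae_mono => x; rewrite !in_cons !negb_or => /and3P[x0 xt xs].
have nw : ~ wall T P x.
  move=> /(wall_wave H P0)[e|e]; first by rewrite e eqxx in x0.
  move: xt; rewrite e (_ : P / 2 / H = tau) ?eqxx//.
  by field; rewrite gt_eqF.
have xi1 : 0 < xi x < tau.
  by rewrite !lt_def x0 [tau == _]eq_sym xt/=; exact: xi_itv.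
have [_ nx] := wave_near P0 H0 nw.
have dw := is_derive_affine (sl x / H) (xi x - sl x / H * x) x.
have {}dw := near_eq_is_derive nx dw.
have dc := is_derive_covar v00 hp (xi_itv x) (dI y) (hs _ xi1 xs).
have := @is_derive1_comp _ (covar w ^~ (dep y)) xi x _ _ dc dw.
move=> /(is_deriveZ (side y)) h; rewrite /div1/= hyH.
apply: is_derive_eq h _; rewrite /GRing.scale/=; ring.
Qed.

Lemma lip2 : {ae mu, forall x, (forall y y', `|(field (x, y)).2 - (field (x, y')).2| <= fieldK * `|y - y'|) /\
  {ae mu, forall y, is_derive y (1 : R) (fun z => (field (x, z)).2) (div2 (x, y))}}.
Proof.
apply: ae_mono (ae_and (ae_wave T P0 H0 0) (ae_wave T P0 H0 tau)) => x [x0 xt].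
split=> [y y'|].
  rewrite /field/= -opprD normrN -mulrBr normrM absl mul1r.
  by have := field_w_lipschitz (x, y) (x, y'); rewrite /= subrr normr0 add0r.
have xi1 : 0 < xi x < tau.
  by rewrite !lt_def x0 [tau == _]eq_sym xt/=; exact: xi_itv.
have [s hs] := profile_wm hp xi1.
(* Only positive exceptional depths can be avoided almost everywhere: the depth 0 is taken on the
   whole exterior of the strip, which is treated separately below. *)
have hn : {ae mu, forall y, y != 0 /\ (y != H /\ (y != - H /\ (forall b, b \in s -> 0 < b -> dep y != b)))}.
  apply: ae_and; first exact: ae_neq.
  apply: ae_and; first exact: ae_neq.
  apply: ae_and; first exact: ae_neq.
  elim: s {hs} => [|b s ih]; first exact: aeW.
  have hb : {ae mu, forall y, 0 < b -> dep y != b}.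
    have [b0|b0] := ltP 0 b; last by apply: aeW.
    by apply: ae_mono (ae_depth H0 b0).
  by apply: ae_mono (ae_and hb ih) => y [h1 h2] c; rewrite in_cons => /predU1P[->|/h2].
apply: ae_mono hn => y [y0 [yH [yH' ys]]].
have [hyH|hyH] := leP H `|y|.
  have hy : H < `|y|.
    rewrite lt_def hyH andbT; apply/eqP; have [yy|yy] := leP 0 y.
      by rewrite ger0_norm//; move/eqP: yH.
    by rewrite ltr0_norm// => e; move/eqP : yH'; apply; rewrite -e opprK.
  rewrite /div2/= ltNge hyH/=.
  have ny : \forall z \near y, cst 0 z = (field (x, z)).2.
    have : \forall z \near y, `|y - z| < `|y| - H.
      by apply: nbhsx_ballx; rewrite subr_gt0.
    apply: filterS => z hz; rewrite /field/= depth_out//.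
      by rewrite (profile_0 hp (xi_itv x)) mulr0 oppr0.
    by have := ler_normD (y - z) z; rewrite subrK; lra.
  exact: near_eq_is_derive ny (is_derive_cst 0 y (1 : R)).
have di : 0 < dep y < 1.
  rewrite depth_in ?(ltW hyH)// subr_gt0 ltr_pdivrMr// mul1r hyH/= gtrBl divr_gt0//.
  by rewrite normr_gt0.
have dns : dep y \notin s.
  by apply/negP => /ys; case/andP: di => -> _ /(_ isT); rewrite eqxx.
have [ny _] := depth_near H0 y0 hyH.
have dw := is_derive_affine (- (side y / H)) 1 y.
have ny' : \forall z \near y, - (side y / H) * z + 1 = dep z.
  by apply: filterS ny => z <-; rewrite mulNr addrC.
have {}dw := near_eq_is_derive ny' dw.
have := @is_derive1_comp _ (w (xi x)) dep y _ _ (hs _ di dns) dw.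
move=> /(is_deriveZ (- sl x)) h; rewrite /div2/= hyH.
have -> : (fun z => (field (x, z)).2) = - sl x \*: (w (xi x) \o dep).
  by apply/funext => z; rewrite /field/= /GRing.scale/= mulNr.
apply: is_derive_eq h _; rewrite /GRing.scale/=; ring.
Qed.

Definition fdiv (p : R * R) : R := div1 p + div2 p.

Lemma field_weak_divergence : weak_divergence H field fdiv.
Proof.
have [m1 m2] := measurable_field; have [n1 n2] := measurable_div.
have -> : field = (fun p => ((field p).1, (field p).2)) by apply/funext.
apply: (@lipschitz_weak_divergence R H (fun p => (field p).1) (fun p => (field p).2) div1 div2 fieldK) => //.
- by move=> p; case: (field_bounded p).
- by move=> p; case: (field_bounded p).
- by move=> p; case: (div_bounded p).
- by move=> p; case: (div_bounded p).
- exact: lip1.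
- exact: lip2.
Qed.

Lemma two_T : 2 * T = k%:R * P. Proof. by rewrite /halfperiod; ring. Qed.

Lemma L2_per_bounded (d : R * R -> R) (M : R) : measurable_fun mT d -> (forall p, `|d p| <= M) ->
  xperiodic T d -> L2_per T H d.
Proof.
move=> md dM pd; split => //; first exact: measurable_funTS.
apply: measurable_bounded_integrable.
- exact: measurable_rectangle.
- exact: area_rectangle_lty.
- by apply: measurable_funTS; exact: measurable_funX.
- apply: (@bounded_fun_in _ _ _ _ (M ^+ 2)) => p _ /=.
  by rewrite normrX ler_sqr ?nnegrE// (le_trans (normr_ge0 _) (dM p)).
Qed.

Lemma field_periodic : xperiodic T field.
Proof. by move=> p; rewrite /field/= two_T wave_periodic// slope_periodic. Qed.

Lemma fdiv_L2 : L2_per T H fdiv.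
Proof.
have [n1 n2] := measurable_div.
apply: (@L2_per_bounded _ (fieldK + fieldK)); first exact: measurable_funD.
- by move=> p; apply: (le_trans (ler_normD _ _)); have [b1 b2] := div_bounded p; exact: lerD.
- by move=> p; rewrite /fdiv/div1/div2/= two_T wave_periodic// slope_periodic.
Qed.

Lemma field_Hdiv : Hdiv_S1 T H field.
Proof.
have [m1 m2] := measurable_field; split.
- apply: (@L2_per_bounded _ 1) => // [p|p]; first by case: (field_bounded p).
  exact: (congr1 fst (field_periodic p)).
- apply: (@L2_per_bounded _ 1) => // [p|p]; first by case: (field_bounded p).
  exact: (congr1 snd (field_periodic p)).
- by exists fdiv; split; [exact: fdiv_L2|exact: field_weak_divergence].
- by apply: aeW => p _; exact: enorm_field.
Qed.

Lemma side_interval y y' : y < y' -> (forall c : R, c \in [:: 0] -> ~~ (y <= c <= y')) -> side y = side y' :> R.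
Proof.
move=> yy /(_ 0 (mem_head _ _)); rewrite negb_and -!ltNge => /orP[h|h]; rewrite /side.
  by rewrite (ltW h) (ltW (lt_trans h yy)).
by rewrite leNgt (lt_trans yy h)/= leNgt h.
Qed.

Lemma field_BV : BV_S1 T H field.
Proof.
have [m1 m2] := measurable_field.
have [s hs] := slope_interval P0 H0 T0.
split; last by apply: aeW => p _; exact: enorm_field.
- apply: (@BV2_rectangle R T H (fst \o field) fieldK [::] [:: 0]) => //; first exact: fieldK_ge0.
  + by move=> p; case: (field_bounded p).
  + move=> y x x' _ xx _ _; rewrite /field/= -mulrBr normrM absd mul1r.
    have := field_v_lipschitz (x, y) (x', y); rewrite /= subrr normr0 addr0.
    by rewrite [`|x - x'|]distrC (gtr0_norm (_ : 0 < x' - x)) ?subr_gt0.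
  + move=> x y y' _ yy _ hw; rewrite /field/= (side_interval yy hw) -mulrBr normrM absd mul1r.
    have := field_v_lipschitz (x, y) (x, y'); rewrite /= subrr normr0 add0r.
    by rewrite [`|y - y'|]distrC (gtr0_norm (_ : 0 < y' - y)) ?subr_gt0.
- apply: (@BV2_rectangle R T H (snd \o field) fieldK s [::]) => //; first exact: fieldK_ge0.
  + by move=> p; case: (field_bounded p).
  + move=> y x x' h1 xx h2 hw; rewrite /field/= (hs x x' h1 xx h2 hw) -opprD normrN -mulrBr normrM absl mul1r.
    have := field_w_lipschitz (x, y) (x', y); rewrite /= subrr normr0 addr0.
    by rewrite [`|x - x'|]distrC (gtr0_norm (_ : 0 < x' - x)) ?subr_gt0.
  + move=> x y y' _ yy _ _; rewrite /field/= -opprD normrN -mulrBr normrM absl mul1r.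
    have := field_w_lipschitz (x, y) (x, y'); rewrite /= subrr normr0 add0r.
    by rewrite [`|y - y'|]distrC (gtr0_norm (_ : 0 < y' - y)) ?subr_gt0.
Qed.

End Field.

Section FieldTraces.
Context {R : realType}.
Variables (tau K v0 H : R) (k : nat) (w wx wm : R -> R -> R).
Hypothesis tau0 : 0 < tau.
Hypothesis v00 : 0 < v0.
Hypothesis H0 : 0 < H.
Hypothesis k0 : (0 < k)%N.
Hypothesis hp : profile tau K v0 w wx wm.
Local Notation T := (halfperiod tau H k).
Local Notation P := (2 * (tau * H)).
Local Notation u := (field tau H k w).
Local Notation C := (fieldK K v0 H).
Local Notation sl := (slope T P).
Local Notation V p := (covar w (wave T P H p.1) (depth H p.2)).
Local Notation W p := (w (wave T P H p.1) (depth H p.2)).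

Let tH : 0 < tau * H. Proof. exact: mulr_gt0. Qed.
Let P0 : 0 < P. Proof. by rewrite mulr_gt0. Qed.
Let C0 : 0 <= C. Proof. exact: (fieldK_ge0 tau0 H0 hp). Qed.
Let mu_ := measurable_field k tau0 H0 hp.
Let uB := field_bounded k tau0 v00 H0 hp.

Lemma slope_side (al x : R) : al = 1 \/ al = -1 -> exists2 d : R, 0 < d &
  exists s : R, [/\ s = 1 \/ s = -1, ~ wall T P x -> s = sl x &
    forall z, 0 < al * (z - x) < d -> sl z = s].
Proof.
case=> ->.
  have [d d0 h] := slope_right T P0 H0 x; exists d => //; exists (sl x); split=> //.
    exact: slope_sign.
  move=> z /andP[h1 h2]; have zi : x <= z < x + d by apply/andP; split; lra.
  by have [] := h z zi.
have [d d0 [s [h1 h2 h3]]] := slope_left T P0 H0 x; exists d => //; exists s; split=> //.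
move=> z /andP[z1 z2]; have zi : x - d < z < x by apply/andP; split; lra.
by have [] := h3 z zi.
Qed.

Lemma field_near p q (s t : R) : s = 1 \/ s = -1 -> t = 1 \/ t = -1 ->
  side q.2 = s -> sl q.1 = t ->
  enorm (u q - (s * V p, - (t * W p))) <= 2 * C * (`|q.1 - p.1| + `|q.2 - p.2|).
Proof.
move=> hs ht sq tq; apply: (le_trans (enorm_le _)); rewrite /field/= sq tq.
have a1 (r : R) : r = 1 \/ r = -1 -> `|r| = 1 by case=> ->; rewrite ?normrN normr1.
rewrite -mulrBr -opprD normrN -mulrBr !normrM (a1 _ hs) (a1 _ ht) !mul1r.
have h1 := field_v_lipschitz k tau0 v00 H0 hp q p.
have h2 := field_w_lipschitz k tau0 H0 hp q p.
by move: h1 h2; set X := C * _; rewrite -mulrA -/X; lra.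
Qed.

Lemma field_quadrants p : strip H p -> exists f g : R -> R,
  [/\ forall be, be = 1 \/ be = -1 -> (f be = 1 \/ f be = -1) /\ (p.2 != 0 -> f be = side p.2),
      forall al, al = 1 \/ al = -1 -> (g al = 1 \/ g al = -1) /\ (~ wall T P p.1 -> g al = sl p.1) &
      forall al be, al = 1 \/ al = -1 -> be = 1 \/ be = -1 ->
        quadrant_limit H u p al be (f be * V p, - (g al * W p))].
Proof.
move=> sp; have one1 : (1 : R) = 1 \/ (1 : R) = -1 by left.
have one2 : (-1 : R) = 1 \/ (-1 : R) = -1 by right.
have n11 : (-1 == 1 :> R) = false by apply/negbTE/eqP; lra.
have [d1 d10 [s1 [hs1 hs1' S1]]] := side_depth one1 (or_intror I : p.2 != 0 \/ True).
have [d2 d20 [s2 [hs2 hs2' S2]]] := side_depth one2 (or_intror I : p.2 != 0 \/ True).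
have [e1 e10 [t1 [ht1 ht1' T1]]] := slope_side p.1 one1.
have [e2 e20 [t2 [ht2 ht2' T2]]] := slope_side p.1 one2.
exists (fun be => if be == 1 then s1 else s2), (fun al => if al == 1 then t1 else t2); split.
- by move=> be [->|->]; rewrite ?eqxx ?n11.
- by move=> al [->|->]; rewrite ?eqxx ?n11.
move=> al be hal hbe.
pose h := H - `|p.2|.
have h0 : 0 < h.
  by rewrite subr_gt0 ltr_norml; case/andP: sp => -> ->.
exists (2 * C), (Num.min h (Num.min (Num.min d1 d2) (Num.min e1 e2))); split.
- by rewrite mulr_ge0.
- by rewrite !lt_min h0 d10 d20 e10 e20.
move=> q; rewrite !lt_min => /and3P[a1 _ /andP[_ /andP[a2 a3]]] /and3P[b1 b2 /andP[/andP[b3 b4] _]].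
split.
  have : `|q.2 - p.2| < h.
    by move: b1 b2; case: hbe => ->; rewrite ?mul1r ?mulN1r => b1 b2; [rewrite gtr0_norm|rewrite ltr0_norm// -oppr_gt0].
  rewrite /h ltrBrDr => hh; have := ler_normD (q.2 - p.2) p.2; rewrite subrK => hh'.
  by have := le_lt_trans hh' hh; rewrite ltr_norml.
apply: field_near.
- by case: hbe => ->; rewrite ?eqxx ?n11.
- by case: hal => ->; rewrite ?eqxx ?n11.
- by case: hbe b1 b2 b3 b4 => -> b1 b2 b3 b4; rewrite ?eqxx ?n11; [apply: S1|apply: S2]; rewrite b1.
- by case: hal a1 a2 a3 => -> a1 a2 a3; rewrite ?eqxx ?n11; [apply: T1|apply: T2]; rewrite a1.
Qed.

(** Both traces are quadrant limits. Off y = 0 they have the same first component and off the walls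
    the same second one, which tells where jumps can lie and how large they are. At a crossing both
    components may change, and |u| = 1 still bounds the jump by 2. *)
Lemma field_jump p : jump_set H u p -> [/\ 0 <= jump_size H u p <= 2,
  p.2 != 0 -> wall T P p.1 /\ jump_size H u p <= 2 * `|W p| &
  ~ wall T P p.1 -> p.2 = 0 /\ jump_size H u p <= 2 * V p].
Proof.
case=> sp [c0 hc0].
have hc : jump_pair H u p (xget (0, 0) [set c | jump_pair H u p c]).
  by apply: (@xgetPex _ (0, 0) [set c | jump_pair H u p c]); exists c0.
rewrite /jump_size; set c := xget _ _ in hc *.
have [f [g [hf hg hq]]] := field_quadrants sp.
have [[mf ms] uB'] := (mu_, uB).
have [cc [al [be [al' [be' [hal hbe hal' hbe' [e1 e2]]]]]]] := jump_quadrants mf ms uB' hq hc.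
have E : enorm (c.2 - c.1) = enorm ((f be' - f be) * V p, (g al' - g al) * W p).
  rewrite e1 e2 /enorm /=; congr (Num.sqrt (_ + _)); first by rewrite mulrBl.
  by rewrite -sqrrN; congr (_ ^+ 2); ring.
have [f1 f1'] := hf _ hbe; have [f2 f2'] := hf _ hbe'.
have [g1 g1'] := hg _ hal; have [g2 g2'] := hg _ hal'.
have sq4 (a b : R) : a = 1 \/ a = -1 -> b = 1 \/ b = -1 -> (a - b) ^+ 2 <= 2 ^+ 2.
  by move=> [->|->] [->|->]; rewrite ?subrr ?expr0n ?opprK//=; lra.
have V0 : 0 <= V p by exact: covar_ge0.
rewrite E; split.
- rewrite /enorm sqrtr_ge0/=; rewrite -[leRHS]ger0_norm// -sqrtr_sqr ler_wsqrtr//.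
  rewrite !exprMn (covar_sqr v00 hp (xi_itv k tau0 H0 p.1) (depth_itv H0 p.2)).
  have := sq4 _ _ f2 f1; have := sq4 _ _ g2 g1.
  have := profile_lt1 hp (xi_itv k tau0 H0 p.1) (depth_itv H0 p.2).
  have := sqr_ge0 (W p); move: v00; set A := (f _ - _) ^+ 2; set B := (g _ - _) ^+ 2; set Z := W p ^+ 2.
  clear; move=> h1 h2 h3 h4 h5.
  have : A * (1 - Z) <= 2 ^+ 2 * (1 - Z) by apply: ler_wpM2r => //; lra.
  have : B * Z <= 2 ^+ 2 * Z by apply: ler_wpM2r.
  by lra.
- move=> p2; have ff : f be' = f be by rewrite f2'// f1'.
  split; last first.
    rewrite /enorm/= ff subrr mul0r expr0n add0r sqrtr_sqr normrM ler_wpM2r//.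
    by case: g1 => ->; case: g2 => ->; rewrite ?subrr ?normr0 ?opprK//; rewrite ler_norml; apply/andP; split; lra.
  apply: contrapT => nw; apply: cc; rewrite e1 e2 ff.
  by rewrite g1'// g2'.
- move=> nw; have gg : g al' = g al by rewrite g2'// g1'.
  split; last first.
    rewrite /enorm/= gg subrr mul0r expr0n addr0 sqrtr_sqr normrM (ger0_norm V0) ler_wpM2r//.
    by case: f1 => ->; case: f2 => ->; rewrite ?subrr ?normr0 ?opprK//; rewrite ler_norml; apply/andP; split; lra.
  apply: contrapT => /eqP p2; apply: cc; rewrite e1 e2 gg.
  by rewrite f1'// f2'.
Qed.

Lemma top_bottom_sign p : top_bottom H p -> [/\ Num.sg p.2 = 1 \/ Num.sg p.2 = -1, `|p.2| = H &
  forall q : R * R, `|q.2 - p.2| < H -> side q.2 = Num.sg p.2].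
Proof.
case=> ->; rewrite ?sgrN ?normrN gtr0_sg// ?gtr0_norm//; split=> //; [by left| |by right|].
  by move=> q; rewrite ltr_norml /side => /andP[h1 h2]; rewrite ifT//; lra.
by move=> q; rewrite ltr_norml /side => /andP[h1 h2]; rewrite ifF//; apply/negbTE; rewrite -ltNge; lra.
Qed.

(** At depth 0 the profile vanishes, so the field attains the prescribed boundary value.
    Impermeability and the vanishing of the boundary penalty both follow. *)
Lemma field_near_boundary p q : top_bottom H p -> `|q.2 - p.2| < H ->
  enorm (u q - gbdry p) <= 2 * C * (`|q.1 - p.1| + `|q.2 - p.2|).
Proof.
move=> /top_bottom_sign[h1 h2 h3] hq.
have d0 : depth H p.2 = 0 by apply: depth_out => //; rewrite h2.
have := @field_near p q (Num.sg p.2) (sl q.1) h1 (slope_sign _ _ _) (h3 q hq) erefl.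
rewrite d0 (covar_0 hp (xi_itv k tau0 H0 p.1)) (profile_0 hp (xi_itv k tau0 H0 p.1)).
by rewrite mulr1 mulr0 oppr0.
Qed.

Lemma field_is_trace p : top_bottom H p -> is_trace H u p (gbdry p).
Proof.
move=> tp; have [[mf ms] uB'] := (mu_, uB).
apply: (@trace_limit R H u mf ms uB' p (- outward p) (gbdry p) (2 * C) H) => //; first by rewrite mulr_ge0.
by move=> q _ hq; exact: field_near_boundary.
Qed.

Lemma field_trace p : top_bottom H p -> trace H u p = gbdry p.
Proof.
move=> tp; have [[mf ms] uB'] := (mu_, uB).
have ht : is_trace H u p (trace H u p).
  by apply: (@xgetPex _ 0 [set a | is_trace H u p a]); exists (gbdry p); exact: field_is_trace.
have [h1 h2 h3] := top_bottom_sign tp.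
have hb : - Num.sg p.2 = 1 \/ - Num.sg p.2 = -1 by case: h1 => ->; rewrite ?opprK; [right|left].
apply: (@trace_quadrant R H u mf ms uB' p (- outward p) _ (gbdry p) 1 (- Num.sg p.2)) => //.
- by left.
- by rewrite mul1r /= oppr0.
- by rewrite /= mulrNN; case: h1 => ->; rewrite ?mulrNN mulr1.
- rewrite /enorm /outward/= oppr0 expr0n add0r sqrrN; case: h1 => ->; rewrite ?sqrrN expr1n sqrtr1//.
exists (2 * C), H; split; [by rewrite mulr_ge0|by []|].
move=> q _ hq; have qH : `|q.2 - p.2| < H.
  by move: hq; case: h1 => ->; rewrite ?opprK ?mulN1r ?mul1r => /andP[a b]; [rewrite ltr0_norm// -oppr_gt0|rewrite gtr0_norm].
split; last exact: field_near_boundary.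
move: hq; rewrite /strip/=; case: tp => tp; rewrite tp ?sgrN gtr0_sg// ?opprK ?mulN1r ?mul1r => /andP[a b];
  by apply/andP; split; lra.
Qed.

Lemma field_impermeable : impermeable H u.
Proof.
apply: aeW => p tp; exists (gbdry p); split; first exact: field_is_trace.
by rewrite /edot/= mulr0 mul0r addr0.
Qed.

Lemma field_admissible : admissible T H u.
Proof.
split.
- exact: field_Hdiv hp.
- exact: field_BV hp.
- exact: field_periodic.
- exact: field_impermeable.
Qed.

End FieldTraces.

Section CoverSeq.
Context {R : realType}.

Lemma cover_sum_seq (f : R * R -> R) (S : R -> set (R * R)) (xs : seq R) (r : R) :
  (forall x, x \in xs -> cover_sum f (S x) r) ->
  cover_sum f [set p | exists2 x, x \in xs & S x p] ((size xs)%:R * r).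
Proof.
elim: xs => [|x xs ih] h.
  rewrite (_ : [set p | _] = set0) ?mul0r; first exact: cover_sum0.
  by apply/seteqP; split=> p // -[].
rewrite (_ : [set p | _] = S x `|` [set p | exists2 x, x \in xs & S x p]); last first.
  apply/seteqP; split=> p /=.
    by move=> [y]; rewrite in_cons => /predU1P[->|ys] Sy; [left|right; exists y].
  by move=> [Sx|[y ys Sy]]; [exists x => //; rewrite mem_head|exists y => //; rewrite in_cons ys orbT].
rewrite /= -natr1 mulrDl mul1r addrC; apply: cover_sumU; first by apply: h; rewrite mem_head.
by apply: ih => y ys; apply: h; rewrite in_cons ys orbT.
Qed.

Lemma cover_sum_point (f : R * R -> R) (S : set (R * R)) (x y c : R) : 0 <= c ->
  (forall p, S p -> p = (x, y)) -> (forall p, S p -> f p <= c) -> cover_sum f S 0.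
Proof.
move=> c0 Sp Sc; have -> : S = set0 `|` S by rewrite set0U.
have -> : (0 : R) = 0 + c * 0 by rewrite mulr0 addr0.
apply: cover_sumS => //; first exact: cover_sum0.
apply: (le_trans (le_hausdorff1 (_ : _ `<=` vsegment x y y))).
  by move=> p /Sp ->; split => //=; rewrite lexx.
by apply: (le_trans (hausdorff1_vsegment x (lexx y))); rewrite subrr.
Qed.

Lemma cube_lipschitz (a b : R) : 0 <= a <= 1 -> 0 <= b <= 1 -> `|a ^+ 3 - b ^+ 3| <= 3 * `|a - b|.
Proof.
move=> /andP[a0 a1] /andP[b0 b1].
have -> : a ^+ 3 - b ^+ 3 = (a ^+ 2 + a * b + b ^+ 2) * (a - b) by ring.
rewrite normrM ler_wpM2r// ger0_norm; last by rewrite !addr_ge0 ?mulr_ge0 ?sqr_ge0.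
have : a ^+ 2 <= 1 by rewrite expr_le1.
have : b ^+ 2 <= 1 by rewrite expr_le1.
have : a * b <= 1 by rewrite -[leRHS]mulr1 ler_pM.
by lra.
Qed.

End CoverSeq.

(** * The energy of the field as integrals over one cell *)

Section FieldEnergy.
Context {R : realType}.
Local Notation mu := (@lebesgue_measure R).
Variables (tau K v0 H : R) (k : nat) (w wx wm : R -> R -> R).
Hypothesis tau0 : 0 < tau.
Hypothesis v00 : 0 < v0.
Hypothesis H0 : 0 < H.
Hypothesis k0 : (0 < k)%N.
Hypothesis hp : profile tau K v0 w wx wm.
Local Notation T := (halfperiod tau H k).
Local Notation P := (2 * (tau * H)).
Local Notation u := (field tau H k w).
Local Notation C := (fieldK K v0 H).
Local Notation xi := (wave T P H).
Local Notation dep := (depth H).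
Local Notation J := (fun p => jump_size H u p ^+ 3).

Let tH : 0 < tau * H. Proof. exact: mulr_gt0. Qed.
Let P0 : 0 < P. Proof. by rewrite mulr_gt0. Qed.
Let C0 : 0 <= C. Proof. exact: (fieldK_ge0 tau0 H0 hp). Qed.
Let T0 : 0 < T. Proof. by rewrite mulr_gt0// ltr0n. Qed.
Let xiI := xi_itv k tau0 H0.
Let dI := depth_itv H0.

Lemma depth0 : dep 0 = 1.
Proof. by rewrite /depth normr0 mul0r subr0 max_r. Qed.

Let bounded_itv_integrable (g : R -> R) (a b M : R) : measurable_fun setT g ->
  (forall x, a <= x <= b -> `|g x| <= M) -> mu.-integrable `[a, b] (EFin \o g).
Proof.
move=> mg gM; apply: measurable_bounded_integrable.
- exact: measurable_itv.
- exact: lebesgue_itv_lty.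
- exact: measurable_funTS.
- by apply: (@bounded_fun_in _ _ _ _ M) => x /=; rewrite in_itv/=; exact: gM.
Qed.

Lemma integrable_scale_itv (c a b : R) (g : R -> R) : mu.-integrable `[a, b] (EFin \o g) ->
  mu.-integrable `[a, b] (EFin \o (fun x => c * g x)).
Proof.
move=> gi; have mi : measurable (`[a, b]%classic : set (measurableTypeR R)) by exact: measurable_itv.
by have := integrableZl mi c gi; apply: eq_integrable.
Qed.

Lemma RintegralZ_itv (c a b : R) (g : R -> R) : mu.-integrable `[a, b] (EFin \o g) ->
  \int[mu]_(x in `[a, b]) (c * g x) = c * \int[mu]_(x in `[a, b]) g x.
Proof. by move=> gi; apply: RintegralZl; [exact: measurable_itv|exact: gi]. Qed.

Lemma depth_fold (g : R -> R) (M : R) : measurable_fun setT g ->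
  (forall m, 0 <= m <= 1 -> 0 <= g m <= M) ->
  \int[mu]_(y in `[(- H), H]) g (dep y) = 2 * H * \int[mu]_(m in `[0, 1]) g m.
Proof.
move=> mg gM; have H1 := H0.
have := @fold_integral R g dep (- H) 1 H M 2 H0 ltr01 mg (measurable_depth H) gM dI.
rewrite (_ : - H + 2 * (1 * H) = H); last by ring.
apply=> j; case: j => [|[|//]] _.
  left=> x; rewrite mul0r addr0 mul1r mul1r => /andP[h1 h2].
  rewrite (depth_in H0); last by rewrite ler0_norm; lra.
  by rewrite ler0_norm; [field; rewrite gt_eqF|lra].
right=> x; rewrite !mul1r => /andP[h1 h2].
rewrite (depth_in H0); last by rewrite ger0_norm; lra.
by rewrite ger0_norm; [field; rewrite gt_eqF|lra].
Qed.

Lemma wave_fold (g : R -> R) (M : R) : measurable_fun setT g ->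
  (forall a, 0 <= a <= tau -> 0 <= g a <= M) ->
  \int[mu]_(x in `[(- T), T]) g (xi x) = 2 * k%:R * H * \int[mu]_(a in `[0, tau]) g a.
Proof.
move=> mg gM; have P1 := P0.
have := @fold_integral R g xi (- T) tau H M (2 * k) H0 tau0 mg (measurable_wave T H P0) gM xiI.
rewrite (_ : - T + (2 * k)%:R * (tau * H) = T); last by rewrite natrM /halfperiod; ring.
rewrite natrM; apply=> j _.
have E : tau * H = P / 2 by field.
have jE : j%:R * (tau * H) = P * (j./2)%:R + (odd j)%:R * (tau * H).
  by rewrite -{1}(odd_double_half j) natrD -muln2 natrM; ring.
rewrite -natr1 mulrDl mul1r jE; case: (odd j);
  [rewrite (_ : true%:R = 1 :> R)// mul1r|rewrite (_ : false%:R = 0 :> R)// mul0r addr0].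
  right=> x /andP[h1 h2]; rewrite (@wave_down R T P H P0 (j./2)%:Z).
    by rewrite -pmulrn; field; rewrite gt_eqF.
  by rewrite -pmulrn; apply/andP; split; lra.
left=> x /andP[h1 h2]; rewrite (@wave_up R T P H P0 (j./2)%:Z).
  by rewrite -pmulrn; field; rewrite gt_eqF.
by rewrite -pmulrn; apply/andP; split; lra.
Qed.

Lemma covar_itv a b : 0 <= covar w a b <= 1.
Proof. by rewrite covar_ge0 covar_le1. Qed.

(** The jump is at most 2 |w|, whence the factor 8, and the wall consists of two halves of length H,
    on which the depth runs through [0, 1]. *)
Lemma vertical_wall (x e : R) : 0 < e ->
  cover_sum J [set p | jump_set H u p /\ p.1 = x]
    (16 * H * \int[mu]_(m in `[0, 1]) `|w (xi x) m| ^+ 3 + e).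
Proof.
move=> e0; have [mw _ _] := profile_measurable hp.
have mws : measurable_fun setT (w (xi x)) by exact: (measurableT_comp mw (pair1_measurable (xi x))).
have w1 m : 0 <= m <= 1 -> 0 <= `|w (xi x) m| <= 1.
  by move=> hm; rewrite normr_ge0 (profile_le1 v00 hp (xiI x) hm).
have mg0 : measurable_fun setT (fun m => `|w (xi x) m| ^+ 3).
  by apply: measurable_funX; exact: (measurableT_comp (@normr_measurable R setT) mws).
have mgd : measurable_fun setT (fun y => `|w (xi x) (dep y)| ^+ 3).
  exact: (measurableT_comp mg0 (measurable_depth H)).
pose g y := 8 * `|w (xi x) (dep y)| ^+ 3.
have cube1 m : 0 <= m <= 1 -> 0 <= `|w (xi x) m| ^+ 3 <= 1.
  by move=> /w1/andP[a b]; rewrite exprn_ge0// exprn_ile1.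
have gi1 : mu.-integrable `[(- H), H] (EFin \o (fun y => `|w (xi x) (dep y)| ^+ 3)).
  by apply: (@bounded_itv_integrable _ _ _ 1) => // y _; have /andP[a b] := cube1 _ (dI y); rewrite ger0_norm.
have gE : \int[mu]_(y in `[(- H), H]) g y = 16 * H * \int[mu]_(m in `[0, 1]) `|w (xi x) m| ^+ 3.
  rewrite /g (RintegralZ_itv _ gi1).
  rewrite (@depth_fold (fun m => `|w (xi x) m| ^+ 3) 1 mg0 cube1).
  by set X := \int[mu]_(_ in _) _; ring.
have jE p : jump_set H u p /\ p.1 = x -> J p <= 8 /\ (p.2 != 0 -> J p <= g p.2).
  move=> [Jp px]; have [/andP[j0 j2] jw _] := field_jump tau0 v00 H0 hp Jp; split.
    by rewrite (_ : 8 = 2 ^+ 3) ?lerXn2r ?nnegrE//; ring.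
  move=> /jw[_ h]; rewrite /g -px (_ : 8 * _ = (2 * `|w (xi p.1) (dep p.2)|) ^+ 3); last by ring.
  by rewrite lerXn2r ?nnegrE ?mulr_ge0.
(* The crossing with the centre line is split off: there the bound by |w| may fail, but a single
   point is charged nothing. *)
rewrite (_ : [set p | _] = [set p | (jump_set H u p /\ p.1 = x) /\ p.2 != 0] `|`
    [set p | (jump_set H u p /\ p.1 = x) /\ p.2 = 0]); last first.
  apply/seteqP; split=> p /=; last by move=> [[]|[]].
  by move=> h; have [p0|p0] := eqVneq p.2 0; [right|left].
rewrite -[16 * H * _ + e]addr0; apply: cover_sumU; last first.
  apply: (@cover_sum_point _ _ _ x 0 8) => //.
    by move=> [p1 p2] /= [[_ ->] ->].
  by move=> p [h _]; case: (jE p h).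
rewrite -gE; apply: (@wall_cover R J [set p | p.1 = x] snd _ g (- H) H (24 * C) e) => //.
- by move=> s t st; exact: hausdorff1_vsegment.
- by have := H0; lra.
- exact: (integrable_scale_itv 8 gi1).
- move=> y y' _ _; rewrite /g -mulrBr normrM (ger0_norm (_ : 0 <= 8))//.
  have h1 := cube_lipschitz (w1 _ (dI y)) (w1 _ (dI y')).
  have h2 := ler_dist_dist (w (xi x) (dep y)) (w (xi x) (dep y')).
  have h3 := field_w_lipschitz k tau0 H0 hp (x, y) (x, y'); rewrite /= subrr normr0 add0r in h3.
  by move: h1 h2 h3; set A := `| _ ^+ 3 - _|; set B := `| `| _ | - _ |; rewrite -mulrA; set D := C * _; lra.
- by move=> y _; rewrite mulr_ge0//; case/andP: (cube1 _ (dI y)).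
- move=> p [h p0]; have [_ /(_ p0) h2] := jE p h; split => //; first by case: h.
  by case: h => -[/andP[a b] _] _; rewrite !ltW.
Qed.

Lemma horizontal_wall (e : R) : 0 < e ->
  cover_sum J [set p | (jump_set H u p /\ one_period T p) /\ ~ wall T P p.1]
    (16 * k%:R * H * \int[mu]_(a in `[0, tau]) covar w a 1 ^+ 3 + e).
Proof.
move=> e0.
have mcs : measurable_fun setT (fun a => covar w a 1) by exact: (measurableT_comp (measurable_covar hp) (pair2_measurable (1 : R))).
have mg0 : measurable_fun setT (fun a => covar w a 1 ^+ 3) by exact: measurable_funX.
have mgd : measurable_fun setT (fun x => covar w (xi x) 1 ^+ 3).
  exact: (measurableT_comp mg0 (measurable_wave T H P0)).
have cube1 a : 0 <= a <= tau -> 0 <= covar w a 1 ^+ 3 <= 1.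
  by move=> _; have /andP[c0 c1] := covar_itv a 1; rewrite exprn_ge0// exprn_ile1.
pose g x := 8 * covar w (xi x) 1 ^+ 3.
have gi1 : mu.-integrable `[(- T), T] (EFin \o (fun x => covar w (xi x) 1 ^+ 3)).
  by apply: (@bounded_itv_integrable _ _ _ 1) => // y _; have /andP[a b] := cube1 _ (xiI y); rewrite ger0_norm.
have gE : \int[mu]_(x in `[(- T), T]) g x = 16 * k%:R * H * \int[mu]_(a in `[0, tau]) covar w a 1 ^+ 3.
  rewrite /g (RintegralZ_itv _ gi1).
  rewrite (@wave_fold (fun a => covar w a 1 ^+ 3) 1 mg0 cube1).
  by set X := \int[mu]_(_ in _) _; ring.
rewrite -gE; apply: (@wall_cover R J [set p | p.2 = 0] fst _ g (- T) T (24 * C) e) => //.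
- by move=> s t st; exact: hausdorff1_hsegment.
- by have := T0; lra.
- exact: (integrable_scale_itv 8 gi1).
- move=> x x' _ _; rewrite /g -mulrBr normrM (ger0_norm (_ : 0 <= 8))//.
  have h1 := cube_lipschitz (covar_itv (xi x) 1) (covar_itv (xi x') 1).
  have h3 := field_v_lipschitz k tau0 v00 H0 hp (x, 0) (x', 0); rewrite /= depth0 subrr normr0 addr0 in h3.
  by move: h1 h3; set A := `| _ ^+ 3 - _|; set B := `| _ - _ |; rewrite -mulrA; set D := C * _; lra.
- by move=> x _; rewrite mulr_ge0//; case/andP: (cube1 _ (xiI x)).
- move=> p [[Jp op] nw]; have [/andP[j0 j2] _ /(_ nw)[p0 h]] := field_jump tau0 v00 H0 hp Jp.
  split => //; first by case/andP: op => -> /ltW.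
  rewrite /g (_ : 8 * _ = (2 * covar w (xi p.1) 1) ^+ 3); last by ring.
  by rewrite p0 depth0 in h; rewrite lerXn2r ?nnegrE ?mulr_ge0 ?covar_ge0.
Qed.

Lemma jump_energy : (\int[Hone]_(p in jump_set H u `&` one_period T) (J p)%:E <=
  (16 * k%:R * H * (\int[mu]_(m in `[0%R, 1%R]) `|w 0 m| ^+ 3 + \int[mu]_(m in `[0%R, 1%R]) `|w tau m| ^+ 3 +
    \int[mu]_(a in `[0%R, tau]) covar w a 1 ^+ 3))%:E)%E.
Proof.
apply: integral_Hone_le.
  by move=> p [Jp _]; have [/andP[j0 j2] _ _] := field_jump tau0 v00 H0 hp Jp; rewrite exprn_ge0.
(* There are k walls over the minima of the wave, k over the maxima, and the centre line; each cover
   is allowed the error e / N. *)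
move=> e e0; pose N : R := 2 * k%:R + 1.
have N0 : 0 < N by rewrite addr_gt0// mulr_gt0// ltr0n.
pose e1 := e / N; have e10 : 0 < e1 by rewrite divr_gt0.
pose xs1 := [seq - T + P * i%:R | i <- iota 0 k]; pose xs2 := [seq - T + P * i%:R + P / 2 | i <- iota 0 k].
pose S x := [set p | jump_set H u p /\ p.1 = x].
have c1 : cover_sum J [set p | exists2 x, x \in xs1 & S x p]
    ((size xs1)%:R * (16 * H * \int[mu]_(m in `[0, 1]) `|w 0 m| ^+ 3 + e1)).
  apply: cover_sum_seq => x /mapP[i _ ->].
  have := vertical_wall (- T + P * i%:R) e10; rewrite (@wave_up R T P H P0 i%:Z).
    by rewrite -pmulrn (_ : (_ - _) / H = 0)//; rewrite (_ : - T + P * i%:R + T - P * i%:R = 0) ?mul0r//; ring.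
  by rewrite -pmulrn; have := P0; move=> P1; apply/andP; split; lra.
have c2 : cover_sum J [set p | exists2 x, x \in xs2 & S x p]
    ((size xs2)%:R * (16 * H * \int[mu]_(m in `[0, 1]) `|w tau m| ^+ 3 + e1)).
  apply: cover_sum_seq => x /mapP[i _ ->].
  have := vertical_wall (- T + P * i%:R + P / 2) e10; rewrite (@wave_up R T P H P0 i%:Z).
    by rewrite -pmulrn (_ : (_ - _) / H = tau)//; field; rewrite gt_eqF.
  by rewrite -pmulrn; have := P0; move=> P1; apply/andP; split; lra.
have c3 := horizontal_wall e10.
have := cover_sumU (cover_sumU c1 c2) c3; set D := _ `|` _ => cD.
exists D.
  move=> p [Jp op]; have [[n hn]|nw] := pselect (wall T P p.1); last by right.
  left; have P1 := P0; have TP : 2 * T = k%:R * P by exact: two_T.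
  case/andP: op => op1 op2.
  (* The period is half-open, so it meets exactly the walls of both kinds with 0 <= n < k. *)
  have n1 : (0 <= n)%R.
    rewrite leNgt; apply/negP => n0; have n0' : (n + 1 <= 0)%R by rewrite lezD1.
    have : P * (n + 1)%:~R <= 0 by rewrite pmulr_rle0// lerz0.
    by rewrite intrD mulrDr mulr1; case: hn => hn; lra.
  have n2 : (n < k%:Z)%R.
    rewrite ltNge; apply/negP => nk.
    have : P * k%:R <= P * n%:~R by rewrite ler_pM2l// -[k%:R]/(k%:Z%:~R) ler_int.
    by case: hn => hn; lra.
  have [i iE] : exists i : nat, n = i%:Z by exists `|n|%N; rewrite gez0_abs.
  have ik : i \in iota 0 k by rewrite mem_iota/= add0n; rewrite iE ltz_nat in n2.
  case: hn => hn; [left|right]; exists p.1 => //; apply/mapP; exists i => //; by rewrite hn iE -pmulrn.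
apply: (cover_sum_le cD); rewrite /xs1 /xs2 !size_map size_iota.
have eE : e = (2 * k%:R + 1) * e1 by rewrite /e1 mulrC divfK// gt_eqF.
by rewrite [in leRHS]eE le_eqVlt; apply/orP; left; apply/eqP; ring.
Qed.

Lemma boundary_energy : (\int[Hone]_(p in top_bottom H `&` one_period T)
  (enorm (trace H u p - gbdry p) ^+ 3)%:E = 0)%E.
Proof.
apply: integral0_eq => p [tp _]; rewrite (field_trace k tau0 v00 H0 hp tp) subrr.
by rewrite /enorm/= expr0n addr0 sqrtr0 expr0n.
Qed.

(** H times the divergence up to sign, in cell coordinates. *)
Definition divD (a b : R) : R := wm a b + covar_x w wx a b.

Lemma divD_bound a b : 0 <= a <= tau -> 0 <= b <= 1 -> `|divD a b| <= K + K / Num.sqrt v0.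
Proof.
move=> ha hb; apply: (le_trans (ler_normD _ _)); apply: lerD.
  by have [] := profile_bound hp ha hb.
exact: (covar_x_bound v00 hp).
Qed.

(** A period consists of 4 k cells of size tau H by H; the Jacobian H^2 cancels the factor H^-2 of
    the squared divergence. *)
Lemma divergence_energy : (\int[area]_(p in rectangle T H) (wdiv T H u p ^+ 2)%:E =
  (4 * k%:R * \int[mu]_(a in `[0%R, tau]) \int[mu]_(b in `[0%R, 1%R]) divD a b ^+ 2)%:E)%E.
Proof.
rewrite (wdiv_sqr_integral (fdiv_L2 k tau0 v00 H0 hp) (field_weak_divergence k tau0 v00 H0 hp)).
set Q := rectangle T H; set d := fdiv _ _ _ _ _ _.
have [_ _ di] := fdiv_L2 k tau0 v00 H0 hp; rewrite -/d -/Q in di.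
have mQ : measurable (Q : set (measurableTypeR R * measurableTypeR R)) by exact: measurable_rectangle.
rewrite -(fineK (integrable_fin_num mQ di)); congr EFin.
rewrite -[LHS]/(\int[area]_(p in Q) (d p ^+ 2)).
pose M := K + K / Num.sqrt v0.
pose D2 (p : R * R) : R := divD p.1 p.2 ^+ 2 * \1_(`[0, tau] `*` `[0, 1]) p.
have mB : measurable (`[0, tau] `*` `[0, 1] : set (measurableTypeR R * measurableTypeR R)).
  by apply: measurableX; exact: measurable_itv.
have [mw mwx mwm] := profile_measurable hp.
have mD : measurable_fun (setT : set (measurableTypeR R * measurableTypeR R)) (fun p => divD p.1 p.2).
  by apply: measurable_funD => //; exact: (measurable_covar_x hp).
have mD2 : measurable_fun (setT : set (measurableTypeR R * measurableTypeR R)) D2.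
  by apply: measurable_funM; [exact: measurable_funX|exact: measurable_indic].
have D2B p : 0 <= D2 p <= M ^+ 2.
  rewrite /D2 indicE; case: (boolP (p \in _)) => [|_]; last by rewrite mulr0 lexx sqr_ge0.
  move=> /set_mem[/=]; rewrite !in_itv/= => h1 h2; rewrite mulr1 sqr_ge0/=.
  rewrite -ler_sqrt ?sqr_ge0// !sqrtr_sqr; apply: (le_trans (divD_bound h1 h2)); exact: ler_norm.
have D2i : area.-integrable setT (EFin \o D2).
  apply: (@integrable_bounded_rect R _ 0 tau 0 1 (M ^+ 2)) => //.
    by move=> p; have /andP[a b] := D2B p; rewrite ger0_norm.
  by move=> p np; rewrite /D2 indicE memNset ?mulr0.
pose h a := \int[mu]_b D2 (a, b).
have mh : measurable_fun setT h.
  have := integrable_fine (integrable_fubini_F D2i).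
  by move=> /integrableP[/measurable_EFinP].
have hE a : 0 <= a <= tau -> h a = \int[mu]_(b in `[0, 1]) divD a b ^+ 2.
  move=> ha; rewrite /h [RHS]Rintegral_mkcond; apply: eq_Rintegral => b _.
  rewrite /D2/= patchE indicE; case: (boolP (b \in _)) => hb.
    by rewrite mem_set ?mulr1//; split; rewrite /= in_itv//=; move: hb; rewrite mem_setE in_itv.
  by rewrite memNset ?mulr0// => -[_ /= h']; move/negP: hb; apply; rewrite mem_setE.
have hB a : 0 <= h a <= M ^+ 2.
  rewrite /h Rintegral_ge0/=; last by move=> b _; case/andP: (D2B (a, b)).
  rewrite (_ : M ^+ 2 = M ^+ 2 * (1 - 0)); last by ring.
  apply: Rintegral_le_itv => //.
    apply: (@integrable_bounded_itv R _ 0 1 (M ^+ 2)).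
    + exact: measurable_fun_pair2.
    + by move=> b; have /andP[x1 x2] := D2B (a, b); rewrite ger0_norm.
    + move=> b hb; rewrite /D2 indicE memNset ?mulr0// => -[_ /= h'].
      by rewrite h' in hb.
  move=> b; rewrite indicE; case: (boolP (b \in _)) => hb; first by rewrite mulr1; case/andP: (D2B (a, b)).
  rewrite mulr0 /D2 indicE memNset ?mulr0// => -[_ /= h']; move/negP: hb; apply; by rewrite mem_setE.
pose F (p : R * R) : R := d p ^+ 2 * \1_Q p.
have FE : \int[area]_(p in Q) (d p ^+ 2) = \int[area]_p F p.
  rewrite Rintegral_mkcond; apply: eq_Rintegral => p _.
  by rewrite patchE /F indicE; case: ifP; rewrite ?mulr1 ?mulr0.
have Fi : area.-integrable setT (EFin \o F).
  have := @integrable_restrict _ _ R area Q (fun p => d p ^+ 2) mQ di.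
  apply: eq_integrable => // p _; rewrite /= patchE /F indicE.
  by case: ifP; rewrite ?mulr1 ?mulr0.
have dE p : `|p.2| < H -> d p ^+ 2 = H ^- 2 * D2 (xi p.1, dep p.2).
  move=> pH; rewrite /d /fdiv /div1 /div2 pH /D2 /divD/= indicE mem_set; last by split; rewrite /= in_itv/=.
  rewrite (_ : true%:R = 1 :> R)// mulr1.
  have sq (x : R) : x = 1 \/ x = -1 -> x ^+ 2 = 1 by case=> ->; rewrite ?sqrrN expr1n.
  rewrite (_ : _ + _ = (side p.2 * slope T P p.1) * (covar_x w wx (xi p.1) (dep p.2) + wm (xi p.1) (dep p.2)) / H); last by ring.
  by rewrite !exprMn (sq _ (side_sign _)) (sq _ (slope_sign _ _ _)) exprVn addrC; ring.
rewrite FE RFubini1//.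
have inner x : \int[mu]_y F (x, y) = \1_(`]-T, T[) x * (2 / H * h (xi x)).
  rewrite indicE mem_setE; case: (boolP (x \in _)) => hx; last first.
    rewrite mul0r; transitivity (\int[mu]_y (0 : R)); last by rewrite Rintegral_cst// mul0r.
    apply: eq_Rintegral => y _; rewrite /F indicE memNset ?mulr0// => -[/= h' _].
    by rewrite in_itv/= h' in hx.
  rewrite mul1r; have mg : measurable_fun setT (fun b => D2 (xi x, b)) by exact: measurable_fun_pair2.
  have := @depth_fold (fun b => D2 (xi x, b)) (M ^+ 2) mg (fun m _ => D2B (xi x, m)).
  have -> : \int[mu]_(m in `[0, 1]) D2 (xi x, m) = h (xi x).
    rewrite /h Rintegral_mkcond; apply: eq_Rintegral => b _; rewrite patchE; case: ifPn => // hb.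
    by rewrite /D2 indicE memNset ?mulr0// => -[_ /= h']; move/negP: hb; apply; rewrite mem_setE.
  move=> e; pose G y := H ^- 2 * D2 (xi x, dep y).
  have mDd : measurable_fun setT (fun y => D2 (xi x, dep y)) by exact: (measurableT_comp mg (measurable_depth H)).
  have Gi (i j : itv_bound R) : (exists x y a b, i = BSide x a /\ j = BSide y b) ->
      mu.-integrable [set` Interval i j] (EFin \o G).
    move=> [x1 [y1 [a [b [-> ->]]]]]; apply: measurable_bounded_integrable.
    - exact: measurable_itv.
    - exact: lebesgue_itv_lty.
    - by apply: measurable_funTS; exact: measurable_funM.
    - apply: (@bounded_fun_in _ _ _ _ (H ^- 2 * M ^+ 2)) => y _.
      have /andP[z1 z2] := D2B (xi x, dep y).
      by rewrite /G normrM (ger0_norm z1) ger0_norm ?invr_ge0 ?sqr_ge0// ler_wpM2l// invr_ge0 sqr_ge0.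
  transitivity (\int[mu]_(y in `]-H, H[) G y).
    rewrite [RHS]Rintegral_mkcond; apply: eq_Rintegral => y _; rewrite patchE /F indicE.
    case: ifPn => [/set_mem/=|/negP hy]; last first.
      rewrite memNset ?mulr0// => -[_ /= h']; apply: hy; apply: mem_set; by rewrite /= in_itv.
    rewrite in_itv/= => hy; rewrite mem_set ?mulr1; last first.
      by split => //=; rewrite in_itv/= in hx.
    by rewrite dE//= ltr_norml.
  rewrite (Rintegral_itv_bndo_bndc (Gi _ _ _)); last by do 4 eexists.
  rewrite (Rintegral_itv_obnd_cbnd (Gi _ _ _)); last by do 4 eexists.
  rewrite /G RintegralZ_itv ?e; first by field; rewrite gt_eqF.
  by apply: (@bounded_itv_integrable _ _ _ (M ^+ 2)) => // y _; have /andP[z1 z2] := D2B (xi x, dep y); rewrite ger0_norm.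
have mhx : measurable_fun setT (fun x => 2 / H * h (xi x)).
  by apply: measurable_funM => //; exact: (measurableT_comp mh (measurable_wave T H P0)).
have hxi (i j : itv_bound R) : (exists x y a b, i = BSide x a /\ j = BSide y b) ->
    mu.-integrable [set` Interval i j] (EFin \o (fun x => 2 / H * h (xi x))).
  move=> [x1 [y1 [a [b [-> ->]]]]]; apply: measurable_bounded_integrable.
  - exact: measurable_itv.
  - exact: lebesgue_itv_lty.
  - exact: measurable_funTS.
  - have H2 : 0 <= 2 / H by rewrite divr_ge0// ltW.
    apply: (@bounded_fun_in _ _ _ _ (2 / H * M ^+ 2)) => y _; have /andP[z1 z2] := hB (xi y).
    by rewrite normrM (ger0_norm z1) (ger0_norm H2) ler_wpM2l.
transitivity (\int[mu]_(x in `]-T, T[) (2 / H * h (xi x))).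
  rewrite [RHS]Rintegral_mkcond; apply: eq_Rintegral => x _; rewrite inner patchE indicE.
  by case: ifP => _; rewrite ?mul1r ?mul0r.
rewrite (Rintegral_itv_bndo_bndc (hxi _ _ _)); last by do 4 eexists.
rewrite (Rintegral_itv_obnd_cbnd (hxi _ _ _)); last by do 4 eexists.
rewrite RintegralZ_itv; last first.
  apply: (@bounded_itv_integrable _ _ _ (M ^+ 2)); first exact: (measurableT_comp mh (measurable_wave T H P0)).
  by move=> x _; have /andP[z1 z2] := hB (xi x); rewrite ger0_norm.
rewrite (@wave_fold h (M ^+ 2) mh (fun a _ => hB a)).
rewrite (_ : \int[mu]_(a in `[0, tau]) h a = \int[mu]_(a in `[0, tau]) \int[mu]_(b in `[0, 1]) divD a b ^+ 2).
  by field; rewrite gt_eqF.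
by apply: eq_Rintegral => a /set_mem/=; rewrite in_itv/=; exact: hE.
Qed.

Lemma field_energy (L : R) : 0 < L -> (E0 T H L u <= (k%:R * H * (2 * (L / H) *
    \int[mu]_(a in `[0%R, tau]) \int[mu]_(b in `[0%R, 1%R]) divD a b ^+ 2 +
  8 / 3 * (\int[mu]_(m in `[0%R, 1%R]) `|w 0 m| ^+ 3 + \int[mu]_(m in `[0%R, 1%R]) `|w tau m| ^+ 3 +
    \int[mu]_(a in `[0%R, tau]) covar w a 1 ^+ 3)))%:E)%E.
Proof.
move=> L0; rewrite /E0 divergence_energy boundary_energy mule0 adde0.
set A := \int[mu]_(_ in _) \int[mu]_(_ in _) _; set B := \int[mu]_(_ in _) _ + _ + _.
have := jump_energy; rewrite -/B; set I := (\int[Hone]_(_ in _) _)%E => hI.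
apply: (@le_trans _ _ ((L / 2)%:E * (4 * k%:R * A)%:E + (6^-1)%:E * (16 * k%:R * H * B)%:E)%E).
  by rewrite leeD2l// lee_wpmul2l// lee_fin invr_ge0.
rewrite -!EFinM -EFinD lee_fin le_eqVlt; apply/orP; left; apply/eqP.
by field; rewrite gt_eqF.
Qed.

End FieldEnergy.

(** * The fan and the wedge *)

Section BoxFunctions.
Context {R : realType}.
Variable tau : R.

Definition boxed (P : R -> R -> Prop) := forall a b, 0 <= a <= tau -> 0 <= b <= 1 -> P a b.

(** A class closed under sums, products, maxima, minima, and roots and inverses of functions bounded
    away from 0. The regularity of the profile is then read off from the shape of its formula. *)
Definition boxfun (f : R -> R -> R) : Prop :=
  [/\ measurable_fun setT (fun p : R * R => f p.1 p.2),
      exists M, boxed (fun a b => `|f a b| <= M) &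
      exists K, boxed (fun a b => boxed (fun a' b' =>
        `|f a b - f a' b'| <= K * (`|a - a'| + `|b - b'|)))].

Lemma boxfun_cst (x : R) : boxfun (fun _ _ => x).
Proof.
split; first exact: measurable_cst.
- by exists `|x| => a b _ _.
- by exists 0 => a b _ _ a' b' _ _; rewrite subrr normr0 mul0r.
Qed.

Lemma boxfun_fst : boxfun (fun a _ => a).
Proof.
split; first exact: measurable_fst.
- by exists tau => a b /andP[a0 a1] _; rewrite ger0_norm.
- by exists 1 => a b _ _ a' b' _ _; rewrite mul1r lerDl.
Qed.

Lemma boxfun_snd : boxfun (fun _ b => b).
Proof.
split; first exact: measurable_snd.
- by exists 1 => a b _ /andP[a0 a1]; rewrite ger0_norm.
- by exists 1 => a b _ _ a' b' _ _; rewrite mul1r lerDr.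
Qed.

Lemma boxfun_lip (f g : R -> R -> R) (k : R) : boxfun f -> 0 <= k ->
  measurable_fun setT (fun p : R * R => g p.1 p.2) ->
  (exists M, boxed (fun a b => `|g a b| <= M)) ->
  boxed (fun a b => boxed (fun a' b' => `|g a b - g a' b'| <= k * `|f a b - f a' b'|)) -> boxfun g.
Proof.
move=> [_ _ [K fK]] k0 mg gM gf; split => //; exists (k * K) => a b ha hb a' b' ha' hb'.
by apply: (le_trans (gf a b ha hb a' b' ha' hb')); rewrite -mulrA ler_wpM2l// fK.
Qed.

Lemma boxfun_opp f : boxfun f -> boxfun (fun a b => - f a b).
Proof.
move=> bf; apply: (boxfun_lip bf ler01); case: (bf) => mf [M fM] _.
- exact: measurable_funN.
- by exists M => a b ha hb; rewrite normrN fM.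
- by move=> a b _ _ a' b' _ _; rewrite mul1r -opprD normrN.
Qed.

Lemma boxfun_add f g : boxfun f -> boxfun g -> boxfun (fun a b => f a b + g a b).
Proof.
move=> [mf [M fM] [K fK]] [mg [M' gM] [K' gK]]; split; first exact: measurable_funD.
- by exists (M + M') => a b ha hb; apply: (le_trans (ler_normD _ _)); rewrite lerD ?fM ?gM.
- exists (K + K') => a b ha hb a' b' ha' hb'.
  have -> : f a b + g a b - (f a' b' + g a' b') = (f a b - f a' b') + (g a b - g a' b') by ring.
  by apply: (le_trans (ler_normD _ _)); rewrite mulrDl lerD ?fK ?gK.
Qed.

Lemma boxfun_mul f g : boxfun f -> boxfun g -> boxfun (fun a b => f a b * g a b).
Proof.
move=> [mf [M fM] [K fK]] [mg [M' gM] [K' gK]]; split; first exact: measurable_funM.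
- by exists (M * M') => a b ha hb; rewrite normrM ler_pM ?fM ?gM.
- exists (M * K' + M' * K) => a b ha hb a' b' ha' hb'.
  have -> : f a b * g a b - f a' b' * g a' b' = f a b * (g a b - g a' b') + g a' b' * (f a b - f a' b') by ring.
  apply: (le_trans (ler_normD _ _)); rewrite !normrM mulrDl -!mulrA.
  by apply: lerD; apply: ler_pM; rewrite ?fM ?gM ?fK ?gK.
Qed.

Lemma boxfun_inv f (d : R) : 0 < d -> boxed (fun a b => d <= f a b) -> boxfun f ->
  boxfun (fun a b => (f a b)^-1).
Proof.
move=> d0 df bf; apply: (boxfun_lip (k := d ^- 2) bf); first by rewrite invr_ge0 sqr_ge0.
- by case: bf => mf _ _; exact: (measurableT_comp (@measurable_inv R) mf).
- exists d^-1 => a b ha hb; have fd := df a b ha hb.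
  have f0 : 0 < f a b by exact: lt_le_trans fd.
  by rewrite gtr0_norm ?invr_gt0// lef_pV2.
- move=> a b ha hb a' b' ha' hb'; have fd := df a b ha hb; have fd' := df a' b' ha' hb'.
  have f0 : 0 < f a b by exact: lt_le_trans fd.
  have f0' : 0 < f a' b' by exact: lt_le_trans fd'.
  have -> : (f a b)^-1 - (f a' b')^-1 = (f a b * f a' b')^-1 * (f a' b' - f a b).
    by field; rewrite !gt_eqF.
  rewrite normrM distrC ler_wpM2r// gtr0_norm ?invr_gt0 ?mulr_gt0// lef_pV2 ?posrE ?mulr_gt0//.
  by rewrite expr2 ler_pM// ltW.
Qed.

Lemma boxfun_sqrt f (d : R) : 0 < d -> boxed (fun a b => d <= f a b) -> boxfun f ->
  boxfun (fun a b => Num.sqrt (f a b)).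
Proof.
move=> d0 df bf; pose e := Num.sqrt d; have e0 : 0 < e by rewrite sqrtr_gt0.
apply: (boxfun_lip (k := (2 * e)^-1) bf); first by rewrite invr_ge0 mulr_ge0// ltW.
- case: bf => mf _ _; apply: (measurableT_comp (f := @Num.sqrt R)) => //.
  by apply: continuous_measurable_fun => x; exact: sqrt_continuous.
- case: bf => _ [M fM] _; exists (Num.sqrt M) => a b ha hb; rewrite ger0_norm ?sqrtr_ge0//.
  by apply: ler_wsqrtr; apply: le_trans (fM a b ha hb); exact: ler_norm.
- move=> a b ha hb a' b' ha' hb'; have fd := df a b ha hb; have fd' := df a' b' ha' hb'.
  have s1 : e <= Num.sqrt (f a b) by exact: ler_wsqrtr.
  have s2 : e <= Num.sqrt (f a' b') by exact: ler_wsqrtr.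
  have E : f a b - f a' b' = (Num.sqrt (f a b) - Num.sqrt (f a' b')) * (Num.sqrt (f a b) + Num.sqrt (f a' b')).
    by rewrite -subr_sqr !sqr_sqrtr//; apply: ltW; [exact: lt_le_trans fd'|exact: lt_le_trans fd].
  rewrite E normrM mulrC ler_pdivlMr ?mulr_gt0// ler_wpM2l// ger0_norm; first by lra.
  by rewrite addr_ge0 ?sqrtr_ge0.
Qed.

Lemma boxfun_max f g : boxfun f -> boxfun g -> boxfun (fun a b => Num.max (f a b) (g a b)).
Proof.
move=> bf bg.
have -> : (fun a b => Num.max (f a b) (g a b)) =
    fun a b => g a b + (fun a b => Num.max 0 (f a b - g a b)) a b.
  apply/funext => a; apply/funext => b /=.
  have [h|h] : g a b <= f a b \/ f a b <= g a b by apply/orP; exact: le_total.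
    by rewrite (max_l h) max_r ?subr_ge0//; ring.
  by rewrite (max_r h) max_l ?subr_le0// addr0.
apply: boxfun_add => //; have bd := boxfun_add bf (boxfun_opp bg).
apply: (boxfun_lip bd ler01); case: (bd) => md [M dM] _.
- exact: measurable_maxr.
- exists M => a b ha hb; have := dM a b ha hb.
  have [h|h] : 0 <= f a b - g a b \/ f a b - g a b <= 0 by apply/orP; exact: le_total.
    by rewrite max_r.
  by rewrite max_l// normr0; exact: le_trans.
- move=> a b _ _ a' b' _ _; rewrite mul1r; set x := f a b - g a b; set y := f a' b' - g a' b'.
  have [hx|hx] : 0 <= x \/ x <= 0 by apply/orP; exact: le_total.
    have [hy|hy] : 0 <= y \/ y <= 0 by apply/orP; exact: le_total.
      by rewrite !max_r.
    by rewrite (max_r hx) (max_l hy) subr0 !ger0_norm//; lra.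
  have [hy|hy] : 0 <= y \/ y <= 0 by apply/orP; exact: le_total.
    by rewrite (max_l hx) (max_r hy) sub0r normrN (ger0_norm hy) ler0_norm; lra.
  by rewrite (max_l hx) (max_l hy) subrr normr0.
Qed.

Lemma boxfun_min f g : boxfun f -> boxfun g -> boxfun (fun a b => Num.min (f a b) (g a b)).
Proof.
move=> bf bg; have := boxfun_opp (boxfun_max (boxfun_opp bf) (boxfun_opp bg)).
rewrite (_ : (fun a b => - _) = fun a b => Num.min (f a b) (g a b))//.
by apply/funext => a; apply/funext => b; rewrite oppr_max !opprK.
Qed.

Lemma boxfun_bound f : boxfun f -> exists2 M, 0 <= M & boxed (fun a b => `|f a b| <= M).
Proof.
move=> [_ [M fM] _]; exists `|M| => // a b ha hb.
by apply: le_trans (fM a b ha hb) _; exact: ler_norm.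
Qed.

End BoxFunctions.

Ltac derive_simpl := rewrite /= ?fctE /= /GRing.scale /=.

(** * The half-angle substitution *)

Section HalfAngle.
Context {R : realType}.
Variables s c : R.
Hypothesis s0 : 0 < s.
Hypothesis c0 : 0 < c.
Hypothesis sc : s ^+ 2 + c ^+ 2 = 1.

Definition rt (m : R) : R := Num.sqrt (1 - s ^+ 2 * m ^+ 2).
(** With s m = sin t this is tan (t / 2), and [rt] is cos t; [tw] is the inverse substitution 2 q /
    (1 + q^2) = sin t. In the variable q both w and sqrt (1 - w^2) are rational. *)
Definition half (m : R) : R := s * m / (1 + rt m).
Definition tw (q : R) : R := 2 * q / (1 + q ^+ 2).
Definition tw' (q : R) : R := 2 * (1 - q ^+ 2) / (1 + q ^+ 2) ^+ 2.
Definition half' (m : R) : R := s / (rt m * (1 + rt m)).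

Lemma rt_arg m : 0 <= m <= 1 -> c ^+ 2 <= 1 - s ^+ 2 * m ^+ 2.
Proof.
move=> /andP[m0 m1]; have : m ^+ 2 <= 1 by rewrite expr_le1.
have s2 : 0 <= s ^+ 2 by rewrite sqr_ge0.
by move=> h; have := ler_wpM2l s2 h; move: sc; lra.
Qed.

Lemma rt_ge m : 0 <= m <= 1 -> c <= rt m.
Proof.
move=> hm; rewrite -[c]ger0_norm ?(ltW c0)// -sqrtr_sqr; apply: ler_wsqrtr; exact: rt_arg.
Qed.

Lemma rt_sqr m : 0 <= m <= 1 -> rt m ^+ 2 = 1 - s ^+ 2 * m ^+ 2.
Proof. by move=> hm; rewrite sqr_sqrtr// (le_trans _ (rt_arg hm))// sqr_ge0. Qed.

Lemma rt_gt0 m : 0 <= m <= 1 -> 0 < rt m.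
Proof. by move=> hm; apply: lt_le_trans (rt_ge hm). Qed.

Lemma half_sqr m : 0 <= m <= 1 -> 1 + half m ^+ 2 = 2 / (1 + rt m) /\ 1 - half m ^+ 2 = 2 * rt m / (1 + rt m).
Proof.
move=> hm; have r0 := rt_gt0 hm; have rn : rt m != 0 by rewrite gt_eqF.
have r1 : 1 + rt m != 0 by rewrite gt_eqF// addr_gt0.
have E : half m ^+ 2 = (1 - rt m ^+ 2) / (1 + rt m) ^+ 2.
  by rewrite /half expr_div_n exprMn rt_sqr//; congr (_ / _); ring.
by rewrite E; split; field.
Qed.

Lemma tw_half m : 0 <= m <= 1 -> tw (half m) = s * m.
Proof.
move=> hm; have r0 := rt_gt0 hm; have rn : rt m != 0 by rewrite gt_eqF.
have r1 : 1 + rt m != 0 by rewrite gt_eqF// addr_gt0.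
by have [E _] := half_sqr hm; rewrite /tw E /half; field; rewrite r1.
Qed.

(** Makes the Jacobian of the substitution rational in the new variable. *)
Lemma half'E m : 0 <= m <= 1 -> half' m = s * ((1 + half m ^+ 2) ^+ 2 / (2 * (1 - half m ^+ 2))).
Proof.
move=> hm; have r0 := rt_gt0 hm; have rn : rt m != 0 by rewrite gt_eqF.
have r1 : 1 + rt m != 0 by rewrite gt_eqF// addr_gt0.
by have [-> ->] := half_sqr hm; rewrite /half'; field; rewrite r1 rn.
Qed.

Lemma is_derive_rt (m : R) : 0 <= m <= 1 -> is_derive m (1 : R) rt (- (s ^+ 2 * m / rt m)).
Proof.
move=> hm; have p0 : 0 < 1 - s ^+ 2 * m ^+ 2 by apply: lt_le_trans (rt_arg hm); rewrite exprn_gt0.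
have ds := is_derive1_sqrt p0.
have di : is_derive m (1 : R) (fun z => 1 - s ^+ 2 * z ^+ 2) (- (2 * s ^+ 2 * m)).
  have := is_deriveB (is_derive_cst (1 : R) m (1 : R)) (is_deriveZ (s ^+ 2) (is_deriveX 2 (is_derive_id m (1 : R)))).
  by move=> h; apply: is_derive_eq h _; derive_simpl; rewrite ?expr1; ring.
have := @is_derive1_comp _ Num.sqrt (fun z => 1 - s ^+ 2 * z ^+ 2) m _ _ ds di.
move=> h; apply: is_derive_eq h _; rewrite -/(rt m); have := rt_gt0 hm => r0.
by field; rewrite gt_eqF.
Qed.

Lemma is_derive_half (m : R) : 0 <= m <= 1 -> is_derive m (1 : R) half (half' m).
Proof.
move=> hm; have r0 := rt_gt0 hm; have rn : rt m != 0 by rewrite gt_eqF.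
have r1 : 1 + rt m != 0 by rewrite gt_eqF// addr_gt0.
have d1 : is_derive m (1 : R) (fun z : R => 1 + rt z) (- (s ^+ 2 * m / rt m)).
  have h := is_deriveD (is_derive_cst (1 : R) m (1 : R)) (is_derive_rt hm).
  by apply: is_derive_eq h _; rewrite add0r.
have d2 := @is_deriveV _ (fun z : R => 1 + rt z) m _ _ r1 d1.
have d3 := is_deriveM (is_deriveZ s (is_derive_id m (1 : R))) d2.
apply: is_derive_eq d3 _; derive_simpl; rewrite /half'.
have E : s ^+ 2 * m ^+ 2 = 1 - rt m ^+ 2 by rewrite rt_sqr//; ring.
transitivity (s * ((rt m + rt m ^+ 2 + s ^+ 2 * m ^+ 2) / (rt m * (1 + rt m) ^+ 2))).
  by field; rewrite r1 rn.
by rewrite E; field; rewrite r1 rn.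
Qed.

Lemma half_ge0 m : 0 <= m -> 0 <= half m.
Proof. by move=> m0; rewrite divr_ge0 ?mulr_ge0 ?addr_ge0 ?sqrtr_ge0// ltW. Qed.

Lemma half0 : half 0 = 0. Proof. by rewrite /half mulr0 mul0r. Qed.

Lemma half_le1 m : 0 <= m <= 1 -> half m <= s / (1 + c).
Proof.
move=> hm; have /andP[m0 m1] := hm; have r := rt_ge hm; rewrite /half.
apply: ler_pM; rewrite ?mulr_ge0 ?invr_ge0 ?addr_ge0 ?(ltW s0) ?sqrtr_ge0//.
  by rewrite ler_piMr// ltW.
by rewrite lef_pV2 ?posrE ?addr_gt0 ?rt_gt0// lerD2l.
Qed.

Lemma half1 : half 1 = s / (1 + c).
Proof.
rewrite /half mulr1 /rt expr1n mulr1 (_ : 1 - s ^+ 2 = c ^+ 2); last by move: sc; lra.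
by rewrite sqrtr_sqr ger0_norm// ltW.
Qed.

Lemma rt_decr m m' : 0 <= m -> m < m' -> m' <= 1 -> rt m' < rt m.
Proof.
move=> m0 mm m1; have h' : 0 <= m' <= 1 by apply/andP; split; lra.
have h : 0 <= m <= 1 by apply/andP; split; lra.
rewrite /rt ltr_sqrt; last by apply: lt_le_trans (rt_arg h); rewrite exprn_gt0.
rewrite ltrD2l ltrN2 ltr_pM2l ?exprn_gt0// ltr_sqr ?nnegrE//; lra.
Qed.

Lemma half_incr m m' : 0 <= m -> m < m' -> m' <= 1 -> half m < half m'.
Proof.
move=> m0 mm m1; have r := rt_decr m0 mm m1.
have h' : 0 <= m' <= 1 by apply/andP; split; lra.
have r0 := rt_gt0 h'; have r1 : 0 < rt m by exact: lt_trans r.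
rewrite /half ltr_pdivrMr ?addr_gt0// mulrAC ltr_pdivlMr ?addr_gt0//.
rewrite -!mulrA ltr_pM2l//; have a1 : m * (1 + rt m') <= m * (1 + rt m) by rewrite ler_wpM2l// lerD2l ltW.
apply: (le_lt_trans a1); rewrite ltr_pM2r// addr_gt0//.
Qed.

Lemma is_derive_tw (q : R) : is_derive q (1 : R) tw (tw' q).
Proof.
have p0 : 0 < 1 + q ^+ 2 by rewrite ltr_pwDl// sqr_ge0.
have p1 : 1 + q ^+ 2 != 0 by rewrite gt_eqF.
have d1 : is_derive q (1 : R) (fun z : R => 1 + z ^+ 2) (2 * q).
  have h := is_deriveD (is_derive_cst (1 : R) q (1 : R)) (is_deriveX 2 (is_derive_id q (1 : R))).
  by apply: is_derive_eq h _; derive_simpl; rewrite ?expr1; ring.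
have d3 := is_deriveM (is_deriveZ 2 (is_derive_id q (1 : R))) (@is_deriveV _ (fun z : R => 1 + z ^+ 2) q _ _ p1 d1).
apply: is_derive_eq d3 _; derive_simpl; rewrite ?expr1 /tw'.
by field.
Qed.

Lemma tw_covar (q : R) : `|q| <= 1 -> Num.sqrt (1 - tw q ^+ 2) = (1 - q ^+ 2) / (1 + q ^+ 2).
Proof.
move=> q1; have p0 : 0 < 1 + q ^+ 2 by rewrite ltr_pwDl// sqr_ge0.
have q2 : q ^+ 2 <= 1 by rewrite -real_normK ?num_real// expr_le1.
have -> : 1 - tw q ^+ 2 = ((1 - q ^+ 2) / (1 + q ^+ 2)) ^+ 2.
  by rewrite /tw; field; rewrite gt_eqF.
by rewrite sqrtr_sqr ger0_norm// divr_ge0 ?subr_ge0// ltW.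
Qed.

End HalfAngle.

(** * The profile: fan, middle region and wedge *)

Section Profile.
Context {R : realType}.
Variables s c eps tau b1 b2 p0 p1 p2 q1 : R.
Hypothesis s0 : 0 < s.
Hypothesis c0 : 0 < c.
Hypothesis sc : s ^+ 2 + c ^+ 2 = 1.
Hypothesis eps0 : 0 < eps.
Hypothesis tau0 : 0 < tau.

(** The product of the squared distances of (X, m) to (0, 1) and to (0, -1). *)
Definition fanS (X m : R) : R := (X ^+ 2 + (1 - m) ^+ 2) * (X ^+ 2 + (1 + m) ^+ 2).
Definition fanr (X m : R) : R := (Num.sqrt (fanS X m))^-1.
(** The curvature of the circle through (X, m), (0, 1) and (0, -1), constant along the arcs that
    leave the end of the wall on the centre line. It vanishes on X = 0 off these points, which is
    how the fan removes the jump. *)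
Definition fan (X m : R) : R := 2 * X * fanr X m.
Definition fanX (X m : R) : R := 2 * fanr X m - X * fanr X m ^+ 3 * (4 * X ^+ 3 + 4 * X * (1 + m ^+ 2)).
Definition fanm (X m : R) : R := - (X * fanr X m ^+ 3 * (4 * X ^+ 2 * m - 4 * m * (1 - m ^+ 2))).
(** The arc of curvature s, that is (X + c / s)^2 + m^2 = 1 / s^2; it separates the fan from the
    region w = s m. *)
Definition xs (m : R) : R := (rt s m - c) / s.

Lemma fanS_gt0 (X m : R) : 0 < X -> 0 < fanS X m.
Proof. by move=> X0; rewrite mulr_gt0// ltr_pwDl ?exprn_gt0 ?sqr_ge0. Qed.

Lemma fanr_gt0 (X m : R) : 0 < X -> 0 < fanr X m.
Proof. by move=> X0; rewrite invr_gt0 sqrtr_gt0 fanS_gt0. Qed.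

Lemma fanr_sqr (X m : R) : 0 < X -> fanr X m ^+ 2 * fanS X m = 1.
Proof.
move=> X0; have S0 := fanS_gt0 m X0; rewrite /fanr exprVn sqr_sqrtr ?(ltW S0)//.
by rewrite mulVf// gt_eqF.
Qed.

Lemma fan_gt0 (X m : R) : 0 < X -> 0 < fan X m.
Proof. by move=> X0; rewrite mulr_gt0 ?fanr_gt0// mulr_gt0. Qed.

Lemma is_derive_fanr (f : R -> R) (g : R -> R) (x df dg : R) : 0 < f x ->
  is_derive x (1 : R) f df -> is_derive x (1 : R) g dg ->
  is_derive x (1 : R) (fun z => fanr (f z) (g z))
    (- (fanr (f x) (g x) ^+ 3 * ((2 * f x ^+ 3 + 2 * f x * (1 + g x ^+ 2)) * df
       + (2 * f x ^+ 2 * g x - 2 * g x * (1 - g x ^+ 2)) * dg))).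
Proof.
move=> f0 hf hg; have S0 := fanS_gt0 (g x) f0.
have dS : is_derive x (1 : R) (fun z => fanS (f z) (g z))
   ((4 * f x ^+ 3 + 4 * f x * (1 + g x ^+ 2)) * df + (4 * f x ^+ 2 * g x - 4 * g x * (1 - g x ^+ 2)) * dg).
  have f2 := is_deriveX 2 hf.
  have gm := is_deriveX 2 (is_deriveB (is_derive_cst (1 : R) x (1 : R)) hg).
  have gp := is_deriveX 2 (is_deriveD (is_derive_cst (1 : R) x (1 : R)) hg).
  have h := is_deriveM (is_deriveD f2 gm) (is_deriveD f2 gp).
  by apply: is_derive_eq h _; derive_simpl; rewrite ?expr1; ring.
have ds := @is_derive1_comp _ Num.sqrt (fun z => fanS (f z) (g z)) x _ _ (is_derive1_sqrt S0) dS.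
have n0 : Num.sqrt (fanS (f x) (g x)) != 0 by rewrite gt_eqF// sqrtr_gt0.
have h := @is_deriveV _ (fun z => Num.sqrt (fanS (f z) (g z))) x _ _ n0 ds.
apply: is_derive_eq h _; derive_simpl; rewrite /fanr; field; exact: n0.
Qed.

Lemma is_derive_fanX (X m : R) : 0 < X -> is_derive X (1 : R) (fan ^~ m) (fanX X m).
Proof.
move=> X0.
have d1 := is_derive_fanr X0 (is_derive_id X (1 : R)) (is_derive_cst m X (1 : R)).
have h := is_deriveM (is_deriveZ 2 (is_derive_id X (1 : R))) d1.
apply: is_derive_eq h _; derive_simpl; rewrite /fanX; ring.
Qed.

Lemma is_derive_fanm (X m : R) : 0 < X -> is_derive m (1 : R) (fan X) (fanm X m).
Proof.
move=> X0.
have d1 := is_derive_fanr X0 (is_derive_cst X m (1 : R)) (is_derive_id m (1 : R)).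
have h := is_deriveZ (2 * X) d1.
apply: is_derive_eq h _; derive_simpl; rewrite /fanm; ring.
Qed.

(** A perfect square, so that the root in [covar] disappears inside the fan. *)
Lemma fan_sqr (X m : R) : 0 < X ->
  1 - m ^+ 2 * fan X m ^+ 2 = (fanr X m * (X ^+ 2 + 1 - m ^+ 2)) ^+ 2.
Proof.
move=> X0; rewrite -{1}(fanr_sqr m X0) /fan /fanS; ring.
Qed.

(** The sign of the left side compares [fan] with s. The first factor on the right is a quadratic in
    s X with roots rt - c and rt + c, and the second is positive; as long as s X <= 2 c, only the
    smaller root matters, and it is s times [xs m]. *)
Lemma fan_factor (X m : R) : 0 <= m <= 1 -> s ^+ 2 * fanS X m - (2 * X) ^+ 2 =
  ((s * X) ^+ 2 - 2 * (s * X) * rt s m + (rt s m ^+ 2 - c ^+ 2)) * (X ^+ 2 + 1 - m ^+ 2 + 2 * X * rt s m / s).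
Proof.
move=> hm; have r2 := rt_sqr sc hm.
have -> : c ^+ 2 = 1 - s ^+ 2 by rewrite -sc; ring.
have -> : (s * X) ^+ 2 - 2 * (s * X) * rt s m + (rt s m ^+ 2 - (1 - s ^+ 2)) =
    s ^+ 2 * (X ^+ 2 + 1 - m ^+ 2 - 2 * X * rt s m / s).
  by rewrite r2; field; rewrite gt_eqF.
transitivity (s ^+ 2 * ((X ^+ 2 + 1 - m ^+ 2) ^+ 2 - (2 * X / s) ^+ 2 * rt s m ^+ 2)).
  by rewrite r2 /fanS; field; rewrite gt_eqF.
by field; rewrite gt_eqF.
Qed.

Lemma fan_lt (X m : R) : 0 < X -> X <= 2 * c / s -> 0 <= m <= 1 -> (fan X m < s) = (X < xs m).
Proof.
move=> X0 Xc hm; have r0 := rt_gt0 c0 sc hm; have S0 := fanS_gt0 m X0.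
have q0 := fanr_gt0 m X0; have qS := fanr_sqr m X0.
have r2 := rt_sqr sc hm; have rc := rt_ge c0 sc hm.
have E := fan_factor X hm.
have pos : 0 < X ^+ 2 + 1 - m ^+ 2 + 2 * X * rt s m / s.
  have : 0 < 2 * X * rt s m / s by rewrite divr_gt0// !mulr_gt0.
  have : m ^+ 2 <= 1 by case/andP: hm => m0 m1; rewrite expr_le1.
  have : 0 < X ^+ 2 by rewrite exprn_gt0.
  by move=> *; lra.
have lhs : (fan X m < s) = (0 < s ^+ 2 * fanS X m - (2 * X) ^+ 2).
  rewrite subr_gt0 -[in LHS]ltr_sqr ?nnegrE ?(ltW s0) ?(ltW (fan_gt0 m X0))//.
  rewrite -(ltr_pM2r S0) /fan exprMn -mulrA qS mulr1//.
rewrite lhs E pmulr_lgt0//.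
rewrite (_ : _ + _ = (s * X - (rt s m - c)) * (s * X - (rt s m + c))); last by ring.
have sX : s * X <= 2 * c by rewrite mulrC -ler_pdivlMr.
rewrite /xs ltr_pdivlMr// [X * s]mulrC.
have [h|h] := ltP (s * X) (rt s m - c).
  by rewrite nmulr_rgt0 ?subr_lt0//; lra.
apply/negbTE; rewrite -leNgt mulr_ge0_le0// ?subr_ge0//; lra.
Qed.

Definition beta (mu : R) : R := b1 * mu + b2 * mu ^+ 2.
Definition wedgeP (z mu : R) : R := p0 + p1 * mu + p2 * z.
(* z is the distance to the side, and beta mu the width of the wedge at height mu. *)
Definition qf (z mu : R) : R := mu + (beta mu - z) * wedgeP z mu.
Definition qz (z mu : R) : R := - wedgeP z mu + (beta mu - z) * p2.
Definition qmu (z mu : R) : R := 1 + (b1 + 2 * b2 * mu) * wedgeP z mu + (beta mu - z) * p1.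

(** The maximum switches the wedge on where tau - a is below its width, and the minimum replaces s
    by the curvature of the fan where that is smaller. Written in this way the profile is Lipschitz
    by construction, with no gluing along the interfaces. *)
Definition prof (a m : R) : R :=
  tw (half s m + Num.max 0 (beta (half s m) - (tau - a)) * wedgeP (tau - a) (half s m))
  + m * Num.min 0 (fan (a + eps) m - s).

Definition prof_x (a m : R) : R :=
  if a + eps < xs m then m * fanX (a + eps) m
  else if tau - a < beta (half s m) then - (tw' (qf (tau - a) (half s m)) * qz (tau - a) (half s m))
  else 0.

Definition prof_m (a m : R) : R :=
  if a + eps < xs m then fan (a + eps) m + m * fanm (a + eps) m
  else if tau - a < beta (half s m) then
    tw' (qf (tau - a) (half s m)) * (qmu (tau - a) (half s m) * half' s m)
  else s.

Hypothesis b10 : 0 <= b1.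
Hypothesis b20 : 0 <= b2.
Hypothesis b12 : 0 < b1 + b2.
Hypothesis q11 : q1 < 1.
Hypothesis hq : forall z mu, 0 <= mu <= s / (1 + c) -> 0 <= z <= beta mu -> `|qf z mu| <= q1.
(** The arc and the wedge stay apart at every height. The condition after it keeps X below the
    second root in [fan_factor]. *)
Hypothesis hsep : forall m, 0 <= m <= 1 -> xs m + beta (half s m) <= tau.
Hypothesis htau : tau + eps <= 2 * c / s.

Let halfI m : 0 <= m <= 1 -> 0 <= half s m <= s / (1 + c).
Proof. by move=> hm; rewrite half_ge0 ?half_le1//; case/andP: hm. Qed.

Lemma beta_ge0 mu : 0 <= mu -> 0 <= beta mu.
Proof. by move=> m0; rewrite addr_ge0 ?mulr_ge0 ?sqr_ge0. Qed.

Lemma beta_incr mu mu' : 0 <= mu -> mu < mu' -> beta mu < beta mu'.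
Proof.
move=> m0 mm; have m' : 0 < mu' by lra.
rewrite /beta -subr_gt0.
have -> : b1 * mu' + b2 * mu' ^+ 2 - (b1 * mu + b2 * mu ^+ 2) = (mu' - mu) * (b1 + b2 * (mu' + mu)) by ring.
rewrite mulr_gt0 ?subr_gt0//; have [b1'|b1'] := ltP 0 b1.
  by rewrite ltr_pwDl// mulr_ge0//; lra.
by rewrite ltr_wpDl// mulr_gt0; move: b12; lra.
Qed.

Lemma xs_decr m m' : 0 <= m -> m < m' -> m' <= 1 -> xs m' < xs m.
Proof.
by move=> m0 mm m1; rewrite ltr_pM2r ?invr_gt0// ltrD2r; exact: (rt_decr s0 c0 sc).
Qed.

Lemma xs_ge0 m : 0 <= m <= 1 -> 0 <= xs m.
Proof. by move=> hm; rewrite divr_ge0 ?(ltW s0)// subr_ge0 (rt_ge c0 sc). Qed.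

Let Xpos a : 0 <= a <= tau -> 0 < a + eps /\ a + eps <= 2 * c / s.
Proof. by move=> /andP[a0 a1]; have e := eps0; have h := htau; split; lra. Qed.

Lemma prof_fan a m : 0 <= a <= tau -> 0 <= m <= 1 -> a + eps < xs m -> prof a m = m * fan (a + eps) m.
Proof.
move=> ha hm h; have [X0 Xc] := Xpos ha; have e := eps0; have hs := hsep hm.
have lt : fan (a + eps) m < s by rewrite fan_lt.
rewrite /prof max_l; last by lra.
by rewrite min_r; [rewrite mul0r addr0 (tw_half c0 sc hm); ring|lra].
Qed.

Lemma prof_nofan a m : 0 <= a <= tau -> 0 <= m <= 1 -> xs m <= a + eps ->
  prof a m = tw (half s m + Num.max 0 (beta (half s m) - (tau - a)) * wedgeP (tau - a) (half s m)).
Proof.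
move=> ha hm h; have [X0 Xc] := Xpos ha.
have ge : s <= fan (a + eps) m by rewrite leNgt fan_lt// -leNgt.
by rewrite /prof min_l ?subr_ge0// mulr0 addr0.
Qed.

Lemma prof_mid a m : 0 <= a <= tau -> 0 <= m <= 1 -> xs m <= a + eps -> beta (half s m) <= tau - a ->
  prof a m = s * m.
Proof.
move=> ha hm h1 h2; rewrite prof_nofan// max_l ?subr_le0// mul0r addr0.
exact: (tw_half c0 sc hm).
Qed.

Lemma prof_wedge a m : 0 <= a <= tau -> 0 <= m <= 1 -> tau - a <= beta (half s m) ->
  prof a m = tw (qf (tau - a) (half s m)).
Proof.
move=> ha hm h; rewrite prof_nofan//; first by rewrite max_r ?subr_ge0.
by have hs := hsep hm; have e := eps0; lra.
Qed.

Let qtot a m := half s m + Num.max 0 (beta (half s m) - (tau - a)) * wedgeP (tau - a) (half s m).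

Lemma qtot_le a m : 0 <= a <= tau -> 0 <= m <= 1 -> `|qtot a m| <= q1.
Proof.
move=> ha hm; have hh := halfI hm; rewrite /qtot.
have [h|h] : 0 <= beta (half s m) - (tau - a) \/ beta (half s m) - (tau - a) <= 0 by apply/orP; exact: le_total.
  by rewrite max_r//; apply: (hq hh); case/andP: ha => a0 a1; apply/andP; split; lra.
rewrite max_l// mul0r addr0.
have := hq hh (_ : 0 <= beta (half s m) <= beta (half s m)); rewrite lexx beta_ge0 ?andbT//; last by case/andP: hh.
by move=> /(_ isT); rewrite /qf subrr mul0r addr0.
Qed.

Let q10 : 0 <= q1.
Proof.
have h0 : 0 <= (0 : R) <= tau by rewrite lexx ltW.
have h1 : 0 <= (0 : R) <= 1 by rewrite lexx ler01.
exact: le_trans (normr_ge0 _) (qtot_le h0 h1).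
Qed.

(** A lower bound for 1 - w^2 = ((1 - q^2) / (1 + q^2))^2 when |q| <= q1, since 1 + q^2 <= 2; it
    serves as the v0 of [profile]. *)
Definition prof_gap : R := ((1 - q1 ^+ 2) / 2) ^+ 2.

Lemma prof_gap_gt0 : 0 < prof_gap.
Proof. by rewrite exprn_gt0// divr_gt0// subr_gt0 expr_lt1. Qed.

Lemma tw_gap q : `|q| <= q1 -> tw q ^+ 2 + prof_gap <= 1.
Proof.
move=> hq1; have q2 : q ^+ 2 <= q1 ^+ 2 by rewrite -(real_normK (num_real q)) lerXn2r// nnegrE.
have q12 : q1 ^+ 2 < 1 by rewrite expr_lt1.
have p0' : 0 < 1 + q ^+ 2 by rewrite ltr_pwDl// sqr_ge0.
have -> : tw q ^+ 2 = 1 - ((1 - q ^+ 2) / (1 + q ^+ 2)) ^+ 2 by rewrite /tw; field; rewrite gt_eqF.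
have : prof_gap <= ((1 - q ^+ 2) / (1 + q ^+ 2)) ^+ 2.
  rewrite /prof_gap lerXn2r ?nnegrE ?divr_ge0// ?subr_ge0; try lra.
  rewrite ler_pdivlMr// mulrAC ler_pdivrMr//.
  have := sqr_ge0 q; set x := q ^+ 2 in q2 *; set y := q1 ^+ 2 in q2 q12 * => x0.
  have : 0 <= x * (1 - y) by rewrite mulr_ge0//; lra.
  by move=> *; nra.
by lra.
Qed.

Lemma prof_lt1 a m : 0 <= a <= tau -> 0 <= m <= 1 -> prof a m ^+ 2 + prof_gap <= 1.
Proof.
move=> ha hm; have [h|h] := ltP (a + eps) (xs m); last first.
  by rewrite prof_nofan//; apply: tw_gap; exact: qtot_le.
have [X0 Xc] := Xpos ha; have m0 : 0 <= m by case/andP: hm.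
rewrite prof_fan//; have lt : fan (a + eps) m < s by rewrite fan_lt.
have hh := halfI hm.
have : `|half s m| <= q1.
  have := hq hh (_ : 0 <= beta (half s m) <= beta (half s m)); rewrite lexx beta_ge0 ?andbT//; last by case/andP: hh.
  by move=> /(_ isT); rewrite /qf subrr mul0r addr0.
move=> /tw_gap; rewrite (tw_half c0 sc hm); apply: le_trans; rewrite lerD2r.
have f0 := ltW (fan_gt0 m X0).
have mf0 : 0 <= m * fan (a + eps) m by exact: mulr_ge0.
have sm0 : 0 <= s * m by rewrite mulr_ge0// ltW.
by rewrite lerXn2r ?nnegrE// [s * m]mulrC ler_wpM2l// ltW.
Qed.

Lemma prof_0 a : 0 <= a <= tau -> prof a 0 = 0.
Proof.
move=> ha; rewrite /prof half0 mul0r addr0 max_l; last first.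
  by case/andP: ha => a0 a1; rewrite /beta; rewrite expr0n/= !mulr0; lra.
by rewrite mul0r addr0 /tw mulr0 mul0r.
Qed.

Lemma is_derive_qf_z (z mu : R) : is_derive z (1 : R) (fun z => qf z mu) (qz z mu).
Proof.
have d1 := is_derive_affine (-1) (beta mu) z; have d2 := is_derive_affine p2 (p0 + p1 * mu) z.
have h := is_deriveD (is_derive_cst mu z (1 : R)) (is_deriveM d1 d2).
have -> : (fun z => qf z mu) = cst mu + (fun y => -1 * y + beta mu) * (fun y => p2 * y + (p0 + p1 * mu)).
  by apply/funext => y; rewrite /qf /wedgeP !fctE; ring.
by apply: is_derive_eq h _; derive_simpl; rewrite /qz /wedgeP; ring.
Qed.

Lemma is_derive_qf_mu (z mu : R) : is_derive mu (1 : R) (fun mu => qf z mu) (qmu z mu).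
Proof.
have id1 := is_derive_id mu (1 : R).
have d1 : is_derive mu (1 : R) (fun y => beta y - z) (b1 + 2 * b2 * mu).
  have h := is_deriveB (is_deriveD (is_deriveZ b1 id1) (is_deriveZ b2 (is_deriveX 2 id1))) (is_derive_cst z mu (1 : R)).
  by apply: is_derive_eq h _; derive_simpl; rewrite ?expr1; ring.
have d2 := is_derive_affine p1 (p0 + p2 * z) mu.
have h := is_deriveD id1 (is_deriveM d1 d2).
have -> : (fun mu => qf z mu) = id + (fun y => beta y - z) * (fun y => p1 * y + (p0 + p2 * z)).
  by apply/funext => y; rewrite /qf /wedgeP !fctE; ring.
by apply: is_derive_eq h _; derive_simpl; rewrite /qmu /wedgeP; ring.
Qed.

Lemma prof_dx (a m : R) : 0 < m < 1 -> 0 < a < tau -> a != xs m - eps -> a != tau - beta (half s m) ->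
  is_derive a (1 : R) (prof ^~ m) (prof_x a m).
Proof.
move=> /andP[m0 m1] /andP[a0 a1] n1 n2.
have hm : 0 <= m <= 1 by rewrite !ltW.
have hs := hsep hm; have e := eps0.
rewrite /prof_x; have [h|h] := ltP (a + eps) (xs m).
  have nr : \forall z \near a, m * fan (z + eps) m = prof z m.
    have : a \in `]0, Num.min tau (xs m - eps)[ by rewrite in_itv/= a0 lt_min a1/=; lra.
    move=> /near_in_itvoo; apply: filterS => z; rewrite in_itv/= lt_min => /and3P[z0 z1 z2].
    by rewrite prof_fan//; [rewrite !ltW|lra].
  have X0 : 0 < a + eps by lra.
  have d1 := is_derive_affine 1 eps a.
  have X1 : 0 < 1 * a + eps by rewrite mul1r.
  have h1 := is_deriveZ m (@is_derive1_comp _ (fan ^~ m) (fun y => 1 * y + eps) a _ _ (is_derive_fanX m X1) d1).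
  apply: near_eq_is_derive nr _; rewrite (_ : (fun z => m * fan (z + eps) m) = m \*: (fan ^~ m \o (fun y => 1 * y + eps))).
    by apply: is_derive_eq h1 _; derive_simpl; rewrite mul1r; ring.
  by apply/funext => z; rewrite /= mul1r.
have {n1}h1 : xs m < a + eps by rewrite lt_def h andbT; apply/eqP => E; move/eqP: n1; apply; lra.
have [h2|h2] := ltP (tau - a) (beta (half s m)).
  have nr : \forall z \near a, tw (qf (tau - z) (half s m)) = prof z m.
    have : a \in `]Num.max 0 (tau - beta (half s m)), tau[ by rewrite in_itv/= gt_max a0 a1 andbT/=; lra.
    move=> /near_in_itvoo; apply: filterS => z; rewrite in_itv/= gt_max => /andP[/andP[z0 z1] z2].
    by rewrite prof_wedge//; [rewrite !ltW|lra].
  apply: near_eq_is_derive nr _.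
  have d1 := is_derive_affine (-1) tau a.
  have d2 := @is_derive1_comp _ (fun z => qf z (half s m)) (fun y => -1 * y + tau) a _ _ (is_derive_qf_z _ _) d1.
  have d3 := @is_derive1_comp _ (@tw R) _ a _ _ (is_derive_tw _) d2.
  rewrite (_ : (fun z => _) = (@tw R) \o ((fun z => qf z (half s m)) \o (fun y => -1 * y + tau))).
    by apply: is_derive_eq d3 _; derive_simpl; rewrite mulN1r addrC; ring.
  by apply/funext => z; rewrite /= mulN1r addrC.
have {n2}h2' : beta (half s m) < tau - a.
  by rewrite lt_def h2 andbT; apply/eqP => E; move/eqP: n2; apply; lra.
have nr : \forall z \near a, cst (s * m) z = prof z m.
  have : a \in `]Num.max 0 (xs m - eps), Num.min tau (tau - beta (half s m))[.
    by rewrite in_itv/= gt_max lt_min a0 a1/=; apply/andP; split; lra.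
  move=> /near_in_itvoo; apply: filterS => z; rewrite in_itv/= gt_max lt_min => /andP[/andP[z0 z1] /andP[z2 z3]].
  by rewrite prof_mid//; [rewrite !ltW|lra|lra].
exact: near_eq_is_derive nr (is_derive_cst (s * m) a (1 : R)).
Qed.

Let cont (f : R -> R) (x df : R) : is_derive x (1 : R) f df -> f @ x --> f x.
Proof. by move=> h; apply: differentiable_continuous; apply/derivable1_diffP; exact: ex_derive. Qed.

Let near_gt (f : R -> R) (x a : R) : f z @[z --> x] --> f x -> a < f x -> \forall z \near x, a < f z.
Proof.
move=> /cvgrPdist_lt cf h; have := cf (f x - a); rewrite subr_gt0 => /(_ h).
by apply: filterS => z; rewrite ltr_norml => /andP[_]; lra.
Qed.

Let near_lt (f : R -> R) (x a : R) : f z @[z --> x] --> f x -> f x < a -> \forall z \near x, f z < a.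
Proof.
move=> /cvgrPdist_lt cf h; have := cf (a - f x); rewrite subr_gt0 => /(_ h).
by apply: filterS => z; rewrite ltr_norml => /andP[]; lra.
Qed.

Lemma xs_cvg (m : R) : 0 <= m <= 1 -> xs z @[z --> m] --> xs m.
Proof.
move=> hm; apply: cvgM; last exact: cvg_cst.
by apply: cvgB; [exact: cont (is_derive_rt c0 sc hm)|exact: cvg_cst].
Qed.

Lemma beta_cvg (m : R) : 0 <= m <= 1 -> beta (half s z) @[z --> m] --> beta (half s m).
Proof.
move=> hm; have h := cont (is_derive_half c0 sc hm).
by apply: cvgD; apply: cvgM; [exact: cvg_cst|exact: h|exact: cvg_cst|apply: cvgM; exact: h].
Qed.

Lemma prof_dm (a m : R) : 0 < m < 1 -> 0 < a < tau -> a + eps != xs m -> tau - a != beta (half s m) ->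
  is_derive m (1 : R) (prof a) (prof_m a m).
Proof.
move=> hm01 /andP[a0 a1] n1 n2; have /andP[m0 m1] := hm01.
have hm : 0 <= m <= 1 by rewrite !ltW.
have ha : 0 <= a <= tau by rewrite !ltW.
have hs := hsep hm; have e := eps0.
have nI : \forall z \near m, 0 <= z <= 1.
  have : m \in `]0, 1[ by rewrite in_itv/= m0.
  by move=> /near_in_itvoo; apply: filterS => z; rewrite in_itv/= => /andP[z0 z1]; rewrite !ltW.
rewrite /prof_m; have [h|h] := ltP (a + eps) (xs m).
  have nr : \forall z \near m, z * fan (a + eps) z = prof a z.
    have n3 : \forall z \near m, a + eps < xs z by exact: (near_gt (xs_cvg hm) h).
    by apply: filterS2 nI n3 => z hz h'; rewrite prof_fan.
  have X0 : 0 < a + eps by lra.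
  apply: near_eq_is_derive nr _.
  have h1 := is_deriveM (is_derive_id m (1 : R)) (is_derive_fanm m X0).
  by apply: is_derive_eq h1 _; derive_simpl; ring.
have {n1}h1 : xs m < a + eps by rewrite lt_def h andbT.
have [h2|h2] := ltP (tau - a) (beta (half s m)).
  have nr : \forall z \near m, tw (qf (tau - a) (half s z)) = prof a z.
    have n3 : \forall z \near m, tau - a < beta (half s z) by exact: (near_gt (f := fun z => beta (half s z)) (beta_cvg hm) h2).
    by apply: filterS2 nI n3 => z hz h'; rewrite prof_wedge// ltW.
  apply: near_eq_is_derive nr _.
  have d2 := @is_derive1_comp _ (qf (tau - a)) (half s) m _ _ (is_derive_qf_mu _ _) (is_derive_half c0 sc hm).
  have d3 := @is_derive1_comp _ (@tw R) _ m _ _ (is_derive_tw _) d2.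
  by apply: is_derive_eq d3 _; derive_simpl; ring.
have {n2}h2' : beta (half s m) < tau - a by rewrite lt_def h2 n2.
have nr : \forall z \near m, s * z = prof a z.
  have n3 : \forall z \near m, xs z < a + eps by exact: (near_lt (xs_cvg hm) h1).
  have n4 : \forall z \near m, beta (half s z) < tau - a by exact: (near_lt (f := fun z => beta (half s z)) (beta_cvg hm) h2').
  by apply: filterS3 nI n3 n4 => z hz z1 z2; rewrite prof_mid// ltW.
apply: near_eq_is_derive nr _.
have h3 := is_deriveZ s (is_derive_id m (1 : R)).
by apply: is_derive_eq h3 _; derive_simpl; ring.
Qed.

(** An interface that is an injective function of m is met at most once by a line a = const. This
    supplies the finite exceptional lists for the derivative in m. *)
Lemma unique_bad (f : R -> R) (x : R) : (forall m m', 0 < m -> m < m' -> m' < 1 -> f m != f m') ->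
  exists t : seq R, forall m, 0 < m < 1 -> m \notin t -> x != f m.
Proof.
move=> inj; have [[m0 [hm0 e0]]|no] := pselect (exists m0, 0 < m0 < 1 /\ x = f m0).
  exists [:: m0] => m hm; rewrite mem_seq1 => mm; apply/eqP => e1.
  have ff : f m = f m0 by rewrite -e0 -e1.
  case/andP: hm => h1 h2; case/andP: hm0 => h3 h4.
  move: mm; rewrite neq_lt => /orP[mm|mm].
    by have := inj m m0 h1 mm h4; rewrite ff eqxx.
  by have := inj m0 m h3 mm h2; rewrite ff eqxx.
by exists [::] => m hm _; apply/eqP => e1; apply: no; exists m.
Qed.

Let boxI := boxfun tau.

Lemma boxfun_exp (f : R -> R -> R) n : boxfun tau f -> boxfun tau (fun a b => f a b ^+ n).
Proof.
move=> bf; elim: n => [|n ih]; first exact: boxfun_cst.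
rewrite (_ : (fun a b => _) = (fun a b => f a b * f a b ^+ n)); first exact: boxfun_mul.
by apply/funext => a; apply/funext => b; rewrite exprS.
Qed.

Ltac box := repeat first [assumption | apply: boxfun_cst | apply: boxfun_fst | apply: boxfun_snd |
  apply: boxfun_add | apply: boxfun_opp | apply: boxfun_mul | apply: boxfun_exp | apply: boxfun_max | apply: boxfun_min].

(** [boxfun] gives the measurability, the bounds and the Lipschitz constant; the partial derivatives
    exist off the two interfaces, which every line parallel to an axis meets at most twice. *)
Lemma profile_prof : exists K, profile tau K prof_gap prof prof_x prof_m.
Proof.
have brt : boxfun tau (fun _ m => rt s m).
  apply: (@boxfun_sqrt _ _ (fun _ m => 1 - s ^+ 2 * m ^+ 2) (c ^+ 2)); first by rewrite exprn_gt0.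
    by move=> a b _ hb; exact: (rt_arg sc).
  by box.
have bhalf : boxfun tau (fun _ m => half s m).
  rewrite /half; box; apply: (@boxfun_inv _ _ (fun _ m => 1 + rt s m) 1) => //; last by box.
  by move=> a b _ _; rewrite lerDl sqrtr_ge0.
have bhalf' : boxfun tau (fun _ m => half' s m).
  rewrite /half'; box; apply: (@boxfun_inv _ _ (fun _ m => rt s m * (1 + rt s m)) c) => //; last by box.
  move=> a b _ hb; have r := rt_ge c0 sc hb; apply: (le_trans r); rewrite ler_peMr ?lerDl ?sqrtr_ge0//.
have bxs : boxfun tau (fun _ m => xs m) by rewrite /xs; box.
have bfanr : boxfun tau (fun a m => fanr (a + eps) m).
  (* The shift keeps X >= eps and so avoids the singularity of the fan at (0, 1); without it the
     profile would not be Lipschitz. *)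
  have lo : boxed tau (fun a m => eps ^+ 4 <= fanS (a + eps) m).
    move=> a b /andP[a0 a1] _; rewrite /fanS (_ : eps ^+ 4 = eps ^+ 2 * eps ^+ 2); last by ring.
    have e2 : eps ^+ 2 <= (a + eps) ^+ 2 by rewrite lerXn2r ?nnegrE ?addr_ge0 ?(ltW eps0)// lerDr.
    by apply: ler_pM; rewrite ?sqr_ge0//; apply: (le_trans e2); rewrite lerDl sqr_ge0.
  have bS : boxfun tau (fun a m => Num.sqrt (fanS (a + eps) m)).
    apply: (@boxfun_sqrt _ _ (fun a m => fanS (a + eps) m) (eps ^+ 4)) => //; first by rewrite exprn_gt0.
    by rewrite /fanS; box.
  apply: (@boxfun_inv _ _ (fun a m => Num.sqrt (fanS (a + eps) m)) (Num.sqrt (eps ^+ 4))) => //.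
    by rewrite sqrtr_gt0 exprn_gt0.
  by move=> a b ha hb; apply: ler_wsqrtr; exact: lo.
have bfan : boxfun tau (fun a m => fan (a + eps) m) by rewrite /fan; box.
have bfanX : boxfun tau (fun a m => fanX (a + eps) m) by rewrite /fanX; box.
have bfanm : boxfun tau (fun a m => fanm (a + eps) m) by rewrite /fanm; box.
have btw (f : R -> R -> R) : boxfun tau f -> boxfun tau (fun a b => tw (f a b)).
  move=> bf; rewrite /tw; box; apply: (@boxfun_inv _ _ (fun a b => 1 + f a b ^+ 2) 1) => //; last by box.
  by move=> a b _ _; rewrite lerDl sqr_ge0.
have btw' (f : R -> R -> R) : boxfun tau f -> boxfun tau (fun a b => tw' (f a b)).
  move=> bf; rewrite /tw'; box; apply: (@boxfun_inv _ _ (fun a b => (1 + f a b ^+ 2) ^+ 2) 1) => //; last by box.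
  by move=> a b _ _; rewrite expr_ge1 ?addr_ge0 ?sqr_ge0// lerDl sqr_ge0.
have bqf : boxfun tau (fun a m => qf (tau - a) (half s m)) by rewrite /qf /beta /wedgeP; box.
have bqz : boxfun tau (fun a m => qz (tau - a) (half s m)) by rewrite /qz /beta /wedgeP; box.
have bqm : boxfun tau (fun a m => qmu (tau - a) (half s m)) by rewrite /qmu /beta /wedgeP; box.
have bprof : boxfun tau prof.
  by rewrite /prof; apply: boxfun_add; [apply: btw; rewrite /beta /wedgeP; box|box].
have bx1 : boxfun tau (fun a m => m * fanX (a + eps) m) by box.
have bx2 : boxfun tau (fun a m => - (tw' (qf (tau - a) (half s m)) * qz (tau - a) (half s m))).
  by apply: boxfun_opp; apply: boxfun_mul => //; exact: btw'.
have bm1 : boxfun tau (fun a m => fan (a + eps) m + m * fanm (a + eps) m) by box.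
have bm2 : boxfun tau (fun a m => tw' (qf (tau - a) (half s m)) * (qmu (tau - a) (half s m) * half' s m)).
  by apply: boxfun_mul; [exact: btw'|box].
have c1 : measurable_fun setT (fun p : R * R => p.1 + eps < xs p.2).
  apply: measurable_fun_ltr; last by case: bxs.
  by apply: measurable_funD => //; exact: measurable_fst.
have c2 : measurable_fun setT (fun p : R * R => tau - p.1 < beta (half s p.2)).
  apply: measurable_fun_ltr; first by apply: measurable_funB => //; exact: measurable_fst.
  have bb : boxfun tau (fun _ m => beta (half s m)) by rewrite /beta; box.
  by case: bb.
have [_ _ [K0 hK0]] := bprof.
have [K1 K10 hK1] := boxfun_bound bx1; have [K2 K20 hK2] := boxfun_bound bx2.
have [K3 K30 hK3] := boxfun_bound bm1; have [K4 K40 hK4] := boxfun_bound bm2.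
exists (`|K0| + K1 + K2 + K3 + K4 + s); split.
- split; first by case: bprof.
    apply: measurable_fun_ifT => //; first by case: bx1.
    by apply: measurable_fun_ifT => //; case: bx2.
  apply: measurable_fun_ifT => //; first by case: bm1.
  by apply: measurable_fun_ifT => //; case: bm2.
- move=> a a' b b' ha ha' hb hb'; apply: (le_trans (hK0 a b ha hb a' b' ha' hb')).
  apply: ler_wpM2r; first by rewrite addr_ge0.
  have := ler_norm K0; have := s0; lra.
- exact: prof_lt1.
- exact: prof_0.
- move=> b hb; exists [:: xs b - eps; tau - beta (half s b)] => a ha.
  by rewrite !inE negb_or => /andP[h1 h2]; exact: prof_dx.
- move=> a ha.
  have [t1 ht1] : exists t : seq R, forall m, 0 < m < 1 -> m \notin t -> a + eps != xs m.
    apply: unique_bad => m m' h1 h2 h3; rewrite gt_eqF//; apply: xs_decr => //; exact: ltW.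
  have [t2 ht2] : exists t : seq R, forall m, 0 < m < 1 -> m \notin t -> tau - a != beta (half s m).
    apply: unique_bad => m m' h1 h2 h3; rewrite lt_eqF//; apply: beta_incr; first by apply: half_ge0 => //; exact: ltW.
    by apply: (half_incr s0 c0 sc) => //; exact: ltW.
  exists (t1 ++ t2) => b hb; rewrite mem_cat negb_or => /andP[h1 h2].
  by apply: prof_dm => //; [exact: ht1|exact: ht2].
- move=> a b ha hb; have k0 := normr_ge0 K0; have s' := s0.
  have := hK1 a b ha hb; have := hK2 a b ha hb; have := hK3 a b ha hb; have := hK4 a b ha hb.
  rewrite /prof_x /prof_m; case: ifP => _; first by move=> *; split; lra.
  case: ifP => _; first by move=> *; split; lra.
  by rewrite normr0 (gtr0_norm s0); move=> *; split; lra.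
Qed.

End Profile.

Section IntegralBounds.
Context {R : realType}.
Local Notation mu := (@lebesgue_measure R).

Lemma Rintegral_FTC (G g : R -> R) (a b : R) : a <= b ->
  (forall x, a <= x <= b -> is_derive x (1 : R) G (g x)) ->
  (forall x, a <= x <= b -> {for x, continuous g}) ->
  mu.-integrable `[a, b] (EFin \o g) /\ \int[mu]_(x in `[a, b]) g x = G b - G a.
Proof.
move=> ab dG cg.
have wc : {within `[a, b], continuous g}.
  apply: continuous_in_subspaceT => x; rewrite mem_setE in_itv/=; exact: cg.
have gi : mu.-integrable `[a, b] (EFin \o g).
  by apply: continuous_compact_integrable => //; exact: segment_compact.
split=> //; move: ab; rewrite le_eqVlt => /predU1P[ab|ab].
  by rewrite -ab set_itv1 Rintegral_set1 subrr.
have lab : a <= a <= b by rewrite lexx ltW.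
have lbb : a <= b <= b by rewrite lexx ltW.
have cG x : a <= x <= b -> {for x, continuous G}.
  move=> hx; have h := dG x hx; apply: differentiable_continuous.
  by apply/derivable1_diffP; exact: ex_derive.
rewrite /Rintegral (@continuous_FTC2 R g G a b ab wc)//.
  split.
  - move=> x; rewrite in_itv/= => /andP[h1 h2].
    by have h := dG x (_ : a <= x <= b); apply: ex_derive; apply: h; rewrite !ltW.
  - by apply: cvg_at_right_filter; exact: cG.
  - by apply: cvg_at_left_filter; exact: cG.
move=> x; rewrite in_itv/= => /andP[h1 h2]; have hx : a <= x <= b by rewrite !ltW.
by rewrite derive1E; have h := dG x hx; exact: derive_val.
Qed.

(** All the energies of the profile are estimated in this way: a majorant with an explicit
    antiderivative. *)
Lemma Rintegral_FTC_le (f G g : R -> R) (a b : R) : a <= b ->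
  (forall x, a <= x <= b -> is_derive x (1 : R) G (g x)) ->
  (forall x, a <= x <= b -> {for x, continuous g}) ->
  mu.-integrable `[a, b] (EFin \o f) -> (forall x, a <= x <= b -> f x <= g x) ->
  \int[mu]_(x in `[a, b]) f x <= G b - G a.
Proof.
move=> ab dG cg fi fg; have [gi <-] := Rintegral_FTC ab dG cg.
by apply: le_Rintegral => // x /=; rewrite in_itv/=; exact: fg.
Qed.

Lemma is_derive_continuous_at (f : R -> R) (x df : R) : is_derive x (1 : R) f df -> {for x, continuous f}.
Proof. by move=> h; apply: differentiable_continuous; apply/derivable1_diffP; exact: ex_derive. Qed.

Lemma is_derive_ge0_le (f f' : R -> R) (a b : R) : a <= b ->
  (forall x, a <= x <= b -> is_derive x (1 : R) f (f' x)) ->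
  (forall x, a <= x <= b -> 0 <= f' x) -> f a <= f b.
Proof.
move=> ab df f0.
have [||z] := @MVT_segment R f f' a b ab.
- by move=> x; rewrite in_itv/= => /andP[h1 h2]; apply: df; rewrite !ltW.
- apply: continuous_in_subspaceT => x; rewrite mem_setE in_itv/= => hx.
  exact: is_derive_continuous_at (df x hx).
rewrite in_itv/= => hz E; rewrite -subr_ge0 E mulr_ge0 ?f0//; by rewrite subr_ge0.
Qed.

Lemma cvg_pow (f : R -> R) (x : R) n : f w @[w --> x] --> f x -> f w ^+ n @[w --> x] --> f x ^+ n.
Proof.
move=> hf; elim: n => [|n ih]; first exact: cvg_cst.
rewrite exprS (_ : (fun w => f w ^+ n.+1) = fun w => f w * f w ^+ n); first exact: cvgM.
by apply/funext => w; rewrite exprS.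
Qed.

End IntegralBounds.

(** * The divergence integral over the fan *)

Section FanIntegral.
Context {R : realType}.
Local Notation mu := (@lebesgue_measure R).
Variables s c : R.
Hypothesis s0 : 0 < s.
Hypothesis c0 : 0 < c.
Hypothesis sc : s ^+ 2 + c ^+ 2 = 1.

(* Taylor polynomial of 1 - sqrt (1 - x). *)
Definition sqrtT (x : R) : R := x / 2 + x ^+ 2 / 8 + x ^+ 3 / 16 + 5 * x ^+ 4 / 128 +
  7 * x ^+ 5 / 256 + 21 * x ^+ 6 / 1024.

Lemma is_derive_sqrtT (x : R) : is_derive x (1 : R) sqrtT
  (2^-1 + x / 4 + 3 * x ^+ 2 / 16 + 5 * x ^+ 3 / 32 + 35 * x ^+ 4 / 256 + 63 * x ^+ 5 / 512).
Proof.
have i := is_derive_id x (1 : R).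
have h := is_deriveD (is_deriveD (is_deriveD (is_deriveD (is_deriveD (is_deriveZ (2^-1) i) (is_deriveZ (8^-1) (is_deriveX 2 i)))
    (is_deriveZ (16^-1) (is_deriveX 3 i))) (is_deriveZ (5 / 128) (is_deriveX 4 i))) (is_deriveZ (7 / 256) (is_deriveX 5 i)))
    (is_deriveZ (21 / 1024) (is_deriveX 6 i)).
rewrite (_ : sqrtT = 2^-1 \*: id + 8^-1 \*: id ^+ 2 + 16^-1 \*: id ^+ 3 + (5 / 128) \*: id ^+ 4 + (7 / 256) \*: id ^+ 5 + (21 / 1024) \*: id ^+ 6).
  by apply: is_derive_eq h _; derive_simpl; rewrite ?expr1; field.
by apply/funext => z; rewrite /sqrtT; derive_simpl; field.
Qed.

(** Apart from a constant this is minus the Taylor remainder of 1 - sqrt (1 - x) at x = 1 - v^2, and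
    that remainder has positive coefficients. The proof sees the sign after taking (1 - z)^6 out of
    the derivative. *)
Lemma sqrtT_incr (v u : R) : 0 <= v -> v <= u -> u <= 1 ->
  v + sqrtT (1 - v ^+ 2) <= u + sqrtT (1 - u ^+ 2).
Proof.
move=> v0 vu u1.
pose X : R -> R := fun z => 1 - z ^+ 2.
pose g : R -> R := fun z => 1 - z * (1 + X z / 2 + 3 * X z ^+ 2 / 8 + 5 * X z ^+ 3 / 16 + 35 * X z ^+ 4 / 128 + 63 * X z ^+ 5 / 256).
pose g' : R -> R := fun z => (1 - z) ^+ 6 * (256 + 843 * z + 1218 * z ^+ 2 + 938 * z ^+ 3 + 378 * z ^+ 4 + 63 * z ^+ 5) / 256.
have gE z : g z = g' z by rewrite /g /g' /X; field.
have dX (z : R) : is_derive z (1 : R) X (- (2 * z)).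
  have h := is_deriveB (is_derive_cst (1 : R) z (1 : R)) (is_deriveX 2 (is_derive_id z (1 : R))).
  by apply: is_derive_eq h _; derive_simpl; rewrite ?expr1; ring.
have dG (z : R) : is_derive z (1 : R) (fun z => z + sqrtT (X z)) (g z).
  have h := is_deriveD (is_derive_id z (1 : R)) (@is_derive1_comp _ sqrtT X z _ _ (is_derive_sqrtT _) (dX z)).
  by apply: is_derive_eq h _; derive_simpl; rewrite /g; field.
suff h z : v <= z <= u -> 0 <= g z by exact: (is_derive_ge0_le vu (fun z _ => dG z) h).
move=> /andP[v_z z_u]; rewrite gE /g'; have z0 : 0 <= z := le_trans v0 v_z.
have z1 : 0 <= 1 - z by rewrite subr_ge0 (le_trans z_u).
apply: divr_ge0; last exact: ler0n.
apply: mulr_ge0; first exact: exprn_ge0.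
do 4 (apply: addr_ge0; last by apply: mulr_ge0; [exact: ler0n|exact: exprn_ge0]).
by apply: addr_ge0; [exact: ler0n|apply: mulr_ge0; [exact: ler0n|]].
Qed.

(** Truncating a series with positive coefficients can only decrease an increment, so differences of
    roots are bounded from below by polynomials. *)
Lemma sqrtT_diff (x y a b : R) : 0 <= b -> b <= a -> a <= 1 -> a ^+ 2 = 1 - x -> b ^+ 2 = 1 - y ->
  sqrtT y - sqrtT x <= a - b.
Proof.
move=> b0 ba a1 ax by_; have := sqrtT_incr b0 ba a1.
rewrite (_ : 1 - b ^+ 2 = y); last by rewrite by_; ring.
by rewrite (_ : 1 - a ^+ 2 = x); [lra|rewrite ax; ring].
Qed.

(** If F = fan X m with (X, m) in the unit disc, then F X = sqrt (1 - m^2 F^2) - sqrt (1 - F^2).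
    [fanp] is twice this with Taylor polynomials in place of the roots, hence a lower bound for 2 F
    X, and [fanQ] is its primitive in F. *)
Definition fanp (m F : R) : R := 2 * (sqrtT (F ^+ 2) - sqrtT (m ^+ 2 * F ^+ 2)).
Definition fanQ (m F : R) : R := F ^+ 3 * (1 - m ^+ 2) / 3 + F ^+ 5 * (1 - m ^+ 4) / 20 +
  F ^+ 7 * (1 - m ^+ 6) / 56 + 5 * F ^+ 9 * (1 - m ^+ 8) / 576 + 7 * F ^+ 11 * (1 - m ^+ 10) / 1408 +
  21 * F ^+ 13 * (1 - m ^+ 12) / 6656.

Lemma is_derive_fanQ (m F : R) : is_derive F (1 : R) (fanQ m) (fanp m F).
Proof.
have i := is_derive_id F (1 : R).
pose k1 := (1 - m ^+ 2) / 3; pose k2 := (1 - m ^+ 4) / 20; pose k3 := (1 - m ^+ 6) / 56.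
pose k4 := 5 * (1 - m ^+ 8) / 576; pose k5 := 7 * (1 - m ^+ 10) / 1408; pose k6 := 21 * (1 - m ^+ 12) / 6656.
have h := is_deriveD (is_deriveD (is_deriveD (is_deriveD (is_deriveD (is_deriveZ k1 (is_deriveX 3 i)) (is_deriveZ k2 (is_deriveX 5 i)))
    (is_deriveZ k3 (is_deriveX 7 i))) (is_deriveZ k4 (is_deriveX 9 i))) (is_deriveZ k5 (is_deriveX 11 i)))
    (is_deriveZ k6 (is_deriveX 13 i)).
rewrite (_ : fanQ m = k1 \*: id ^+ 3 + k2 \*: id ^+ 5 + k3 \*: id ^+ 7 + k4 \*: id ^+ 9 + k5 \*: id ^+ 11 + k6 \*: id ^+ 13).
  by apply: is_derive_eq h _; derive_simpl; rewrite /k1 /k2 /k3 /k4 /k5 /k6 /fanp /sqrtT; field.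
by apply/funext => z; rewrite /fanQ /k1 /k2 /k3 /k4 /k5 /k6; derive_simpl; field.
Qed.

Lemma fanQ_le (m F : R) : 0 <= m <= 1 -> 0 <= F -> 0 <= fanQ m F <= F * fanp m F.
Proof.
move=> /andP[m0 m1] F0.
have h (n k : nat) : 0 <= F ^+ n * (1 - m ^+ k) by rewrite mulr_ge0 ?exprn_ge0// subr_ge0 exprn_ile1.
have -> : F * fanp m F = F ^+ 3 * (1 - m ^+ 2) + F ^+ 5 * (1 - m ^+ 4) / 4 + F ^+ 7 * (1 - m ^+ 6) / 8 +
    5 * (F ^+ 9 * (1 - m ^+ 8)) / 64 + 7 * (F ^+ 11 * (1 - m ^+ 10)) / 128 + 21 * (F ^+ 13 * (1 - m ^+ 12)) / 512.
  by rewrite /fanp /sqrtT; field.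
rewrite /fanQ -!(mulrA 5) -!(mulrA 7) -!(mulrA 21).
move: (h 3 2) (h 5 4) (h 7 6) (h 9 8) (h 11 10) (h 13 12).
set x1 := F ^+ 3 * _; set x2 := F ^+ 5 * _; set x3 := F ^+ 7 * _; set x4 := F ^+ 9 * _; set x5 := F ^+ 11 * _; set x6 := F ^+ 13 * _.
by move=> *; apply/andP; split; lra.
Qed.

Lemma fanp_le (X m : R) : 0 < X -> 0 <= m <= 1 -> X ^+ 2 + m ^+ 2 <= 1 ->
  fanp m (fan X m) <= 2 * fan X m * X.
Proof.
move=> X0 /andP[m0 m1] Xm; have r0 := fanr_gt0 m X0; have rS := fanr_sqr m X0.
(* These are the two roots sqrt (1 - m^2 F^2) and sqrt (1 - F^2) at F = fan X m, in a form without
   roots other than [fanr]; the second needs X^2 + m^2 <= 1 for its sign. *)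
set a := fanr X m * (X ^+ 2 + 1 - m ^+ 2); set b := fanr X m * (1 - m ^+ 2 - X ^+ 2).
have ab : a - b = fan X m * X by rewrite /a /b /fan; ring.
have b2 : b ^+ 2 = 1 - fan X m ^+ 2 by rewrite -{1}rS /b /fan /fanS; ring.
have a2 : a ^+ 2 = 1 - m ^+ 2 * fan X m ^+ 2 by rewrite fan_sqr.
have b0 : 0 <= b by rewrite mulr_ge0 ?(ltW r0)//; lra.
have f0 := fan_gt0 m X0.
have ba : b <= a by rewrite -subr_ge0 ab mulr_ge0// ltW.
have a1 : a <= 1.
  rewrite -(expr_le1 (n := 2))//; last by exact: le_trans ba.
  by rewrite a2 gerBl mulr_ge0 ?sqr_ge0.
have := sqrtT_diff b0 ba a1 a2 b2; rewrite /fanp ab; lra.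
Qed.

(** Inside the unit disc the curvature increases with X, and the whole fan lies there. *)
Lemma xs_disc m : 0 <= m <= 1 -> xs s c m ^+ 2 + m ^+ 2 <= 1.
Proof.
move=> hm; have rc := rt_ge c0 sc hm; have r2 := rt_sqr sc hm.
rewrite -lerBrDr -(ler_pM2l (_ : 0 < s ^+ 2)) ?exprn_gt0//.
have -> : s ^+ 2 * xs s c m ^+ 2 = (rt s m - c) ^+ 2 by rewrite /xs; field; rewrite gt_eqF.
have -> : s ^+ 2 * (1 - m ^+ 2) = rt s m ^+ 2 - c ^+ 2.
  have c2 : c ^+ 2 = 1 - s ^+ 2 by rewrite -sc; ring.
  by rewrite r2 c2; ring.
have -> : rt s m ^+ 2 - c ^+ 2 = (rt s m - c) * (rt s m + c) by ring.
by rewrite expr2 ler_wpM2l ?subr_ge0//; have := c0; lra.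
Qed.

Lemma fan_xs m : 0 <= m <= 1 -> 0 < xs s c m -> fan (xs s c m) m = s.
Proof.
move=> hm x0; have E := fan_factor s0 sc (xs s c m) hm.
have sX : s * xs s c m = rt s m - c by rewrite /xs; field; rewrite gt_eqF.
rewrite sX in E; have E0 : s ^+ 2 * fanS (xs s c m) m = (2 * xs s c m) ^+ 2.
  by apply/eqP; rewrite -subr_eq0 E; apply/eqP; ring.
have rS := fanr_sqr m x0; have f0 := fan_gt0 m x0.
apply/eqP; rewrite -(eqrXn2 (n := 2))// ?(ltW s0) ?(ltW f0)//; apply/eqP.
by rewrite /fan exprMn -E0 -mulrA [fanS _ _ * _]mulrC rS mulr1.
Qed.

Lemma fan_le X m : 0 <= m <= 1 -> 0 < X -> X <= xs s c m -> fan X m <= s.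
Proof.
move=> hm X0 Xx; have E := fan_factor s0 sc X hm.
have rS := fanr_sqr m X0; have f0 := fan_gt0 m X0; have S0 := fanS_gt0 m X0.
have sX : s * X <= rt s m - c by move: Xx; rewrite /xs ler_pdivlMr// mulrC.
have r0 := rt_gt0 c0 sc hm.
rewrite -(ler_sqr (x := fan X m)) ?nnegrE ?(ltW f0) ?(ltW s0)// -(ler_pM2r S0).
rewrite [X in X <= _](_ : _ = (2 * X) ^+ 2); last by rewrite /fan exprMn -mulrA rS mulr1.
rewrite -subr_ge0 E mulr_ge0//.
  rewrite (_ : _ + _ = (rt s m - c - s * X) * (rt s m + c - s * X)); last by ring.
  by have c' := c0; rewrite mulr_ge0// subr_ge0//; lra.
have : 0 <= 2 * X * rt s m / s by rewrite divr_ge0 ?(ltW s0)// !mulr_ge0// ltW.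
have : m ^+ 2 <= 1 by case/andP: hm => m0 m1; rewrite expr_le1.
by have := sqr_ge0 X; move=> *; lra.
Qed.

(** Used on the slices near m = 1, where the arc is narrower than the shift and no fan is left. *)
Lemma fanQ_s m : 0 <= m <= 1 -> fanQ m s <= 2 * s ^+ 2 * xs s c m.
Proof.
move=> hm; have /andP[_ h] := fanQ_le hm (ltW s0).
have := xs_ge0 s0 c0 sc hm; rewrite le_eqVlt => /predU1P[x0|x0]; last first.
  have := fanp_le x0 hm (xs_disc hm); rewrite fan_xs// => h2.
  apply: (le_trans h); have := ler_wpM2l (ltW s0) h2.
  by move=> h3; apply: (le_trans h3); rewrite le_eqVlt; apply/orP; left; apply/eqP; ring.
have m1 : m = 1.
  have r2 := rt_sqr sc hm; have rc : rt s m = c.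
    by apply/eqP; rewrite -subr_eq0; move/esym/eqP : x0; rewrite mulf_eq0 invr_eq0 (gt_eqF s0) orbF.
  have : s ^+ 2 * (1 - m ^+ 2) = 0 by rewrite mulrBr mulr1; move: r2; rewrite rc; move: sc; lra.
  move=> /eqP; rewrite mulf_eq0 sqrf_eq0 (gt_eqF s0)/= subr_eq0 => /eqP m2.
  by apply/eqP; rewrite -(eqrXn2 (n := 2))// -?m2 ?expr1n//; case/andP: hm.
by rewrite -x0 mulr0 m1 /fanQ !expr1n !subrr !mulr0 !mul0r !addr0.
Qed.

(** With F = fan as variable, the integral of F^2 dX is F^2 X minus the integral of 2 F X dF.
    Replacing 2 F X by the smaller [fanp] gives the antiderivative F^2 X - fanQ, whose derivative
    dominates F^2 because F increases with X. The lower end X = eps accounts for the last term. *)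
Lemma fan_integral (eps m : R) : 0 < eps -> 0 <= m <= 1 -> eps <= xs s c m ->
  \int[mu]_(x in `[0, xs s c m - eps]) (fan (x + eps) m ^+ 2) <= s ^+ 2 * xs s c m - fanQ m s + s ^+ 2 * eps.
Proof.
move=> e0 hm ex; have x0 : 0 < xs s c m by exact: lt_le_trans ex.
pose F x := fan (x + eps) m; pose F' x := fanX (x + eps) m.
pose Th x := F x ^+ 2 * (x + eps) - fanQ m (F x).
pose g x := F x ^+ 2 + F' x * (2 * F x * (x + eps) - fanp m (F x)).
have dF (x : R) : 0 <= x -> is_derive x (1 : R) F (F' x).
  move=> hx; have X0 : 0 < 1 * x + eps by lra.
  have h := @is_derive1_comp _ (fan ^~ m) (fun y => 1 * y + eps) x _ _ (is_derive_fanX m X0) (is_derive_affine 1 eps x).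
  rewrite (_ : F = fan ^~ m \o (fun y => 1 * y + eps)); last by apply/funext => y; rewrite /F/= mul1r.
  by apply: is_derive_eq h _; rewrite mul1r mulr1.
have dTh (x : R) : 0 <= x -> is_derive x (1 : R) Th (g x).
  move=> hx; have h1 := is_derive_affine 1 eps x; have h2 := dF x hx.
  have h := is_deriveB (is_deriveM (is_deriveX 2 h2) h1) (@is_derive1_comp _ (fanQ m) F x _ _ (is_derive_fanQ m _) h2).
  rewrite (_ : Th = F ^+ 2 * (fun y => 1 * y + eps) - (fanQ m \o F)); last first.
    by apply/funext => y; rewrite /Th; derive_simpl; rewrite mul1r.
  by apply: is_derive_eq h _; derive_simpl; rewrite /g ?expr1; ring.
have cF (x : R) : 0 <= x -> F w @[w --> x] --> F x by move=> hx; exact: is_derive_continuous_at (dF x hx).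
have cr (x : R) : 0 <= x -> fanr (w + eps) m @[w --> x] --> fanr (x + eps) m.
  move=> hx; have X0 : 0 < 1 * x + eps by lra.
  have h := is_derive_continuous_at (is_derive_fanr (f := fun y => 1 * y + eps) (g := cst m) X0 (is_derive_affine 1 eps x) (is_derive_cst m x (1 : R))).
  have E : (fun w => fanr (w + eps) m) = (fun w => fanr (1 * w + eps) m) by apply/funext => y; rewrite mul1r.
  have -> : fanr (x + eps) m = fanr (1 * x + eps) m by rewrite mul1r.
  by rewrite E; exact: h.
have cI (x : R) : w + eps @[w --> x] --> x + eps by apply: cvgD; [exact: cvg_id|exact: cvg_cst].
have cX (f : R -> R) (x : R) n : f w @[w --> x] --> f x -> f w ^+ n @[w --> x] --> f x ^+ n.
  exact: cvg_pow.
have cg (x : R) : 0 <= x <= xs s c m - eps -> {for x, continuous g}.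
  move=> /andP[hx _]; have h1 := cF x hx; have h2 := cr x hx; have h3 := cI x.
  apply: cvgD; first exact: cX.
  apply: cvgM.
    apply: cvgB; first by apply: cvgM; [exact: cvg_cst|].
    apply: cvgM; first by apply: cvgM => //; exact: cX.
    apply: cvgD; first by apply: cvgM; [exact: cvg_cst|exact: (cX (fun w => w + eps))].
    apply: cvgM; last exact: cvg_cst.
    by apply: cvgM; [exact: cvg_cst|].
  apply: cvgB; first by apply: cvgM => //; apply: cvgM => //; exact: cvg_cst.
  have cT (f : R -> R) : f w @[w --> x] --> f x -> sqrtT (f w) @[w --> x] --> sqrtT (f x).
    by move=> hf; exact: (cvg_comp _ _ hf (is_derive_continuous_at (is_derive_sqrtT (f x)))).
  apply: cvgM; first exact: cvg_cst.
  apply: cvgB; first by apply: (cT (fun w => F w ^+ 2)); exact: cX.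
  by apply: (cT (fun w => m ^+ 2 * F w ^+ 2)); apply: cvgM; [exact: cvg_cst|exact: cX].
have fle (x : R) : 0 <= x <= xs s c m - eps -> F x ^+ 2 <= g x.
  move=> /andP[hx1 hx2]; rewrite /g lerDl; have X0 : 0 < x + eps by lra.
  have Xd : (x + eps) ^+ 2 + m ^+ 2 <= 1.
    apply: le_trans (xs_disc hm); rewrite lerD2r lerXn2r ?nnegrE ?(ltW X0) ?(ltW x0)//; lra.
  rewrite mulr_ge0//; last by rewrite subr_ge0; exact: fanp_le.
  have rS := fanr_sqr m X0; have r0 := fanr_gt0 m X0.
  (* Inserting fanr^2 * fanS = 1 in the first term shows the sign of F': it is nonnegative exactly
     where X^2 <= 1 - m^2. *)
  have -> : F' x = 2 * fanr (x + eps) m ^+ 3 * ((1 - m ^+ 2) ^+ 2 - (x + eps) ^+ 4).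
    rewrite (_ : F' x = 2 * (fanr (x + eps) m * (fanr (x + eps) m ^+ 2 * fanS (x + eps) m)) -
      (x + eps) * fanr (x + eps) m ^+ 3 * (4 * (x + eps) ^+ 3 + 4 * (x + eps) * (1 + m ^+ 2))); last by rewrite rS mulr1.
    by rewrite /fanS; ring.
  rewrite mulr_ge0 ?mulr_ge0 ?exprn_ge0 ?(ltW r0)// subr_ge0 (_ : (x + eps) ^+ 4 = ((x + eps) ^+ 2) ^+ 2); last by ring.
  by rewrite lerXn2r ?nnegrE ?sqr_ge0//; have := sqr_ge0 (x + eps); lra.
have b0 : 0 <= xs s c m - eps by rewrite subr_ge0.
have fi : mu.-integrable `[0, xs s c m - eps] (EFin \o (fun x => F x ^+ 2)).
  apply: continuous_compact_integrable; first exact: segment_compact.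
  apply: continuous_in_subspaceT => x; rewrite mem_setE in_itv/= => /andP[hx _].
  by apply: cX; exact: cF.
have := Rintegral_FTC_le b0 (fun x h => dTh x (proj1 (andP h))) cg fi fle.
move=> h; apply: (le_trans h); rewrite /Th /F subrK add0r fan_xs//.
have f0 := fan_gt0 m e0; have /andP[_ q1] := fanQ_le hm (ltW f0).
have ed : eps ^+ 2 + m ^+ 2 <= 1.
  by apply: le_trans (xs_disc hm); rewrite lerD2r lerXn2r ?nnegrE ?(ltW e0) ?(ltW x0).
have q2 := ler_wpM2l (ltW f0) (fanp_le e0 hm ed).
have fs : fan eps m <= s by exact: fan_le.
have : fan eps m ^+ 2 * eps <= s ^+ 2 * eps by rewrite ler_wpM2r ?(ltW e0)// lerXn2r ?nnegrE ?(ltW f0) ?(ltW s0).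
by move: q1 q2; lra.
Qed.

End FanIntegral.

(** * Exchange of integrals and substitution in the slices *)

Section SliceIntegrals.
Context {R : realType}.
Local Notation mu := (@lebesgue_measure R).

Lemma box_swap (f : R * R -> R) (tau M : R) :
  measurable_fun (setT : set (measurableTypeR R * measurableTypeR R)) f ->
  (forall a b, 0 <= a <= tau -> 0 <= b <= 1 -> `|f (a, b)| <= M) ->
  \int[mu]_(a in `[0, tau]) \int[mu]_(b in `[0, 1]) f (a, b) =
    \int[mu]_(b in `[0, 1]) \int[mu]_(a in `[0, tau]) f (a, b) /\
  mu.-integrable `[0, 1] (EFin \o (fun b => \int[mu]_(a in `[0, tau]) f (a, b))).
Proof.
move=> mf fM; pose F (p : R * R) : R := f p * \1_(`[0, tau] `*` `[0, 1]) p.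
have mB : measurable (`[0, tau] `*` `[0, 1] : set (measurableTypeR R * measurableTypeR R)).
  by apply: measurableX; exact: measurable_itv.
have F0 p : ~ ((0 <= p.1 <= tau) /\ (0 <= p.2 <= 1)) -> F p = 0.
  by move=> np; rewrite /F indicE memNset ?mulr0// => -[/=]; rewrite !in_itv/= => h1 h2; apply: np.
have Fi : area.-integrable setT (EFin \o F).
  apply: (@integrable_bounded_rect R _ 0 tau 0 1 `|M|) => //.
    by apply: measurable_funM => //; exact: measurable_indic.
  move=> p; rewrite /F indicE; case: (boolP (p \in _)) => [|_]; last by rewrite mulr0 normr0.
  move=> /set_mem[/=]; rewrite !in_itv/= => h1 h2; rewrite mulr1.
  by apply: (le_trans _ (ler_norm M)); have := fM _ _ h1 h2; case: p {h1 h2}.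
have E1 a : \int[mu]_b F (a, b) = ((fun a => \int[mu]_(b in `[0, 1]) f (a, b)) \_ `[0, tau]) a.
  rewrite patchE; case: (boolP (a \in _)) => ha; last first.
    transitivity (\int[mu]_b (0 : R)); last by rewrite /Rintegral integral0.
    apply: eq_Rintegral => b _; apply: F0 => -[h _].
    by move/negP: ha; apply; rewrite mem_setE/= in_itv.
  rewrite [RHS]Rintegral_mkcond; apply: eq_Rintegral => b _; rewrite patchE /F indicE.
  case: (boolP (b \in _)) => hb; first by rewrite mem_set ?mulr1//; split; exact: set_mem.
  by rewrite memNset ?mulr0// => -[_ h']; move/negP: hb; apply; exact: mem_set.
have E2 b : \int[mu]_a F (a, b) = ((fun b => \int[mu]_(a in `[0, tau]) f (a, b)) \_ `[0, 1]) b.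
  rewrite patchE; case: (boolP (b \in _)) => hb; last first.
    transitivity (\int[mu]_a (0 : R)); last by rewrite /Rintegral integral0.
    apply: eq_Rintegral => a _; apply: F0 => -[_ h].
    by move/negP: hb; apply; rewrite mem_setE/= in_itv.
  rewrite [RHS]Rintegral_mkcond; apply: eq_Rintegral => a _; rewrite patchE /F indicE.
  case: (boolP (a \in _)) => ha; first by rewrite mem_set ?mulr1//; split; exact: set_mem.
  by rewrite memNset ?mulr0// => -[h' _]; move/negP: ha; apply; exact: mem_set.
split.
  have := RFubini1 Fi; rewrite (RFubini2 Fi) => h.
  rewrite [LHS]Rintegral_mkcond [RHS]Rintegral_mkcond.
  transitivity (\int[mu]_a \int[mu]_b F (a, b)); first by apply: eq_Rintegral => a _; rewrite E1.
  by rewrite -h; apply: eq_Rintegral => b _; rewrite E2.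
have h : mu.-integrable setT (EFin \o (fun b => \int[mu]_a F (a, b))).
  exact: (integrable_fine (integrable_fubini_G Fi)).
have mI : measurable (`[0, 1] : set (measurableTypeR R)) by exact: measurable_itv.
have h' := integrableS measurableT mI (@subsetT _ _) h.
by apply: eq_integrable h' => // b hb; rewrite /= E2 patchE hb.
Qed.

Lemma Rintegral_le_const (f : R -> R) (C a b : R) : a <= b -> mu.-integrable `[a, b] (EFin \o f) ->
  (forall x, a <= x <= b -> f x <= C) -> \int[mu]_(x in `[a, b]) f x <= C * (b - a).
Proof.
move=> ab fi fC.
have := Rintegral_FTC_le ab (fun x _ => is_derive_affine C 0 x) (fun x _ => @cst_continuous R R C _) fi fC.
by rewrite (_ : C * b + 0 - (C * a + 0) = C * (b - a)); last by ring.
Qed.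

(** The substitution x = [half s m], running from 0 to s / (1 + c). The majorant may have one part
    in the new variable, weighted with the Jacobian, and one part in m itself. *)
Lemma half_substitution (s c : R) (f GI g PI p : R -> R) : 0 < c -> s ^+ 2 + c ^+ 2 = 1 ->
  mu.-integrable `[0, 1] (EFin \o f) ->
  (forall x, is_derive x (1 : R) GI (g x)) -> (forall x, {for x, continuous g}) ->
  (forall m, is_derive m (1 : R) PI (p m)) -> (forall m, {for m, continuous p}) ->
  (forall m, 0 <= m <= 1 -> f m <= half' s m * g (half s m) + p m) ->
  \int[mu]_(m in `[0, 1]) f m <= GI (s / (1 + c)) - GI 0 + (PI 1 - PI 0).
Proof.
move=> c0 sc fi dG cg dP cp fle.
have dh := is_derive_half c0 sc.
have dF (m : R) : 0 <= m <= 1 ->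
    is_derive m (1 : R) (fun m => GI (half s m) + PI m) (half' s m * g (half s m) + p m).
  move=> hm; have h := is_deriveD (@is_derive1_comp _ GI (half s) m _ _ (dG _) (dh m hm)) (dP m).
  by apply: is_derive_eq h _; rewrite mulrC.
have cF (m : R) : 0 <= m <= 1 -> {for m, continuous (fun m => half' s m * g (half s m) + p m)}.
  move=> hm; have ch : half s t @[t --> m] --> half s m by exact: is_derive_continuous_at (dh m hm).
  have cr : rt s t @[t --> m] --> rt s m by exact: is_derive_continuous_at (is_derive_rt c0 sc hm).
  have r0 := rt_gt0 c0 sc hm.
  apply: cvgD; last exact: cp.
  apply: cvgM; last by apply: (@continuous_comp _ _ _ (half s) g).
  apply: cvgM; first exact: cvg_cst.
  apply: cvgV; first by rewrite gt_eqF// mulr_gt0// addr_gt0.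
  by apply: cvgM => //; apply: cvgD => //; exact: cvg_cst.
have := Rintegral_FTC_le ler01 dF cF fi fle; rewrite (half1 c0 sc) half0.
by move=> h; apply: (le_trans h); rewrite le_eqVlt; apply/orP; left; apply/eqP; ring.
Qed.

End SliceIntegrals.

(** * Divergence and wall integrals of the profile *)

Section ProfileEnergy.
Context {R : realType}.
Local Notation mu := (@lebesgue_measure R).
Variables s c eps tau b1 b2 p0 p1 p2 q1 : R.
Hypothesis s0 : 0 < s.
Hypothesis c0 : 0 < c.
Hypothesis sc : s ^+ 2 + c ^+ 2 = 1.
Hypothesis eps0 : 0 < eps.
Hypothesis tau0 : 0 < tau.
Hypothesis b10 : 0 <= b1.
Hypothesis b20 : 0 <= b2.
Hypothesis b12 : 0 < b1 + b2.
Hypothesis q11 : q1 < 1.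
Local Notation beta := (beta b1 b2).
Local Notation qf := (qf b1 b2 p0 p1 p2).
Local Notation qz := (qz b1 b2 p0 p1 p2).
Local Notation qmu := (qmu b1 b2 p0 p1 p2).
Local Notation xs := (xs s c).
Local Notation mu1 := (s / (1 + c)).
Hypothesis hq : forall z x, 0 <= x <= mu1 -> 0 <= z <= beta x -> `|qf z x| <= q1.
Hypothesis hsep : forall m, 0 <= m <= 1 -> xs m + beta (half s m) <= tau.
Hypothesis htau : tau + eps <= 2 * c / s.
Local Notation w := (prof s eps tau b1 b2 p0 p1 p2).
Local Notation wx := (prof_x s c eps tau b1 b2 p0 p1 p2).
Local Notation wm := (prof_m s c eps tau b1 b2 p0 p1 p2).
Local Notation D := (divD w wx wm).

(** The Jacobian [half'] divided by s, as a rational function of the half-angle variable. *)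
Definition stretch (x : R) : R := (1 + x ^+ 2) ^+ 2 / (2 * (1 - x ^+ 2)).
(** The squared divergence in the wedge per unit of the half-angle variable instead of m. It is
    expanded so that the Jacobian occurs once as a factor and once as a divisor, and not at all in
    the mixed term. *)
Definition density (z x : R) : R :=
  4 / (1 + qf z x ^+ 2) ^+ 4 * ((1 - qf z x ^+ 2) ^+ 2 * qmu z x ^+ 2 * (s * stretch x)
    + 4 * (1 - qf z x ^+ 2) * qf z x * qmu z x * qz z x
    + 4 * qf z x ^+ 2 * qz z x ^+ 2 / (s * stretch x)).

Lemma half'_stretch m : 0 <= m <= 1 -> half' s m = s * stretch (half s m) /\ 0 < half' s m.
Proof.
move=> hm; split; first exact: (half'E c0 sc hm).
by have r0 := rt_gt0 c0 sc hm; rewrite divr_gt0// mulr_gt0// addr_gt0.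
Qed.

Let wedge_d (z m : R) : R := 2 / (1 + qf z (half s m) ^+ 2) ^+ 2 *
  ((1 - qf z (half s m) ^+ 2) * (qmu z (half s m) * half' s m) + 2 * qf z (half s m) * qz z (half s m)).

Lemma wedge_d_sqr z m : 0 <= m <= 1 -> wedge_d z m ^+ 2 = half' s m * density z (half s m).
Proof.
move=> hm; have [E h0] := half'_stretch hm; rewrite /density -E /wedge_d.
have n1 : half' s m != 0 by rewrite gt_eqF.
have n2 : 1 + qf z (half s m) ^+ 2 != 0 by rewrite gt_eqF// ltr_pwDl// sqr_ge0.
by field; rewrite n1 n2.
Qed.

Lemma wedge_d_continuous z m : wedge_d t m @[t --> z] --> wedge_d z m.
Proof.
rewrite /wedge_d; set x := half s m.
have cq : qf t x @[t --> z] --> qf z x by exact: is_derive_continuous_at (is_derive_qf_z b1 b2 p0 p1 p2 z x).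
have cP : wedgeP p0 p1 p2 t x @[t --> z] --> wedgeP p0 p1 p2 z x.
  by apply: cvgD; [exact: cvg_cst|apply: cvgM; [exact: cvg_cst|exact: cvg_id]].
have cB : beta x - t @[t --> z] --> beta x - z by apply: cvgB; [exact: cvg_cst|exact: cvg_id].
have cz : qz t x @[t --> z] --> qz z x.
  by apply: cvgD; [exact: cvgN|apply: cvgM; [|exact: cvg_cst]].
have cm : qmu t x @[t --> z] --> qmu z x.
  apply: cvgD; last by apply: cvgM; [|exact: cvg_cst].
  by apply: cvgD; [exact: cvg_cst|apply: cvgM; [exact: cvg_cst|]].
have c2 := @cvg_pow R _ _ 2 cq.
apply: cvgM.
  apply: cvgM; first exact: cvg_cst.
  apply: cvgV; first by rewrite gt_eqF// exprn_gt0// ltr_pwDl// sqr_ge0.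
  by apply: cvg_pow; apply: cvgD; [exact: cvg_cst|].
apply: cvgD.
  apply: cvgM; first by apply: cvgB; [exact: cvg_cst|].
  by apply: cvgM; [|exact: cvg_cst].
by apply: cvgM => //; apply: cvgM; [exact: cvg_cst|].
Qed.

Let Xpos a : 0 <= a <= tau -> 0 < a + eps /\ a + eps <= 2 * c / s.
Proof. by move=> /andP[a0 a1]; have e := eps0; have h := htau; split; lra. Qed.

(** The term m * [fanm] of the derivative in m cancels against the derivative of [covar] in a; this
    is the identity [key]. What remains is the curvature itself. *)
Lemma divD_fan a m : 0 <= a <= tau -> 0 <= m <= 1 -> a + eps < xs m -> D a m = fan (a + eps) m.
Proof.
move=> ha hm h; have [X0 Xc] := Xpos ha.
rewrite /divD /covar_x /covar (prof_fan p0 p1 p2 s0 c0 sc eps0 hsep htau ha hm h) /prof_x /prof_m h.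
set X := a + eps in X0 *.
have r0 := fanr_gt0 m X0; have rS := fanr_sqr m X0.
have m1 : m ^+ 2 <= 1 by case/andP: hm => m0 m1; rewrite expr_le1.
have d0 : 0 < X ^+ 2 + 1 - m ^+ 2 by have : 0 < X ^+ 2 by [rewrite exprn_gt0|]; lra.
rewrite exprMn (fan_sqr m X0) sqrtr_sqr ger0_norm; last by rewrite mulr_ge0// ltW.
have n1 : fanr X m != 0 by rewrite gt_eqF.
have n2 : X ^+ 2 + 1 - m ^+ 2 != 0 by rewrite gt_eqF.
have key : fanm X m * (X ^+ 2 + 1 - m ^+ 2) = 2 * m * X * fanX X m.
  rewrite (_ : fanX X m = 2 * (fanr X m * (fanr X m ^+ 2 * fanS X m)) -
    X * fanr X m ^+ 3 * (4 * X ^+ 3 + 4 * X * (1 + m ^+ 2))); last by rewrite rS mulr1.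
  by rewrite /fanm /fanS; ring.
rewrite -addrA -[RHS]addr0; congr (_ + _).
have -> : m * fan X m * (m * fanX X m) / (fanr X m * (X ^+ 2 + 1 - m ^+ 2)) =
    m * (2 * m * X * fanX X m) / (X ^+ 2 + 1 - m ^+ 2).
  by rewrite /fan; field; rewrite n1 n2.
by rewrite -key; field.
Qed.

Lemma divD_mid a m : xs m <= a + eps -> beta (half s m) <= tau - a -> D a m = s.
Proof.
move=> h1 h2; rewrite /divD /covar_x /prof_x /prof_m ltNge h1/= ltNge h2/=.
by rewrite mulr0 mul0r oppr0 addr0.
Qed.

Lemma divD_wedge a m : 0 <= a <= tau -> 0 <= m <= 1 -> tau - a < beta (half s m) ->
  D a m = wedge_d (tau - a) m.
Proof.
move=> ha hm h; have hs := hsep hm; have e := eps0; have /andP[a0 a1] := ha.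
have hh : 0 <= half s m <= mu1 by rewrite half_ge0 ?(half_le1 s0 c0 sc)//; case/andP: hm.
rewrite /divD /covar_x /covar (prof_wedge p0 p1 p2 s0 c0 sc eps0 hsep htau ha hm (ltW h)) /prof_x /prof_m.
rewrite ltNge (_ : xs m <= a + eps)/=; last by lra.
rewrite h; have qq : `|qf (tau - a) (half s m)| <= q1 by apply: hq => //; apply/andP; split; lra.
rewrite tw_covar; last by apply: (le_trans qq); exact: ltW.
rewrite /wedge_d /tw /tw'; set q := qf _ _ in qq *.
have q2 : q ^+ 2 < 1.
  rewrite -(real_normK (num_real q)) expr_lt1//; exact: le_lt_trans qq q11.
have n1 : 1 + q ^+ 2 != 0 by rewrite gt_eqF// ltr_pwDl// sqr_ge0.
have n2 : 1 - q ^+ 2 != 0 by rewrite subr_eq0 eq_sym lt_eqF.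
by field; rewrite n1 n2.
Qed.

Lemma Rintegral_split (f : R -> R) (a t b : R) : a <= t -> t <= b ->
  mu.-integrable `[a, b] (EFin \o f) ->
  \int[mu]_(x in `[a, b]) f x = \int[mu]_(x in `[a, t]) f x + \int[mu]_(x in `]t, b]) f x.
Proof.
move=> at_ tb fi; have := @Rintegral_itvB R f (BLeft a) (BRight b) t fi.
rewrite !bnd_simp => /(_ at_ tb) <-; by rewrite addrC subrK.
Qed.

Lemma profile_exists : exists K, profile tau K (prof_gap q1) w wx wm.
Proof. exact: (profile_prof s0 c0 sc eps0 tau0 b10 b20 b12 q11 hq hsep htau). Qed.

Lemma divD_measurable : measurable_fun setT (fun p : R * R => D p.1 p.2).
Proof.
have [K hp] := profile_exists; have [mw mwx mwm] := profile_measurable hp.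
by apply: measurable_funD => //; exact: (measurable_covar_x hp).
Qed.

Lemma divD_bounded : exists2 M, 0 <= M & forall a m, 0 <= a <= tau -> 0 <= m <= 1 -> 0 <= D a m ^+ 2 <= M.
Proof.
have [K hp] := profile_exists; have g0 := prof_gap_gt0 s0 c0 sc tau0 b10 b20 q11 hq.
exists ((K + K / Num.sqrt (prof_gap q1)) ^+ 2); first exact: sqr_ge0.
move=> a m ha hm; have hb := divD_bound g0 hp ha hm.
rewrite sqr_ge0/= -(real_normK (num_real (D a m))) lerXn2r ?nnegrE//.
exact: le_trans hb.
Qed.

Let slice_measurable m : measurable_fun setT (fun a => D a m ^+ 2).
Proof. by apply: measurable_funX; exact: (measurableT_comp divD_measurable (pair2_measurable m)). Qed.

Let slice_integrable m (x y : bool) (a b : R) : 0 <= m <= 1 -> [set` Interval (BSide x a) (BSide y b)] `<=` `[0, tau] ->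
  mu.-integrable [set` Interval (BSide x a) (BSide y b)] (EFin \o (fun a => D a m ^+ 2)).
Proof.
move=> hm sub; have [M M0 hM] := divD_bounded.
apply: measurable_bounded_integrable.
- exact: measurable_itv.
- exact: lebesgue_itv_lty.
- by apply: (measurable_funS measurableT) => //; exact: slice_measurable.
- apply: (@bounded_fun_in _ _ _ _ M) => t /sub/=; rewrite in_itv/= => ht.
  by have /andP[h1 h2] := hM t m ht hm; rewrite ger0_norm.
Qed.

Variables (Nf NI : R -> R -> R).
Hypothesis hN : forall z x, 0 <= x <= mu1 -> 0 <= z <= beta x -> density z x <= Nf z x.
Hypothesis dNI : forall z x, is_derive z (1 : R) (NI ^~ x) (Nf z x).
Hypothesis cNf : forall z x, {for z, continuous (Nf ^~ x)}.
Hypothesis NI0 : forall x, NI 0 x = 0.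

(** Fan, middle region and wedge are integrated separately, and the widths of the arc cancel. The
    loss s^2 beta of the middle region is written as half' * (s beta / stretch), so that it can be
    integrated in the half-angle variable together with the wedge. Shortening the fan by eps costs
    at most 2 s^2 eps; the constant 3 also covers the slices without fan. *)
Lemma divD_slice m : 0 <= m <= 1 -> \int[mu]_(a in `[0, tau]) (D a m ^+ 2) <=
  s ^+ 2 * tau - fanQ m s + 3 * s ^+ 2 * eps +
  half' s m * (NI (beta (half s m)) (half s m) - s * beta (half s m) / stretch (half s m)).
Proof.
move=> hm; have hs := hsep hm; have e := eps0; have x0 := xs_ge0 s0 c0 sc hm.
have hh : 0 <= half s m <= mu1 by rewrite half_ge0 ?(half_le1 s0 c0 sc)//; case/andP: hm.
have be0 : 0 <= beta (half s m) by apply: beta_ge0 => //; case/andP: hh.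
set be := beta (half s m) in hs be0 *.
pose X2 := tau - be.
have X20 : 0 <= X2 by rewrite /X2; lra.
have X2t : X2 <= tau by rewrite /X2; lra.
have [E h0] := half'_stretch hm.
have it : mu.-integrable `[0, tau] (EFin \o (fun a => D a m ^+ 2)).
  exact: slice_integrable.
rewrite (Rintegral_split X20 X2t it).
have wedge : \int[mu]_(a in `]X2, tau]) (D a m ^+ 2) <= half' s m * NI be (half s m).
  have -> : \int[mu]_(a in `]X2, tau]) (D a m ^+ 2) = \int[mu]_(a in `]X2, tau]) (wedge_d (tau - a) m ^+ 2).
    apply: eq_Rintegral => a /set_mem/=; rewrite in_itv/= => /andP[h1 h2].
    by rewrite divD_wedge//; [apply/andP; split; lra|rewrite -/be /X2 in h1 *; lra].
  pose G a := - half' s m * NI (tau - a) (half s m); pose g a := half' s m * Nf (tau - a) (half s m).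
  have dG (a : R) : is_derive a (1 : R) G (g a).
    have h := is_deriveZ (- half' s m) (@is_derive1_comp _ (NI ^~ (half s m)) (fun y => -1 * y + tau) a _ _ (dNI _ _) (is_derive_affine (-1) tau a)).
    rewrite (_ : G = (- half' s m) \*: (NI ^~ (half s m) \o (fun y => -1 * y + tau))); last first.
      by apply/funext => y; rewrite /G/=; derive_simpl; rewrite mulN1r addrC.
    by apply: is_derive_eq h _; derive_simpl; rewrite /g mulN1r addrC; ring.
  have cg (a : R) : {for a, continuous g}.
    rewrite /continuous_at /g; apply: cvgM; first exact: cvg_cst.
    apply: (@continuous_comp _ _ _ (fun a => tau - a) (Nf ^~ (half s m))); last exact: cNf.
    by apply: cvgB; [exact: cvg_cst|exact: cvg_id].
  have fle a : X2 <= a <= tau -> wedge_d (tau - a) m ^+ 2 <= g a.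
    move=> /andP[h1 h2]; rewrite wedge_d_sqr// /g ler_pM2l//; apply: hN => //.
    by rewrite -/be /X2 in h1 *; apply/andP; split; lra.
  have fi : mu.-integrable `[X2, tau] (EFin \o (fun a => wedge_d (tau - a) m ^+ 2)).
    apply: continuous_compact_integrable; first exact: segment_compact.
    apply: continuous_in_subspaceT => a _; apply: cvg_pow.
    apply: (@continuous_comp _ _ _ (fun a => tau - a) (wedge_d ^~ m)); last exact: wedge_d_continuous.
    by apply: cvgB; [exact: cvg_cst|exact: cvg_id].
  rewrite Rintegral_itv_obnd_cbnd; last first.
    by apply: integrableS fi => // t /=; rewrite !in_itv/= => /andP[h1 ->]; rewrite ltW.
  have := Rintegral_FTC_le X2t (fun x _ => dG x) (fun x _ => cg x) fi fle.
  rewrite /G subrr NI0 mulr0 sub0r (_ : tau - X2 = be); first by rewrite mulNr opprK.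
  by rewrite /X2; ring.
have cst_int (a b : R) : a <= b -> \int[mu]_(x in `[a, b]) (s ^+ 2 : R) = s ^+ 2 * (b - a).
  move=> ab; have [_ ->] := Rintegral_FTC ab (fun x _ => is_derive_affine (s ^+ 2) 0 x) (fun x _ => @cst_continuous R R (s ^+ 2) _).
  by ring.
have first : \int[mu]_(a in `[0, X2]) (D a m ^+ 2) <= s ^+ 2 * X2 - fanQ m s + 3 * s ^+ 2 * eps.
  have [ex|ex] := leP eps (xs m); last first.
    have -> : \int[mu]_(a in `[0, X2]) (D a m ^+ 2) = \int[mu]_(a in `[0, X2]) (s ^+ 2 : R).
      apply: eq_Rintegral => a /set_mem/=; rewrite in_itv/= => /andP[h1 h2].
      by rewrite divD_mid//; rewrite -/be /X2 in h2 *; lra.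
    rewrite cst_int// subr0; have := fanQ_s s0 c0 sc hm.
    have : s ^+ 2 * xs m <= s ^+ 2 * eps by rewrite ler_wpM2l ?sqr_ge0// ltW.
    have : 0 <= s ^+ 2 * eps by rewrite mulr_ge0 ?sqr_ge0// ltW.
    by rewrite -!mulrA; lra.
  pose X1 := xs m - eps; have X10 : 0 <= X1 by rewrite subr_ge0.
  have X12 : X1 <= X2 by rewrite /X1 /X2; lra.
  have i2 : mu.-integrable `[0, X2] (EFin \o (fun a => D a m ^+ 2)).
    by apply: slice_integrable => // t /=; rewrite !in_itv/= => /andP[-> h]; exact: le_trans X2t.
  rewrite (Rintegral_split X10 X12 i2).
  have -> : \int[mu]_(a in `]X1, X2]) (D a m ^+ 2) = s ^+ 2 * (X2 - X1).
    rewrite -cst_int// -Rintegral_itv_obnd_cbnd; last first.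
      apply: measurable_bounded_integrable => //; first exact: lebesgue_itv_lty.
      exact: (@bounded_fun_in _ _ _ _ `|s ^+ 2|).
    apply: eq_Rintegral => a /set_mem/=; rewrite in_itv/= => /andP[h1 h2].
    by rewrite divD_mid//; [rewrite /X1 in h1; lra|rewrite -/be /X2 in h2 *; lra].
  have -> : \int[mu]_(a in `[0, X1]) (D a m ^+ 2) = \int[mu]_(a in `[0, X1]) (fan (a + eps) m ^+ 2).
    apply: eq_Rintegral => a /set_mem/=; rewrite in_itv/= => /andP[h1 h2].
    move: h2; rewrite le_eqVlt => /predU1P[aX|h2].
      rewrite divD_mid; [|by rewrite aX /X1; lra|by rewrite -/be aX; rewrite /X2 in X12; lra].
      by rewrite aX /X1 subrK (fan_xs s0 sc)//; exact: lt_le_trans ex.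
    by rewrite divD_fan//; [apply/andP; split; lra|rewrite /X1 in h2; lra].
  have := fan_integral s0 c0 sc eps0 hm ex; rewrite -/X1 => hf.
  have se : 0 <= s ^+ 2 * eps by rewrite mulr_ge0 ?sqr_ge0// ltW.
  by move: hf se; rewrite /X1 -!mulrA !mulrBr; lra.
have Eb : half' s m * (s * be / stretch (half s m)) = s ^+ 2 * be.
  have n : stretch (half s m) != 0 by apply/eqP => n; move: h0; rewrite E n mulr0 ltxx.
  by rewrite E; field.
rewrite mulrBr Eb; move: first wedge; rewrite /X2 mulrBr; lra.
Qed.

(** The integral of [fanQ m s] over 0 <= m <= 1. *)
Definition fanPhi (s : R) : R := 2 * s ^+ 3 / 9 + s ^+ 5 / 25 + 3 * s ^+ 7 / 196 + 5 * s ^+ 9 / 648 +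
  35 * s ^+ 11 / (88 * 88) + 63 * s ^+ 13 / (64 * 338).

Lemma divD_integral (GI g : R -> R) :
  (forall x, is_derive x (1 : R) GI (g x)) -> (forall x, {for x, continuous g}) ->
  (forall x, 0 <= x <= mu1 -> NI (beta x) x - s * beta x / stretch x <= g x) ->
  \int[mu]_(a in `[0, tau]) \int[mu]_(m in `[0, 1]) (D a m ^+ 2) <=
    s ^+ 2 * tau - fanPhi s + (GI mu1 - GI 0) + 3 * s ^+ 2 * eps.
Proof.
move=> dG cg hg; have [M M0 hM] := divD_bounded.
have mD2 : measurable_fun (setT : set (measurableTypeR R * measurableTypeR R)) (fun q : R * R => D q.1 q.2 ^+ 2).
  by apply: measurable_funX; exact: divD_measurable.
have [-> si] := @box_swap R (fun q => D q.1 q.2 ^+ 2) tau M mD2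
  (fun a b ha hb => let h := hM a b ha hb in eq_ind_r (fun y => y <= M) (proj2 (andP h)) (ger0_norm (proj1 (andP h)))).
pose C := s ^+ 2 * tau + 3 * s ^+ 2 * eps.
pose p m := C - fanQ m s.
pose PI m := C * m - (s ^+ 3 / 3 * (m - m ^+ 3 / 3) + s ^+ 5 / 20 * (m - m ^+ 5 / 5) + s ^+ 7 / 56 * (m - m ^+ 7 / 7) +
  5 * s ^+ 9 / 576 * (m - m ^+ 9 / 9) + 7 * s ^+ 11 / 1408 * (m - m ^+ 11 / 11) + 21 * s ^+ 13 / 6656 * (m - m ^+ 13 / 13)).
have dI (m : R) := is_derive_id m (1 : R).
have dt (k : nat) (K m : R) : is_derive m (1 : R) (fun m => K * (m - m ^+ k.+1 / k.+1%:R)) (K * (1 - m ^+ k)).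
  have h := is_deriveZ K (is_deriveB (dI m) (is_deriveZ (k.+1%:R^-1) (is_deriveX k.+1 (dI m)))).
  rewrite (_ : (fun m => _) = K \*: (id - k.+1%:R^-1 \*: id ^+ k.+1)).
    apply: is_derive_eq h _; rewrite /GRing.scale/= mulr1 mulrA mulVf ?mul1r ?pnatr_eq0//.
  by apply/funext => z; derive_simpl; rewrite [_^-1 * _]mulrC.
have dP (m : R) : is_derive m (1 : R) PI (p m).
  have h := is_deriveB (is_deriveZ C (dI m)) (is_deriveD (is_deriveD (is_deriveD (is_deriveD (is_deriveD
    (dt 2%N (s ^+ 3 / 3) m) (dt 4%N (s ^+ 5 / 20) m)) (dt 6%N (s ^+ 7 / 56) m)) (dt 8%N (5 * s ^+ 9 / 576) m))
    (dt 10%N (7 * s ^+ 11 / 1408) m)) (dt 12%N (21 * s ^+ 13 / 6656) m)).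
  rewrite (_ : PI = C \*: id - ((fun m => s ^+ 3 / 3 * (m - m ^+ 3 / 3)) + (fun m => s ^+ 5 / 20 * (m - m ^+ 5 / 5)) +
    (fun m => s ^+ 7 / 56 * (m - m ^+ 7 / 7)) + (fun m => 5 * s ^+ 9 / 576 * (m - m ^+ 9 / 9)) +
    (fun m => 7 * s ^+ 11 / 1408 * (m - m ^+ 11 / 11)) + (fun m => 21 * s ^+ 13 / 6656 * (m - m ^+ 13 / 13)))).
    by apply: is_derive_eq h _; derive_simpl; rewrite /p /fanQ; field.
  by apply/funext => z; rewrite /PI; derive_simpl.
have cp (m : R) : {for m, continuous p}.
  have cI : (id : R -> R) t @[t --> m] --> m by exact: cvg_id.
  have ct (k : nat) (K K' : R) : K * (1 - t ^+ k) / K' @[t --> m] --> K * (1 - m ^+ k) / K'.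
    apply: cvgM; last exact: cvg_cst.
    apply: cvgM; first exact: cvg_cst.
    apply: cvgB; first exact: cvg_cst.
    exact: (@cvg_pow R id).
  rewrite /continuous_at /p /fanQ; apply: cvgB; first exact: cvg_cst.
  by do 5 (apply: cvgD; last exact: ct); exact: ct.
have := half_substitution c0 sc si dG cg dP cp.
have PI1 : PI 1 - PI 0 = C - fanPhi s by rewrite /PI /fanPhi; field.
rewrite PI1 => h.
have fle m : 0 <= m <= 1 -> \int[mu]_(a in `[0, tau]) (D a m ^+ 2) <= half' s m * g (half s m) + p m.
  move=> hm; apply: (le_trans (divD_slice hm)).
  have hh : 0 <= half s m <= mu1 by rewrite half_ge0 ?(half_le1 s0 c0 sc)//; case/andP: hm.
  have [_ h0] := half'_stretch hm; have := ler_wpM2l (ltW h0) (hg _ hh).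
  by rewrite /p /C; lra.
by move: (h fle); rewrite /C; lra.
Qed.

Let w_slice m : measurable_fun setT (w ^~ m).
Proof.
have [K hp] := profile_exists; have [mw mwx mwm] := profile_measurable hp.
exact: (measurableT_comp mw (pair2_measurable m)).
Qed.

Lemma prof_le1 a m : 0 <= a <= tau -> 0 <= m <= 1 -> `|w a m| <= 1.
Proof.
move=> ha hm; have := prof_lt1 s0 c0 sc eps0 tau0 b10 b20 q11 hq hsep htau ha hm.
have g0 := prof_gap_gt0 s0 c0 sc tau0 b10 b20 q11 hq.
by move=> h; rewrite -(expr_le1 (n := 2))// real_normK ?num_real//; lra.
Qed.

Let w_cube_integrable a : 0 <= a <= tau -> mu.-integrable `[0, 1] (EFin \o (fun m => `|w a m| ^+ 3)).
Proof.
move=> ha; have [K hp] := profile_exists; have [mw mwx mwm] := profile_measurable hp.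
apply: measurable_bounded_integrable.
- exact: measurable_itv.
- exact: lebesgue_itv_lty.
- apply: (measurable_funS measurableT) => //; apply: measurable_funX; apply: measurableT_comp => //.
  exact: (measurableT_comp mw (pair1_measurable a)).
- apply: (@bounded_fun_in _ _ _ _ 1) => t /=; rewrite in_itv/= => ht.
  by rewrite ger0_norm ?exprn_ge0// exprn_ile1// prof_le1.
Qed.

(** On the wall a = tau the distance z is 0, so the jump is governed by [qf 0]; the weight in the
    hypothesis on [W] is the Jacobian. *)
Lemma wedge_wall_integral (WI W : R -> R) :
  (forall x, is_derive x (1 : R) WI (W x)) -> (forall x, {for x, continuous W}) ->
  (forall x, 0 <= x <= mu1 -> `|tw (qf 0 x)| ^+ 3 <= s * stretch x * W x) ->
  \int[mu]_(m in `[0, 1]) `|w tau m| ^+ 3 <= WI mu1 - WI 0.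
Proof.
move=> dW cW hW; have ht : 0 <= tau <= tau by rewrite lexx ltW.
have := half_substitution c0 sc (w_cube_integrable ht) dW cW
  (fun m => is_derive_cst (0 : R) m (1 : R)) (fun m => @cst_continuous R R (0 : R) _).
rewrite !subrr addr0; apply=> m hm; rewrite addr0.
have hh : 0 <= half s m <= mu1 by rewrite half_ge0 ?(half_le1 s0 c0 sc)//; case/andP: hm.
have [E _] := half'_stretch hm; rewrite E (prof_wedge p0 p1 p2 s0 c0 sc eps0 hsep htau ht hm).
  by rewrite subrr; exact: hW.
by rewrite subrr beta_ge0//; case/andP: hh.
Qed.

(** Because of the shift a small jump remains at a = 0. With 2 eps = d^2 one has fan^2 * fanS = d^4,
    while fanS >= d^2 for m <= 1 - d; there the curvature is at most d. The rest of the wall has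
    length d, and |w| <= 1 on it. *)
Lemma fan_wall_integral (d : R) : 0 < d -> d <= 1 -> eps = d ^+ 2 / 2 ->
  \int[mu]_(m in `[0, 1]) `|w 0 m| ^+ 3 <= 2 * d.
Proof.
move=> d0 d1 ed; have h0 : 0 <= (0 : R) <= tau by rewrite lexx ltW.
have wi := w_cube_integrable h0.
have le1 m : 0 <= m <= 1 -> `|w 0 m| ^+ 3 <= 1 by move=> hm; rewrite exprn_ile1// prof_le1.
have t0 : 0 <= 1 - d by rewrite subr_ge0.
have t1 : 1 - d <= 1 by lra.
have led m : 0 <= m <= 1 - d -> `|w 0 m| ^+ 3 <= d.
  move=> /andP[m0 md]; have hm : 0 <= m <= 1 by rewrite m0/=; lra.
  have X0 := eps0; have f0 := fan_gt0 m eps0.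
  have fd : fan eps m <= d.
    rewrite -(ler_sqr (x := fan eps m)) ?nnegrE ?(ltW f0) ?(ltW d0)// -(ler_pM2r (exprn_gt0 2 d0)).
    have S : fan eps m ^+ 2 * fanS eps m = d ^+ 2 * d ^+ 2.
      by rewrite /fan exprMn -mulrA (fanr_sqr m eps0) ed; field.
    rewrite -S ler_wpM2l ?sqr_ge0// /fanS.
    have h1 : d ^+ 2 <= eps ^+ 2 + (1 - m) ^+ 2.
      have : d ^+ 2 <= (1 - m) ^+ 2 by rewrite lerXn2r ?nnegrE ?(ltW d0)//; lra.
      by have := sqr_ge0 eps; lra.
    have h2 : 1 <= eps ^+ 2 + (1 + m) ^+ 2.
      have : 1 <= (1 + m) ^+ 2 by rewrite expr_ge1//; lra.
      by have := sqr_ge0 eps; lra.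
    by rewrite -[d ^+ 2]mulr1; apply: ler_pM; rewrite ?sqr_ge0.
  have wf : 0 <= w 0 m <= fan eps m.
    have [h|h] := ltP (0 + eps) (xs m).
      rewrite (prof_fan p0 p1 p2 s0 c0 sc eps0 hsep htau h0 hm h) add0r mulr_ge0 ?(ltW f0)//=.
      by rewrite ger_pMl//; lra.
    have xm := xs_ge0 s0 c0 sc hm; have hs := hsep hm.
    rewrite (prof_mid p0 p1 p2 s0 c0 sc eps0 htau h0 hm h); last by lra.
    rewrite mulr_ge0 ?(ltW s0)//=; apply: (@le_trans _ _ s).
      by rewrite ger_pMr//; lra.
    have ec : eps <= 2 * c / s by have := htau; have := tau0; lra.
    by rewrite leNgt (fan_lt s0 c0 sc eps0 ec hm) -leNgt; rewrite add0r in h.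
  case/andP: wf => w0 wf; rewrite ger0_norm//; apply: (@le_trans _ _ (d ^+ 3)).
    by rewrite lerXn2r ?nnegrE ?(ltW d0)//; lra.
  by rewrite exprS ger_pMr// exprn_ile1// ltW.
rewrite (Rintegral_split t0 t1 wi).
have sub1 : mu.-integrable `[0, 1 - d] (EFin \o (fun m => `|w 0 m| ^+ 3)).
  by apply: integrableS wi => // t /=; rewrite !in_itv/= => /andP[-> h]; exact: le_trans t1.
have sub2 : mu.-integrable `[1 - d, 1] (EFin \o (fun m => `|w 0 m| ^+ 3)).
  by apply: integrableS wi => // t /=; rewrite !in_itv/= => /andP[h ->]; rewrite (le_trans t0).
have sub3 : mu.-integrable `]1 - d, 1] (EFin \o (fun m => `|w 0 m| ^+ 3)).
  by apply: integrableS sub2 => // t /=; rewrite !in_itv/= => /andP[h ->]; rewrite ltW.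
rewrite Rintegral_itv_obnd_cbnd//.
have i1 := Rintegral_le_const t0 sub1 led.
have le2 m : 1 - d <= m <= 1 -> `|w 0 m| ^+ 3 <= 1 by move=> /andP[h1 h2]; apply: le1; rewrite h2 (le_trans t0).
have i2 := Rintegral_le_const t1 sub2 le2.
have : 0 <= d * d by rewrite mulr_ge0 ?ltW.
by move: i1 i2; rewrite subr0 mulrBr mul1r mulr1; lra.
Qed.

(** The wall in question is the centre line m = 1. There the arc has width 0, so outside the wedge
    u_1 has modulus c. *)
Lemma boundary_integral (BI B : R -> R) :
  (forall z, is_derive z (1 : R) BI (B z)) -> (forall z, {for z, continuous B}) ->
  (forall z, 0 <= z <= beta mu1 -> ((1 - qf z mu1 ^+ 2) / (1 + qf z mu1 ^+ 2)) ^+ 3 <= B z) ->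
  \int[mu]_(a in `[0, tau]) covar w a 1 ^+ 3 <= c ^+ 3 * (tau - beta mu1) + (BI (beta mu1) - BI 0).
Proof.
move=> dB cB hB; have h1 : 0 <= (1 : R) <= 1 by rewrite ler01 lexx.
have hs := hsep h1; have e := eps0; have x0 := xs_ge0 s0 c0 sc h1.
have xs1 : xs 1 = 0.
  rewrite /xs /rt expr1n mulr1 (_ : 1 - s ^+ 2 = c ^+ 2); last by move: sc; lra.
  by rewrite sqrtr_sqr ger0_norm ?subrr ?mul0r// ltW.
rewrite (half1 c0 sc) in hs; have m10 : 0 <= mu1 by rewrite divr_ge0 ?(ltW s0)// addr_ge0// ltW.
have be0 : 0 <= beta mu1 by exact: beta_ge0.
set be := beta mu1 in hs be0 *.
pose X2 := tau - be.
have X20 : 0 <= X2 by rewrite /X2; lra.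
have X2t : X2 <= tau by rewrite /X2; lra.
have ci : mu.-integrable `[0, tau] (EFin \o (fun a => covar w a 1 ^+ 3)).
  have mc : measurable_fun setT (fun a => covar w a 1 ^+ 3).
    have [K hp] := profile_exists; apply: measurable_funX.
    exact: (measurableT_comp (measurable_covar hp) (pair2_measurable (1 : R))).
  apply: measurable_bounded_integrable.
  - exact: measurable_itv.
  - exact: lebesgue_itv_lty.
  - exact: (measurable_funS measurableT).
  - apply: (@bounded_fun_in _ _ _ _ 1) => t /=; rewrite in_itv/= => ht.
    rewrite ger0_norm ?exprn_ge0 ?sqrtr_ge0// exprn_ile1 ?sqrtr_ge0//.
    by rewrite -[leRHS]sqrtr1 ler_wsqrtr// gerBl sqr_ge0.
rewrite (Rintegral_split X20 X2t ci).
have s1 : mu.-integrable `[0, X2] (EFin \o (fun a => covar w a 1 ^+ 3)).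
  by apply: integrableS ci => // t /=; rewrite !in_itv/= => /andP[-> h]; exact: le_trans X2t.
have s2 : mu.-integrable `[X2, tau] (EFin \o (fun a => covar w a 1 ^+ 3)).
  by apply: integrableS ci => // t /=; rewrite !in_itv/= => /andP[h ->]; rewrite (le_trans X20).
have s3 : mu.-integrable `]X2, tau] (EFin \o (fun a => covar w a 1 ^+ 3)).
  by apply: integrableS s2 => // t /=; rewrite !in_itv/= => /andP[h ->]; rewrite ltW.
rewrite Rintegral_itv_obnd_cbnd//.
have i1 : \int[mu]_(a in `[0, X2]) covar w a 1 ^+ 3 <= c ^+ 3 * X2.
  rewrite -[X2 in leRHS]subr0; apply: Rintegral_le_const => // a /andP[a0 aX].
  have ha : 0 <= a <= tau by rewrite a0 (le_trans aX).
  rewrite /covar (prof_mid p0 p1 p2 s0 c0 sc eps0 htau ha h1); last first.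
  - by rewrite (half1 c0 sc) -/be; move: aX; rewrite /X2; lra.
  - by rewrite xs1; lra.
  rewrite mulr1 (_ : 1 - s ^+ 2 = c ^+ 2); last by move: sc; lra.
  by rewrite sqrtr_sqr ger0_norm// ltW.
have i2 : \int[mu]_(a in `[X2, tau]) covar w a 1 ^+ 3 <= BI be - BI 0.
  have dG (a : R) : is_derive a (1 : R) (fun a => - BI (tau - a)) (B (tau - a)).
    have h := is_deriveN (@is_derive1_comp _ BI (fun y => -1 * y + tau) a _ _ (dB _) (is_derive_affine (-1) tau a)).
    rewrite (_ : (fun a => - BI (tau - a)) = - (BI \o (fun y => -1 * y + tau))); last first.
      by apply/funext => y; derive_simpl; rewrite mulN1r addrC.
    by apply: is_derive_eq h _; rewrite mulN1r addrC mulrN1 opprK.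
  have cg (a : R) : {for a, continuous (fun a => B (tau - a))}.
    apply: (@continuous_comp _ _ _ (fun a => tau - a) B); last exact: cB.
    by apply: cvgB; [exact: cvg_cst|exact: cvg_id].
  have fle a : X2 <= a <= tau -> covar w a 1 ^+ 3 <= B (tau - a).
    move=> /andP[a1 a2]; have ha : 0 <= a <= tau by rewrite a2 (le_trans X20).
    have hz : 0 <= tau - a <= be by move: a1; rewrite /X2 => a1; apply/andP; split; lra.
    have hm1 : 0 <= mu1 <= mu1 by rewrite m10 lexx.
    rewrite /covar (prof_wedge p0 p1 p2 s0 c0 sc eps0 hsep htau ha h1); last by rewrite (half1 c0 sc); case/andP: hz.
    rewrite (half1 c0 sc) tw_covar; first exact: hB.
    by apply: le_trans (hq hm1 hz) _; exact: ltW.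
  have := Rintegral_FTC_le X2t (fun x _ => dG x) (fun x _ => cg x) s2 fle.
  rewrite subrr (_ : tau - X2 = be); last by rewrite /X2; ring.
  by move=> h; lra.
by move: i1 i2; rewrite /X2; lra.
Qed.

Lemma prof_energy (GI g WI W BI B : R -> R) (k : nat) (H L d : R) :
  (0 < k)%N -> 0 < H -> 0 < L -> 0 < d -> d <= 1 -> eps = d ^+ 2 / 2 ->
  (forall x, is_derive x (1 : R) GI (g x)) -> (forall x, {for x, continuous g}) ->
  (forall x, 0 <= x <= mu1 -> NI (beta x) x - s * beta x / stretch x <= g x) ->
  (forall x, is_derive x (1 : R) WI (W x)) -> (forall x, {for x, continuous W}) ->
  (forall x, 0 <= x <= mu1 -> `|tw (qf 0 x)| ^+ 3 <= s * stretch x * W x) ->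
  (forall z, is_derive z (1 : R) BI (B z)) -> (forall z, {for z, continuous B}) ->
  (forall z, 0 <= z <= beta mu1 -> ((1 - qf z mu1 ^+ 2) / (1 + qf z mu1 ^+ 2)) ^+ 3 <= B z) ->
  admissible (halfperiod tau H k) H (field tau H k w) /\
  (E0 (halfperiod tau H k) H L (field tau H k w) <= (k%:R * H *
    (2 * (L / H) * (s ^+ 2 * tau - fanPhi s + (GI mu1 - GI 0) + 3 * s ^+ 2 * eps) +
     8 / 3 * (2 * d + (WI mu1 - WI 0) + (c ^+ 3 * (tau - beta mu1) + (BI (beta mu1) - BI 0)))))%:E)%E.
Proof.
move=> k0 H0 L0 d0 d1 ed dG cg hg dW cW hW dB cB hB.
have [K hp] := profile_exists; have v00 := prof_gap_gt0 s0 c0 sc tau0 b10 b20 q11 hq.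
split; first exact: (field_admissible tau0 v00 H0 k0 hp).
apply: (le_trans (field_energy tau0 v00 H0 k0 hp L0)); rewrite lee_fin.
have i1 := divD_integral dG cg hg; have i2 := wedge_wall_integral dW cW hW.
have i3 := fan_wall_integral d0 d1 ed; have i4 := boundary_integral dB cB hB.
rewrite ler_wpM2l//; first by rewrite mulr_ge0// ltW.
apply: lerD; first by rewrite ler_wpM2l// mulr_ge0// divr_ge0// ltW.
by rewrite ler_wpM2l//; lra.
Qed.

End ProfileEnergy.

(** * Integer polynomials *)

From Stdlib Require Import BinInt.
From mathcomp Require Import ssrZ.

Section ListPolynomials.
Context {R : realType}.
Variables (C : Type) (c0 : C) (ca cm : C -> C -> C) (ev : C -> R).
Hypothesis ev0 : ev c0 = 0.
Hypothesis evD : forall x y, ev (ca x y) = ev x + ev y.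
Hypothesis evM : forall x y, ev (cm x y) = ev x * ev y.

(** The coefficients are abstract because the same operations serve for integer coefficients and,
    with polynomials as coefficients, for polynomials in z and the half-angle variable. *)
Fixpoint padd (p q : seq C) : seq C :=
  match p, q with
  | [::], _ => q
  | _, [::] => p
  | x :: p', y :: q' => ca x y :: padd p' q'
  end.

Definition pscale (x : C) (q : seq C) : seq C := map (cm x) q.

Fixpoint pmul (p q : seq C) : seq C :=
  if p is x :: p' then padd (pscale x q) (c0 :: pmul p' q) else [::].

Fixpoint pder (p : seq C) : seq C :=
  if p is _ :: p' then padd p' (c0 :: pder p') else [::].

Fixpoint peval (p : seq C) (x : R) : R :=
  if p is y :: p' then ev y + x * peval p' x else 0.

Lemma peval_add p q x : peval (padd p q) x = peval p x + peval q x.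
Proof.
elim: p q => [|y p ih] [|z q] //=; rewrite ?add0r ?addr0//.
by rewrite evD ih; ring.
Qed.

Lemma peval_scale y q x : peval (pscale y q) x = ev y * peval q x.
Proof. by elim: q => [|z q ih] /=; rewrite ?mulr0// evM ih; ring. Qed.

Lemma peval_mul p q x : peval (pmul p q) x = peval p x * peval q x.
Proof.
elim: p => [|y p ih] /=; first by rewrite mul0r.
by rewrite peval_add peval_scale /= ev0 add0r ih; ring.
Qed.

Lemma is_derive_peval p (x : R) : is_derive x (1 : R) (peval p) (peval (pder p) x).
Proof.
elim: p => [|y p ih]; first exact: is_derive_cst.
have h := is_deriveD (is_derive_cst (ev y) x (1 : R)) (is_deriveM (is_derive_id x (1 : R)) ih).
by apply: is_derive_eq h _; derive_simpl; rewrite peval_add /= ev0; ring.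
Qed.

Lemma peval_continuous p : continuous (peval p).
Proof.
by move=> x; apply: differentiable_continuous; apply/derivable1_diffP; have h := is_derive_peval p x; exact: ex_derive.
Qed.

End ListPolynomials.

Section IntegerCoefficients.
Context {R : realType}.

(** Follows the binary digits, so that on a literal it simplifies to an expression in numerals that
    [ring], [field] and [lra] can handle. *)
Fixpoint posr (p : positive) : R :=
  match p with
  | xH => 1
  | xO p' => 2 * posr p'
  | xI p' => 2 * posr p' + 1
  end.

Definition zr (z : Z) : R :=
  match z with Z0 => 0 | Zpos p => posr p | Zneg p => - posr p end.

Lemma posrE p : posr p = (Pos.to_nat p)%:R.
Proof.
elim: p => [p ih|p ih|] //=; rewrite ih.
  have -> : Pos.to_nat p~1 = (2 * Pos.to_nat p).+1 by exact: Pnat.Pos2Nat.inj_xI.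
  by rewrite -[in RHS]natr1 natrM.
have -> : Pos.to_nat p~0 = (2 * Pos.to_nat p)%N by exact: Pnat.Pos2Nat.inj_xO.
by rewrite natrM.
Qed.

Lemma zrE z : zr z = (int_of_Z z)%:~R.
Proof.
case: z => [|p|p] //=; first by rewrite posrE pmulrn.
by rewrite posrE NegzE rmorphN/= prednK// ?pmulrn//; apply/ssrnat.ltP; exact: Pnat.Pos2Nat.is_pos.
Qed.

Lemma zrD x y : zr (Z.add x y) = zr x + zr y.
Proof. by rewrite !zrE -rmorphD/= -(rmorphD int_of_Z). Qed.

Lemma zrM x y : zr (Z.mul x y) = zr x * zr y.
Proof. by rewrite !zrE -rmorphM/= -(rmorphM int_of_Z). Qed.

Lemma zr_le x y : Z.leb x y -> zr x <= zr y.
Proof.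
move=> /Z.leb_le h; rewrite -subr_ge0.
have -> : zr y - zr x = zr (Z.sub y x).
  by rewrite -[RHS](addrK (zr x)) -zrD Z.sub_add.
by have := Zorder.Zle_minus_le_0 _ _ h; case: (Z.sub y x) => [|p|p] //= h'; rewrite posrE.
Qed.

Definition poly1 := seq Z.
Definition poly2 := seq poly1.
Definition add1 := padd Z.add.
Definition mul1 := pmul Z0 Z.add Z.mul.
Definition der1 := pder Z0 Z.add.
Definition ev1 : poly1 -> R -> R := peval zr.
Definition add2 := padd add1.
Definition mul2 := pmul [::] add1 mul1.
Definition der2 := pder [::] add1.
Definition ev2 (p : poly2) (z x : R) : R := peval (fun q => ev1 q x) p z.

Lemma ev1_add p q x : ev1 (add1 p q) x = ev1 p x + ev1 q x.
Proof. exact: (peval_add zrD). Qed.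

Lemma ev1_mul p q x : ev1 (mul1 p q) x = ev1 p x * ev1 q x.
Proof. exact: (peval_mul (erefl : zr Z0 = 0) zrD zrM). Qed.

Lemma ev2_add p q z x : ev2 (add2 p q) z x = ev2 p z x + ev2 q z x.
Proof. by apply: (@peval_add R poly1 add1) => a b; exact: ev1_add. Qed.

Lemma ev2_mul p q z x : ev2 (mul2 p q) z x = ev2 p z x * ev2 q z x.
Proof. by apply: (@peval_mul R poly1 [::] add1 mul1) => // a b; [exact: ev1_add|exact: ev1_mul]. Qed.

Lemma is_derive_ev1 p (x : R) : is_derive x (1 : R) (ev1 p) (ev1 (der1 p) x).
Proof. exact: (is_derive_peval (erefl : zr Z0 = 0) zrD). Qed.

Lemma is_derive_ev2 p (z x : R) : is_derive z (1 : R) (ev2 p ^~ x) (ev2 (der2 p) z x).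
Proof. by apply: (@is_derive_peval R poly1 [::] add1) => // a b; exact: ev1_add. Qed.

Lemma ev1_continuous p : continuous (ev1 p).
Proof. exact: (peval_continuous (erefl : zr Z0 = 0) zrD). Qed.

Lemma ev2_continuous p x : continuous (ev2 p ^~ x).
Proof. by apply: (@peval_continuous R poly1 [::] add1) => // a b; exact: ev1_add. Qed.

(* Antiderivative multiplied by a common multiple L of the denominators. *)
Fixpoint prim1_rec (L : Z) (k : Z) (p : poly1) : poly1 :=
  if p is a :: p' then Z.mul a (Z.div L k) :: prim1_rec L (Z.succ k) p' else [::].
Definition prim1 L p : poly1 := Z0 :: prim1_rec L 1 p.

Fixpoint prim2_rec (L : Z) (k : Z) (p : poly2) : poly2 :=
  if p is a :: p' then mul1 [:: Z.div L k] a :: prim2_rec L (Z.succ k) p' else [::].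
Definition prim2 L p : poly2 := [::] :: prim2_rec L 1 p.

Fixpoint subst2 (p : poly2) (b : poly1) : poly1 :=
  if p is a :: p' then add1 a (mul1 b (subst2 p' b)) else [::].

Lemma ev_subst2 p b x : ev1 (subst2 p b) x = ev2 p (ev1 b x) x.
Proof. by elim: p => [|a p ih] //=; rewrite ev1_add ev1_mul ih. Qed.

(* Numerator and denominator of p (a / b). *)
Fixpoint homog (a b : Z) (p : poly1) : Z * Z :=
  if p is c :: p' then
    let: (v, w) := homog a b p' in let w' := Z.mul b w in (Z.add (Z.mul c w') (Z.mul a v), w')
  else (Z0, 1%Z).

Lemma homogE a b p : zr b != 0 -> (homog a b p).1 = (homog a b p).1 /\
  zr (homog a b p).2 != 0 /\ ev1 p (zr a / zr b) = zr (homog a b p).1 / zr (homog a b p).2.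
Proof.
move=> b0; split=> //; elim: p => [|c p [ih1 ih2]] /=.
  by rewrite oner_eq0 mul0r.
case: (homog a b p) ih1 ih2 => v w /= ih1 ih2; rewrite zrM mulf_neq0//; split=> //.
by rewrite -/(ev1 p _) ih2 zrD !zrM; field; rewrite b0 ih1.
Qed.

End IntegerCoefficients.

Section ReflectionTools.
Context {R : realType}.
Local Notation ev1 := (@ev1 R).
Local Notation ev2 := (@ev2 R).

Definition outer (p : poly1) : poly2 := map (fun a => [:: a]) p.
Definition const2 (a : Z) : poly2 := [:: [:: a]].
Definition opp2 (p : poly2) : poly2 := mul2 (const2 (-1)) p.
Definition zero1 (p : poly1) : bool := all (Z.eqb 0) p.
Definition zero2 (p : poly2) : bool := all zero1 p.
Definition inner0 (p : poly2) : poly1 := map (head 0%Z) p.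

(* E ^ (size p - 1) * p(X / E) *)
Fixpoint hom2 (E : Z) (X : poly2) (p : poly1) : poly2 :=
  if p is u :: p' then add2 (const2 (Z.mul u (Z.pow E (Z.of_nat (size p'))))) (mul2 X (hom2 E X p'))
  else [::].

Lemma ev1_cons c p x : ev1 (c :: p) x = zr c + x * ev1 p x. Proof. by []. Qed.

Lemma ev2_cons q p z x : ev2 (q :: p) z x = ev1 q x + z * ev2 p z x. Proof. by []. Qed.

Lemma ev_outer p z x : ev2 (outer p) z x = ev1 p z.
Proof. by rewrite /ev2 /ev1; elim: p => [|a p ih] //=; rewrite ih mulr0 addr0. Qed.

Lemma ev_inner p z x : ev2 [:: p] z x = ev1 p x.
Proof. by rewrite /ev2 /= mulr0 addr0. Qed.

Lemma ev_const2 a z x : ev2 (const2 a) z x = zr a.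
Proof. by rewrite ev_inner /ev1 /= mulr0 addr0. Qed.

Lemma ev_inner0 p z : ev2 p z 0 = ev1 (inner0 p) z.
Proof.
elim: p => [|q p ih] //; rewrite /ev2 /= -/(ev2 p z 0) ih /ev1 /=.
by case: q => [|a q] /=; rewrite ?mul0r ?addr0.
Qed.

Lemma zero1_ev p x : zero1 p -> ev1 p x = 0.
Proof.
elim: p => [|a p ih] //= /andP[a0 /ih h].
by case: a a0 => // _; rewrite /= h mulr0 addr0.
Qed.

Lemma zero2_ev p z x : zero2 p -> ev2 p z x = 0.
Proof.
elim: p => [|q p ih] //= /andP[h1 /ih h].
by rewrite h mulr0 addr0 zero1_ev.
Qed.

Lemma zr_pow E n : zr (Z.pow E (Z.of_nat n)) = zr E ^+ n :> R.
Proof.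
elim: n => [|n ih]; first by rewrite expr0.
by rewrite Znat.Nat2Z.inj_succ Z.pow_succ_r ?zrM ?ih ?exprS//; exact: Zorder.Zle_0_nat.
Qed.

Lemma ev_hom2 E X p z x : zr E != 0 :> R ->
  ev2 (hom2 E X p) z x * zr E = zr E ^+ size p * ev1 p (ev2 X z x / zr E).
Proof.
move=> E0; elim: p => [|u p ih]; first by rewrite /ev1 /ev2 /= mul0r mulr0.
rewrite -[hom2 E X (u :: p)]/(add2 (const2 (Z.mul u (Z.pow E (Z.of_nat (size p))))) (mul2 X (hom2 E X p))).
rewrite ev2_add ev2_mul ev_const2 zrM zr_pow mulrDl -[X in _ + X = _]mulrA ih ev1_cons -[size (u :: p)]/(size p).+1 exprS.
by field.
Qed.

Lemma zr_lt0 a : Z.ltb 0 a -> 0 < zr a :> R.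
Proof. by move=> /Z.ltb_lt; case: a => //= p _; rewrite posrE ltr0n; apply/ssrnat.ltP; exact: Pnat.Pos2Nat.is_pos. Qed.

(* b ^ n * p(a / b) with n = size p, as polynomials in the substituted variable *)
Fixpoint homP (a b : poly1) (p : poly1) : poly1 * poly1 :=
  if p is c :: p' then let h := homP a b p' in (add1 (mul1 [:: c] (mul1 b h.2)) (mul1 a h.1), mul1 b h.2)
  else ([::], [:: 1%Z]).

Lemma homPE a b p u : ev1 b u != 0 -> ev1 (homP a b p).2 u != 0 /\ ev1 (homP a b p).2 u = ev1 b u ^+ size p /\
  ev1 p (ev1 a u / ev1 b u) * ev1 (homP a b p).2 u = ev1 (homP a b p).1 u.
Proof.
move=> b0; elim: p => [|c p [ih1 [ih2 ih3]]].
  by rewrite /ev1 /= mulr0 addr0 oner_eq0 mul0r expr0.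
rewrite -[homP a b (c :: p)]/(add1 (mul1 [:: c] (mul1 b (homP a b p).2)) (mul1 a (homP a b p).1), mul1 b (homP a b p).2).
rewrite [(_, _).1]/fst [(_, _).2]/snd ev1_add !ev1_mul mulf_neq0// -[size (c :: p)]/(size p).+1 exprS ih2.
split=> //; split=> //; rewrite -ih3 ih2 ev1_cons [ev1 [:: c] u]ev1_cons /ev1 /= -/(ev1 p _) mulr0 addr0.
by rewrite -!/(ev1 _ _); field.
Qed.

Lemma ev1_ge0 p u : all (Z.leb 0) p -> 0 <= u -> 0 <= ev1 p u.
Proof.
move=> h u0; elim: p h => [|c p ih] //= /andP[c0 /ih h].
by rewrite /ev1 /= -/(ev1 p u) addr_ge0 ?mulr_ge0//; exact: (@zr_le R 0 c).
Qed.

(** A sufficient test for nonnegativity on [a / d, b / d[: after a Moebius map from the half-line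
    onto the interval, and multiplication by a power of the denominator, all coefficients are
    nonnegative. *)
Definition pos_on (p : poly1) (d a b : Z) : bool :=
  [&& Z.ltb 0 d, Z.ltb a b & all (Z.leb 0) (homP [:: a; b] [:: d; d] p).1].

(* The substitution t = (a + b u) / (d + d u) maps [0, +oo[ onto [a / d, b / d[ *)
Lemma pos_onP p d a b (t : R) : pos_on p d a b -> zr a <= zr d * t -> zr d * t < zr b -> 0 <= ev1 p t.
Proof.
move=> /and3P[/zr_lt0 d0 ab hp] ta tb; pose u := (zr d * t - zr a) / (zr b - zr d * t).
have u0 : 0 <= u by rewrite divr_ge0 ?subr_ge0// ltW.
have n1 : zr b - zr d * t != 0 by rewrite gt_eqF// subr_gt0.
have ab' : 0 < zr b - zr a :> R by rewrite subr_gt0 (le_lt_trans ta).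
have eb : ev1 [:: d; d] u = zr d * (1 + u) by rewrite /ev1 /=; ring.
have b0 : 0 < ev1 [:: d; d] u by rewrite eb mulr_gt0// ltr_pwDl.
have ea : ev1 [:: a; b] u / ev1 [:: d; d] u = t.
  have u1 : 1 + u = (zr b - zr a) / (zr b - zr d * t) by rewrite /u; field.
  rewrite eb u1 (_ : ev1 [:: a; b] u = zr d * t * (zr b - zr a) / (zr b - zr d * t)).
    by field; rewrite n1 !gt_eqF.
  by rewrite /ev1 /= /u; field.
have [h1 [h2 h3]] := homPE [:: a; b] p (lt0r_neq0 b0).
rewrite ea in h3; have := ev1_ge0 hp u0; rewrite -h3 pmulr_lge0// h2 exprn_gt0//.
Qed.

End ReflectionTools.

(** * Polynomial bounds for the rational factors *)

Section RationalBounds.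
Context {R : realType}.

(* Cubic approximations found numerically, with coefficients in thousandths. *)
Definition U4 : poly1 := [:: 1001; -3886; 8027; -7599]%Z.
Definition U3 : poly1 := [:: 1001; -2946; 5074; -4339]%Z.
Definition SU : poly1 := [:: 501; 1513; 1741; 3483]%Z.
Definition VU : poly1 := [:: 2001; -5959; 9144; -7782]%Z.
Definition VL : poly1 := [:: 1999; -5959; 9144; -7782]%Z.

Lemma pos_range (p : poly1) (n : nat) (N : Z) (t : R) :
  all (fun i => pos_on p N (Z.of_nat i) (Z.of_nat i.+1)) (iota 0 n.+1) ->
  0 <= t -> zr N * t < n.+1%:R -> 0 <= ev1 p t.
Proof.
have zn k : zr (Z.of_nat k) = k%:R :> R by case: k => //= k; rewrite posrE Pnat.SuccNat2Pos.id_succ.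
move=> /allP h t0 tn.
suff [i /andP[i1 i2] i3] : exists2 i : nat, i%:R <= zr N * t < i.+1%:R & (i < n.+1)%nat.
  apply: (pos_onP (h i _)); rewrite ?zn//; by rewrite mem_iota.
have Nt0 : 0 <= zr N * t.
  have := h 0%nat; rewrite mem_iota/= => /(_ isT)/and3P[/(@zr_lt0 R) N0 _ _].
  by rewrite mulr_ge0// ltW.
exists (Num.truncn (zr N * t)); first exact: truncn_itv.
by rewrite -(ltr_nat R); apply: le_lt_trans tn; have /andP[] := truncn_itv Nt0.
Qed.

Let div_le_div (a b u K : R) : 0 < b -> 0 < K -> a * K <= u * b -> a / b <= u / K.
Proof. by move=> b0 K0 h; rewrite ler_pdivrMr// mulrAC ler_pdivlMr. Qed.

(** The range is the square of 56 / 100, the bound on |q| for both families; 13 cells of length 1 /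
    40 cover it. *)
Lemma U4_ge (t : R) : 0 <= t <= 3136 / 10000 -> ((1 + t) ^+ 4)^-1 <= ev1 U4 t / 1000.
Proof.
move=> /andP[t0 t1]; have p0 : 0 < (1 + t) ^+ 4 by rewrite exprn_gt0// ltr_pwDl.
have h := @pos_range (add1 (mul1 [:: 1; 4; 6; 4; 1]%Z U4) [:: -1000]%Z) 12 40 t.
rewrite -[leLHS]mul1r; apply: div_le_div; [exact: p0|exact: ltr0n|rewrite -subr_ge0].
suff -> : ev1 U4 t * (1 + t) ^+ 4 - 1 * 1000 = ev1 (add1 (mul1 [:: 1; 4; 6; 4; 1]%Z U4) [:: -1000]%Z) t.
  by apply: h; [by vm_compute|exact: t0|rewrite /=; lra].
by rewrite ev1_add ev1_mul /ev1 /=; ring.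
Qed.

Lemma U3_ge (t : R) : 0 <= t <= 3136 / 10000 -> ((1 + t) ^+ 3)^-1 <= ev1 U3 t / 1000.
Proof.
move=> /andP[t0 t1]; have p0 : 0 < (1 + t) ^+ 3 by rewrite exprn_gt0// ltr_pwDl.
have h := @pos_range (add1 (mul1 [:: 1; 3; 3; 1]%Z U3) [:: -1000]%Z) 12 40 t.
rewrite -[leLHS]mul1r; apply: div_le_div; [exact: p0|exact: ltr0n|rewrite -subr_ge0].
suff -> : ev1 U3 t * (1 + t) ^+ 3 - 1 * 1000 = ev1 (add1 (mul1 [:: 1; 3; 3; 1]%Z U3) [:: -1000]%Z) t.
  by apply: h; [by vm_compute|exact: t0|rewrite /=; lra].
by rewrite ev1_add ev1_mul /ev1 /=; ring.
Qed.

(** x is the square of the half-angle variable, which is at most 1 / 2, and the quotient is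
    [stretch]; [VU] and [VL] bound its inverse from the two sides. *)
Lemma SU_ge (x : R) : 0 <= x <= 1 / 4 -> (1 + x) ^+ 2 / (2 * (1 - x)) <= ev1 SU x / 1000.
Proof.
move=> /andP[t0 t1]; have p0 : 0 < 2 * (1 - x) by lra.
have h := @pos_range (add1 (mul1 [:: 2; -2]%Z SU) [:: -1000; -2000; -1000]%Z) 10 40 x.
apply: div_le_div; [exact: p0|exact: ltr0n|rewrite -subr_ge0].
suff -> : ev1 SU x * (2 * (1 - x)) - (1 + x) ^+ 2 * 1000 = ev1 (add1 (mul1 [:: 2; -2]%Z SU) [:: -1000; -2000; -1000]%Z) x.
  by apply: h; [by vm_compute|exact: t0|rewrite /=; lra].
by rewrite ev1_add ev1_mul /ev1 /=; ring.
Qed.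

Lemma VU_ge (x : R) : 0 <= x <= 1 / 4 -> 2 * (1 - x) / (1 + x) ^+ 2 <= ev1 VU x / 1000.
Proof.
move=> /andP[t0 t1]; have p0 : 0 < (1 + x) ^+ 2 by rewrite exprn_gt0// ltr_pwDl.
have h := @pos_range (add1 (mul1 [:: 1; 2; 1]%Z VU) [:: -2000; 2000]%Z) 12 50 x.
apply: div_le_div; [exact: p0|exact: ltr0n|rewrite -subr_ge0].
suff -> : ev1 VU x * (1 + x) ^+ 2 - 2 * (1 - x) * 1000 = ev1 (add1 (mul1 [:: 1; 2; 1]%Z VU) [:: -2000; 2000]%Z) x.
  by apply: h; [by vm_compute|exact: t0|rewrite /=; lra].
by rewrite ev1_add ev1_mul /ev1 /=; ring.
Qed.

Lemma VL_le (x : R) : 0 <= x <= 1 / 4 -> ev1 VL x / 1000 <= 2 * (1 - x) / (1 + x) ^+ 2.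
Proof.
move=> /andP[t0 t1]; have p0 : 0 < (1 + x) ^+ 2 by rewrite exprn_gt0// ltr_pwDl.
have h := @pos_range (add1 (mul1 [:: -1; -2; -1]%Z VL) [:: 2000; -2000]%Z) 2 10 x.
apply: div_le_div; [exact: ltr0n|exact: p0|rewrite -subr_ge0].
suff -> : 2 * (1 - x) * 1000 - ev1 VL x * (1 + x) ^+ 2 = ev1 (add1 (mul1 [:: -1; -2; -1]%Z VL) [:: 2000; -2000]%Z) x.
  by apply: h; [by vm_compute|exact: t0|rewrite /=; lra].
by rewrite ev1_add ev1_mul /ev1 /=; ring.
Qed.

End RationalBounds.

Section CheckedPrimitives.
Context {R : realType}.
Local Notation ev1 := (@ev1 R).
Local Notation ev2 := (@ev2 R).

(** The divisions inside [prim2] are certified afterwards, by differentiating the result. *)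
Definition is_prim2 (n : Z) (I p : poly2) : bool := zero2 (add2 (der2 I) (opp2 (mul2 (const2 n) p))).
Definition is_prim1 (n : Z) (I p : poly1) : bool := zero1 (add1 (der1 I) (mul1 [:: Z.opp n] p)).

Lemma zr_opp n : zr (Z.opp n) = - zr n :> R.
Proof. by case: n => [|p|p] /=; rewrite ?oppr0 ?opprK. Qed.

Lemma ev1_const n x : ev1 [:: n] x = zr n.
Proof. by rewrite ev1_cons /ev1 /= mulr0 addr0. Qed.

Lemma is_prim2P n I p z x : is_prim2 n I p -> ev2 (der2 I) z x = zr n * ev2 p z x.
Proof.
move=> /(@zero2_ev R _ z x); rewrite /opp2 ev2_add !ev2_mul !ev_const2 /=.
by move=> h; apply/eqP; rewrite -subr_eq0 -h; apply/eqP; ring.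
Qed.

Lemma is_prim1P n I p x : is_prim1 n I p -> ev1 (der1 I) x = zr n * ev1 p x.
Proof.
move=> /(@zero1_ev R _ x); rewrite ev1_add ev1_mul ev1_const zr_opp mulNr.
by move/eqP; rewrite subr_eq0 => /eqP.
Qed.

Lemma is_derive_prim2 n I p D dz (z x : R) : is_prim2 n I p -> Z.ltb 0 n -> Z.ltb 0 dz ->
  is_derive z (1 : R) (fun z => ev2 I (zr dz * z) x / (zr n * zr D * zr dz)) (ev2 p (zr dz * z) x / zr D).
Proof.
move=> hp /(@zr_lt0 R) n0 /(@zr_lt0 R) dz0.
have h := is_deriveZ (zr n * zr D * zr dz)^-1 (@is_derive1_comp _ (ev2 I ^~ x) (fun y => zr dz * y + 0) z _ _
  (is_derive_ev2 I _ x) (is_derive_affine (zr dz) 0 z)).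
rewrite (_ : (fun z => _) = (zr n * zr D * zr dz)^-1 \*: (ev2 I ^~ x \o (fun y => zr dz * y + 0))).
  apply: is_derive_eq h _; rewrite addr0 (is_prim2P _ _ hp) /GRing.scale/=.
  by rewrite !invfM; move: (zr D)^-1 => e; field; rewrite !gt_eqF.
by apply/funext => y; derive_simpl; rewrite addr0 mulrC.
Qed.

Lemma is_derive_prim1 n I p D (x : R) : is_prim1 n I p -> Z.ltb 0 n ->
  is_derive x (1 : R) (fun x => ev1 I x / (zr n * D)) (ev1 p x / D).
Proof.
move=> hp /(@zr_lt0 R) n0.
have h := is_deriveZ (zr n * D)^-1 (is_derive_ev1 I x).
rewrite (_ : (fun z => _) = (zr n * D)^-1 \*: ev1 I).
  apply: is_derive_eq h _; rewrite (is_prim1P _ hp) /GRing.scale/=.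
  by rewrite !invfM; move: D^-1 => e; field; rewrite !gt_eqF.
by apply/funext => y; derive_simpl; rewrite mulrC.
Qed.

(** Cross-multiplied, so that a bound on the value at a / b becomes one comparison of integers. *)
Definition value_le (p : poly1) (a b D i K : Z) : bool :=
  let h := homog a b p in [&& Z.ltb 0 h.2, Z.ltb 0 D, Z.ltb 0 K & Z.leb (Z.mul h.1 K) (Z.mul i (Z.mul D h.2))].

Lemma value_leP p a b D i K : zr b != 0 :> R -> value_le p a b D i K ->
  ev1 p (zr a / zr b) / zr D <= zr i / zr K.
Proof.
move=> b0 /and4P[/(@zr_lt0 R) h0 /(@zr_lt0 R) D0 /(@zr_lt0 R) K0 /(@zr_le R) h].
have [_ [_ ->]] := homogE a p b0; rewrite !zrM in h.
by rewrite -mulrA -invfM ler_pdivrMr ?mulr_gt0// mulrAC ler_pdivlMr// [zr _.2 * _]mulrC.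
Qed.

Lemma hom2E (E : Z) (X : poly2) (p : poly1) z x y n : size p = n.+1 -> zr E != 0 :> R ->
  ev2 X z x = zr E * y -> ev2 (hom2 E X p) z x = zr E ^+ n * ev1 p y.
Proof.
move=> sp E0 hX; apply: (mulIf E0); rewrite ev_hom2// sp hX (_ : zr E * y / zr E = y); last by field.
by rewrite exprS; ring.
Qed.

Fixpoint sqp (p : poly1) : poly1 := if p is a :: p' then [:: a, 0%Z & sqp p'] else [::].

Lemma ev_sqp p x : ev1 (sqp p) x = ev1 p (x ^+ 2).
Proof. by elim: p => [|a p ih] //; rewrite [sqp _]/= !ev1_cons ih /=; ring. Qed.

End CheckedPrimitives.

(** * The wedge energies evaluated in integer arithmetic *)

Section WedgeFamily.
(** [Q], [Qm], [Qz] are dq times q and its two partial derivatives in the variable dz * z; [QB] is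
    dB times q on the centre line. Further s = sn / sd and the largest half-angle value is mn / md.
    [ip], [wp], [vp] bound, in units of 1 / 100000, the excess of the divergence integral and the
    wedge parts of the vertical wall and of the centre line. *)
Variables (Q Qm Qz : poly2) (bp QB : poly1) (dq dz dB sn sd n2 n1 nW nB mn md bn bd ip wp vp : Z).

Let E := Z.mul dq dq.
(** Numerator, over [DN], of [density] with its denominator (1 + q^2)^4 replaced by means of [U4],
    the Jacobian by [SU] and its inverse by [VU]. *)
Definition NPoly : poly2 :=
  let Q2 := mul2 Q Q in let EQ := add2 (const2 E) (opp2 Q2) in
  mul2 (const2 4) (mul2 (hom2 E Q2 U4)
    (add2 (add2 (mul2 (mul2 (mul2 EQ EQ) (mul2 Qm Qm)) [:: mul1 [:: Z.mul sn sn] (sqp SU)])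
      (mul2 (mul2 (const2 (Z.mul (Z.mul 4 1000) (Z.mul (Z.mul sn sd) dq))) EQ) (mul2 Q (mul2 Qm Qz))))
      (mul2 (mul2 [:: sqp VU] (const2 (Z.mul 4 (Z.mul E (Z.mul sd sd))))) (mul2 Q2 (mul2 Qz Qz))))).
Let E6 := Z.pow E (Z.of_nat 6).
Definition DN : Z := Z.mul (Z.mul (Z.mul 1000 1000) E6) (Z.mul sn sd).
Definition GPoly (NI : poly2) : poly1 :=
  add1 (subst2 NI bp) (mul1 [:: Z.opp (Z.mul (Z.mul (Z.mul sn sn) n2) (Z.mul 1000 E6))] (mul1 bp (sqp VL))).
(** The only variable is the half-angle one; it is put in the place of z so that the tools for
    [poly2] apply again. *)
Definition WPoly : poly2 := let Q0 := outer (head [::] Q) in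
  mul2 (const2 (Z.mul 8 sd)) (mul2 (mul2 Q0 (mul2 Q0 Q0)) (mul2 (hom2 E (mul2 Q0 Q0) U3) (outer (sqp VU)))).
Definition DW : Z := Z.mul (Z.mul (Z.mul dq E) (Z.mul 1000 1000)) (Z.mul (Z.pow E (Z.of_nat 3)) sn).
Let EB := Z.mul dB dB.
Definition BPoly : poly2 := let q2 := mul2 (outer QB) (outer QB) in let e := add2 (const2 EB) (opp2 q2) in
  mul2 (mul2 e (mul2 e e)) (hom2 EB q2 U3).
Definition DB : Z := Z.mul (Z.pow EB (Z.of_nat 6)) 1000.

Definition check_G (NI : poly2) (GP : poly1) : bool :=
  let GI := prim1 n1 GP in is_prim1 n1 GI GP &&
    value_le GI mn md (Z.mul n1 (Z.mul (Z.mul n2 DN) dz)) ip 100000.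
Definition check_N (NP : poly2) : bool :=
  let NI := prim2 n2 NP in is_prim2 n2 NI NP && check_G NI (GPoly NI).
Definition check_W (WP : poly2) : bool :=
  let WI := prim2 nW WP in is_prim2 nW WI WP && value_le (inner0 WI) mn md (Z.mul (Z.mul nW DW) 1) wp 100000.
Definition check_B (BP : poly2) : bool :=
  let BI := prim2 nB BP in is_prim2 nB BI BP && value_le (inner0 BI) bn bd (Z.mul (Z.mul nB DB) dz) vp 100000.
Definition family_check : bool :=
  [&& [&& Z.ltb 0 dq, Z.ltb 0 dz, Z.ltb 0 dB, Z.ltb 0 sn & Z.ltb 0 sd],
      [&& [&& Z.ltb 0 n2, Z.ltb 0 n1 & Z.ltb 0 nW], Z.ltb 0 nB, Z.ltb 0 md & Z.ltb 0 bd],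
      check_N NPoly, check_W WPoly & check_B BPoly].

Context {R : realType}.
Local Notation ev1 := (@ev1 R).
Local Notation ev2 := (@ev2 R).
Variables s c b1 b2 p0 p1 p2 : R.
Hypothesis s0 : 0 < s.
Hypothesis c0 : 0 < c.
Hypothesis sc : s ^+ 2 + c ^+ 2 = 1.
Hypothesis b10 : 0 <= b1.
Hypothesis b20 : 0 <= b2.
Hypothesis b12 : 0 < b1 + b2.
Local Notation beta := (beta b1 b2).
Local Notation qf := (qf b1 b2 p0 p1 p2).
Local Notation qz := (qz b1 b2 p0 p1 p2).
Local Notation qmu := (qmu b1 b2 p0 p1 p2).
Local Notation mu1 := (s / (1 + c)).
Local Notation q1 := (56 / 100 : R).
Hypothesis chk : family_check.
Hypothesis sE : s = zr sn / zr sd.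
Hypothesis mu1E : mu1 = zr mn / zr md.
Hypothesis mu1_le : mu1 <= 1 / 2.
Hypothesis hQ : forall z x, ev2 Q (zr dz * z) x = zr dq * qf z x.
Hypothesis hQm : forall z x, ev2 Qm (zr dz * z) x = zr dq * qmu z x.
Hypothesis hQz : forall z x, ev2 Qz (zr dz * z) x = zr dq * qz z x.
Hypothesis hbp : forall x, ev1 bp x = zr dz * beta x.
Hypothesis hQB : forall z, ev1 QB (zr dz * z) = zr dB * qf z mu1.
Hypothesis hb : zr dz * beta mu1 = zr bn / zr bd.
Hypothesis hq : forall z x, 0 <= x <= mu1 -> 0 <= z <= beta x -> `|qf z x| <= q1.
Hypothesis hq0 : forall x, 0 <= x <= mu1 -> 0 <= qf 0 x.

Let posZ : [/\ 0 < zr dq :> R, 0 < zr dz :> R, 0 < zr dB :> R, 0 < zr sn :> R & 0 < zr sd :> R].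
Proof. by move: chk => /and5P[/and5P[h1 h2 h3 h4 h5] _ _ _ _]; split; exact: zr_lt0. Qed.

Let z1000 : zr 1000 = 1000 :> R. Proof. by rewrite /=; ring. Qed.
Let k0 : 0 < zr 1000 :> R. Proof. exact: zr_lt0. Qed.

Let q_cap : 3136 / 10000 <= 1 :> R. Proof. lra. Qed.

Let q_sqr z x : 0 <= x <= mu1 -> 0 <= z <= beta x -> 0 <= qf z x ^+ 2 <= 3136 / 10000.
Proof.
move=> hx hz; have h := hq hx hz; rewrite sqr_ge0/= -(real_normK (num_real (qf z x))).
rewrite (_ : 3136 / 10000 = q1 ^+ 2); last by field.
by rewrite lerXn2r ?nnegrE// divr_ge0.
Qed.

Let x_sqr x : 0 <= x <= mu1 -> 0 <= x ^+ 2 <= 1 / 4.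
Proof.
move=> /andP[x0 x1]; rewrite sqr_ge0/= (_ : 1 / 4 = (1 / 2) ^+ 2); last by field.
by rewrite lerXn2r ?nnegrE ?divr_ge0// (le_trans x1).
Qed.

Let stretch_bounds x : 0 <= x <= mu1 ->
  [/\ 0 < stretch x, stretch x <= ev1 SU (x ^+ 2) / zr 1000, (stretch x)^-1 <= ev1 VU (x ^+ 2) / zr 1000 &
      ev1 VL (x ^+ 2) / zr 1000 <= (stretch x)^-1].
Proof.
move=> hx; have h := x_sqr hx; have /andP[h0 h1] := h.
have p0' : 0 < 1 - x ^+ 2 by lra.
have E1 : (stretch x)^-1 = 2 * (1 - x ^+ 2) / (1 + x ^+ 2) ^+ 2 by rewrite /stretch invf_div.
split.
- by rewrite divr_gt0 ?exprn_gt0 ?mulr_gt0// ltr_pwDl.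
- by rewrite z1000; exact: SU_ge.
- by rewrite E1 z1000; exact: VU_ge.
- by rewrite E1 z1000; exact: VL_le.
Qed.

Definition Nf (z x : R) : R := ev2 NPoly (zr dz * z) x / zr DN.
Definition NI (z x : R) : R := ev2 (prim2 n2 NPoly) (zr dz * z) x / (zr n2 * zr DN * zr dz).

Lemma density_le z x : 0 <= x <= mu1 -> 0 <= z <= beta x -> density s b1 b2 p0 p1 p2 z x <= Nf z x.
Proof.
move=> hx hz; have [dq0 dz0 dB0 sn0 sd0] := posZ.
have [st0 stU stV _] := stretch_bounds hx; have ht := q_sqr hx hz; have /andP[t0 t1] := ht.
have E0 : zr E != 0 :> R by rewrite zrM mulf_neq0// gt_eqF.
have n1' : zr dq != 0 :> R by rewrite gt_eqF.
have n2' : zr sn != 0 :> R by rewrite gt_eqF.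
have n3' : zr sd != 0 :> R by rewrite gt_eqF.
have n4' : zr 1000 != 0 :> R by rewrite gt_eqF.
have hQ2 : ev2 (mul2 Q Q) (zr dz * z) x = zr E * qf z x ^+ 2 by rewrite ev2_mul hQ zrM; ring.
have z4 : zr 4 = 4 :> R by rewrite /=; ring.
have zm1 : zr (-1) = -1 :> R by [].
have -> : Nf z x = 4 * (ev1 U4 (qf z x ^+ 2) / zr 1000) *
    ((1 - qf z x ^+ 2) ^+ 2 * qmu z x ^+ 2 * (s * (ev1 SU (x ^+ 2) / zr 1000))
    + 4 * (1 - qf z x ^+ 2) * qf z x * qmu z x * qz z x
    + 4 * qf z x ^+ 2 * qz z x ^+ 2 / s * (ev1 VU (x ^+ 2) / zr 1000)).
  rewrite /Nf /NPoly /DN /E6 /opp2 !ev2_mul (hom2E (n := 3) _ E0 hQ2)//.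
  rewrite !(ev2_mul, ev2_add, ev_const2, ev_inner, ev1_mul, ev1_const, ev_sqp).
  rewrite hQ hQm hQz zm1 !(zr_pow, zrM) z4 sE.
  set u4 := ev1 U4 _; set su := ev1 SU _; set vu := ev1 VU _; set k := zr 1000 in n4' *.
  by field; rewrite n1' n2' n3' n4'.
rewrite /density; set br := (X in _ * X <= _); set br' := (X in _ <= _ * X).
(* The mixed term has no sign, but the whole bracket is a square divided by the Jacobian; its
   nonnegativity permits multiplying the bounds of the two factors. *)
have br0 : 0 <= br.
  have -> : br = ((1 - qf z x ^+ 2) * qmu z x * (s * stretch x) + 2 * qf z x * qz z x) ^+ 2 / (s * stretch x).
    by rewrite /br; field; rewrite !gt_eqF.
  by rewrite divr_ge0 ?sqr_ge0// mulr_ge0// ltW.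
have brle : br <= br'.
  rewrite /br /br'; apply: lerD; first rewrite lerD2r.
    apply: ler_wpM2l; first by rewrite mulr_ge0 ?sqr_ge0.
    by apply: ler_wpM2l; [exact: ltW|exact: stU].
  rewrite invfM [leLHS]mulrA; apply: ler_wpM2l; last exact: stV.
  apply: divr_ge0; last exact: ltW.
  by apply: mulr_ge0; [apply: mulr_ge0; [exact: ler0n|exact: sqr_ge0]|exact: sqr_ge0].
have hU := U4_ge ht; rewrite -z1000 in hU.
have i0 : 0 <= ((1 + qf z x ^+ 2) ^+ 4)^-1 by rewrite invr_ge0 exprn_ge0// addr_ge0.
by apply: ler_pM => //; rewrite ?mulr_ge0// ler_wpM2l.
Qed.

Lemma is_derive_NI z x : is_derive z (1 : R) (NI ^~ x) (Nf z x).
Proof.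
by move: chk => /and5P[/and5P[_ h2 _ _ _] /and4P[/and3P[h3 _ _] _ _ _] /andP[h _] _ _]; exact: is_derive_prim2.
Qed.

Let cont2 (p : poly2) (D : R) (z x : R) : {for z, continuous (fun z => ev2 p (zr dz * z) x / D)}.
Proof.
apply: cvgM; last exact: cvg_cst.
apply: (@continuous_comp _ _ _ (fun z => zr dz * z) (ev2 p ^~ x)); last exact: ev2_continuous.
by apply: cvgM; [exact: cvg_cst|exact: cvg_id].
Qed.

Definition GP := GPoly (prim2 n2 NPoly).
Definition gf (x : R) : R := ev1 GP x / (zr n2 * zr DN * zr dz).
Definition GI (x : R) : R := ev1 (prim1 n1 GP) x / (zr n1 * (zr n2 * zr DN * zr dz)).
Definition Wf (x : R) : R := ev2 WPoly (zr 1 * x) 0 / zr DW.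
Definition WI (x : R) : R := ev2 (prim2 nW WPoly) (zr 1 * x) 0 / (zr nW * zr DW * zr 1).
Definition Bf (z : R) : R := ev2 BPoly (zr dz * z) 0 / zr DB.
Definition BI (z : R) : R := ev2 (prim2 nB BPoly) (zr dz * z) 0 / (zr nB * zr DB * zr dz).

(** The inverse Jacobian occurs with a minus sign, so it is bounded from below by [VL]. *)
Lemma gf_ge x : 0 <= x <= mu1 -> NI (beta x) x - s * beta x / stretch x <= gf x.
Proof.
move=> hx; have [dq0 dz0 dB0 sn0 sd0] := posZ; have [_ _ _ VL1] := stretch_bounds hx.
have n20 : zr n2 != 0 :> R by move: chk => /and5P[_ /and4P[/and3P[/(@zr_lt0 R) h _ _] _ _ _] _ _ _]; rewrite gt_eqF.
have be0 : 0 <= beta x by apply: beta_ge0 => //; case/andP: hx.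
have n1' : zr dq != 0 :> R by rewrite gt_eqF.
have n2' : zr sn != 0 :> R by rewrite gt_eqF.
have n3' : zr sd != 0 :> R by rewrite gt_eqF.
have n4' : zr 1000 != 0 :> R by rewrite gt_eqF.
have n5' : zr dz != 0 :> R by rewrite gt_eqF.
have -> : gf x = NI (beta x) x - s * beta x * (ev1 VL (x ^+ 2) / zr 1000).
  rewrite /gf /GP /GPoly ev1_add ev_subst2 !ev1_mul ev1_const ev_sqp hbp /NI /DN /E6 zr_opp !(zr_pow, zrM) sE.
  set ni := ev2 _ _ _; set vl := ev1 VL _; set k := zr 1000 in n4' *.
  by field; rewrite n1' n2' n3' n4' n5' n20.
by rewrite lerD2l lerN2; apply: ler_wpM2l => //; rewrite mulr_ge0// ltW.
Qed.

(** The factor [VU] in [Wf] is at least the inverse of [stretch] and so compensates the weight that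
    the substitution introduces. *)
Lemma Wf_ge x : 0 <= x <= mu1 -> `|tw (qf 0 x)| ^+ 3 <= s * stretch x * Wf x.
Proof.
move=> hx; have [dq0 dz0 dB0 sn0 sd0] := posZ; have [st0 _ stV _] := stretch_bounds hx.
have be0 : 0 <= beta x by apply: beta_ge0 => //; case/andP: hx.
have hz : 0 <= (0 : R) <= beta x by rewrite lexx.
have ht := q_sqr hx hz; have /andP[t0 t1] := ht; have qq := hq0 hx.
have E0 : zr E != 0 :> R by rewrite zrM mulf_neq0// gt_eqF.
have n1' : zr dq != 0 :> R by rewrite gt_eqF.
have n2' : zr sn != 0 :> R by rewrite gt_eqF.
have n3' : zr sd != 0 :> R by rewrite gt_eqF.
have n4' : zr 1000 != 0 :> R by rewrite gt_eqF.
have hQ0 : ev2 (outer (head [::] Q)) (zr 1 * x) 0 = zr dq * qf 0 x.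
  rewrite ev_outer -(hQ 0 x) mulr0 [zr 1]/= mul1r; case: (Q) => [|q p] //=.
  by rewrite mul0r addr0.
have hQ2 : ev2 (mul2 (outer (head [::] Q)) (outer (head [::] Q))) (zr 1 * x) 0 = zr E * qf 0 x ^+ 2.
  by rewrite ev2_mul hQ0 zrM; ring.
have z8 : zr 8 = 8 :> R by rewrite /=; ring.
have -> : Wf x = 8 * qf 0 x ^+ 3 * (ev1 U3 (qf 0 x ^+ 2) / zr 1000) * (ev1 VU (x ^+ 2) / zr 1000) / s.
  rewrite /Wf /WPoly /DW !ev2_mul (hom2E (n := 3) _ E0 hQ2)// hQ0 ev_const2 ev_outer [zr 1 * x]mul1r ev_sqp.
  rewrite !(zr_pow, zrM) z8 sE.
  set u3 := ev1 U3 _; set vu := ev1 VU _; set k := zr 1000 in n4' *.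
  by field; rewrite n1' n2' n3' n4'.
have tw0 : 0 <= tw (qf 0 x) by rewrite divr_ge0 ?mulr_ge0// addr_ge0.
have hU := U3_ge ht; rewrite -z1000 in hU.
rewrite ger0_norm// /tw expr_div_n exprMn (_ : 2 ^+ 3 = 8); last by ring.
set u := ev1 U3 _ / _ in hU *; set v := ev1 VU _ / _ in stV *.
have -> : s * stretch x * (8 * qf 0 x ^+ 3 * u * v / s) = 8 * qf 0 x ^+ 3 * (u * (stretch x * v)).
  by field; rewrite gt_eqF.
apply: ler_wpM2l; first by rewrite mulr_ge0// exprn_ge0.
have u0 : 0 <= u by apply: le_trans hU; rewrite invr_ge0 exprn_ge0// addr_ge0.
apply: (le_trans hU); rewrite -[leLHS]mulr1; apply: ler_wpM2l => //.
by rewrite -(mulfV (lt0r_neq0 st0)) ler_wpM2l// ltW.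
Qed.

Lemma Bf_ge z : 0 <= z <= beta mu1 -> ((1 - qf z mu1 ^+ 2) / (1 + qf z mu1 ^+ 2)) ^+ 3 <= Bf z.
Proof.
move=> hz; have [dq0 dz0 dB0 sn0 sd0] := posZ.
have m0 : 0 <= mu1 by rewrite divr_ge0 ?(ltW s0)// addr_ge0// ltW.
have hx : 0 <= mu1 <= mu1 by rewrite m0 lexx.
have ht := q_sqr hx hz; have /andP[t0 t1] := ht.
have E0 : zr EB != 0 :> R by rewrite zrM mulf_neq0// gt_eqF.
have n1' : zr dB != 0 :> R by rewrite gt_eqF.
have n4' : zr 1000 != 0 :> R by rewrite gt_eqF.
have hQ2 : ev2 (mul2 (outer QB) (outer QB)) (zr dz * z) 0 = zr EB * qf z mu1 ^+ 2.
  by rewrite ev2_mul ev_outer hQB zrM; ring.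
have -> : Bf z = (1 - qf z mu1 ^+ 2) ^+ 3 * (ev1 U3 (qf z mu1 ^+ 2) / zr 1000).
  rewrite /Bf /BPoly /DB /opp2 !ev2_mul (hom2E (n := 3) _ E0 hQ2)// !(ev2_mul, ev2_add, ev_const2).
  rewrite !ev_outer hQB (_ : zr (-1) = -1 :> R)// !(zr_pow, zrM).
  set u3 := ev1 U3 _; set k := zr 1000 in n4' *.
  by field; rewrite n1' n4'.
have hU := U3_ge ht; rewrite -z1000 in hU.
by rewrite expr_div_n; apply: ler_wpM2l => //; rewrite exprn_ge0// subr_ge0 (le_trans t1).
Qed.

Lemma GI_bound : GI mu1 - GI 0 <= zr ip / zr 100000.
Proof.
have -> : GI 0 = 0 by rewrite /GI /prim1 ev1_cons mul0r addr0 mul0r.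
move: chk => /and5P[_ /and4P[_ _ /(@zr_lt0 R) md0 _] /andP[_ /andP[_ h]] _ _].
have := value_leP (lt0r_neq0 md0) h.
by rewrite subr0 /GI mu1E !zrM.
Qed.

Lemma WI_bound : WI mu1 - WI 0 <= zr wp / zr 100000.
Proof.
have -> : WI 0 = 0 by rewrite /WI /prim2 ev2_cons mulr0 mul0r addr0 mul0r.
move: chk => /and5P[_ /and4P[_ _ /(@zr_lt0 R) md0 _] _ /andP[_ h] _].
have := value_leP (lt0r_neq0 md0) h.
by rewrite subr0 /WI ev_inner0 mu1E !zrM [zr 1]/= mul1r.
Qed.

Lemma BI_bound : BI (beta mu1) - BI 0 <= zr vp / zr 100000.
Proof.
have -> : BI 0 = 0 by rewrite /BI /prim2 ev2_cons mulr0 mul0r addr0 mul0r.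
move: chk => /and5P[_ /and4P[_ _ _ /(@zr_lt0 R) bd0] _ _ /andP[_ h]].
have := value_leP (lt0r_neq0 bd0) h.
by rewrite subr0 /BI ev_inner0 hb !zrM.
Qed.

Lemma family_energy (k : nat) (tau eps d L H : R) : (0 < k)%nat -> 0 < H -> 0 < L -> 0 < tau ->
  0 < d -> d <= 1 -> eps = d ^+ 2 / 2 ->
  (forall m, 0 <= m <= 1 -> xs s c m + beta (half s m) <= tau) -> tau + eps <= 2 * c / s ->
  exists2 u, admissible (halfperiod tau H k) H u &
  (E0 (halfperiod tau H k) H L u <= (k%:R * H *
    (2 * (L / H) * (s ^+ 2 * tau - fanPhi s + zr ip / zr 100000 + 3 * s ^+ 2 * eps) +
     8 / 3 * (2 * d + zr wp / zr 100000 + (c ^+ 3 * (tau - beta mu1) + zr vp / zr 100000))))%:E)%E.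
Proof.
move=> kn H0 L0 tau0 d0 d1 ed hsep htau.
have eps0 : 0 < eps by rewrite ed divr_gt0// exprn_gt0.
have q11 : q1 < 1 by lra.
have NI0 x : NI 0 x = 0 by rewrite /NI /prim2 ev2_cons mulr0 mul0r addr0 mul0r.
move: (chk) => /and5P[/and5P[_ hz _ _ _] /and4P[/and3P[_ h1 hW] hB _ _] /andP[_ /andP[hG _]] /andP[hWP _] /andP[hBP _]].
have dG x : is_derive x (1 : R) GI (gf x) by exact: is_derive_prim1.
have cG (x : R) : {for x, continuous gf} by apply: cvgM; [exact: ev1_continuous|exact: cvg_cst].
have dW x : is_derive x (1 : R) WI (Wf x) by exact: is_derive_prim2.
have cW (x : R) : {for x, continuous Wf}.
  apply: cvgM; last exact: cvg_cst.
  apply: (@continuous_comp _ _ _ (fun z => zr 1 * z) (ev2 WPoly ^~ 0)); last exact: ev2_continuous.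
  by apply: cvgM; [exact: cvg_cst|exact: cvg_id].
have dB' x : is_derive x (1 : R) BI (Bf x) by exact: is_derive_prim2.
have [] := prof_energy s0 c0 sc eps0 tau0 b10 b20 b12 q11 hq hsep htau density_le is_derive_NI
  (fun z x => @cont2 NPoly (zr DN) z x) NI0 kn H0 L0 d0 d1 ed dG cG gf_ge dW cW Wf_ge dB'
  (fun z => @cont2 BPoly (zr DB) z 0) Bf_ge.
move=> adm hE; eexists; first exact: adm.
apply: (le_trans hE); rewrite lee_fin; apply: ler_wpM2l; first by rewrite mulr_ge0// ltW.
have g1 := GI_bound; have g2 := WI_bound; have g3 := BI_bound.
have l0 : 0 <= 2 * (L / H) by rewrite mulr_ge0// divr_ge0// ltW.
apply: lerD; first by apply: ler_wpM2l => //; rewrite lerD2r lerD2l.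
by apply: ler_wpM2l; [exact: divr_ge0|apply: lerD; rewrite lerD2l].
Qed.

End WedgeFamily.

Lemma half_sqr_le {R : realType} (d : R) : 0 < d -> d <= 1 -> d ^+ 2 / 2 <= 1 / 2.
Proof. by move=> d0 d1; rewrite ler_wpM2r ?invr_ge0// exprn_ile1// ltW. Qed.

(** Fixes d = 1 / 10000, and with it the shift eps = d^2 / 2 of the fan, for both families. *)
Lemma small_step {R : realType} :
  [/\ 0 < (1 / 10000 : R), (1 / 10000 : R) <= 1 & (1 / 10000) ^+ 2 / 2 <= (1 / 2 : R)].
Proof.
have h0 : 0 < (1 / 10000 : R) by lra.
have h1 : (1 / 10000 : R) <= 1 by lra.
by split; [exact: h0|exact: h1|exact: half_sqr_le h0 h1].
Qed.

Lemma half_le_11_4 (R : realType) : 1 / 2 <= 11 / 4 :> R.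
Proof. lra. Qed.

(** * The family with one cell per half period *)

Section WideFamily.
Context {R : realType}.
Local Notation ev1 := (@ev1 R).
Local Notation ev2 := (@ev2 R).

(* Here q is given as 1000 q in the variables (10 z, mu), with
   q = mu + (beta mu - z) (95 - 250 mu + 170 z) / 100 and beta mu = mu / 2 + 6 mu^2 / 5;
   the coefficients come from a numerical minimisation. *)
Definition Qa : poly2 := [:: [:: 0; 1475; -110; -3000]; [:: -95; 335; 204]; [:: -17]]%Z.
Definition Qma : poly2 := [:: [:: 1475; -220; -9000]; [:: 335; 408]]%Z.
Definition Qza : poly2 := [:: [:: -950; 3350; 2040]; [:: -340]]%Z.

(* The large integers are multiples of all exponents occurring in the primitives. *)
Lemma family_check_wide : family_check Qa Qma Qza [:: 0; 5; 12]%Z [:: 670; 247; -34]%Z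
  1000 10 2000 4 5 5354228880 164249358725037825439200 144403552893600 26771144400 1 2 11 2 (-2120) 14103 12197.
Proof. by vm_compute. Qed.

(** q = x + D Y, where D has slope -1 and Y slope 17 / 10 in z, so 17 / 10 * D + Y depends on x
    alone. The inequality between the means bounds D Y by the square of this sum over 68 / 10. The
    lower bound uses Y >= - 3 / 10 and the width of the wedge. *)
Lemma wide_q_le (z x : R) : 0 <= x <= 1 / 2 -> 0 <= z <= beta (1 / 2) (12 / 10) x ->
  `|qf (1 / 2) (12 / 10) (95 / 100) (- 250 / 100) (170 / 100) z x| <= 56 / 100.
Proof.
move=> /andP[x0 x1] /andP[z0 z1]; rewrite /qf.
set Y := wedgeP _ _ _ _ _; set D := beta (1 / 2) (12 / 10) x - z.
have D0 : 0 <= D by rewrite subr_ge0.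
have x2 : x ^+ 2 <= x / 2 by rewrite expr2; nra.
have D1 : D <= 55 / 100 by rewrite /D /beta; lra.
have Y0 : 0 <= Y + 3 / 10 by rewrite /Y /wedgeP; lra.
have DY : 0 <= D * (Y + 3 / 10) by rewrite mulr_ge0.
pose v := 95 / 100 - 165 / 100 * x + 204 / 100 * x ^+ 2.
have vE : v = 17 / 10 * D + Y by rewrite /v /D /Y /wedgeP /beta; field.
have v0 : 0 <= v by rewrite /v; have := sqr_ge0 (x - 4 / 10); lra.
have v1 : v <= 95 / 100 - 63 / 100 * x by rewrite /v; lra.
have v2 : v ^+ 2 <= (95 / 100 - 63 / 100 * x) ^+ 2 by rewrite lerXn2r ?nnegrE//; lra.
have amgm : 4 * (17 / 10) * (D * Y) <= v ^+ 2.
  by rewrite vE -subr_ge0 (_ : _ - _ = (17 / 10 * D - Y) ^+ 2) ?sqr_ge0//; field.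
have fin : (95 / 100 - 63 / 100 * x) ^+ 2 <= 68 / 10 * (56 / 100 - x) by nra.
by rewrite ler_norml; apply/andP; split; lra.
Qed.

(** A Pythagorean pair: c is rational and s / (1 + c) = 1 / 2. *)
Let s : R := 4 / 5.
Let c : R := 3 / 5.

Lemma wide_energy (tau L H : R) : 0 < H -> 0 < L -> 555 / 1000 <= tau -> tau <= 1 ->
  exists2 u, admissible (halfperiod tau H 1) H u &
  (E0 (halfperiod tau H 1) H L u <= (1%:R * H *
    (2 * (L / H) * (s ^+ 2 * tau - fanPhi s + zr (-2120) / zr 100000 + 3 * s ^+ 2 * ((1 / 10000) ^+ 2 / 2)) +
     8 / 3 * (2 * (1 / 10000) + zr 14103 / zr 100000 + (c ^+ 3 * (tau - 11 / 20) + zr 12197 / zr 100000))))%:E)%E.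
Proof.
move=> H0 L0 tau1 tau2; have tau0 : 0 < tau by lra.
have s0 : 0 < s by rewrite /s; lra.
have c0 : 0 < c by rewrite /c; lra.
have sc : s ^+ 2 + c ^+ 2 = 1 by rewrite /s /c; field.
have m1 : s / (1 + c) = 1 / 2 by rewrite /s /c; field.
pose b1 : R := 1 / 2; pose b2 : R := 12 / 10.
have b10 : 0 <= b1 by rewrite /b1; lra.
have b20 : 0 <= b2 by rewrite /b2; lra.
have b12 : 0 < b1 + b2 by rewrite /b1 /b2; lra.
pose p0 : R := 95 / 100; pose p1 : R := - 250 / 100; pose p2 : R := 170 / 100.
have bm : beta b1 b2 (s / (1 + c)) = 11 / 20 by rewrite m1 /beta /b1 /b2; field.
have sE : s = zr 4 / zr 5 by rewrite /s /=; field.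
have mE : s / (1 + c) = zr 1 / zr 2 by rewrite m1 /=; field.
have ml : s / (1 + c) <= 1 / 2 by rewrite m1.
have hQ z x : ev2 Qa (zr 10 * z) x = zr 1000 * qf b1 b2 p0 p1 p2 z x.
  by rewrite /qf /wedgeP /beta /b1 /b2 /p0 /p1 /p2 /ev2 /ev1 /=; field.
have hQm z x : ev2 Qma (zr 10 * z) x = zr 1000 * qmu b1 b2 p0 p1 p2 z x.
  by rewrite /qmu /wedgeP /beta /b1 /b2 /p0 /p1 /p2 /ev2 /ev1 /=; field.
have hQz z x : ev2 Qza (zr 10 * z) x = zr 1000 * qz b1 b2 p0 p1 p2 z x.
  by rewrite /qz /wedgeP /beta /b1 /b2 /p0 /p1 /p2 /ev2 /ev1 /=; field.
have hbp x : ev1 [:: 0; 5; 12]%Z x = zr 10 * beta b1 b2 x.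
  by rewrite /beta /b1 /b2 /ev1 /=; field.
have hQB z : ev1 [:: 670; 247; -34]%Z (zr 10 * z) = zr 2000 * qf b1 b2 p0 p1 p2 z (s / (1 + c)).
  by rewrite m1 /qf /wedgeP /beta /b1 /b2 /p0 /p1 /p2 /ev1 /=; field.
have hb : zr 10 * beta b1 b2 (s / (1 + c)) = zr 11 / zr 2 by rewrite bm /=; field.
have hq z x : 0 <= x <= s / (1 + c) -> 0 <= z <= beta b1 b2 x -> `|qf b1 b2 p0 p1 p2 z x| <= 56 / 100.
  by rewrite m1; exact: wide_q_le.
have hq0 x : 0 <= x <= s / (1 + c) -> 0 <= qf b1 b2 p0 p1 p2 0 x.
  rewrite m1 => /andP[x0 x1].
  have -> : qf b1 b2 p0 p1 p2 0 x = x * (1475 - 110 * x - 3000 * x ^+ 2) / 1000.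
    by rewrite /qf /wedgeP /beta /b1 /b2 /p0 /p1 /p2; field.
  have x2 : x ^+ 2 <= x / 2 by rewrite expr2; nra.
  by apply: divr_ge0; [apply: mulr_ge0; [|lra]|exact: ler0n].
have hsep m : 0 <= m <= 1 -> xs s c m + beta b1 b2 (half s m) <= tau.
  move=> hm; have [h1 _] := half_sqr c0 sc hm; have r0 := rt_gt0 c0 sc hm.
  have x0 : 0 <= half s m by rewrite half_ge0//; case/andP: hm.
  have x1 : half s m <= 1 / 2 by rewrite -m1 (half_le1 s0 c0 sc).
  rewrite /xs; set r := rt s m in h1 r0 *; set x := half s m in h1 x0 x1 *.
  have xn : 1 + x ^+ 2 != 0 by rewrite gt_eqF// ltr_pwDl// sqr_ge0.
  have rn : 1 + r != 0 by rewrite gt_eqF// addr_gt0.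
  have rE : r = 2 / (1 + x ^+ 2) - 1 by rewrite h1; field.
  (* In the half-angle variable the separation of arc and wedge is the nonnegativity of this quartic
     on [0, 1 / 2], tested on 17 cells of length 1 / 32. *)
  have P0 := @pos_range R [:: 550; -5000; 13550; -5000; -12000]%Z 16 32 x.
  have P1 : 0 <= ev1 [:: 550; -5000; 13550; -5000; -12000]%Z x.
    by apply: P0; [by vm_compute|exact: x0|rewrite /=; lra].
  apply: le_trans tau1; rewrite -subr_ge0 rE.
  have -> : 555 / 1000 - ((2 / (1 + x ^+ 2) - 1 - c) / s + beta b1 b2 x) =
      ev1 [:: 550; -5000; 13550; -5000; -12000]%Z x / (10000 * (1 + x ^+ 2)).
    by rewrite /c /s /beta /b1 /b2 /ev1 /=; field.
  apply: divr_ge0; first exact: P1.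
  by apply: mulr_ge0; [exact: ler0n|rewrite addr_ge0// sqr_ge0].
have [d0 d1 d2] := @small_step R.
have ht : tau + (1 / 10000) ^+ 2 / 2 <= 2 * c / s.
  rewrite (_ : 2 * c / s = 1 + 1 / 2); last by rewrite /c /s; field.
  by apply: lerD; [exact: tau2|exact: d2].
have := family_energy s0 c0 sc b10 b20 b12 family_check_wide sE mE ml hQ hQm hQz hbp hQB hb hq hq0
  (isT : (0 < 1)%nat) H0 L0 tau0 d0 d1 (erefl _) hsep ht.
by rewrite bm.
Qed.

End WideFamily.

(** * The family with two cells per half period *)

Section NarrowFamily.
Context {R : realType}.
Local Notation ev1 := (@ev1 R).
Local Notation ev2 := (@ev2 R).

(* 10 q in (z, mu), with q = mu + (beta mu - z) (8 - 5 mu + 35 z) / 10 and beta mu = 4 mu^2. *)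
Definition Qb : poly2 := [:: [:: 0; 10; 32; -20]; [:: -8; 5; 140]; [:: -35]]%Z.
Definition Qmb : poly2 := [:: [:: 10; 64; -60]; [:: 5; 280]]%Z.
Definition Qzb : poly2 := [:: [:: -8; 5; 140]; [:: -70]]%Z.

Lemma family_check_narrow : family_check Qb Qmb Qzb [:: 0; 0; 4]%Z [:: 67; 32; -560]%Z
  10 1 160 8 17 5354228880 164249358725037825439200 144403552893600 26771144400 1 4 1 4 (-1) 8185 11007.
Proof. by vm_compute. Qed.

(** As in [wide_q_le], now with 35 / 10 * D + Y independent of z; here Y >= 0, so q stays
    nonnegative. *)
Lemma narrow_q_bounds (z x : R) : 0 <= x <= 1 / 4 -> 0 <= z <= beta 0 4 x ->
  0 <= qf 0 4 (8 / 10) (- 5 / 10) (35 / 10) z x <= 56 / 100.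
Proof.
move=> /andP[x0 x1] /andP[z0 z1]; rewrite /qf.
set Y := wedgeP _ _ _ _ _; set D := beta 0 4 x - z.
have D0 : 0 <= D by rewrite subr_ge0.
have x2 : x ^+ 2 <= x / 4 by rewrite expr2; nra.
have Y0 : 0 <= Y by rewrite /Y /wedgeP; lra.
have DY : 0 <= D * Y by rewrite mulr_ge0.
pose v := 8 / 10 - 5 / 10 * x + 14 * x ^+ 2.
have vE : v = 35 / 10 * D + Y by rewrite /v /D /Y /wedgeP /beta; field.
have v0 : 0 <= v by rewrite vE addr_ge0// mulr_ge0//; lra.
have v1 : v <= 8 / 10 + 3 * x by rewrite /v; lra.
have v2 : v ^+ 2 <= (8 / 10 + 3 * x) ^+ 2 by rewrite lerXn2r ?nnegrE//; lra.
have amgm : 4 * (35 / 10) * (D * Y) <= v ^+ 2.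
  by rewrite vE -subr_ge0 (_ : _ - _ = (35 / 10 * D - Y) ^+ 2) ?sqr_ge0//; field.
have fin : (8 / 10 + 3 * x) ^+ 2 <= 14 * (56 / 100 - x) by nra.
by apply/andP; split; lra.
Qed.

(** Again a Pythagorean pair, with s / (1 + c) = 1 / 4. *)
Let s : R := 8 / 17.
Let c : R := 15 / 17.

Lemma narrow_energy (tau L H : R) : 0 < H -> 0 < L -> 1 / 4 <= tau -> tau <= 1 ->
  exists2 u, admissible (halfperiod tau H 2) H u &
  (E0 (halfperiod tau H 2) H L u <= (2%:R * H *
    (2 * (L / H) * (s ^+ 2 * tau - fanPhi s + zr (-1) / zr 100000 + 3 * s ^+ 2 * ((1 / 10000) ^+ 2 / 2)) +
     8 / 3 * (2 * (1 / 10000) + zr 8185 / zr 100000 + (c ^+ 3 * (tau - 1 / 4) + zr 11007 / zr 100000))))%:E)%E.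
Proof.
move=> H0 L0 tau1 tau2; have tau0 : 0 < tau by lra.
have s0 : 0 < s by rewrite /s; lra.
have c0 : 0 < c by rewrite /c; lra.
have sc : s ^+ 2 + c ^+ 2 = 1 by rewrite /s /c; field.
have m1 : s / (1 + c) = 1 / 4 by rewrite /s /c; field.
pose b1 : R := 0; pose b2 : R := 4.
have b10 : 0 <= b1 by rewrite /b1.
have b20 : 0 <= b2 by rewrite /b2; lra.
have b12 : 0 < b1 + b2 by rewrite /b1 /b2; lra.
pose p0 : R := 8 / 10; pose p1 : R := - 5 / 10; pose p2 : R := 35 / 10.
have bm : beta b1 b2 (s / (1 + c)) = 1 / 4 by rewrite m1 /beta /b1 /b2; field.
have sE : s = zr 8 / zr 17 by rewrite /s /=; field.
have mE : s / (1 + c) = zr 1 / zr 4 by rewrite m1 /=; field.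
have ml : s / (1 + c) <= 1 / 2 by rewrite m1; lra.
have hQ z x : ev2 Qb (zr 1 * z) x = zr 10 * qf b1 b2 p0 p1 p2 z x.
  by rewrite /qf /wedgeP /beta /b1 /b2 /p0 /p1 /p2 /ev2 /ev1 /=; field.
have hQm z x : ev2 Qmb (zr 1 * z) x = zr 10 * qmu b1 b2 p0 p1 p2 z x.
  by rewrite /qmu /wedgeP /beta /b1 /b2 /p0 /p1 /p2 /ev2 /ev1 /=; field.
have hQz z x : ev2 Qzb (zr 1 * z) x = zr 10 * qz b1 b2 p0 p1 p2 z x.
  by rewrite /qz /wedgeP /beta /b1 /b2 /p0 /p1 /p2 /ev2 /ev1 /=; field.
have hbp x : ev1 [:: 0; 0; 4]%Z x = zr 1 * beta b1 b2 x.
  by rewrite /beta /b1 /b2 /ev1 /=; ring.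
have hQB z : ev1 [:: 67; 32; -560]%Z (zr 1 * z) = zr 160 * qf b1 b2 p0 p1 p2 z (s / (1 + c)).
  by rewrite m1 /qf /wedgeP /beta /b1 /b2 /p0 /p1 /p2 /ev1 /=; field.
have hb : zr 1 * beta b1 b2 (s / (1 + c)) = zr 1 / zr 4 by rewrite bm /=; field.
have hqq z x : 0 <= x <= 1 / 4 -> 0 <= z <= beta b1 b2 x -> 0 <= qf b1 b2 p0 p1 p2 z x <= 56 / 100.
  exact: narrow_q_bounds.
have hq z x : 0 <= x <= s / (1 + c) -> 0 <= z <= beta b1 b2 x -> `|qf b1 b2 p0 p1 p2 z x| <= 56 / 100.
  by rewrite m1 => hx hz; have /andP[h1 h2] := hqq z x hx hz; rewrite ger0_norm.
have hq0 x : 0 <= x <= s / (1 + c) -> 0 <= qf b1 b2 p0 p1 p2 0 x.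
  rewrite m1 => hx; have hz : 0 <= (0 : R) <= beta b1 b2 x by rewrite lexx beta_ge0//; case/andP: hx.
  by case/andP: (hqq 0 x hx hz).
have hsep m : 0 <= m <= 1 -> xs s c m + beta b1 b2 (half s m) <= tau.
  move=> hm; have [h1 _] := half_sqr c0 sc hm; have r0 := rt_gt0 c0 sc hm.
  have x0 : 0 <= half s m by rewrite half_ge0//; case/andP: hm.
  have x1 : half s m <= 1 / 4 by rewrite -m1 (half_le1 s0 c0 sc).
  rewrite /xs; set r := rt s m in h1 r0 *; set x := half s m in h1 x0 x1 *.
  have xn : 1 + x ^+ 2 != 0 by rewrite gt_eqF// ltr_pwDl// sqr_ge0.
  have rn : 1 + r != 0 by rewrite gt_eqF// addr_gt0.
  have rE : r = 2 / (1 + x ^+ 2) - 1 by rewrite h1; field.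
  apply: le_trans tau1; rewrite -subr_ge0 rE.
  (* For tau = 1 / 4 the arc and the wedge touch at x = 0 and at x = 1 / 4, and the difference
     factors accordingly. *)
  have -> : 1 / 4 - ((2 / (1 + x ^+ 2) - 1 - c) / s + beta b1 b2 x) = 4 * x ^+ 2 * ((1 / 4) ^+ 2 - x ^+ 2) / (1 + x ^+ 2).
    by rewrite /c /s /beta /b1 /b2; field.
  apply: divr_ge0; last by rewrite addr_ge0// sqr_ge0.
  apply: mulr_ge0; first by apply: mulr_ge0; [exact: ler0n|exact: sqr_ge0].
  by rewrite subr_ge0 lerXn2r ?nnegrE//; lra.
have [d0 d1 d2] := @small_step R.
have ht : tau + (1 / 10000) ^+ 2 / 2 <= 2 * c / s.
  rewrite (_ : 2 * c / s = 1 + 11 / 4); last by rewrite /c /s; field.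
  by apply: lerD; [exact: tau2|exact: le_trans d2 (half_le_11_4 R)].
have := family_energy s0 c0 sc b10 b20 b12 family_check_narrow sE mE ml hQ hQm hQz hbp hQB hb hq hq0
  (isT : (0 < 2)%nat) H0 L0 tau0 d0 d1 (erefl _) hsep ht.
by rewrite bm.
Qed.

End NarrowFamily.

(** * The period equation *)

Section PeriodEquation.
Context {R : realType}.
Implicit Types l t a b : R.

(** P t = (1 + t)^2 - 2 vanishes at sqrt 2 - 1, the lower end of the range of t. Without the square
    root the period equation reads L / H = A t / B t. *)
Let P (t : R) : R := t ^+ 2 + 2 * t - 1.
Let A (t : R) : R := 4 * t ^+ 2 * (1 - t ^+ 2).
Let B (t : R) : R := P t * (1 + t ^+ 2).

Lemma sqrt2_lt t : 0 < t -> (Num.sqrt 2 - 1 < t) = (0 < P t).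
Proof.
move=> t0; have -> : P t = (1 + t) ^+ 2 - 2 by rewrite /P; ring.
rewrite subr_gt0 ltrBlDl -[RHS](@ltr_sqrt _ 2) ?exprn_gt0 ?addr_gt0//.
by rewrite sqrtr_sqr ger0_norm// addr_ge0// ltW.
Qed.

Lemma sqrt2_gt1 : 0 < Num.sqrt 2 - 1 :> R.
Proof. by rewrite subr_gt0 -[X in X < _]sqrtr1 ltr_sqrt; lra. Qed.

(* Clearing the square root gives (l B t)^2 = (A t)^2. *)
Lemma period_equationE l t : 0 < l -> Num.sqrt 2 - 1 < t < 1 -> period_equation l t <-> l * B t = A t.
Proof.
move=> l0 /andP[t1 t2]; have t0 : 0 < t := lt_trans sqrt2_gt1 t1.
have P0 : 0 < P t by rewrite -sqrt2_lt.
have q0 : 0 < 1 + t ^+ 2 by rewrite ltr_pwDl// sqr_ge0.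
have qn : 1 + t ^+ 2 != 0 by rewrite gt_eqF.
have t21 : t ^+ 2 < 1 by rewrite expr_lt1// ltW.
pose f := 8 * t ^+ 3 * (1 - t ^+ 2) / (1 + t ^+ 2) ^+ 2.
have f0 : 0 < f.
  by rewrite divr_gt0 ?exprn_gt0// mulr_gt0 ?subr_gt0// mulr_gt0// exprn_gt0.
have key : (f / l + l) ^+ 2 - (l ^+ 2 + 4 * t ^+ 2) = 
    (A t - l * B t) * (A t + l * B t) * (4 * t ^+ 2) / (l ^+ 2 * (1 + t ^+ 2) ^+ 4).
  by rewrite /f /A /B /P; field; rewrite qn gt_eqF.
have s0 : 0 <= f / l + l by apply: addr_ge0; [apply: divr_ge0|]; exact: ltW.
have AB : 0 < A t + l * B t.
  rewrite addr_gt0//; last by rewrite !mulr_gt0.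
  by rewrite mulr_gt0 ?subr_gt0// mulr_gt0// exprn_gt0.
rewrite /period_equation [t ^+ 2 + 1]addrC -/f; split=> h.
  have E : Num.sqrt (l ^+ 2 + 4 * t ^+ 2) = f / l + l.
    apply: (mulfI (lt0r_neq0 l0)); have -> : l * (f / l + l) = f + l * l by field; rewrite gt_eqF.
    by move: h; rewrite mulrBr; lra.
  have k0 : (A t - l * B t) * (A t + l * B t) * (4 * t ^+ 2) / (l ^+ 2 * (1 + t ^+ 2) ^+ 4) = 0.
    by rewrite -key -E sqr_sqrtr ?subrr// addr_ge0 ?sqr_ge0// mulr_ge0// sqr_ge0.
  apply/esym/eqP; rewrite -subr_eq0.
  have -> : A t - l * B t = (A t - l * B t) * (A t + l * B t) * (4 * t ^+ 2) / (l ^+ 2 * (1 + t ^+ 2) ^+ 4) *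
      (l ^+ 2 * (1 + t ^+ 2) ^+ 4 / ((A t + l * B t) * (4 * t ^+ 2))).
    by field; rewrite qn !gt_eqF.
  by rewrite k0 mul0r.
have E : (f / l + l) ^+ 2 = l ^+ 2 + 4 * t ^+ 2.
  by apply/eqP; rewrite -subr_eq0 key h subrr !mul0r.
rewrite -E sqrtr_sqr ger0_norm//; field; by rewrite gt_eqF.
Qed.

(** A / B is 4 times the product of t^2 / P t and (1 - t^2) / (1 + t^2), and both factors decrease;
    the two inequalities are multiplied in cross-multiplied form. *)
Lemma period_ratio_decr a b : 0 < P a -> 0 < a -> a < b -> b < 1 -> A b * B a < A a * B b.
Proof.
move=> Pa a0 ab b1; have b0 : 0 < b := lt_trans a0 ab.
have Pb : 0 < P b by apply: (lt_trans Pa); rewrite /P; nra.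
have h1 : b ^+ 2 * P a < a ^+ 2 * P b.
  rewrite -subr_gt0 (_ : _ - _ = (b - a) * (a * (1 - b) + b * (1 - a))); last by rewrite /P; ring.
  by rewrite mulr_gt0 ?subr_gt0// addr_gt0// mulr_gt0// subr_gt0// (lt_trans ab).
have b2 : b ^+ 2 < 1 by rewrite expr_lt1// ltW.
have h2 : (1 - b ^+ 2) * (1 + a ^+ 2) < (1 - a ^+ 2) * (1 + b ^+ 2).
  rewrite -subr_gt0 (_ : _ - _ = 2 * ((b - a) * (b + a))); last by ring.
  by rewrite !mulr_gt0 ?subr_gt0 ?addr_gt0.
have -> : A b * B a = 4 * ((b ^+ 2 * P a) * ((1 - b ^+ 2) * (1 + a ^+ 2))) by rewrite /A /B; ring.
have -> : A a * B b = 4 * ((a ^+ 2 * P b) * ((1 - a ^+ 2) * (1 + b ^+ 2))) by rewrite /A /B; ring.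
rewrite ltr_pM2l ?ltr0n//; apply: ltr_pM => //; apply: mulr_ge0.
- exact: sqr_ge0.
- exact: ltW.
- by rewrite subr_ge0 ltW.
- by rewrite addr_ge0// sqr_ge0.
Qed.

Let B_gt0 t : 0 < P t -> 0 < B t.
Proof. by move=> h; rewrite mulr_gt0// ltr_pwDl// sqr_ge0. Qed.

(** As A / B decreases, the sign of l B - A at a rational point b tells on which side of b the
    solution lies. *)
Lemma period_lower l t b : 0 < l -> 0 < P t -> 0 < t -> b < 1 -> l * B t = A t -> l * B b <= A b -> b <= t.
Proof.
move=> l0 Pt t0 b1 ht hb; rewrite leNgt; apply/negP => tb.
have := period_ratio_decr Pt t0 tb b1; rewrite ltNge => /negP; apply.
by rewrite -ht mulrAC ler_pM2r// B_gt0.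
Qed.

Lemma period_upper l t b : 0 < l -> 0 < P t -> t < 1 -> 0 < P b -> 0 < b -> l * B t = A t ->
  A b <= l * B b -> t <= b.
Proof.
move=> l0 Pt t1 Pb b0 ht hb; rewrite leNgt; apply/negP => bt.
have := period_ratio_decr Pb b0 bt t1; rewrite ltNge => /negP; apply.
by rewrite -ht [leRHS]mulrAC; apply: ler_wpM2r => //; exact: ltW (B_gt0 Pt).
Qed.

(** l B - A is negative at sqrt 2 - 1, where B vanishes, and positive at 1, where A vanishes.
    Uniqueness is the monotonicity of A / B. *)
Lemma period_unique l : 0 < l ->
  exists t, unique (fun t => Num.sqrt 2 - 1 < t < 1 /\ period_equation l t) t.
Proof.
move=> l0; pose r : R := Num.sqrt 2 - 1; have r0 : 0 < r := sqrt2_gt1.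
have rP : P r = 0.
  have -> : P r = Num.sqrt 2 ^+ 2 - 2 by rewrite /P /r; ring.
  by rewrite sqr_sqrtr ?subrr// ler0n.
have r1 : r < 1 by rewrite ltNge; apply/negP => h; move: rP; rewrite /P; nra.
pose F := (fun t : R => l * B t - A t).
have cF : continuous F.
  rewrite (_ : F = peval idfun [:: - l; 2 * l; -4; 2 * l; l + 4]); last first.
    by apply/funext => z; rewrite /F /B /A /P /=; ring.
  exact: (@peval_continuous R R 0 +%R idfun erefl (fun x y => erefl)).
have Fr : F r < 0.
  have r2 : r ^+ 2 < 1 by rewrite expr_lt1// ltW.
  rewrite /F /B rP mul0r mulr0 sub0r oppr_lt0 mulr_gt0 ?subr_gt0//.
  by rewrite mulr_gt0// exprn_gt0.
have F1 : 0 < F 1.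
  rewrite /F /B /A /P !expr1n subrr mulr0 subr0 mulr_gt0//; lra.
have [||t] := @IVT R F r 1 0 (ltW r1).
- exact: continuous_subspaceT.
- by rewrite ge_min le_max (ltW Fr) (ltW F1) orbT.
rewrite in_itv/= => /andP[rt t1] Ft.
have rt' : r < t by rewrite lt_neqAle rt andbT; apply/eqP => E; move: Fr; rewrite E Ft ltxx.
have t1' : t < 1 by rewrite lt_neqAle t1 andbT; apply/eqP => E; move: F1; rewrite -E Ft ltxx.
have ht : l * B t = A t by apply/eqP; rewrite -subr_eq0 -/(F t) Ft.
have It : Num.sqrt 2 - 1 < t < 1 by rewrite rt' t1'.
exists t; split; first by split=> //; apply/period_equationE.
move=> t' [It' /(period_equationE l0 It') ht'].
have lt0 (x : R) : Num.sqrt 2 - 1 < x < 1 -> 0 < x.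
  by move=> /andP[h _]; have h0 := sqrt2_gt1; lra.
have Pp (x : R) (h : Num.sqrt 2 - 1 < x < 1) : 0 < P x by rewrite -sqrt2_lt ?lt0//; case/andP: h.
apply/eqP; rewrite eq_le; apply/andP; split.
- by apply: (period_lower l0 (Pp _ It') (lt0 _ It') t1' ht'); rewrite ht.
- have /andP[_ t'1] := It'.
  by apply: (period_lower l0 (Pp _ It) (lt0 _ It) t'1 ht); rewrite ht'.
Qed.

End PeriodEquation.

(** A simple fraction just below the value keeps the numbers in the final comparison small. *)
Lemma fanPhi_wide {R : realType} : 5 / 38 <= fanPhi (4 / 5 : R).
Proof. by rewrite /fanPhi; lra. Qed.

Lemma fanPhi_narrow {R : realType} : 1 / 42 <= fanPhi (8 / 17 : R).
Proof. by rewrite /fanPhi; lra. Qed.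

(** * Comparison with the one-dimensional bound *)

Section EnergyComparison.
Context {R : realType}.

(** Convexity of the cube: between a and b it lies below its chord. Afterwards the comparison is
    affine in l. *)
Lemma cube_chord (l a b : R) : 0 <= a -> a <= l -> l <= b -> l ^+ 3 <= (a ^+ 2 + a * b + b ^+ 2) * l - a * b * (a + b).
Proof.
move=> a0 al lb; rewrite -subr_ge0.
rewrite (_ : _ - _ = (l - a) * (b - l) * (l + a + b)); last by ring.
by rewrite !mulr_ge0 ?subr_ge0 ?addr_ge0//; lra.
Qed.

(** The tangent to the cube at 2 c; it gives the sign of the coefficient of tau in the
    comparison. *)
Lemma cube_tangent (l c : R) : 0 <= c -> 0 <= l -> 3 * (2 * c) ^+ 2 * l - 2 * (2 * c) ^+ 3 <= l ^+ 3.
Proof.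
move=> c0 l0; rewrite -subr_ge0 (_ : _ - _ = (l - 2 * c) ^+ 2 * (l + 4 * c)); last by ring.
by rewrite mulr_ge0 ?sqr_ge0// addr_ge0// mulr_ge0.
Qed.

(** The left side minus the right side is affine in tau with slope (l - 6/5)^2 (l + 12/5) / 6 >= 0,
    so the largest tau is the worst. There l^3 is replaced by its chord over [51/40, 153/100], and
    an inequality affine in l remains. *)
Lemma wide_compare (l tau ip wp vp e : R) : 51 / 40 <= l -> l <= 153 / 100 -> tau <= 36 / 61 ->
  ip <= - 3 / 142 -> wp + vp <= 5 / 19 -> 0 <= e -> 100 * (100 * e) <= 1 ->
  2 * l * ((4 / 5) ^+ 2 * tau - fanPhi (4 / 5) + ip + 3 * (4 / 5) ^+ 2 * (e ^+ 2 / 2)) +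
  8 / 3 * (2 * e + wp + ((3 / 5) ^+ 3 * (tau - 11 / 20) + vp)) < 2 * tau * (l - l ^+ 3 / 12).
Proof.
have a0 : 0 <= 51 / 40 :> R by lra.
have cc0 : 0 <= 3 / 5 :> R by lra.
have z0 : 0 <= 3 * (4 / 5) ^+ 2 :> R by lra.
move=> l1 l2; have l0 : 0 <= l := le_trans a0 l1.
have ch := cube_chord a0 l1 l2; have tg := cube_tangent cc0 l0.
move=> t1 hi hw e0 e1.
have lPh : 0 <= l * (fanPhi (4 / 5) - 5 / 38) by rewrite mulr_ge0// subr_ge0; exact: fanPhi_wide.
have li : 0 <= l * (- 3 / 142 - ip) by rewrite mulr_ge0// subr_ge0.
pose K := 18 / 25 * l - l ^+ 3 / 6 - 72 / 125.
have K0 : 0 <= - K by move: tg {ch t1 hi hw e0 e1 lPh li z0}; rewrite /K; lra.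
have tK : 0 <= (36 / 61 - tau) * - K by rewrite mulr_ge0// subr_ge0.
have e2 : e ^+ 2 <= e / 100.
  by move: e0 e1 {tg ch t1 hi hw lPh li z0 tK K0}; rewrite expr2; nra.
have le2 : 0 <= 3 * (4 / 5) ^+ 2 * (l * (e / 100 - e ^+ 2)) by apply: mulr_ge0 => //; rewrite mulr_ge0// subr_ge0.
have le1 : 0 <= 3 * (4 / 5) ^+ 2 * (l * (1 - 100 * (100 * e))) by apply: mulr_ge0 => //; rewrite mulr_ge0// subr_ge0.
rewrite -subr_gt0.
(* Each deviation from the extreme values of the parameters is a separate nonnegative term; the last
   bracket is the extreme case, a function of l only. *)
rewrite (_ : _ - _ = (36 / 61 - tau) * - K + 2 * (l * (fanPhi (4 / 5) - 5 / 38)) + 2 * (l * (- 3 / 142 - ip)) +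
  3 * (4 / 5) ^+ 2 * (l * (e / 100 - e ^+ 2)) + 3 * (4 / 5) ^+ 2 * (l * (1 - 100 * (100 * e))) / (100 * (100 * 100)) + 8 / 3 * (5 / 19 - (wp + vp)) +
  (16 / 3) / (100 * 100) * (1 - 100 * (100 * e)) +
  (36 / 61 * K + 2 * l * (5 / 38 - (- 3 / 142)) - 3 * (4 / 5) ^+ 2 * l / (100 * (100 * 100)) - 16 / 3 / (100 * 100)
   - 8 / 3 * (5 / 19 - (3 / 5) ^+ 3 * (11 / 20)))); last by rewrite /K; field.
have : 0 < 36 / 61 * K + 2 * l * (5 / 38 - (- 3 / 142)) - 3 * (4 / 5) ^+ 2 * l / (100 * (100 * 100)) - 16 / 3 / (100 * 100)
   - 8 / 3 * (5 / 19 - (3 / 5) ^+ 3 * (11 / 20)).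
  by move: ch l1 l2 {tg t1 hi hw e0 e1 lPh li z0 tK K0 e2 le2 le1}; rewrite /K; lra.
move: tK lPh li le2 le1 hw e1 {ch tg t1 hi e0 z0 K0 e2 l1 l2}.
set y1 := (_ - tau) * _; set y2 := l * _; set y3 := l * (_ - ip); set y4 := 3 * _ * _; set y5 := 3 * _ * (l * _); set y6 := _ * K + _ - _ - _ - _.
by move=> *; lra.
Qed.

(** The argument of [wide_compare] with c = 15 / 17. The bound on tau is half of 14 / 25, because
    half a period holds two cells. *)
Lemma narrow_compare (l tau ip wp vp e : R) : 153 / 100 <= l -> l <= 427 / 200 -> tau <= 7 / 25 ->
  ip <= 0 -> wp + vp <= 5 / 26 -> 0 <= e -> 100 * (100 * e) <= 1 ->
  2 * l * ((8 / 17) ^+ 2 * tau - fanPhi (8 / 17) + ip + 3 * (8 / 17) ^+ 2 * (e ^+ 2 / 2)) +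
  8 / 3 * (2 * e + wp + ((15 / 17) ^+ 3 * (tau - 1 / 4) + vp)) < 2 * tau * (l - l ^+ 3 / 12).
Proof.
have a0 : 0 <= 153 / 100 :> R by lra.
have cc0 : 0 <= 15 / 17 :> R by lra.
have z0 : 0 <= 3 * (8 / 17) ^+ 2 :> R by lra.
move=> l1 l2; have l0 : 0 <= l := le_trans a0 l1.
have ch := cube_chord a0 l1 l2; have tg := cube_tangent cc0 l0.
move=> t1 hi hw e0 e1.
have lPh : 0 <= l * (fanPhi (8 / 17) - 1 / 42) by rewrite mulr_ge0// subr_ge0; exact: fanPhi_narrow.
have li : 0 <= l * (0 - ip) by rewrite mulr_ge0// subr_ge0.
pose K := 450 / 289 * l - l ^+ 3 / 6 - 9000 / 4913.
have K0 : 0 <= - K by move: tg {ch t1 hi hw e0 e1 lPh li z0}; rewrite /K; lra.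
have tK : 0 <= (7 / 25 - tau) * - K by rewrite mulr_ge0// subr_ge0.
have e2 : e ^+ 2 <= e / 100.
  by move: e0 e1 {tg ch t1 hi hw lPh li z0 tK K0}; rewrite expr2; nra.
have le2 : 0 <= 3 * (8 / 17) ^+ 2 * (l * (e / 100 - e ^+ 2)) by apply: mulr_ge0 => //; rewrite mulr_ge0// subr_ge0.
have le1 : 0 <= 3 * (8 / 17) ^+ 2 * (l * (1 - 100 * (100 * e))) by apply: mulr_ge0 => //; rewrite mulr_ge0// subr_ge0.
rewrite -subr_gt0.
rewrite (_ : _ - _ = (7 / 25 - tau) * - K + 2 * (l * (fanPhi (8 / 17) - 1 / 42)) + 2 * (l * (0 - ip)) +
  3 * (8 / 17) ^+ 2 * (l * (e / 100 - e ^+ 2)) + 3 * (8 / 17) ^+ 2 * (l * (1 - 100 * (100 * e))) / (100 * (100 * 100)) + 8 / 3 * (5 / 26 - (wp + vp)) +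
  (16 / 3) / (100 * 100) * (1 - 100 * (100 * e)) +
  (7 / 25 * K + 2 * l * (1 / 42 - (0)) - 3 * (8 / 17) ^+ 2 * l / (100 * (100 * 100)) - 16 / 3 / (100 * 100)
   - 8 / 3 * (5 / 26 - (15 / 17) ^+ 3 * (1 / 4)))); last by rewrite /K; field.
have : 0 < 7 / 25 * K + 2 * l * (1 / 42 - (0)) - 3 * (8 / 17) ^+ 2 * l / (100 * (100 * 100)) - 16 / 3 / (100 * 100)
   - 8 / 3 * (5 / 26 - (15 / 17) ^+ 3 * (1 / 4)).
  by move: ch l1 l2 {tg t1 hi hw e0 e1 lPh li z0 tK K0 e2 le2 le1}; rewrite /K; lra.
move: tK lPh li le2 le1 hw e1 {ch tg t1 hi e0 z0 K0 e2 l1 l2}.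
set y1 := (_ - tau) * _; set y2 := l * _; set y3 := l * (_ - ip); set y4 := 3 * _ * _; set y5 := 3 * _ * (l * _); set y6 := _ * K + _ - _ - _ - _.
by move=> *; lra.
Qed.

End EnergyComparison.

Section EnergyConstants.
Context {R : realType}.

Lemma wide_constants : zr (-2120) / zr 100000 <= - 3 / 142 :> R /\
  zr 14103 / zr 100000 + zr 12197 / zr 100000 <= 5 / 19 :> R.
Proof.
split; first by rewrite (_ : zr _ / zr _ = - 53 / 2500 :> R); [lra|rewrite /=; field].
by rewrite -mulrDl (_ : (_ + _) / _ = 263 / 1000 :> R); [lra|rewrite /=; field].
Qed.

Lemma narrow_constants : zr (-1) / zr 100000 <= 0 :> R /\
  zr 8185 / zr 100000 + zr 11007 / zr 100000 <= 5 / 26 :> R.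
Proof.
split; first by rewrite (_ : zr (-1) = -1 :> R)// mulN1r oppr_le0 invr_ge0; exact: ltW (zr_lt0 _).
by rewrite -mulrDl (_ : (_ + _) / _ = 2399 / 12500 :> R); [lra|rewrite /=; field].
Qed.

Lemma small_constant : 0 <= 1 / 10000 :> R /\ 100 * (100 * (1 / 10000)) <= 1 :> R.
Proof. by split; lra. Qed.

End EnergyConstants.

Theorem theorem6p7 (R : realType) :
  exists L0 L1 : R,
    [/\ `|L0 - 127 / 100| <= 5 / 1000,
        `|L1 - 214 / 100| <= 5 / 1000 &
        forall L H T : R, 0 < L -> 0 < H -> 0 < T ->
          L0 < L / H < L1 ->
          exists Tt : R,
            unique (fun t => Num.sqrt 2 - 1 < t < 1 /\
                             period_equation (L / H) t) Tt /\
            (T = H * Tt ->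
              (ereal_inf [set E0 T H L u | u in admissible T H] <
               (2 * T)%:E * ereal_inf [set E1D L H u | u in A0 H])%E)].
Proof.
(* 1.275 and 2.135: the largest L0 and the smallest L1 that the two tolerances admit. *)
exists (51 / 40), (427 / 200); split.
- by rewrite ler_norml; apply/andP; split; lra.
- by rewrite ler_norml; apply/andP; split; lra.
move=> L H T L0 H0 T0 /andP[l1 l2].
have l0 : 0 < L / H by rewrite divr_gt0.
have [t ut] := period_unique l0; exists t; split=> // TE.
have [[It pe] _] := ut; have {pe}tE := (period_equationE l0 It).1 pe.
have /andP[t1 t2] := It; have t0 : 0 < t := lt_trans sqrt2_gt1 t1.
have Pt : 0 < t ^+ 2 + 2 * t - 1 by rewrite -sqrt2_lt.
have hinf : ((L / H - (L / H) ^+ 3 / 12)%:E <= ereal_inf [set E1D L H u | u in A0 H])%E.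
  by apply: le_ereal_inf_tmp => _ [u hu <-]; exact: E1D_ge.
suff [u uadm hu] : exists2 u, admissible T H u &
    (E0 T H L u < (2 * T)%:E * (L / H - (L / H) ^+ 3 / 12)%:E)%E.
  apply: (@le_lt_trans _ _ (E0 T H L u)); first by apply: ereal_inf_lbound; exists u.
  by apply: (lt_le_trans hu); apply: lee_wpmul2l => //; rewrite lee_fin mulr_ge0// ltW.
have compare (X k tau : R) : 0 < k -> T = k * (tau * H) ->
    X < 2 * tau * (L / H - (L / H) ^+ 3 / 12) ->
    ((k * H * X)%:E < (2 * T)%:E * (L / H - (L / H) ^+ 3 / 12)%:E)%E.
  move=> k0 -> hX; rewrite -EFinM lte_fin (_ : 2 * (k * (tau * H)) * _ = k * H *
    (2 * tau * (L / H - (L / H) ^+ 3 / 12))); last by ring.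
  by rewrite ltr_pM2l// mulr_gt0.
have [lm|lm] : L / H <= 153 / 100 \/ 153 / 100 <= L / H by apply/orP; exact: le_total.
(* The solution decreases as L / H grows, so these bounds are decided by the sign of l B - A at the
   ends 153/100 and 51/40; 5/9 exceeds the width 555/1000 that the wide profile requires. *)
- have t3 : 5 / 9 <= t by apply: (period_lower l0 Pt t0 _ tE); lra.
  have t4 : t <= 36 / 61 by apply: (period_upper l0 Pt t2 _ _ tE); lra.
  have TE' : T = 1%:R * (t * H) by rewrite TE; ring.
  have [||u uadm hu] := @wide_energy R t L H H0 L0; [lra|lra|].
  rewrite /halfperiod -TE' in uadm hu; exists u => //; apply: (le_lt_trans hu).
  have [c1 c2] := @wide_constants R; have [e0 e1] := @small_constant R.
  by apply: (compare _ 1%:R t) => //; apply: wide_compare => //; exact: ltW.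
(* With two cells the width is t / 2, between 1/4, the least width that the narrow profile admits,
   and 7/25. *)
have t3 : 1 / 2 <= t by apply: (period_lower l0 Pt t0 _ tE); lra.
have t4 : t <= 14 / 25 by apply: (period_upper l0 Pt t2 _ _ tE); lra.
have TE' : T = 2%:R * (t / 2 * H) by rewrite TE; field.
have [||u uadm hu] := @narrow_energy R (t / 2) L H H0 L0; [lra|lra|].
rewrite /halfperiod -TE' in uadm hu; exists u => //; apply: (le_lt_trans hu).
have [c1 c2] := @narrow_constants R; have [e0 e1] := @small_constant R.
apply: (compare _ 2%:R (t / 2)) => //; apply: narrow_compare => //; first exact: ltW.
by move: t4 {hu e0 e1 c1 c2}; lra.
Qed.
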